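(* Let $n\ge 2$ be an integer, let $\alpha\ge 0$ be a real number and let $p\in[1,n+\alpha+1)$. Suppose that the map $\mathbf{B}^{n+1}\to\mathbb{S}^n$, $x\mapsto \frac{x}{\|x\|}$, minimizes $E^{n+1}_{p,\alpha}$ among the maps $u\in W^{1,p}_{\alpha}(\mathbf{B}^{n+1},\mathbb{S}^n)$ satisfying $u(x)=x$ on $\mathbb{S}^n$. Then the map $\mathbf{B}^{n}\to\mathbb{S}^{n-1}$, $y\mapsto\frac{y}{\|y\|}$, minimizes $E^{n}_{p,\alpha+1}$ among the maps $v\in W^{1,p}_{\alpha+1}(\mathbf{B}^n,\mathbb{S}^{n-1})$ satisfying $v(y)=y$ on $\mathbb{S}^{n-1}$.
   Context: For an integer $m\ge 2$, $\mathbf{B}^m$ is the unit Euclidean ball of $\mathbb{R}^m$ and $\mathbb{S}^{m-1}$ is its boundary sphere. For real $\beta\ge 0$ and $p\ge 1$, the $r^\beta$-weighted $p$-energy of a map $u:\mathbf{B}^m\to\mathbb{S}^{m-1}$ is $$E^m_{p,\beta}(u)=\int_{\mathbf{B}^m}\|x\|^{\beta}\,\|\nabla u(x)\|^p\,dx,$$ where $\|\nabla u(x)\|^2=\sum_{i=1}^m\|du(x).e_i\|^2$ with $(e_i)$ the standard basis. The space $W^{1,p}_{\beta}(\mathbf{B}^m,\mathbb{S}^{m-1})$ is the set of measurable maps $u:\mathbf{B}^m\to\mathbb{R}^m$ with $\|u\|=1$ a.e., weakly differentiable on $\mathbf{B}^m\setminus\{0\}$, with $E^m_{p,\beta}(u)<\infty$.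 The boundary condition $u(x)=x$ on $\mathbb{S}^{m-1}$ is understood in the sense of traces. ''The map $u_0$ minimizes $E^m_{p,\beta}$ among the maps of a class'' means that $u_0$ belongs to the class and $E^m_{p,\beta}(u_0)\le E^m_{p,\beta}(u)$ for every $u$ in the class. *)

(* Defs.v *)
From HB Require Import structures.
From mathcomp Require Import all_boot all_order all_algebra.
From mathcomp Require Import all_classical all_reals all_analysis.
From mathcomp Require Import measurable_realfun.

Set Implicit Arguments.
Unset Strict Implicit.
Unset Printing Implicit Defensive.

Import Order.TTheory GRing.Theory Num.Theory.
Import numFieldNormedType.Exports.

Local Open Scope classical_set_scope.
Local Open Scope ring_scope.

Definition measure_rV_display : measure_display -> measure_display.
Proof. exact. Qed.

(* The Borel sigma-algebra of R^n, generated by the coordinates. *)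
Section measurable_rV.
Context {R : realType} (n : nat).

Let coors : 'I_n -> 'rV[R]_n -> measurableTypeR R := fun i x => x ord0 i.

Let rV_set0 : g_sigma_preimage coors set0.
Proof. exact: sigma_algebra0. Qed.

Let rV_setC A : g_sigma_preimage coors A -> g_sigma_preimage coors (~` A).
Proof. exact: sigma_algebraC. Qed.

Let rV_bigcup (F : _^nat) : (forall i, g_sigma_preimage coors (F i)) ->
  g_sigma_preimage coors (\bigcup_i (F i)).
Proof. exact: sigma_algebra_bigcup. Qed.

HB.instance Definition _ :=
  @isMeasurable.Build (measure_rV_display R.-ocitv.-measurable.-sigma)
    'rV[R]_n (g_sigma_preimage coors) rV_set0 rV_setC rV_bigcup.

End measurable_rV.

Lemma measurable_coor (R : realType) n (i : 'I_n) :
  measurable_fun [set: 'rV[R]_n] (fun x => x ord0 i : R).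
Proof.
move=> _ Y mY; rewrite setTI; apply: sub_sigma_algebra => /=.
rewrite -bigcup_seq/=; exists i => /=; first by rewrite mem_index_enum.
by exists Y => //; rewrite setTI.
Qed.

Lemma measurable_fun_rVP (R : realType) d (T : measurableType d) n
    (f : T -> 'rV[R]_n) :
  (forall i, measurable_fun [set: T] (fun x => f x ord0 i : R)) ->
  measurable_fun [set: T] f.
Proof.
move=> mf _ A mA; rewrite setTI; move: A mA.
pose G := [set A : set 'rV[R]_n | measurable (f @^-1` A)].
suff: measurable `<=` G by [].
apply: smallest_sub.
  split; rewrite /G /=.
  - by rewrite preimage_set0.
  - by move=> A mA; rewrite setTD preimage_setC; exact: measurableC.
  - by move=> F mF; rewrite preimage_bigcup; exact: bigcupT_measurable.
move=> A; rewrite -bigcup_seq => -[i /= _ [B mB <-]].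
rewrite /G /= setTI.
by have := mf i measurableT B mB; rewrite setTI.
Qed.

Section lebesgue_rV.
Context {R : realType}.

Let cons_rV n (z : measurableTypeR R * 'rV[R]_n) : 'rV[R]_n.+1 :=
  row_mx (z.1%:M : 'rV[R]_1) z.2.

Let behead_rV n (x : 'rV[R]_n.+1) : 'rV[R]_n := \row_i x ord0 (lift ord0 i).

Let cons_rV0 n (z : measurableTypeR R * 'rV[R]_n) : cons_rV z ord0 ord0 = z.1.
Proof.
transitivity (row_mx (z.1%:M : 'rV[R]_1) z.2 ord0 (lshift n (ord0 : 'I_1))).
  by congr fun_of_matrix; exact/val_inj.
by rewrite row_mxEl mxE eqxx mulr1n.
Qed.

Let cons_rV_lift n (z : measurableTypeR R * 'rV[R]_n) i :
  cons_rV z ord0 (lift ord0 i) = z.2 ord0 i.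
Proof.
transitivity (row_mx (z.1%:M : 'rV[R]_1) z.2 ord0 (rshift 1 i)).
  by congr fun_of_matrix; exact/val_inj.
by rewrite row_mxEr.
Qed.

Let measurable_cons_rV n : measurable_fun setT (@cons_rV n).
Proof.
apply: measurable_fun_rVP => i.
have [j ->|->] := unliftP ord0 i.
  under eq_fun do rewrite cons_rV_lift.
  exact: (measurableT_comp (@measurable_coor R n j) measurable_snd).
under eq_fun do rewrite cons_rV0.
exact: measurable_fst.
Qed.

Let measurable_behead_rV n : measurable_fun setT (@behead_rV n).
Proof.
apply: measurable_fun_rVP => i; under eq_fun do rewrite mxE.
exact: measurable_coor.
Qed.

Section step.
Context n (mu : {sigma_finite_measure set 'rV[R]_n -> \bar R}).
Local Open Scope ereal_scope.

Definition lebesgue_cons (A : set 'rV[R]_n.+1) : \bar R :=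
  (lebesgue_measure \x mu) (@cons_rV n @^-1` A).

Let lc0 : lebesgue_cons set0 = 0.
Proof. by rewrite /lebesgue_cons preimage_set0 measure0. Qed.

Let lc_ge0 A : 0 <= lebesgue_cons A.
Proof. exact: measure_ge0. Qed.

Let lc_sigma_additive : semi_sigma_additive lebesgue_cons.
Proof.
exact: (@measure_semi_sigma_additive _ _ _
  (measure_function_pushforward__canonical__measure_function_Measure
     (lebesgue_measure \x mu) (@measurable_cons_rV n))).
Qed.

HB.instance Definition _ := isMeasure.Build _ _ _ lebesgue_cons
  lc0 lc_ge0 lc_sigma_additive.

Let lc_sigma_finite : sigma_finite setT lebesgue_cons.
Proof.
have /sigma_finiteP[F [TF ndF Foo]] := sigma_finiteT (@lebesgue_measure R).
have /sigma_finiteP[G [TG ndG Goo]] := sigma_finiteT mu.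
pose g (x : 'rV[R]_n.+1) : measurableTypeR R * 'rV[R]_n :=
  (x ord0 ord0, behead_rV x).
have mg : measurable_fun setT g.
  apply/measurable_fun_pair; first exact: measurable_coor.
  exact: measurable_behead_rV.
have gK z : g (cons_rV z) = z.
  case: z => t y; rewrite /g cons_rV0; congr pair.
  by apply/rowP => i; rewrite mxE cons_rV_lift.
exists (fun k => g @^-1` (F k `*` G k)).
  rewrite -preimage_bigcup (_ : \bigcup_k _ = setT) ?preimage_setT//.
  rewrite -subTset => -[t y] _.
  have [i _ Fit] : (\bigcup_k F k) t by rewrite -TF.
  have [j _ Gjy] : (\bigcup_k G k) y by rewrite -TG.
  exists (maxn i j) => //; split.
  - by move: t Fit; exact/subsetPset/ndF/leq_maxl.
  - by move: y Gjy; exact/subsetPset/ndG/leq_maxr.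
move=> k; have [mFk Fkoo] := Foo k; have [mGk Gkoo] := Goo k; split.
  by rewrite -[X in measurable X]setTI; apply: mg => //; exact: measurableX.
rewrite /lebesgue_cons -comp_preimage (_ : g \o _ = id).
  by rewrite product_measure1E// lte_mul_pinfty// ge0_fin_numE.
by apply/funext => z /=; rewrite gK.
Qed.

HB.instance Definition _ := Measure_isSigmaFinite.Build _ _ _ lebesgue_cons
  lc_sigma_finite.

End step.

(* Lebesgue measure on the Borel subsets of R^n, as an iterated product. *)
Fixpoint lebesgue_rV n : {sigma_finite_measure set 'rV[R]_n -> \bar R} :=
  if n is n'.+1 then lebesgue_cons (lebesgue_rV n') else \d_(0 : 'rV[R]_0).

Lemma lebesgue_rV_box n (A : 'I_n -> set (measurableTypeR R)) :
  (forall i, measurable (A i)) ->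
  lebesgue_rV n [set x | forall i, A i (x ord0 i)] =
  (\prod_(i < n) lebesgue_measure (A i))%E.
Proof.
elim: n A => [|n IH] A mA.
  rewrite big_ord0 /= diracE mem_set//= => -[]//.
rewrite big_ord_recl /= /lebesgue_cons.
rewrite (_ : _ @^-1` _ =
    A ord0 `*` [set y : 'rV[R]_n | forall i, A (lift ord0 i) (y ord0 i)]).
  rewrite product_measure1E//; first by rewrite -IH.
  rewrite (_ : [set y | _] = \bigcap_(i in setT)
      [set y : 'rV[R]_n | A (lift ord0 i) (y ord0 i)]).
    apply: fin_bigcap_measurable => // i _.
    have := measurable_coor i measurableT (mA (lift ord0 i)).
    by rewrite setTI.
  by apply/seteqP; split => y /= h i => [_|]; apply: h.
apply/seteqP; split => -[t y] /=.
  move=> h; split; first by have := h ord0; rewrite cons_rV0.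
  by move=> i; have := h (lift ord0 i); rewrite cons_rV_lift.
move=> [h0 h] i; have [j ->|->] := unliftP ord0 i.
  by rewrite cons_rV_lift; exact: h.
by rewrite cons_rV0.
Qed.

End lebesgue_rV.

Section euclidean.
Context {R : realType} (m : nat).
Implicit Types x : 'rV[R]_m.

Definition enorm x : R := Num.sqrt (\sum_(i < m) x ord0 i ^+ 2).

Definition ball_rV : set 'rV[R]_m := [set x | enorm x < 1].

Definition sphere_rV : set 'rV[R]_m := [set x | enorm x = 1].

(* The value at 0 is 0, which is harmless since {0} is a null set. *)
Definition radial x : 'rV[R]_m := (enorm x)^-1 *: x.

Lemma measurable_enorm : measurable_fun [set: 'rV[R]_m] enorm.
Proof.
rewrite (_ : enorm = fun x => (\sum_(i < m) x ord0 i ^+ 2) `^ 2^-1); last first.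
  by apply/funext => x; rewrite powR12_sqrt// sumr_ge0// => i _; rewrite sqr_ge0.
apply: (measurableT_comp (measurable_powR _)).
apply: measurable_sum => i; apply: measurable_funX; exact: measurable_coor.
Qed.

Lemma measurable_radial : measurable_fun [set: 'rV[R]_m] radial.
Proof.
apply: measurable_fun_rVP => i; under eq_fun do rewrite mxE.
apply: measurable_funM; last exact: measurable_coor.
rewrite (_ : (fun x => (enorm x)^-1) = fun x => enorm x `^ (-1)); last first.
  by apply/funext => x; rewrite powR_inv1// sqrtr_ge0.
exact: (measurableT_comp (measurable_powR _) measurable_enorm).
Qed.

Lemma measurable_ball_rV : measurable ball_rV.
Proof.
rewrite -[X in measurable X]setTI.
rewrite (_ : ball_rV = enorm @^-1` `]-oo, 1[%classic).
  exact: measurable_enorm.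
by apply/seteqP; split => x /=; rewrite in_itv.
Qed.

(* The surface measure of the unit sphere in polar coordinates: the measure of
   A is m times the volume of the part of the unit ball lying in the cone
   over A. *)
Definition surface_measure : {measure set 'rV[R]_m -> \bar R} :=
  mscale m%:R%:nng
    (measure_function_pushforward__canonical__measure_function_Measure
       (mrestr (lebesgue_rV m) measurable_ball_rV) measurable_radial).

End euclidean.

Section sobolev.
Context {R : realType} (m : nat).
Local Notation mu := (lebesgue_rV m).
Implicit Types (Omega : set 'rV[R]_m) (u w : 'rV[R]_m -> 'rV[R]_m)
  (G : 'rV[R]_m -> 'M[R]_m) (p beta : R).

Definition basis_rV (i : 'I_m) : 'rV[R]_m := delta_mx ord0 i.

(* The class C^1_c(Omega). *)
Definition test_function Omega (phi : 'rV[R]_m -> R) :=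
  [/\ forall i x, derivable phi x (basis_rV i),
      forall i, continuous ('D_(basis_rV i) phi) &
      exists K, [/\ compact K, K `<=` Omega & forall x, ~ K x -> phi x = 0]].

Definition locally_integrable_rV Omega (f : 'rV[R]_m -> R) :=
  measurable_fun Omega f /\
  forall K, K `<=` Omega -> compact K ->
    (\int[mu]_(x in K) `|f x|%:E < +oo)%E.

(* Row i of G x is the weak partial derivative du(x).e_i. *)
Definition weak_gradient Omega u G :=
  [/\ forall j, locally_integrable_rV Omega (fun x => u x ord0 j),
      forall i j, locally_integrable_rV Omega (fun x => G x i j) &
      forall i j phi, test_function Omega phi ->
        (\int[mu]_(x in Omega) (u x ord0 j * 'D_(basis_rV i) phi x)%:E =
         - \int[mu]_(x in Omega) (G x i j * phi x)%:E)%E].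

Definition weakly_differentiable Omega u := exists G, weak_gradient Omega u G.

(* A weak gradient of u, which is unique up to equality almost everywhere in
   Omega; it is meaningful only if u is weakly differentiable in Omega. *)
Definition wgrad Omega u : 'rV[R]_m -> 'M[R]_m :=
  xget (cst 0) (weak_gradient Omega u).

Definition mxnorm2 (A : 'M[R]_m) : R :=
  Num.sqrt (\sum_(i < m) enorm (row i A) ^+ 2).

Definition punctured_ball : set 'rV[R]_m := @ball_rV R m `\ 0.

Definition energy p beta u : \bar R :=
  (\int[mu]_(x in @ball_rV R m)
     (enorm x `^ beta * mxnorm2 (wgrad punctured_ball u x) `^ p)%:E)%E.

Definition sphere_sobolev p beta u :=
  [/\ measurable_fun (@ball_rV R m) u,
      {ae mu, forall x, @ball_rV R m x -> enorm (u x) = 1},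
      weakly_differentiable punctured_ball u &
      (energy p beta u < +oo)%E].

Definition sobolev Omega p w :=
  [/\ measurable_fun Omega w,
      (\int[mu]_(x in Omega) (enorm (w x) `^ p)%:E < +oo)%E,
      weakly_differentiable Omega w &
      (\int[mu]_(x in Omega) (mxnorm2 (wgrad Omega w x) `^ p)%:E < +oo)%E].

Definition collar : set 'rV[R]_m := [set x | 2^-1 < enorm x < 1].

Definition closed_collar : set 'rV[R]_m := [set x | 2^-1 <= enorm x <= 1].

(* u has trace g on the unit sphere: the trace operator is the continuous
   extension to W^{1,p} of the restriction to the sphere of the functions of
   W^{1,p} that are continuous up to the boundary. It is taken on a collar of
   the sphere, where the weights |x|^beta are bounded away from 0 and oo. *)
Definition has_trace p u (g : 'rV[R]_m -> 'rV[R]_m) :=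
  exists w : nat -> 'rV[R]_m -> 'rV[R]_m,
  [/\ forall k, {within closed_collar, continuous (w k)} /\
                sobolev collar p (w k),
      (\int[mu]_(x in collar) (enorm (w k x - u x) `^ p)%:E)%E
        @[k --> \oo] --> 0%E,
      (\int[mu]_(x in collar)
         (mxnorm2 (wgrad collar (w k) x - wgrad punctured_ball u x) `^ p)%:E)%E
        @[k --> \oo] --> 0%E &
      (\int[@surface_measure R m]_(x in @sphere_rV R m)
         (enorm (w k x - g x) `^ p)%:E)%E
        @[k --> \oo] --> 0%E].

Definition admissible p beta u := sphere_sobolev p beta u /\ has_trace p u id.

Definition minimizes_energy p beta u0 :=
  admissible p beta u0 /\
  forall u, admissible p beta u -> (energy p beta u0 <= energy p beta u)%E.

End sobolev.

(* Main.v *)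
Require Import Defs.
From HB Require Import structures.
From mathcomp Require Import all_boot all_order all_algebra.
From mathcomp Require Import all_classical all_reals all_analysis.
From mathcomp Require Import measurable_realfun.
From mathcomp Require Import ring lra.

Set Implicit Arguments.
Unset Strict Implicit.
Unset Printing Implicit Defensive.

Import Order.TTheory GRing.Theory Num.Theory.
Import numFieldNormedType.Exports.
Local Open Scope classical_set_scope.
Local Open Scope ring_scope.

(** The radial map of dimension n is compared with an arbitrary competitor v.

    For p >= 2 the competitor is suspended. Writing a point of the larger ball
    in polar coordinates about the first axis, with radius r, colatitude t and
    direction w in the equator, put u(r, t, w) = (cos t, sin t v(r w)). This is
    again an admissible map: it is a unit field, it has the identity as trace
    ([has_trace_extv]), and its weak gradient is computed from that of v
    ([weak_gradient_extv_ball]); v = radial gives u = radial. The square of the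
    norm of its gradient is controlled by the sum of r^-2 and |grad v|^2 at r w,
    so the convexity of s |-> s^(p/2) bounds |grad u|^p by a combination of
    r^-p and |grad v|^p whose coefficients make the bound sharp for the radial
    map ([energy_extv_bound]). Integration over the colatitude contributes the
    same constant to every term and one extra factor r, which turns the weight
    r^alpha into r^(alpha + 1) ([le_integral_unpolar]). The inequality between
    the energies of the radial map and of u, which holds by hypothesis, becomes
    the one between the energies of the radial map and of v
    ([energy_radial_le_of_extv]).

    For p < 2 the function s |-> s^(p/2) is concave and this bound fails, but
    then the exponent beta + 1 - p, with beta = alpha + 1, is nonnegative and
    the radial map is minimal for a direct reason. The gradient G of a unit
    field is tangential ([tangential_gradient]), so its trace, the divergence
    of v, is at most sqrt(m - 1) |G| ([trace_le]), with equality for the radial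
    map. By the tangent inequality of the p-th power ([density_lower]) the
    energy density of v exceeds that of the radial map by at least a positive
    multiple of r^(beta + 1 - p) (div v - div (x / |x|)). The integral of this
    quantity is nonnegative by the divergence theorem: v and x / |x| agree on
    the sphere, the weight is nondecreasing in r, and v has a smaller radial
    component than x / |x|. As v has only a weak gradient and a trace in
    the sense of limits, the weight is cut off near the origin and near
    the sphere, and the flux created by the outer cut-off tends to zero
    ([boundary_flux], [small_flux]); [energy_radial_le_of_trace] concludes.

    Both cases use that the radial map of dimension n has finite energy, which
    follows from the finite energy of the radial map of dimension n + 1
    ([energy_radial_lty]). *)

(** * Lebesgue measure on row vectors: Fubini and affine changes of variables *)

Section cons_rV.
Context {R : realType} (n : nat).
Implicit Types (z : measurableTypeR R * 'rV[R]_n) (x : 'rV[R]_n.+1).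

Definition cons_rV z : 'rV[R]_n.+1 := row_mx (z.1%:M : 'rV[R]_1) z.2.

Definition behead_rV x : 'rV[R]_n := \row_i x ord0 (lift ord0 i).

Lemma cons_rV0 z : cons_rV z ord0 ord0 = z.1.
Proof.
transitivity (row_mx (z.1%:M : 'rV[R]_1) z.2 ord0 (lshift n (ord0 : 'I_1))).
  by congr fun_of_matrix; exact/val_inj.
by rewrite row_mxEl mxE eqxx mulr1n.
Qed.

Lemma cons_rV_lift z i : cons_rV z ord0 (lift ord0 i) = z.2 ord0 i.
Proof.
transitivity (row_mx (z.1%:M : 'rV[R]_1) z.2 ord0 (rshift 1 i)).
  by congr fun_of_matrix; exact/val_inj.
by rewrite row_mxEr.
Qed.

Lemma behead_cons_rV z : behead_rV (cons_rV z) = z.2.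
Proof. by apply/rowP => i; rewrite mxE cons_rV_lift. Qed.

Lemma cons_behead_rV x : cons_rV (x ord0 ord0, behead_rV x) = x.
Proof.
apply/rowP => i; have [j ->|->] := unliftP ord0 i.
  by rewrite cons_rV_lift/= mxE.
by rewrite cons_rV0.
Qed.

Lemma measurable_cons_rV : measurable_fun setT cons_rV.
Proof.
apply: measurable_fun_rVP => i.
have [j ->|->] := unliftP ord0 i.
  under eq_fun do rewrite cons_rV_lift.
  exact: (measurableT_comp (@measurable_coor R n j) measurable_snd).
under eq_fun do rewrite cons_rV0.
exact: measurable_fst.
Qed.

Lemma measurable_behead_rV : measurable_fun setT behead_rV.
Proof.
apply: measurable_fun_rVP => i; under eq_fun do rewrite mxE.
exact: measurable_coor.
Qed.

Lemma cons_rV_add z w : cons_rV z + cons_rV w = cons_rV (z.1 + w.1, z.2 + w.2).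
Proof.
apply/rowP => i; have [j ->|->] := unliftP ord0 i.
  by rewrite mxE !cons_rV_lift/= mxE.
by rewrite mxE !cons_rV0.
Qed.

Lemma cons_rV_scale a z : a *: cons_rV z = cons_rV (a * z.1, a *: z.2).
Proof.
apply/rowP => i; have [j ->|->] := unliftP ord0 i.
  by rewrite mxE !cons_rV_lift/= mxE.
by rewrite mxE !cons_rV0.
Qed.

End cons_rV.

Section lebesgue_fubini.
Context {R : realType} (n : nat).
Local Notation leb := (@lebesgue_measure R).
Local Open Scope ereal_scope.

Lemma ge0_integral_lebesgue_cons (f : 'rV[R]_n.+1 -> \bar R) :
  measurable_fun setT f -> (forall x, 0 <= f x) ->
  \int[lebesgue_rV n.+1]_x f x = \int[leb \x lebesgue_rV n]_z f (cons_rV z).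
Proof.
move=> mf f0.
rewrite -(ge0_integral_pushforward (@measurable_cons_rV R n) _ measurableT)//.
Qed.

Lemma measurable_comp_cons_rV (f : 'rV[R]_n.+1 -> \bar R) :
  measurable_fun setT f -> measurable_fun setT (fun z => f (@cons_rV R n z)).
Proof. by move=> mf; apply: measurableT_comp => //; exact: measurable_cons_rV. Qed.

Lemma ge0_integral_lebesgue_iter (f : 'rV[R]_n.+1 -> \bar R) :
  measurable_fun setT f -> (forall x, 0 <= f x) ->
  \int[lebesgue_rV n.+1]_x f x =
  \int[lebesgue_rV n]_y \int[leb]_t f (cons_rV (t, y)).
Proof.
move=> mf f0; rewrite ge0_integral_lebesgue_cons//.
by rewrite fubini_tonelli2//; exact: measurable_comp_cons_rV.
Qed.

End lebesgue_fubini.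

Section lebesgue_affine.
Context {R : realType}.
Local Notation leb := (@lebesgue_measure R).

Lemma measurable_affine (a b : R) :
  measurable_fun setT (fun t : measurableTypeR R => a * t + b : measurableTypeR R).
Proof. by apply: measurable_funD => //; apply: mulrl_measurable. Qed.

Lemma ge0_integral_affine (a b : R) (f : R -> \bar R) : 0 < a ->
  measurable_fun setT f -> (forall x, 0 <= f x)%E ->
  (\int[leb]_t f (a * t + b)%R = (a^-1)%:E * \int[leb]_t f t)%E.
Proof.
move=> a0 mf f0.
pose h t : measurableTypeR R := a * t + b.
pose nu := mscale (NngNum (ltW a0))
  (measure_function_pushforward__canonical__measure_function_Measure leb
     (measurable_affine a b)).
have lebE A : measurable A -> leb A = nu A.
  apply: lebesgue_measure_unique => _ [[c d] _ <-].
  transitivity (a%:E *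
    leb ((fun t : measurableTypeR R => (a * t + b)%R) @^-1` `]c, d]%classic))%E;
    last by [].
  have -> : (fun t : measurableTypeR R => a * t + b) @^-1` `]c, d]%classic =
      `](c - b) / a, (d - b) / a]%classic.
    apply/seteqP; split => t /=; rewrite !in_itv/= ltr_pdivrMr// ler_pdivlMr//.
      by rewrite ltrBlDr lerBrDr mulrC.
    by rewrite ltrBlDr lerBrDr mulrC.
  rewrite !lebesgue_measure_itv/= !lte_fin ltr_pM2r ?invr_gt0// ltrD2r.
  case: ifPn => cd; last by rewrite mule0.
  rewrite -EFinB -EFinM; congr (_%:E); field; exact: lt0r_neq0.
transitivity ((a^-1)%:E * (a%:E * \int[leb]_t f (a * t + b)%R))%E.
  by rewrite muleA -EFinM mulVf ?mul1e// lt0r_neq0.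
congr (_ * _)%E.
transitivity (\int[nu]_t f t)%E; last first.
  by apply: eq_measure_integral => A mA _; exact: esym (lebE A mA).
rewrite /nu ge0_integral_mscale//=; congr (_ * _)%E.
rewrite (ge0_integral_pushforward (measurable_affine a b) _ measurableT)//.
Qed.

End lebesgue_affine.

Section lebesgue_rV_affine.
Context {R : realType}.
Local Open Scope ereal_scope.

Lemma measurable_rV_affine n (a : R) (b : 'rV[R]_n) :
  measurable_fun setT (fun x : 'rV[R]_n => (a *: x + b)%R).
Proof.
apply: measurable_fun_rVP => i; under eq_fun do rewrite !mxE.
apply: measurable_funD => //; apply: measurable_funM => //; exact: measurable_coor.
Qed.

(** Translations and dilations act on volumes in each coordinate separately, so
    that the one-dimensional formula propagates through the iterated product. *)
Lemma ge0_integral_rV_affine n (a : R) (b : 'rV[R]_n) (f : 'rV[R]_n -> \bar R) :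
  (0 < a)%R -> measurable_fun setT f -> (forall x, 0 <= f x) ->
  \int[lebesgue_rV n]_x f (a *: x + b)%R =
  (a ^- n)%:E * \int[lebesgue_rV n]_x f x.
Proof.
move=> a0; elim: n b f => [|n IH] b f mf f0.
  rewrite expr0 invr1 mul1e; apply: eq_integral => x _; congr f.
  by apply/rowP => -[].
have mF : measurable_fun setT
    (fun y => \int[@lebesgue_measure R]_t f (cons_rV (t, y))).
  apply: (measurable_fun_fubini_tonelli_G (fun z => f (cons_rV z))) => //.
  exact: measurable_comp_cons_rV.
rewrite ge0_integral_lebesgue_iter; last 2 first.
- by apply: (measurableT_comp mf); exact: measurable_rV_affine.
- by [].
have affE t y : (a *: cons_rV (t, y) + b)%R =
    cons_rV ((a * t + b ord0 ord0)%R, (a *: y + behead_rV b)%R).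
  by rewrite -[in LHS](cons_behead_rV b) cons_rV_scale cons_rV_add.
transitivity (\int[lebesgue_rV n]_y ((a^-1)%:E *
    \int[@lebesgue_measure R]_t f (cons_rV (t, (a *: y + behead_rV b)%R)))).
  apply: eq_integral => y _; under eq_integral do rewrite affE.
  rewrite (ge0_integral_affine (b ord0 ord0)
    (f := fun t => f (cons_rV (t, (a *: y + behead_rV b)%R))))//.
  apply: (measurableT_comp mf).
  apply: (measurableT_comp (@measurable_cons_rV R n)).
  exact: measurable_pair2.
rewrite ge0_integralZl_EFin ?invr_ge0 ?ltW//; first last.
- apply: (measurableT_comp mF); exact: measurable_rV_affine.
- by move=> y _; exact: integral_ge0.
rewrite (IH (behead_rV b) (fun y => \int[lebesgue_measure]_t f (cons_rV (t, y))))//.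
  rewrite muleA -EFinM -invfM -exprS; congr (_ * _).
  by rewrite ge0_integral_lebesgue_iter.
by move=> y; exact: integral_ge0.
Qed.

End lebesgue_rV_affine.

(** * Borel sets and topology of row vectors *)

Section rV_topology.
Context {R : realType} (m : nat).
Implicit Types (A K : set 'rV[R]_m) (x : 'rV[R]_m).

Lemma measurable_ball_max x (e : R) : measurable (ball x e).
Proof.
have [e0|e0] := ltP 0 e; last first.
  rewrite (_ : ball x e = set0)//; apply/seteqP; split => // y [].
  by rewrite ltNge e0.
rewrite (_ : ball x e = \bigcap_(i in [set: 'I_m])
    ((fun y : 'rV[R]_m => y ord0 i) @^-1` (ball (x ord0 i) e))).
  apply: fin_bigcap_measurable => // i _; rewrite -[X in measurable X]setTI.
  apply: (@measurable_coor R m i) => //; exact: measurable_ball.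
apply/seteqP; split => y /=.
  by move=> [_ h] i _; exact: h.
by move=> h; split=> // i j; rewrite !(ord1 i); exact: h.
Qed.

(** An open set is the union of the balls with rational centre and radius 1/k
    that it contains. *)
Lemma open_measurable_rV A : open A -> measurable A.
Proof.
move=> oA.
pose B (qk : 'rV[rat]_m * nat) : set 'rV[R]_m :=
  if `[< ball (map_mx ratr qk.1 : 'rV[R]_m) qk.2.+1%:R^-1 `<=` A >]
  then ball (map_mx ratr qk.1 : 'rV[R]_m) qk.2.+1%:R^-1 else set0.
rewrite (_ : A = \bigcup_qk B qk).
  apply: countable_bigcupT_measurable; first exact: countableP.
  by move=> qk; rewrite /B; case: ifP => _ //; exact: measurable_ball_max.
apply/seteqP; split => [x Ax|x [qk _]]; last first.
  by rewrite /B; case: ifPn => // /asboolP; apply.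
have /nbhs_ballP[e /= e0 xeA] : nbhs x A by exact: open_nbhs_nbhs.
have [k ke] : exists k : nat, k.+1%:R^-1 + k.+1%:R^-1 < e.
  have e20 : 0 < e / 2 by rewrite divr_gt0.
  have [k _ /(_ k (leqnn k))/= ke] := near_infty_natSinv_lt (PosNum e20).
  by exists k; rewrite (splitr e) ltrD.
have k0 : (0 : R) < k.+1%:R^-1 by rewrite invr_gt0.
have /choice[q qx] : forall i, exists q : rat, ball (x ord0 i) k.+1%:R^-1 (ratr q).
  move=> i; have : x ord0 i - k.+1%:R^-1 < x ord0 i + k.+1%:R^-1.
    by rewrite ltrBlDr -addrA ltrDl addr_gt0.
  move=> /rat_in_itvoo[q]; rewrite in_itv/= => /andP[q1 q2].
  by exists q; rewrite /ball/= ltr_distlC q1.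
have xb : ball x k.+1%:R^-1 (map_mx ratr (\row_i q i) : 'rV[R]_m).
  by split => // i j; rewrite !mxE !(ord1 i).
have sub : ball (map_mx ratr (\row_i q i) : 'rV[R]_m) k.+1%:R^-1 `<=` A.
  move=> y qy; apply: xeA; apply: (le_ball (ltW ke)).
  exact: ball_triangle qy.
exists (\row_i q i, k) => //; rewrite /B/= asboolT//; exact: ball_sym.
Qed.

Lemma closed_measurable_rV A : closed A -> measurable A.
Proof.
by move=> /closed_openC/open_measurable_rV/measurableC; rewrite setCK.
Qed.

Lemma compact_closed_rV K : compact K -> closed K.
Proof. by apply: compact_closed; exact: norm_hausdorff. Qed.

Lemma compact_measurable_rV K : compact K -> measurable K.
Proof. by move/compact_closed_rV/closed_measurable_rV. Qed.

Lemma open_continuous_measurable_rV A (f : 'rV[R]_m -> R) : open A ->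
  {in A, continuous f} -> measurable_fun A f.
Proof.
move=> oA cf; apply: (measurability _ (measurable_realfun.RGenOpens.measurableE R)).
move=> _ [_ [a [b ->]] <-].
apply: open_measurable_rV; rewrite openE => x [Ax fx].
apply: filterI; first exact: open_nbhs_nbhs.
by apply: (cf x (mem_set Ax)); exact: open_nbhs_nbhs.
Qed.

Lemma continuous_measurable_rV (f : 'rV[R]_m -> R) : continuous f ->
  measurable_fun setT f.
Proof. by move=> cf; apply: open_continuous_measurable_rV => //; exact: openT. Qed.

Lemma compact_coor_le K : compact K ->
  exists M : R, forall x, K x -> forall i, `|x ord0 i| <= M.
Proof.
move=> /compact_bounded[M [Mr HM]]; exists (M + 1) => x Kx i.
have := HM (M + 1) ltac:(by rewrite ltrDl) x Kx.
apply: le_trans; rewrite -[leRHS]/(mx_norm x) mx_normrE.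
by apply/bigmax_geP; right => /=; exists (ord0, i).
Qed.

Lemma lebesgue_rV_compact K : compact K -> (lebesgue_rV m K < +oo)%E.
Proof.
move=> cK; have [M KM] := compact_coor_le cK.
pose box := [set x : 'rV[R]_m | forall i, `[- M, M]%classic (x ord0 i)].
apply: (@le_lt_trans _ _ (lebesgue_rV m box)).
  apply: le_measure; rewrite ?inE; first exact: compact_measurable_rV.
    apply: compact_measurable_rV.
    by apply: (@rV_compact _ _ (fun=> `[- M, M]%classic)) => i; exact: segment_compact.
  by move=> x /KM xM i; rewrite /= in_itv/= -ler_norml.
have -> : lebesgue_rV m box = (\prod_(i < m) lebesgue_measure (`[(- M)%R, M]%classic : set R))%E.
  exact: (@lebesgue_rV_box R m (fun=> `[- M, M]%classic)).
rewrite ltey_eq; apply/orP; left.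
elim/big_ind: _ => // [x y xf yf|i _]; first exact: fin_numM.
by rewrite lebesgue_measure_itv/=; case: ifPn.
Qed.

End rV_topology.

(** * Euclidean norm, annuli, norm of a gradient *)

Section dot_product.
Context {R : realType} (m : nat).
Implicit Types (x y : 'rV[R]_m) (a : R).

Definition dotr x y : R := \sum_(i < m) x ord0 i * y ord0 i.

Lemma dotrC x y : dotr x y = dotr y x.
Proof. by apply: eq_bigr => i _; rewrite mulrC. Qed.

Lemma dotrDl x y z : dotr (x + y) z = dotr x z + dotr y z.
Proof. by rewrite -big_split; apply: eq_bigr => i _; rewrite mxE mulrDl. Qed.

Lemma dotrZl a x y : dotr (a *: x) y = a * dotr x y.
Proof. by rewrite mulr_sumr; apply: eq_bigr => i _; rewrite mxE mulrA. Qed.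

Lemma dotrZr a x y : dotr x (a *: y) = a * dotr x y.
Proof. by rewrite dotrC dotrZl dotrC. Qed.

Lemma dotrBl x y z : dotr (x - y) z = dotr x z - dotr y z.
Proof. by rewrite dotrDl -scaleN1r dotrZl mulN1r. Qed.

Lemma sqr_enorm x : enorm x ^+ 2 = dotr x x.
Proof.
rewrite /enorm sqr_sqrtr; first by apply: eq_bigr => i _; rewrite expr2.
by apply: sumr_ge0 => i _; exact: sqr_ge0.
Qed.

Lemma enorm_ge0 x : 0 <= enorm x.
Proof. exact: sqrtr_ge0. Qed.

Lemma dotr_ge0 x : 0 <= dotr x x.
Proof. by rewrite -sqr_enorm sqr_ge0. Qed.

Lemma enormE x : enorm x = Num.sqrt (dotr x x).
Proof. by rewrite -sqr_enorm sqrtr_sqr ger0_norm// enorm_ge0. Qed.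

Lemma coor_le_enorm x i : `|x ord0 i| <= enorm x.
Proof.
rewrite -sqrtr_sqr /enorm ler_wsqrtr// (bigD1 i)//= lerDl.
by apply: sumr_ge0 => j _; exact: sqr_ge0.
Qed.

Lemma enorm_eq0 x : enorm x = 0 -> x = 0.
Proof.
move=> x0; apply/rowP => i; rewrite mxE; apply/normr0_eq0/le_anti.
by rewrite normr_ge0 andbT -x0 coor_le_enorm.
Qed.

Lemma enorm0 : enorm (0 : 'rV[R]_m) = 0.
Proof. by rewrite enormE /dotr big1 ?sqrtr0// => i _; rewrite mxE mul0r. Qed.

Lemma enorm_gt0 x : (0 < enorm x) = (x != 0).
Proof.
rewrite lt0r enorm_ge0 andbT; congr (~~ _); apply/eqP/eqP; first exact: enorm_eq0.
by move=> ->; exact: enorm0.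
Qed.

Lemma enormZ a x : enorm (a *: x) = `|a| * enorm x.
Proof.
by rewrite !enormE dotrZl dotrZr mulrA -expr2 sqrtrM ?sqr_ge0// sqrtr_sqr.
Qed.

Lemma enormN x : enorm (- x) = enorm x.
Proof. by rewrite -scaleN1r enormZ normrN1 mul1r. Qed.

Lemma dotr_le x y : dotr x y <= enorm x * enorm y.
Proof.
have [->|y0] := eqVneq y 0.
  by rewrite enorm0 mulr0 /dotr big1// => i _; rewrite mxE mulr0.
have d0 : 0 < dotr y y by rewrite -sqr_enorm exprn_gt0// enorm_gt0.
have : 0 <= dotr (dotr y y *: x - dotr x y *: y) (dotr y y *: x - dotr x y *: y).
  exact: dotr_ge0.
rewrite dotrBl dotrZl dotrZl [dotr x (_ - _)]dotrC [dotr y (_ - _)]dotrC.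
rewrite !dotrBl !dotrZl (dotrC y x).
move=> h; have {}h : dotr x y ^+ 2 <= dotr x x * dotr y y.
  by rewrite -(ler_pM2l d0); nra.
apply: le_trans (ler_norm _) _; rewrite -sqrtr_sqr.
by rewrite !enormE -sqrtrM ?dotr_ge0// ler_wsqrtr.
Qed.

Lemma ler_enormD x y : enorm (x + y) <= enorm x + enorm y.
Proof.
rewrite -(ler_pXn2r (n := 2))// ?nnegrE ?addr_ge0 ?enorm_ge0//.
rewrite sqr_enorm dotrDl 2![dotr _ (x + y)]dotrC !dotrDl sqrrD !sqr_enorm.
have := dotr_le x y; rewrite (dotrC y x); set d := dotr x y; set p := enorm x * _.
move=> h; rewrite -mulr_natl; lra.
Qed.

Lemma ler_dist_enorm x y : `|enorm x - enorm y| <= enorm (x - y).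
Proof.
have h (u v : 'rV[R]_m) : enorm u - enorm v <= enorm (u - v).
  by rewrite lerBlDr; have := ler_enormD (u - v) v; rewrite subrK.
by rewrite ler_norml h andbT lerNl opprB -(enormN (x - y)) opprB h.
Qed.

Lemma enorm_radial x : x != 0 -> enorm (radial x) = 1.
Proof.
move=> x0; rewrite /radial enormZ ger0_norm ?invr_ge0 ?enorm_ge0//.
by rewrite mulVf// gt_eqF// enorm_gt0.
Qed.

Lemma radialZ a x : 0 < a -> radial (a *: x) = radial x.
Proof.
move=> a0; rewrite /radial enormZ gtr0_norm// scalerA.
by rewrite invfM mulrAC mulVf ?mul1r// gt_eqF.
Qed.

Lemma enorm_scale_radial x : enorm x *: radial x = x.
Proof.
have [->|x0] := eqVneq x 0; first by rewrite enorm0 scale0r.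
by rewrite /radial scalerA mulfV ?scale1r// gt_eqF// enorm_gt0.
Qed.

Lemma enorm_le_sum x : enorm x <= \sum_(i < m) `|x ord0 i|.
Proof.
rewrite -(ler_pXn2r (n := 2))// ?nnegrE ?enorm_ge0 ?sumr_ge0// sqr_enorm.
rewrite expr2 mulr_suml; apply: ler_sum => i _.
rewrite (le_trans (ler_norm _))// normrM ler_wpM2l//.
by rewrite (bigD1 i)//= lerDl sumr_ge0.
Qed.

Lemma enorm_le_mxnorm x : enorm x <= m%:R * `|x|.
Proof.
rewrite (le_trans (enorm_le_sum x))// -[m in m%:R]card_ord -sum1_card natr_sum mulr_suml.
apply: ler_sum => i _; rewrite mul1r -[leRHS]/(mx_norm x) mx_normrE.
by apply/bigmax_geP; right => /=; exists (ord0, i).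
Qed.

Lemma continuous_enorm : continuous (@enorm R m).
Proof.
move=> x; apply/(@cvgrPdist_le _ _ _ (nbhs x)) => e e0.
have e0' : 0 < e / m.+1%:R by rewrite divr_gt0.
apply/nbhs_ballP; exists (e / m.+1%:R) => //= y; rewrite -ball_normE => /ltW xy.
apply: le_trans (ler_dist_enorm x y) _.
apply: le_trans (enorm_le_mxnorm _) _.
apply: (@le_trans _ _ (m.+1%:R * `|x - y|)); first by rewrite ler_wpM2r// ler_nat.
by rewrite mulrC -ler_pdivlMr.
Qed.

End dot_product.

Section annuli.
Context {R : realType} (m : nat).

Definition annulus (a b : R) : set 'rV[R]_m := [set x | a < enorm x < b].

Lemma open_annulus a b : open (annulus a b).
Proof.
rewrite (_ : annulus a b = @enorm R m @^-1` `]a, b[%classic).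
  by apply: open_comp => [x _|]; [exact: continuous_enorm|exact: interval_open].
by apply/seteqP; split => x /=; rewrite in_itv.
Qed.

Definition closed_annulus (a b : R) : set 'rV[R]_m := [set x | a <= enorm x <= b].

Lemma compact_closed_annulus a b : compact (closed_annulus a b).
Proof.
apply: bounded_closed_compact.
  exists b; split; first exact: num_real.
  move=> M bM x /= /andP[_ xb]; rewrite -[leLHS]/(mx_norm x) mx_normrE.
  apply/bigmax_leP; split=> [|[i j] _]/=.
    by rewrite (le_trans (enorm_ge0 x))// (le_trans xb)// ltW.
  by rewrite (ord1 i) (le_trans (coor_le_enorm x j))// (le_trans xb)// ltW.
rewrite (_ : closed_annulus a b = @enorm R m @^-1` `[a, b]%classic).
  apply: closed_comp => [x _|]; [exact: continuous_enorm|exact: interval_closed].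
by apply/seteqP; split => x /=; rewrite in_itv.
Qed.

Lemma annulus_sub_closed a b a' b' : a' <= a -> b <= b' ->
  annulus a b `<=` closed_annulus a' b'.
Proof.
move=> aa bb x /= /andP[ax xb].
by rewrite /closed_annulus/= (le_trans aa (ltW ax))/= (le_trans (ltW xb)).
Qed.

Lemma closed_annulus_sub a b a' b' : a' < a -> b < b' ->
  closed_annulus a b `<=` annulus a' b'.
Proof.
move=> aa bb x /= /andP[ax xb].
by rewrite /annulus/= (lt_le_trans aa ax)/= (le_lt_trans xb).
Qed.

Lemma punctured_ballE : @punctured_ball R m = annulus 0 1.
Proof.
apply/seteqP; split => x; rewrite /punctured_ball/annulus/ball_rV/=.
  by move=> [-> /eqP x0]; rewrite enorm_gt0 x0.
by move=> /andP[+ ->]; rewrite enorm_gt0 => /eqP.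
Qed.

Lemma collarE : @collar R m = annulus 2^-1 1.
Proof. by []. Qed.

Lemma measurable_annulus a b : measurable (annulus a b).
Proof. by apply: open_measurable_rV; exact: open_annulus. Qed.

(** The distance to the two bounding spheres is bounded below on a compact set. *)
Lemma compact_annulus a b (K : set 'rV[R]_m) : a < b -> compact K -> K `<=` annulus a b ->
  exists a' b', [/\ a < a', a' <= b', b' < b & K `<=` closed_annulus a' b'].
Proof.
move=> ab cK Kab.
have [->|/set0P K0] := eqVneq K set0.
  by exists ((a + b) / 2), ((a + b) / 2); split => //; lra.
have cf : {within K, continuous (@enorm R m)}.
  by apply: continuous_subspaceT; exact: continuous_enorm.
have /= [x /set_mem Kx xK] := EVT_max_rV K0 cK cf.
have /= [y /set_mem Ky yK] := EVT_min_rV K0 cK cf.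
exists (enorm y), (enorm x); split; [|exact: yK (mem_set Kx)| |].
- by have /andP[] := Kab _ Ky.
- by have /andP[] := Kab _ Kx.
- by move=> z /mem_set Kz; rewrite /closed_annulus/= yK ?xK.
Qed.

End annuli.

Section gradient_norm.
Context {R : realType} (m : nat).
Implicit Types A B : 'M[R]_m.

Lemma sqr_mxnorm2 A : mxnorm2 A ^+ 2 = \sum_(i < m) \sum_(j < m) A i j ^+ 2.
Proof.
rewrite /mxnorm2 sqr_sqrtr; last by apply: sumr_ge0 => i _; exact: sqr_ge0.
apply: eq_bigr => i _; rewrite sqr_enorm; apply: eq_bigr => j _.
by rewrite !mxE expr2.
Qed.

Lemma mxnorm2_ge0 A : 0 <= mxnorm2 A.
Proof. exact: sqrtr_ge0. Qed.

Lemma mxnorm2_vec A : mxnorm2 A = enorm (mxvec A).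
Proof.
apply/eqP; rewrite -(eqrXn2 (n := 2))// ?mxnorm2_ge0 ?enorm_ge0//.
rewrite sqr_mxnorm2 sqr_enorm /dotr (reindex _ (curry_mxvec_bij _ _))/= pair_bigA/=.
by apply/eqP/eq_bigr => -[i j] _ /=; rewrite mxvecE expr2.
Qed.

Lemma mxnorm2_entry A i j : `|A i j| <= mxnorm2 A.
Proof. by rewrite mxnorm2_vec -mxvecE coor_le_enorm. Qed.

End gradient_norm.

(** * Continuity, functions of class C^1, test functions *)

Section max_norm.
Context {R : realType} (m : nat).
Implicit Types x : 'rV[R]_m.

Lemma coor_le_norm x i : `|x ord0 i| <= `|x|.
Proof.
rewrite -[leRHS]/(mx_norm x) mx_normrE.
by apply/bigmax_geP; right => /=; exists (ord0, i).
Qed.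

Lemma norm_le_coor x (M : R) : 0 <= M -> (forall i, `|x ord0 i| <= M) -> `|x| <= M.
Proof.
move=> M0 xM; rewrite -[leLHS]/(mx_norm x) mx_normrE.
by apply/bigmax_leP; split => // -[i j] _ /=; rewrite (ord1 i).
Qed.

Lemma basis_rVE (i j : 'I_m) : @basis_rV R m i ord0 j = (j == i)%:R.
Proof. by rewrite mxE eqxx. Qed.

End max_norm.

Lemma cvg_rsum {R : realType} (T I : Type) (F : set_system T) {FF : Filter F}
    (r : seq I) (f : I -> T -> R) (l : I -> R) :
  (forall i, f i x @[x --> F] --> l i) ->
  \sum_(i <- r) f i x @[x --> F] --> \sum_(i <- r) l i.
Proof.
move=> fl; elim: r => [|i r IH].
  under eq_fun do rewrite big_nil; rewrite big_nil; exact: cvg_cst.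
by under eq_fun do rewrite big_cons; rewrite big_cons; apply: cvgD.
Qed.

Section pointwise_continuity.
Context {R : realType} {T : topologicalType}.
Implicit Types (f g : T -> R) (x : T).

Lemma ctsC (a : R) x : {for x, continuous (fun=> a)}.
Proof. exact: cvg_cst. Qed.

Lemma ctsD f g x : {for x, continuous f} -> {for x, continuous g} ->
  {for x, continuous (fun y => f y + g y)}.
Proof. by move=> cf cg; apply: cvgD. Qed.

Lemma ctsN f x : {for x, continuous f} -> {for x, continuous (fun y => - f y)}.
Proof. by move=> cf; apply: cvgN. Qed.

Lemma ctsB f g x : {for x, continuous f} -> {for x, continuous g} ->
  {for x, continuous (fun y => f y - g y)}.
Proof. by move=> cf cg; apply: cvgB. Qed.

Lemma ctsM f g x : {for x, continuous f} -> {for x, continuous g} ->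
  {for x, continuous (fun y => f y * g y)}.
Proof. by move=> cf cg; apply: cvgM. Qed.

Lemma ctsV f x : f x != 0 -> {for x, continuous f} ->
  {for x, continuous (fun y => (f y)^-1)}.
Proof. by move=> f0 cf; apply: cvgV. Qed.

Lemma cts_sum (I : Type) (r : seq I) (f : I -> T -> R) x :
  (forall i, {for x, continuous (f i)}) ->
  {for x, continuous (fun y => \sum_(i <- r) f i y)}.
Proof. by move=> cf; apply: cvg_rsum. Qed.

Lemma cts_comp (h : R -> R) f x : {for x, continuous f} -> {for f x, continuous h} ->
  {for x, continuous (fun y => h (f y))}.
Proof. by move=> cf ch; apply: (continuous_comp cf ch). Qed.

Lemma cts_max0 f x : {for x, continuous f} ->
  {for x, continuous (fun y => Num.max (f y) 0)}.
Proof. by move=> cf; apply: continuous_max; [exact: cf|exact: cvg_cst]. Qed.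

End pointwise_continuity.

Lemma cts_coor {R : realType} m (i : 'I_m) (x : 'rV[R]_m) :
  {for x, continuous (fun y : 'rV[R]_m => y ord0 i)}.
Proof. exact: coord_continuous. Qed.

Section is_derive_line.
Context {R : realType} {V : normedModType R}.
Implicit Types (f : V -> R) (x v : V).

Lemma is_derive1_quotP (f : R -> R) (t d : R) : is_derive t 1 f d <->
  h^-1 * (f (h + t) - f t) @[h --> 0^'] --> d.
Proof.
have E : (fun h => h^-1 *: ((f \o shift t) (h *: 1) - f t)) =
         (fun h => h^-1 * (f (h + t) - f t)).
  by apply/funext => h /=; rewrite [h%:A]mulr1.
split=> [[fd <-]|fd].
  by rewrite /derive E; move: fd; rewrite /derivable E.
apply: DeriveDef; first by rewrite /derivable E; apply/cvg_ex; exists d.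
by rewrite /derive E; exact/cvg_lim.
Qed.

Lemma is_derive_quotP f x v d : is_derive x v f d <->
  h^-1 * (f (h *: v + x) - f x) @[h --> 0^'] --> d.
Proof.
split=> [[fd <-]|fd]; first exact: fd.
apply: DeriveDef; first by apply/cvg_ex; exists d.
exact/cvg_lim.
Qed.

Lemma is_derive_line f x v t d :
  is_derive (t *: v + x) v f d <-> is_derive t 1 (fun h => f (h *: v + x)) d.
Proof.
rewrite is_derive_quotP is_derive1_quotP.
by under eq_fun do rewrite addrA -scalerDl.
Qed.

Lemma is_derive_line0 f x v d :
  is_derive x v f d <-> is_derive (0 : R) 1 (fun h => f (h *: v + x)) d.
Proof. by rewrite -is_derive_line scale0r add0r. Qed.

Lemma is_derive_comp1 (h : R -> R) f x v a b :
  is_derive (f x) 1 h a -> is_derive x v f b -> is_derive x v (h \o f) (a * b).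
Proof.
move=> ha /is_derive_line0 fb; apply/is_derive_line0.
by apply: (is_derive1_comp _ fb); rewrite scale0r add0r.
Qed.

(** The mean value theorem along a segment. *)
Lemma MVT_line f (g : V -> R) x v (a : R) :
  (forall y, is_derive y v f (g y)) ->
  exists c, 0 <= c <= 1 /\ f (a *: v + x) - f x = a * g ((c * a) *: v + x).
Proof.
move=> fg.
have D (s : R) : is_derive s 1 (fun s => f ((s * a) *: v + x)) (a * g ((s * a) *: v + x)).
  have -> : (fun s => f ((s * a) *: v + x)) = (fun h => f (h *: v + x)) \o ( *%R^~ a).
    by [].
  rewrite mulrC; apply: is_derive1_comp.
    by apply/is_derive_line; exact: fg.
  have -> : *%R^~ a = (a \*: @idfun R) by apply/funext => z /=; rewrite mulrC.
  have := is_deriveZ a (@is_derive_id R R s 1).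
  by rewrite [a *: 1 in X in X -> _]mulr1.
have cD : {within `[(0 : R), 1], continuous (fun s => f ((s * a) *: v + x))}.
  apply: derivable_within_continuous => s _.
  exact: (@ex_derive _ _ _ _ _ _ _ (D s)).
have [c] := @MVT_segment R _ _ 0 1 ler01 (fun s _ => D s) cD.
rewrite in_itv/= mul1r mul0r scale0r add0r subr0 mulr1 => c01 E.
by exists c.
Qed.

End is_derive_line.

Section C1.
Context {R : realType} (m : nat).
Variables (f : 'rV[R]_m -> R) (g : 'I_m -> 'rV[R]_m -> R).
Hypothesis fg : forall i x, is_derive x (basis_rV i) f (g i x).

(** Moving from x to y one coordinate at a time. *)
Lemma mean_value_coor x y : exists xi : 'I_m -> 'rV[R]_m,
  (forall k, `|xi k - x| <= `|y - x|) /\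
  f y - f x = \sum_k (y ord0 k - x ord0 k) * g k (xi k).
Proof.
pose p (k : nat) : 'rV[R]_m := \row_i (if (i < k)%N then y ord0 i else x ord0 i).
have p0 : p 0 = x by apply/rowP => i; rewrite mxE.
have pm : p m = y by apply/rowP => i; rewrite mxE ltn_ord.
have pS (k : 'I_m) : p k.+1 = (y ord0 k - x ord0 k) *: basis_rV k + p k.
  apply/rowP => i; rewrite 3!mxE basis_rVE mxE ltnS leq_eqVlt.
  have [/val_inj->|ik] := eqVneq (i : nat) k.
    by rewrite /= eqxx ltnn mulr1 subrK.
  by rewrite /= (_ : (i == k) = false) ?mulr0 ?add0r//; apply/negbTE.
have /choice[xi Hxi] : forall k : 'I_m, exists z : 'rV[R]_m, `|z - x| <= `|y - x| /\
    f (p k.+1) - f (p k) = (y ord0 k - x ord0 k) * g k z.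
  move=> k; rewrite pS; have [c [/andP[c0 c1] E]] := MVT_line (p k) (y ord0 k - x ord0 k) (fg k).
  exists ((c * (y ord0 k - x ord0 k)) *: basis_rV k + p k); split; last exact: E.
  apply: norm_le_coor => // i; apply: le_trans (coor_le_norm _ i).
  rewrite !mxE eqxx/=; have [->|ik] := eqVneq i k.
    by rewrite ltnn mulr1 addrK normrM ger0_norm// -[leRHS]mul1r ler_wpM2r.
  by rewrite mulr0 add0r; case: ifP => _ //; rewrite subrr normr0.
exists xi; split=> [k|]; first by case: (Hxi k).
rewrite -[in LHS]pm -[in LHS]p0 -(telescope_sumr (fun k => f (p k)))// big_mkord.
by apply: eq_bigr => k _; case: (Hxi k).
Qed.

Hypothesis cg : forall i, continuous (g i).

(** The chain rule along a differentiable curve. *)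
Lemma is_derive_curve (c : R -> 'rV[R]_m) (c' : 'rV[R]_m) (t : R) :
  (forall i, is_derive t 1 (fun s => c s ord0 i) (c' ord0 i)) ->
  is_derive t 1 (f \o c) (\sum_i c' ord0 i * g i (c t)).
Proof.
move=> dc; apply/is_derive1_quotP.
have /choice[xi Hxi] : forall s, exists xi : 'I_m -> 'rV[R]_m,
    (forall k, `|xi k - c t| <= `|c s - c t|) /\
    f (c s) - f (c t) = \sum_k (c s ord0 k - c t ord0 k) * g k (xi k).
  by move=> s; exact: mean_value_coor.
have dnb (i : 'I_m) : c (h + t) ord0 i @[h --> 0^'] --> c t ord0 i.
  have /differentiable_continuous ct : differentiable (fun s => c s ord0 i) t.
    by apply/derivable1_diffP; exact: (@ex_derive _ _ _ _ _ _ _ (dc i)).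
  have ht : h + t @[h --> (0 : R)^'] --> t.
    suff : h + t @[h --> (0 : R)^'] --> 0 + t by rewrite add0r.
    by apply: cvgD; [exact: nbhs_dnbhs|exact: cvg_cst].
  exact: (cvg_comp _ _ ht ct).
have sum0 : \sum_i `|c (h + t) ord0 i - c t ord0 i| @[h --> 0^'] --> (0 : R).
  rewrite [X in _ --> X](_ : 0 = \sum_(i < m) `|c t ord0 i - c t ord0 i|).
    apply: cvg_rsum => i; apply: cvg_norm; apply: cvgB => //; exact: cvg_cst.
  by rewrite big1// => i _; rewrite subrr normr0.
rewrite (_ : (fun h => _) = (fun h => \sum_k
    (h^-1 * (c (h + t) ord0 k - c t ord0 k)) * g k (xi (h + t) k))); last first.
  apply/funext => h; rewrite /= (Hxi (h + t)).2 mulr_sumr.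
  by apply: eq_bigr => k _; rewrite mulrA.
apply: cvg_rsum => k; apply: cvgM; first exact/is_derive1_quotP.
apply/cvgrPdist_le => e e0.
have /(@cvgrPdist_le _ _ _ (nbhs (c t)))/(_ _ e0)/nbhs_ballP[d /= d0 gd] :=
  @cg k (c t).
have /cvgrPdist_lt/(_ _ d0) := sum0.
apply: filterS => h; rewrite sub0r normrN => hd.
apply: gd; rewrite -ball_normE/=; apply: le_lt_trans (hd).
rewrite distrC; apply: le_trans ((Hxi (h + t)).1 k) _.
rewrite ger0_norm ?sumr_ge0//; apply: norm_le_coor; first by rewrite sumr_ge0.
by move=> i; rewrite !mxE (bigD1 i)//= lerDl sumr_ge0.
Qed.

End C1.

(** A function that vanishes off a compact subset of an open set and is of class
    C^1 on this open set is of class C^1 everywhere. *)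
Section test_function_intro.
Context {R : realType} (m : nat).
Variables (Omega K : set 'rV[R]_m) (f : 'rV[R]_m -> R) (g : 'I_m -> 'rV[R]_m -> R).
Hypotheses (oO : open Omega) (cK : compact K) (KO : K `<=` Omega).
Hypothesis f0 : forall x, ~ K x -> f x = 0.
Hypothesis fg : forall i x, Omega x -> is_derive x (basis_rV i) f (g i x).
Hypothesis cg : forall i x, Omega x -> {for x, continuous (g i)}.

Let nK x : ~ K x -> \forall y \near x, ~ K y.
Proof.
move=> nKx; have := closed_openC (compact_closed_rV cK).
by rewrite openE => /(_ x nKx).
Qed.

Let nO x : Omega x -> \forall y \near x, Omega y.
Proof. by move=> Ox; move: oO; rewrite openE => /(_ x Ox). Qed.

Let D0 i x : ~ K x -> is_derive x (basis_rV i) f 0.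
Proof.
move=> nKx; apply: (@near_eq_is_derive _ _ _ (cst 0)).
by apply: filterS (nK nKx) => y /f0 ->.
Qed.

Lemma test_function_derive i x : Omega x -> 'D_(basis_rV i) f x = g i x.
Proof. by move=> Ox; exact: (@derive_val _ _ _ _ _ _ _ (fg i Ox)). Qed.

Lemma test_function_derive0 i x : ~ K x -> 'D_(basis_rV i) f x = 0.
Proof. by move=> nKx; exact: (@derive_val _ _ _ _ _ _ _ (D0 i nKx)). Qed.

Lemma test_functionI : test_function Omega f.
Proof.
split=> [i x|i x|]; last by exists K.
  have [Kx|nKx] := pselect (K x).
    exact: (@ex_derive _ _ _ _ _ _ _ (fg i (KO Kx))).
  exact: (@ex_derive _ _ _ _ _ _ _ (D0 i nKx)).
have [Kx|nKx] := pselect (K x).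
  rewrite /continuous_at test_function_derive; last exact: KO.
  move=> A /(cg (i := i) (KO Kx)) gA.
  have gA' : nbhs x (fun y => A (g i y)) by exact: gA.
  suff : nbhs x (fun y => A ('D_(basis_rV i) f y)) by [].
  have gO : nbhs x ((fun y => A (g i y)) `&` Omega).
    by apply: filterI => //; exact: nO (KO Kx).
  apply: filterS gO => y [Ay Oy].
  by rewrite test_function_derive.
rewrite /continuous_at test_function_derive0// => A /nbhs_singleton A0.
suff : nbhs x (fun y => A ('D_(basis_rV i) f y)) by [].
have nKn : nbhs x (~` K) by exact: nK.
by apply: filterS nKn => y nKy; rewrite test_function_derive0.
Qed.

End test_function_intro.

Section test_function_elim.
Context {R : realType} (m : nat).
Variables (Omega : set 'rV[R]_m) (phi : 'rV[R]_m -> R).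
Hypothesis tphi : test_function Omega phi.

Lemma test_is_derive i x :
  is_derive x (basis_rV i) phi ('D_(basis_rV i) phi x).
Proof. by case: tphi => dphi _ _; exact: derivableP. Qed.

Lemma test_continuous_derive i : continuous ('D_(basis_rV i) phi).
Proof. by case: tphi. Qed.

Lemma compact_support_bounded (f : 'rV[R]_m -> R) (K : set 'rV[R]_m) :
  compact K -> continuous f -> (forall x, ~ K x -> f x = 0) ->
  exists M, 0 <= M /\ forall x, `|f x| <= M.
Proof.
move=> cK cf f0; have [K0|/set0P K0] := eqVneq K set0.
  by exists 0; split=> // x; rewrite f0 ?normr0// K0.
have cfK : {within K, continuous (fun x => `|f x|)}.
  apply: continuous_subspaceT => x.
  apply: (@continuous_comp _ _ _ f (@Num.norm R R)); first exact: cf.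
  exact: norm_continuous.
have /= [x _ xK] := EVT_max_rV K0 cK cfK.
exists `|f x|; split=> // y; have [Ky|nKy] := pselect (K y).
  exact: xK (mem_set Ky).
by rewrite f0// normr0.
Qed.

Lemma test_support : exists K, [/\ compact K, K `<=` Omega,
  forall x, ~ K x -> phi x = 0 &
  forall i x, ~ K x -> 'D_(basis_rV i) phi x = 0].
Proof.
case: tphi => _ _ [K [cK KO K0]]; exists K; split=> // i x nKx.
rewrite (@near_eq_derive _ _ _ _ (cst 0)) ?derive_cst//.
have : nbhs x (~` K).
  have := closed_openC (compact_closed_rV cK).
  by rewrite openE => /(_ x nKx).
by apply: filterS => y /K0.
Qed.

Lemma test_derive_bounded : exists M, 0 <= M /\
  forall i x, `|'D_(basis_rV i) phi x| <= M.
Proof.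
have [K [cK KO _ K0]] := test_support.
have /choice[M HM] : forall i, exists M, 0 <= M /\
    forall x, `|'D_(basis_rV i) phi x| <= M.
  move=> i; apply: (compact_support_bounded cK); first exact: test_continuous_derive.
  by move=> x; exact: K0.
exists (\sum_i M i); split; first by apply: sumr_ge0 => i _; case: (HM i).
move=> i x; apply: le_trans ((HM i).2 x) _; rewrite (bigD1 i)//= lerDl.
by apply: sumr_ge0 => j _; case: (HM j).
Qed.

Lemma test_continuous : continuous phi.
Proof.
move=> x; apply/(@cvgrPdist_le _ _ _ (nbhs x)) => e e0.
have [M [M0 HM]] := test_derive_bounded.
have C0 : 0 < m%:R * M + 1 by rewrite ltr_wpDl// mulr_ge0.
apply/nbhs_ballP; exists (e / (m%:R * M + 1)); first by rewrite /= divr_gt0.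
move=> y; rewrite -ball_normE/= distrC => /ltW xy.
have [xi [_ E]] := mean_value_coor test_is_derive x y.
rewrite distrC E; apply: le_trans (ler_norm_sum _ _ _) _.
apply: (@le_trans _ _ (\sum_(k < m) `|y - x| * M)).
  apply: ler_sum => k _; rewrite normrM; apply: ler_pM => //.
  by have := coor_le_norm (y - x) k; rewrite !mxE.
rewrite sumr_const card_ord -mulr_natl mulrCA.
apply: (@le_trans _ _ (`|y - x| * (m%:R * M + 1))).
  by rewrite ler_wpM2l// lerDl.
by rewrite -ler_pdivlMr.
Qed.

Lemma test_bounded : exists M, 0 <= M /\ forall x, `|phi x| <= M.
Proof.
have [K [cK KO K0 _]] := test_support.
exact: (compact_support_bounded cK test_continuous K0).
Qed.

Lemma test_measurable : measurable_fun setT phi.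
Proof. exact: continuous_measurable_rV test_continuous. Qed.

Lemma test_measurable_derive i : measurable_fun setT ('D_(basis_rV i) phi).
Proof. by apply: continuous_measurable_rV; exact: test_continuous_derive. Qed.

End test_function_elim.

(** * Derivatives integrate to zero *)

Section integrable_support.
Context {R : realType} (m : nat).
Local Notation mu := (@lebesgue_rV R m).
Implicit Types (f h : 'rV[R]_m -> R) (K : set 'rV[R]_m).

Lemma integrable_mul_support f h K (M : R) :
  compact K -> mu.-integrable K (EFin \o f) -> measurable_fun setT h ->
  (forall x, `|h x| <= M) -> (forall x, ~ K x -> h x = 0) ->
  mu.-integrable setT (EFin \o (f \* h)).
Proof.
move=> cK intf mh hM h0.
have mK := compact_measurable_rV cK.
have -> : EFin \o (f \* h) = ((EFin \o (f \* h)) \_ K).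
  apply/funext => x; rewrite /patch; case: ifPn => //.
  by rewrite notin_setE => /h0 /= ->; rewrite mulr0.
apply/(integrable_mkcond _ mK).
have fM : mu.-integrable K (EFin \o (cst M \* f)).
  have := integrableZl mK M intf.
  by apply: eq_integrable => //.
apply: le_integrable fM => //.
  apply/measurable_EFinP; apply: measurable_funM.
    by case/integrableP : intf => /measurable_EFinP.
  exact: measurable_funTS.
move=> x Kx /=; rewrite lee_fin !normrM mulrC ler_wpM2r//.
exact: le_trans (hM x) (ler_norm _).
Qed.

Lemma integrable_support h K (M : R) : compact K -> measurable_fun setT h ->
  (forall x, `|h x| <= M) -> (forall x, ~ K x -> h x = 0) ->
  mu.-integrable setT (EFin \o h).
Proof.
move=> cK mh hM h0.
have i1 : mu.-integrable K (EFin \o cst 1).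
  apply/integrableP; split; first by apply/measurable_EFinP; exact: measurable_cst.
  under eq_integral do rewrite /= normr1.
  by rewrite integral_cst ?mul1e ?lebesgue_rV_compact//; exact: compact_measurable_rV.
have := integrable_mul_support cK i1 mh hM h0.
by have -> : cst 1 \* h = h by apply/funext => x /=; rewrite mul1r.
Qed.

Lemma integral_translate (f : 'rV[R]_m -> \bar R) (b : 'rV[R]_m) :
  measurable_fun setT f -> (\int[mu]_x f (x + b)%R = \int[mu]_x f x)%E.
Proof.
move=> mf.
have H (g : 'rV[R]_m -> \bar R) : measurable_fun setT g -> (forall x, 0 <= g x)%E ->
    (\int[mu]_x g (x + b)%R = \int[mu]_x g x)%E.
  move=> mg g0; have := ge0_integral_rV_affine b ltr01 mg g0.
  rewrite expr1n invr1 mul1e => <-.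
  by apply: eq_integral => x _; rewrite scale1r.
rewrite integralE [RHS]integralE; congr (_ - _)%E.
  rewrite -(H _ (measurable_funepos mf)); last by move=> x; exact: funepos_ge0.
  by apply: eq_integral => x _; rewrite !funeposE.
rewrite -(H _ (measurable_funeneg mf)); last by move=> x; exact: funeneg_ge0.
by apply: eq_integral => x _; rewrite !funenegE.
Qed.

Lemma integrable_translate (f : 'rV[R]_m -> R) (b : 'rV[R]_m) :
  mu.-integrable setT (EFin \o f) -> mu.-integrable setT (EFin \o (fun x => f (x + b))).
Proof.
move=> /integrableP[mf intf]; apply/integrableP; split.
  apply: (measurableT_comp mf).
  have := measurable_rV_affine 1 b; under eq_fun do rewrite scale1r; exact.
have mabs : measurable_fun setT (fun x => `|(f x)%:E|%E).
  exact: (measurableT_comp _ mf).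
by have /= -> := integral_translate b mabs.
Qed.

End integrable_support.

Section integral_derive_flow.
Context d (T : measurableType d) {R : realType} (mu : {measure set T -> \bar R}).
Variables (f g : T -> R) (s : R -> T -> T) (G : T -> R).
Hypothesis s0 : forall x, s 0 x = x.
Hypothesis fg : forall x (t : R), is_derive t 1 (fun t => f (s t x)) (g (s t x)).
Hypothesis ints : forall t, mu.-integrable setT (EFin \o (fun x => f (s t x))).
Hypothesis invs : forall t, (\int[mu]_x (f (s t x))%:E = \int[mu]_x (f x)%:E)%E.
Hypothesis mg : measurable_fun setT g.
Hypothesis intG : mu.-integrable setT (EFin \o G).
Hypothesis gG : forall (t : R) x, 0 <= t <= 1 -> `|g (s t x)| <= G x.

Let cvg_diff_quot x :
  n.+1%:R * (f (s n.+1%:R^-1 x) - f x) @[n --> \oo] --> g x.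
Proof.
have := fg x 0; rewrite s0 => /is_derive1_quotP/cvgr_dnbhsP.
have h0 : (forall n, n.+1%:R^-1 != 0 :> R) /\ n.+1%:R^-1 @[n --> \oo] --> (0 : R).
  by split=> [n|]; [rewrite invr_eq0 pnatr_eq0|exact: cvg_harmonic].
by move=> /(_ _ h0); under eq_fun do rewrite /= invrK addr0 s0.
Qed.

(** Invariance under the flow s kills the integrals of the difference quotients
    of f, which converge to the derivative g of f along s. *)
Lemma integral_derive_flow : \int[mu]_x g x = 0.
Proof.
pose F (n : nat) x := n.+1%:R * (f (s n.+1%:R^-1 x) - f x).
have intf : mu.-integrable setT (EFin \o f).
  by have := ints 0; under eq_fun do rewrite s0.
have intF n : mu.-integrable setT (EFin \o F n).
  rewrite (_ : EFin \o F n = (fun x => n.+1%:R%:E *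
      ((EFin \o (fun x => f (s n.+1%:R^-1 x))) \- (EFin \o f)) x)%E) //.
  by apply: integrableZl => //; apply: integrableB.
have F0 n : (\int[mu]_x (F n x)%:E = 0)%E.
  under eq_integral do rewrite EFinM.
  rewrite integralZl//; last exact: (integrableB measurableT (ints _) intf).
  rewrite integralB_EFin// invs subee ?mule0//; exact: integrable_fin_num.
have [] := @dominated_convergence _ _ _ mu setT measurableT
  (fun n => EFin \o F n) (EFin \o g) (EFin \o G).
- by move=> n; case/integrableP : (intF n).
- exact/measurable_EFinP.
- by apply: aeW => x _; apply: cvg_EFin; [exact: nearW|exact: cvg_diff_quot].
- exact: intG.
- apply: aeW => x n _; rewrite /= lee_fin /F.
  have n0 : 0 <= n.+1%:R^-1 :> R by rewrite invr_ge0.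
  have cD : {within `[(0 : R), n.+1%:R^-1], continuous (fun t => f (s t x))}.
    apply: derivable_within_continuous => t _.
    exact: (@ex_derive _ _ _ _ _ _ _ (fg x t)).
  have [c] := @MVT_segment R _ _ 0 _ n0 (fun t _ => fg x t) cD.
  rewrite in_itv/= s0 subr0 => /andP[c0 c1] ->.
  rewrite mulrC mulfVK ?pnatr_eq0//; apply: gG.
  by rewrite c0 (le_trans c1)// invf_le1// ler1n.
move=> _ _; rewrite /=; under eq_fun do rewrite F0.
move=> /cvg_lim; rewrite lim_cst// => /(_ _) E.
by rewrite /Rintegral -E.
Qed.

End integral_derive_flow.

Section integral_derive.
Context {R : realType} (m : nat).
Local Notation mu := (@lebesgue_rV R m).
Variables (f g : 'rV[R]_m -> R) (v : 'rV[R]_m).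
Hypothesis fg : forall x, is_derive x v f (g x).

Lemma integral_derive0 (G : 'rV[R]_m -> R) :
  mu.-integrable setT (EFin \o f) -> measurable_fun setT g ->
  mu.-integrable setT (EFin \o G) ->
  (forall (t : R) x, 0 <= t <= 1 -> `|g (t *: v + x)| <= G x) ->
  \int[mu]_x g x = 0.
Proof.
move=> intf mg intG gG.
have mf : measurable_fun setT (EFin \o f) by case/integrableP : intf.
apply: (@integral_derive_flow _ _ _ mu f g (fun t x => t *: v + x) G) => //.
- by move=> x; rewrite scale0r add0r.
- by move=> x t; exact: (proj1 (@is_derive_line R _ f x v t _) (fg _)).
- by move=> t; under eq_fun do rewrite addrC; exact: integrable_translate.
- by move=> t; under eq_integral do rewrite addrC; exact: (integral_translate (t *: v) mf).
Qed.

End integral_derive.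

Section integral_test_derive.
Context {R : realType} (m : nat).
Local Notation mu := (@lebesgue_rV R m).

Lemma integral_test_derive (Omega : set 'rV[R]_m) phi i :
  test_function Omega phi -> \int[mu]_x 'D_(basis_rV i) phi x = 0.
Proof.
move=> tphi; have [K [cK KO phi0 dphi0]] := test_support tphi.
have [M [M0 HM]] := test_derive_bounded tphi.
have [N [N0 HN]] := test_bounded tphi.
have [L KL] := compact_coor_le cK.
pose B := [set x : 'rV[R]_m | forall i, `[- (L + 1), L + 1]%classic (x ord0 i)].
have cB : compact B.
  by apply: (@rV_compact _ _ (fun=> `[- (L + 1), L + 1]%classic)) => j; exact: segment_compact.
apply: (@integral_derive0 _ _ phi _ (basis_rV i) (test_is_derive tphi i) (M \*o \1_B)).
- exact: (integrable_support cK (test_measurable tphi) HN phi0).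
- exact: (test_measurable_derive tphi i).
- have mB := compact_measurable_rV cB.
  apply: (@integrable_support _ _ _ B M) => //.
  + by apply: measurable_funM => //; exact: measurable_indic.
  + by move=> x /=; rewrite indicE; case: (_ \in _); rewrite ?mulr1 ?mulr0 ?normr0// ger0_norm.
  + by move=> x /= nBx; rewrite indicE memNset// mulr0.
- move=> t x /andP[t0 t1] /=; rewrite indicE.
  have [Bx|nBx] := pselect (B x); first by rewrite mem_set// mulr1.
  rewrite memNset// mulr0 dphi0 ?normr0// => Kx; apply: nBx => j /=.
  rewrite in_itv/= -ler_norml.
  have -> : x ord0 j = (t *: basis_rV i + x) ord0 j - t * basis_rV i ord0 j.
    by rewrite !mxE addrAC subrr add0r.
  apply: le_trans (ler_normB _ _) _; apply: lerD; first exact: KL.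
  rewrite basis_rVE normrM ger0_norm// ger0_norm//.
  by rewrite (le_trans _ t1)// ler_piMr// lern1; case: (_ == _).
Qed.

End integral_test_derive.

(** * Cut-offs of class C^1 *)

Section square_of_positive_part.
Context {R : realType}.
Implicit Types x h d C : R.

Lemma is_derive_quadratic (f : R -> R) x d C : 0 <= C ->
  (forall h, `|f (h + x) - f x - h * d| <= C * h ^+ 2) -> is_derive x 1 f d.
Proof.
move=> C0 H; apply/is_derive1_quotP/cvgrPdist_le => e e0.
have d0 : 0 < e / (C + 1) by rewrite divr_gt0// ltr_wpDl.
apply/nbhs_ballP; exists (e / (C + 1)) => //= h.
rewrite -ball_normE/= sub0r normrN => /ltW he h0.
rewrite -[d]mul1r -(mulVf h0) -mulrA -mulrBr normrM distrC.
rewrite normfV ler_pdivrMl ?normr_gt0//; apply: le_trans (H h) _.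
rewrite -[X in C * X]ger0_norm ?sqr_ge0// normrX expr2 mulrCA ler_wpM2l//.
apply: (@le_trans _ _ ((C + 1) * `|h|)); first by rewrite ler_wpM2r// lerDl.
by rewrite mulrC -ler_pdivlMr// ltr_wpDl.
Qed.

(** The square of the positive part: the building block of the C^1 cutoffs. *)
Definition sqpos x : R := Num.max x 0 ^+ 2.

Lemma sqpos_ge0 x : 0 <= sqpos x. Proof. exact: sqr_ge0. Qed.

Lemma sqpos_eq0 x : x <= 0 -> sqpos x = 0.
Proof. by move=> x0; rewrite /sqpos max_r// expr0n. Qed.

Lemma sqpos_gt0 x : 0 < x -> 0 < sqpos x.
Proof. by move=> x0; rewrite /sqpos max_l ?exprn_gt0// ltW. Qed.

Lemma is_derive_sqpos x : is_derive x 1 sqpos (2 * Num.max x 0).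
Proof.
apply: (@is_derive_quadratic _ _ _ 1 ler01) => h; rewrite mul1r /sqpos.
rewrite !maxEle ler_norml.
case: ifPn; rewrite -?ltNge => a; case: ifPn; rewrite -?ltNge => b;
  apply/andP; split; nra.
Qed.

Lemma continuous_sqpos : continuous sqpos.
Proof.
move=> x; apply/differentiable_continuous/derivable1_diffP.
exact: (@ex_derive _ _ _ _ _ _ _ (is_derive_sqpos x)).
Qed.

End square_of_positive_part.

Section box_cutoff.
Context {R : realType} (m : nat).
Implicit Types (c d x : 'rV[R]_m).

Definition cbox c d : set 'rV[R]_m := [set x | forall i, c ord0 i <= x ord0 i <= d ord0 i].

Lemma compact_cbox c d : compact (cbox c d).
Proof.
have -> : cbox c d = [set x | forall i, `[c ord0 i, d ord0 i]%classic (x ord0 i)].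
  by apply/seteqP; split => x /= h i; have := h i; rewrite in_itv.
by apply: (@rV_compact _ _ (fun i => `[c ord0 i, d ord0 i]%classic)) => i; exact: segment_compact.
Qed.

Lemma measurable_cbox c d : measurable (cbox c d).
Proof. by apply: compact_measurable_rV; exact: compact_cbox. Qed.

Lemma is_derive_coor (i j : 'I_m) x : is_derive x (basis_rV j) (fun y => y ord0 i) ((i == j)%:R : R).
Proof.
apply/is_derive_line0; have -> : (fun h => (h *: basis_rV j + x) ord0 i) =
    ((i == j)%:R : R) \*: @idfun R \+ cst (x ord0 i).
  by apply/funext => h; rewrite !mxE ?eqxx/= mulrC.
have := is_deriveD (is_deriveZ ((i == j)%:R : R) (@is_derive_id R R 0 1))
  (is_derive_cst (x ord0 i) (0 : R) 1).
by rewrite addr0 [_ *: 1 in X in X -> _]mulr1.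
Qed.

(** The squared distance to the box, coordinate by coordinate. *)
Definition box_dist c d x : R := \sum_i (sqpos (c ord0 i - x ord0 i) + sqpos (x ord0 i - d ord0 i)).

Lemma box_dist_ge0 c d x : 0 <= box_dist c d x.
Proof. by apply: sumr_ge0 => i _; rewrite addr_ge0 ?sqpos_ge0. Qed.

Lemma box_dist_eq0 c d x : cbox c d x -> box_dist c d x = 0.
Proof.
move=> xb; rewrite /box_dist big1// => i _; have /andP[a b] := xb i.
by rewrite !sqpos_eq0 ?addr0// subr_le0.
Qed.

Lemma box_dist_gt0 c d x : ~ cbox c d x -> 0 < box_dist c d x.
Proof.
move=> /existsNP[i /negP]; rewrite negb_and -!ltNge => xi.
rewrite /box_dist (bigD1 i)//= ltr_pwDl//; last first.
  by apply: sumr_ge0 => j _; rewrite addr_ge0 ?sqpos_ge0.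
case/orP: xi => xi; first by rewrite ltr_pwDl ?sqpos_ge0// sqpos_gt0// subr_gt0.
by rewrite ltr_wpDl ?sqpos_ge0// sqpos_gt0// subr_gt0.
Qed.

Lemma box_dist_coor c d x i (e : R) : 0 <= e -> box_dist c d x <= e ^+ 2 ->
  c ord0 i - e <= x ord0 i <= d ord0 i + e.
Proof.
move=> e0; rewrite /box_dist (bigD1 i)//= => h.
have {h} : sqpos (c ord0 i - x ord0 i) + sqpos (x ord0 i - d ord0 i) <= e ^+ 2.
  by apply: le_trans h; rewrite lerDl sumr_ge0// => j _; rewrite addr_ge0 ?sqpos_ge0.
have key (y : R) : sqpos y <= e ^+ 2 -> y <= e.
  move=> h; have [y0|y0] := leP y 0; first exact: le_trans e0.
  by move: h; rewrite /sqpos max_l ?(ltW y0)// ler_pXn2r// nnegrE ltW.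
move=> h; have a : c ord0 i - x ord0 i <= e.
  by apply: key; apply: le_trans h; rewrite lerDl sqpos_ge0.
have b : x ord0 i - d ord0 i <= e.
  by apply: key; apply: le_trans h; rewrite lerDr sqpos_ge0.
by apply/andP; split; lra.
Qed.

Definition box_cutoff c d (k : R) x : R := sqpos (1 - k * box_dist c d x).

Definition box_cutoff' c d (k : R) (j : 'I_m) x : R :=
  2 * Num.max (1 - k * box_dist c d x) 0 *
  (- k * (- (2 * Num.max (c ord0 j - x ord0 j) 0) + 2 * Num.max (x ord0 j - d ord0 j) 0)).

Lemma is_derive_box_dist c d x j : is_derive x (basis_rV j) (box_dist c d)
  (- (2 * Num.max (c ord0 j - x ord0 j) 0) + 2 * Num.max (x ord0 j - d ord0 j) 0).
Proof.
pose D (i : 'I_m) := (2 * Num.max (c ord0 i - x ord0 i) 0) * (- (i == j)%:R) +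
    (2 * Num.max (x ord0 i - d ord0 i) 0) * (i == j)%:R.
have H (i : 'I_m) : is_derive x (basis_rV j)
    ((sqpos \o (fun y : 'rV[R]_m => c ord0 i - y ord0 i)) \+
    (sqpos \o (fun y : 'rV[R]_m => y ord0 i - d ord0 i))) (D i).
  apply: is_deriveD; apply: is_derive_comp1; try exact: is_derive_sqpos.
    have := is_deriveB (is_derive_cst (c ord0 i) x (basis_rV j)) (is_derive_coor i j x).
    by rewrite sub0r.
  have := is_deriveB (is_derive_coor i j x) (is_derive_cst (d ord0 i) x (basis_rV j)).
  by rewrite subr0.
have S := is_derive_sum H.
have E : \sum_i D i = - (2 * Num.max (c ord0 j - x ord0 j) 0) +
    2 * Num.max (x ord0 j - d ord0 j) 0.
  rewrite (bigD1 j)//= big1 ?addr0; last first.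
    by move=> i /negbTE ij; rewrite /D ij oppr0 !mulr0 addr0.
  by rewrite /D eqxx mulrN !mulr1.
move: S; rewrite E; set F := (F in is_derive _ _ F _).
suff -> : F = box_dist c d by [].
by apply/funext => y; rewrite /F fct_sumE.
Qed.

Lemma is_derive_box_cutoff c d k j x :
  is_derive x (basis_rV j) (box_cutoff c d k) (box_cutoff' c d k j x).
Proof.
have -> : box_cutoff c d k = sqpos \o (cst 1 - k \*: box_dist c d).
  by apply/funext.
apply: is_derive_comp1; first exact: is_derive_sqpos.
have := is_deriveB (is_derive_cst (1 : R) x (basis_rV j))
  (is_deriveZ k (is_derive_box_dist c d x j)).
by rewrite sub0r -[k *: _]/(k * _) [in X in _ -> X]mulNr.
Qed.

Lemma cts_box_dist c d x : {for x, continuous (box_dist c d)}.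
Proof.
rewrite /box_dist; apply: cts_sum => i; apply: ctsD.
  by apply: (cts_comp (h := sqpos)); [apply: ctsB; [exact: ctsC|exact: cts_coor]|exact: continuous_sqpos].
by apply: (cts_comp (h := sqpos)); [apply: ctsB; [exact: cts_coor|exact: ctsC]|exact: continuous_sqpos].
Qed.

Lemma cts_box_cutoff' c d k j x : {for x, continuous (box_cutoff' c d k j)}.
Proof.
rewrite /box_cutoff'; apply: ctsM.
  apply: ctsM; first exact: ctsC.
  apply: cts_max0; apply: ctsB; first exact: ctsC.
  by apply: ctsM; [exact: ctsC|exact: cts_box_dist].
apply: ctsM; first exact: ctsC.
apply: ctsD; [apply: ctsN|]; (apply: ctsM; first exact: ctsC); apply: cts_max0.
  apply: ctsB; [exact: ctsC|exact: cts_coor].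
apply: ctsB; [exact: cts_coor|exact: ctsC].
Qed.

Lemma box_cutoff_eq0 c d (e : R) k x : 0 < e -> e ^- 2 <= k ->
  ~ cbox (c - const_mx e) (d + const_mx e) x -> box_cutoff c d k x = 0.
Proof.
move=> e0 ek nx; rewrite /box_cutoff sqpos_eq0// subr_le0 leNgt.
have k0 : 0 < k by apply: lt_le_trans ek; rewrite invr_gt0 exprn_gt0.
apply/negP => h; apply: nx => i.
have := @box_dist_coor c d x i e (ltW e0); rewrite !mxE; apply.
have : box_dist c d x < k^-1 by rewrite -[ltRHS]mul1r ltr_pdivlMr// mulrC.
by move=> /ltW/le_trans; apply; rewrite -[leRHS]invrK lef_pV2// posrE// invr_gt0 exprn_gt0.
Qed.

Lemma test_function_box_cutoff (Omega : set 'rV[R]_m) c d (e : R) k : open Omega ->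
  0 < e -> e ^- 2 <= k ->
  cbox (c - const_mx e) (d + const_mx e) `<=` Omega ->
  test_function Omega (box_cutoff c d k).
Proof.
move=> oO e0 ek KO.
apply: (@test_functionI _ _ Omega _ _ (box_cutoff' c d k) oO (@compact_cbox _ _) KO).
- by move=> x; exact: box_cutoff_eq0.
- by move=> i x _; exact: is_derive_box_cutoff.
- by move=> i x _; exact: cts_box_cutoff'.
Qed.

Lemma box_cutoff_ge0 c d k x : 0 <= box_cutoff c d k x.
Proof. exact: sqpos_ge0. Qed.

Lemma box_cutoff_le1 c d k x : 0 <= k -> box_cutoff c d k x <= 1.
Proof.
move=> k0; rewrite /box_cutoff /sqpos expr_le1 ?le_max ?lexx ?orbT// ge_max ler01 andbT.
by rewrite gerBl mulr_ge0// box_dist_ge0.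
Qed.

Lemma cvg_box_cutoff c d x :
  box_cutoff c d k.+1%:R x @[k --> \oo] --> (\1_(cbox c d) x : R).
Proof.
rewrite indicE; have [xb|nxb] := pselect (cbox c d x).
  rewrite mem_set//; under eq_fun do
    rewrite /box_cutoff box_dist_eq0// mulr0 subr0 /sqpos max_l// expr1n.
  exact: cvg_cst.
rewrite memNset//; apply: cvg_near_cst.
have b0 := box_dist_gt0 nxb.
have [k _ Hk] := near_infty_natSinv_lt (PosNum b0).
exists k => // l kl; rewrite /box_cutoff sqpos_eq0//.
have := Hk l kl; rewrite /= => h.
rewrite subr_le0 -ler_pdivrMl// mulr1; exact: ltW.
Qed.

End box_cutoff.

(** * The fundamental lemma of the calculus of variations *)

Section fundamental_lemma.
Context {R : realType} (m : nat).
Local Notation mu := (@lebesgue_rV R m).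

Definition boxes : set (set 'rV[R]_m) := [set A | exists c d, A = cbox c d].

Lemma measurable_coor_boxes (i : 'I_m) :
  measurable_fun setT (fun x : g_sigma_algebraType boxes => (x : 'rV[R]_m) ord0 i : R).
Proof.
apply: (measurability _ (measurable_realfun.RGenCInfty.measurableE R)).
move=> _ [_ [a ->] <-]; rewrite setTI.
pose c (k : nat) : 'rV[R]_m := \row_j (if j == i then a else - k%:R).
pose d (k : nat) : 'rV[R]_m := const_mx k%:R.
have -> : (fun x : g_sigma_algebraType boxes => (x : 'rV[R]_m) ord0 i) @^-1` `[a, +oo[%classic =
    \bigcup_k cbox (c k) (d k).
  apply/seteqP; split=> [x /=|x [k _ /(_ i)]]; last first.
    by rewrite !mxE eqxx /= in_itv/= andbT => /andP[].
  rewrite in_itv/= andbT => ax.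
  have [k xk] : exists k : nat, `|x : 'rV[R]_m| <= k%:R.
    exists (Num.truncn `|x : 'rV[R]_m|).+1.
    exact/ltW/truncnS_gt.
  exists k => // j; rewrite !mxE.
  have := le_trans (coor_le_norm x j) xk; rewrite ler_norml => /andP[xj1 xj2].
  by rewrite xj2 andbT; case: eqVneq => [->|].
by apply: bigcupT_measurable => k; apply: sub_sigma_algebra; exists (c k), (d k).
Qed.

Lemma measurable_boxes : @measurable _ 'rV[R]_m = <<s boxes >>.
Proof.
apply/seteqP; split; last first.
  apply: smallest_sub; first exact: sigma_algebra_measurable.
  by move=> _ [c [d ->]]; exact: measurable_cbox.
apply: smallest_sub; first exact: smallest_sigma_algebra.
move=> A; rewrite -bigcup_seq => -[i /= _ [B mB <-]].
by have /(_ measurableT B mB) := measurable_coor_boxes i.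
Qed.

Lemma cbox_setI (a b c d : 'rV[R]_m) : cbox a b `&` cbox c d =
  cbox (\row_i Num.max (a ord0 i) (c ord0 i)) (\row_i Num.min (b ord0 i) (d ord0 i)).
Proof.
apply/seteqP; split=> [x [h1 h2] i|x h].
  have /andP[a1 a2] := h1 i; have /andP[b1 b2] := h2 i.
  by rewrite !mxE ge_max le_min a1 a2 b1 b2.
by split=> i; have := h i; rewrite !mxE ge_max le_min =>
  /andP[/andP[x1 x2] /andP[x3 x4]]; apply/andP; split.
Qed.

Lemma setI_closed_boxes : setI_closed boxes.
Proof. by move=> _ _ [a [b ->]] [c [d ->]]; rewrite cbox_setI; do 2 eexists. Qed.

(** An integrable function whose integral over every box vanishes is null. *)
Lemma ae_eq0_boxes (h : 'rV[R]_m -> R) (a b : 'rV[R]_m) :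
  mu.-integrable setT (EFin \o h) -> (forall x, ~ cbox a b x -> h x = 0) ->
  (forall c d, \int[mu]_(x in cbox c d) (h x)%:E = 0)%E ->
  {ae mu, forall x, h x = 0}.
Proof.
move=> inth h0 hb.
pose P (A : set 'rV[R]_m) := (\int[mu]_(x in A) (h x)%:E = 0)%E.
have mh : measurable_fun setT (EFin \o h) by case/integrableP : inth.
have PT : P setT.
  rewrite /P -[RHS](hb a b) [RHS]integral_mkcond; apply: eq_integral => x _.
  rewrite /patch; have [xb|nx] := pselect (cbox a b x); first by rewrite mem_set.
  by rewrite memNset// h0.
have HP : forall A, <<s boxes >> A -> P A.
  apply: (dynkin_induction measurable_boxes setI_closed_boxes PT).
  - by move=> _ [c [d ->]]; exact: hb.
  - move=> S mS PS; rewrite /P.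
    have : (\int[mu]_(x in S `|` ~` S) (h x)%:E = 0)%E by rewrite setUv.
    rewrite integral_setU//; last 3 first.
    + exact: measurableC.
    + exact: measurable_funTS.
    + by rewrite disj_set2E setICr.
    by rewrite PS add0e.
  - move=> F mF tF PF; rewrite /P integral_bigcup//; last first.
      by apply: (integrableS measurableT) => //; exact: bigcupT_measurable.
    by apply: eseries0 => i _ _; exact: PF.
have : ae_eq mu setT (EFin \o h) (cst 0%E).
  apply: integral_ae_eq => // E _ mE.
  by rewrite integral0; apply: HP; rewrite -measurable_boxes.
by apply: filterS => x /(_ I) [].
Qed.

Variables (Omega : set 'rV[R]_m) (f : 'rV[R]_m -> R).
Hypotheses (oO : open Omega) (mf : measurable_fun setT f).
Hypothesis intf : forall K, compact K -> K `<=` Omega -> mu.-integrable K (EFin \o f).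
Hypothesis f0 : forall phi, test_function Omega phi -> \int[mu]_x (f x * phi x) = 0.

Lemma ae_eq0_box a b (e : R) : 0 < e ->
  cbox (a - const_mx e) (b + const_mx e) `<=` Omega ->
  {ae mu, forall x, cbox a b x -> f x = 0}.
Proof.
move=> e0 QO.
pose K := cbox (a - const_mx e) (b + const_mx e).
have cK : compact K by exact: compact_cbox.
have mK : measurable K by exact: measurable_cbox.
have Kab : cbox a b `<=` K.
  by move=> x xab i; have /andP[x1 x2] := xab i; rewrite !mxE; apply/andP; split; lra.
have mab := measurable_cbox a b.
have intab : mu.-integrable (cbox a b) (EFin \o f).
  by apply: (integrableS mK) => //; exact: intf.
have E : EFin \o (f \_ (cbox a b)) = ((EFin \o f) \_ (cbox a b)).
  by apply/funext => x /=; rewrite /patch; case: ifP.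
have inth : mu.-integrable setT (EFin \o (f \_ (cbox a b))).
  by rewrite E; apply/(integrable_mkcond _ mab).
suff : {ae mu, forall x, (f \_ (cbox a b)) x = 0}.
  by apply: filterS => x + xab; rewrite /patch mem_set.
apply: (ae_eq0_boxes inth (a := a) (b := b)) => [x nx|c d].
  by rewrite /patch memNset.
pose c' : 'rV[R]_m := \row_i Num.max (a ord0 i) (c ord0 i).
pose d' : 'rV[R]_m := \row_i Num.min (b ord0 i) (d ord0 i).
have cdE : cbox a b `&` cbox c d = cbox c' d' by exact: cbox_setI.
have cdK : cbox (c' - const_mx e) (d' + const_mx e) `<=` K.
  move=> x xcd i; have := xcd i; rewrite !mxE => /andP[x1 x2].
  rewrite (le_trans _ x1) ?(le_trans x2)//.
    by rewrite lerD2r ge_min lexx.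
  by rewrite lerD2r le_max lexx.
have cd'K : cbox c' d' `<=` K by rewrite -cdE; apply: subset_trans Kab; exact: subIsetl.
transitivity (\int[mu]_x (f x * \1_(cbox c' d') x)%:E)%E.
  rewrite integral_mkcond; apply: eq_integral => x _; rewrite indicE -cdE in_setI.
  by rewrite /patch; case: (x \in cbox c d); case: (x \in cbox a b); rewrite ?mulr1 ?mulr0.
have [N eN] : exists N : nat, e ^- 2 <= N.+1%:R.
  by exists (Num.truncn (e ^- 2)); exact/ltW/truncnS_gt.
have tcut k : test_function Omega (box_cutoff c' d' (k + N).+1%:R).
  apply: test_function_box_cutoff oO e0 _ (subset_trans cdK QO).
  by apply: le_trans eN _; rewrite ler_nat ltnS leq_addl.
have cut0 k x : ~ K x -> box_cutoff c' d' (k + N).+1%:R x = 0.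
  move=> nx; apply: (box_cutoff_eq0 e0); last by move/cdK.
  by apply: le_trans eN _; rewrite ler_nat ltnS leq_addl.
have [] := @dominated_convergence _ _ _ mu setT measurableT
  (fun k x => (f x * box_cutoff c' d' (k + N).+1%:R x)%:E)
  (fun x => (f x * \1_(cbox c' d') x)%:E) (abse \o ((EFin \o f) \_ K)).
- move=> k; apply/measurable_EFinP; apply: measurable_funM => //.
  exact: test_measurable (tcut k).
- apply/measurable_EFinP; apply: measurable_funM => //; apply: measurable_indic.
  exact: measurable_cbox.
- apply: aeW => x _; apply: cvg_EFin; first exact: nearW.
  apply: cvgM; first exact: cvg_cst.
  have := @cvg_box_cutoff R m c' d' x.
  by rewrite -(cvg_shiftn N).
- apply: integrable_abse; apply/(integrable_mkcond _ mK); exact: intf.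
- apply: aeW => x k _ /=; rewrite /patch; have [Kx|nKx] := pselect (K x).
    rewrite mem_set//= lee_fin normrM ler_piMr// ger0_norm ?box_cutoff_ge0//.
    exact: box_cutoff_le1.
  by rewrite memNset//= cut0// mulr0 normr0.
move=> _ _ /=.
have E0 k : (\int[mu]_x (f x * box_cutoff c' d' (k + N).+1%:R x)%:E = 0)%E.
  have := f0 (tcut k); rewrite /Rintegral => h; rewrite -[LHS]fineK ?h//.
  apply: integrable_fin_num => //.
  apply: (integrable_mul_support cK (intf cK QO) _ (M := 1) _ (cut0 k)).
    exact: test_measurable (tcut k).
  by move=> x; rewrite ger0_norm ?box_cutoff_ge0//; exact: box_cutoff_le1.
under eq_fun do rewrite E0.
by move=> /cvg_lim; rewrite lim_cst// => <-.
Qed.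

(** The open set is covered by countably many rational boxes. *)
Lemma ae_eq0_of_test : {ae mu, forall x, Omega x -> f x = 0}.
Proof.
pose r (k : nat) : 'rV[R]_m := const_mx k.+1%:R^-1.
pose q (j : nat) : 'rV[rat]_m * nat := odflt (0, 0%N) (unpickle j).
pose c j : 'rV[R]_m := map_mx ratr (q j).1.
have H j : {ae mu, forall x, cbox (c j - r (q j).2) (c j + r (q j).2) x ->
    cbox (c j - r (q j).2 - r (q j).2) (c j + r (q j).2 + r (q j).2) `<=` Omega ->
    f x = 0}.
  have [sub|nsub] := pselect
    (cbox (c j - r (q j).2 - r (q j).2) (c j + r (q j).2 + r (q j).2) `<=` Omega).
    have k0 : 0 < (q j).2.+1%:R^-1 :> R by rewrite invr_gt0.
    by have := ae_eq0_box k0 sub; apply: filterS => x + xb _; exact.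
  by apply: aeW => x _ /nsub.
have := ae_foralln H; apply: filterS => x Hx Ox.
have /nbhs_ballP[e /= e0 xeO] : nbhs x Omega by exact: open_nbhs_nbhs.
have [k ke] : exists k : nat, k.+1%:R^-1 *+ 3 < e.
  have e30 : 0 < e / 3 by rewrite divr_gt0.
  have [k _ /(_ k (leqnn k))/= ke] := near_infty_natSinv_lt (PosNum e30).
  by exists k; move: ke; rewrite ltr_pdivlMr// mulr_natr.
have k0 : (0 : R) < k.+1%:R^-1 by rewrite invr_gt0.
have /choice[s sx] : forall i, exists s : rat, ball (x ord0 i) k.+1%:R^-1 (ratr s).
  move=> i; have : x ord0 i - k.+1%:R^-1 < x ord0 i + k.+1%:R^-1.
    by rewrite ltrBlDr -addrA ltrDl addr_gt0.
  move=> /rat_in_itvoo[s]; rewrite in_itv/= => /andP[q1 q2].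
  by exists s; rewrite /ball/= ltr_distlC q1.
have [j qj] : exists j, q j = (\row_i s i, k).
  by exists (pickle ((\row_i s i : 'rV[rat]_m), k)); rewrite /q pickleK.
have cx i : `|x ord0 i - c j ord0 i| < k.+1%:R^-1.
  by rewrite /c qj !mxE; exact: sx.
move: (Hx j) cx; rewrite qj/=; move: (c j) => C HC cx; apply: HC => //.
  by move=> i; have := cx i; rewrite ltr_distl !mxE => /andP[/ltW-> /ltW].
move=> y yb; apply: xeO; split=> // u i; have -> : u = ord0 by exact: ord1.
have := yb i; rewrite !mxE => /andP[y1 y2]; have := cx i.
rewrite /ball/= !ltr_norml => /andP[h1 h2]; move: ke; rewrite -[_ *+ 3]mulr_natr => ke.
move: h1 h2 y1 y2 ke; move: (x ord0 i) (y ord0 i) (C ord0 i) k.+1%:R^-1 => X Y Z W h1 h2 y1 y2 ke.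
by apply/andP; split; lra.
Qed.

End fundamental_lemma.

(** * Weak gradients and their uniqueness *)

Section integrable_real.
Context d (T : measurableType d) {R : realType} (mu : {measure set T -> \bar R}).
Variables (D : set T) (mD : measurable D).
Implicit Types (f g : T -> R).

Lemma integrable_realD f g : mu.-integrable D (EFin \o f) -> mu.-integrable D (EFin \o g) ->
  mu.-integrable D (EFin \o (fun x => f x + g x)).
Proof. by move=> fi gi; have := integrableD mD fi gi; exact: eq_integrable. Qed.

Lemma integrable_realB f g : mu.-integrable D (EFin \o f) -> mu.-integrable D (EFin \o g) ->
  mu.-integrable D (EFin \o (fun x => f x - g x)).
Proof. by move=> fi gi; have := integrableB mD fi gi; exact: eq_integrable. Qed.

Lemma integrable_realZ f (a : R) : mu.-integrable D (EFin \o f) ->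
  mu.-integrable D (EFin \o (fun x => a * f x)).
Proof. by move=> fi; have := integrableZl mD a fi; exact: eq_integrable. Qed.

End integrable_real.

Section scalar_weak_gradient.
Context {R : realType} (m : nat).
Local Notation mu := (@lebesgue_rV R m).
Implicit Types (Omega K : set 'rV[R]_m) (f : 'rV[R]_m -> R) (g : 'I_m -> 'rV[R]_m -> R).

Definition loc_integrable Omega f := forall K, compact K -> K `<=` Omega ->
  mu.-integrable K (EFin \o f).

(** The weak gradient of a scalar function, for globally measurable
    representatives, so that all the integrals are taken over the whole space. *)
Definition sweak Omega f g :=
  [/\ measurable_fun setT f /\ (forall i, measurable_fun setT (g i)),
      loc_integrable Omega f, (forall i, loc_integrable Omega (g i)) &
      forall i phi, test_function Omega phi ->
        \int[mu]_x (f x * 'D_(basis_rV i) phi x + g i x * phi x) = 0].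

Lemma loc_integrable_mul Omega f (h : 'rV[R]_m -> R) K (M : R) : compact K -> K `<=` Omega ->
  loc_integrable Omega f -> measurable_fun setT h -> (forall x, `|h x| <= M) ->
  (forall x, ~ K x -> h x = 0) -> mu.-integrable setT (EFin \o (fun x => f x * h x)).
Proof. by move=> cK KO lf mh hM h0; exact: (integrable_mul_support cK (lf _ cK KO) mh hM h0). Qed.

Lemma loc_integrable_test Omega f phi : loc_integrable Omega f ->
  test_function Omega phi -> mu.-integrable setT (EFin \o (fun x => f x * phi x)).
Proof.
move=> lf tphi; have [K [cK KO p0 _]] := test_support tphi.
have [M [_ HM]] := test_bounded tphi.
exact: (loc_integrable_mul cK KO lf (test_measurable tphi) HM p0).
Qed.

Lemma loc_integrable_test_derive Omega f phi i : loc_integrable Omega f ->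
  test_function Omega phi ->
  mu.-integrable setT (EFin \o (fun x => f x * 'D_(basis_rV i) phi x)).
Proof.
move=> lf tphi; have [K [cK KO _ p0]] := test_support tphi.
have [M [_ HM]] := test_derive_bounded tphi.
exact: (loc_integrable_mul cK KO lf (test_measurable_derive tphi i) (HM i) (p0 i)).
Qed.

Lemma sweakE Omega f g : sweak Omega f g -> forall i phi, test_function Omega phi ->
  \int[mu]_x (f x * 'D_(basis_rV i) phi x) = - \int[mu]_x (g i x * phi x).
Proof.
move=> [_ lf lg H] i phi tphi; have := H i phi tphi.
rewrite RintegralD//; first by move/eqP; rewrite addr_eq0 => /eqP.
  exact: loc_integrable_test_derive lf tphi.
exact: loc_integrable_test (lg i) tphi.
Qed.

Lemma loc_integrable_ae Omega f f' : measurable Omega -> measurable_fun setT f' ->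
  {ae mu, forall x, Omega x -> f x = f' x} ->
  loc_integrable Omega f -> loc_integrable Omega f'.
Proof.
move=> mO mf' ff' lf K cK KO; have mK := compact_measurable_rV cK.
have /integrableP[mf intf] := lf K cK KO.
have mf'K : measurable_fun K (EFin \o f').
  by apply/measurable_EFinP; exact: measurable_funTS.
apply/integrableP; split=> //; move: intf; congr (_ < _)%E.
apply: ae_eq_integral => //; [exact: measurableT_comp|exact: measurableT_comp|].
by apply: filterS ff' => x h Kx /=; rewrite h//; exact: KO.
Qed.

Lemma sweak_ae Omega f g f' g' : measurable Omega ->
  measurable_fun setT f' -> (forall i, measurable_fun setT (g' i)) ->
  {ae mu, forall x, Omega x -> f x = f' x} ->
  (forall i, {ae mu, forall x, Omega x -> g i x = g' i x}) ->
  sweak Omega f g -> sweak Omega f' g'.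
Proof.
move=> mO mf' mg' ff' gg' [[mf mg] lf lg H].
have lf' := loc_integrable_ae mO mf' ff' lf.
have lg' i := loc_integrable_ae mO (mg' i) (gg' i) (lg i).
split=> // i phi tphi; rewrite -(H i phi tphi); congr fine.
have mdp := test_measurable_derive tphi i; have mp := test_measurable tphi.
apply: ae_eq_integral => //.
- by apply/measurable_EFinP; apply: measurable_funD; exact: measurable_funM.
- by apply/measurable_EFinP; apply: measurable_funD; exact: measurable_funM.
have [K [cK KO p0 dp0]] := test_support tphi.
move: (gg' i) ff'; apply: filterS2 => x hg hf _.
have [Kx|nKx] := pselect (K x); first by rewrite hf ?hg//; exact: KO.
by rewrite p0// dp0// !mulr0.
Qed.

Lemma test_functionS Omega Omega' phi : Omega `<=` Omega' ->
  test_function Omega phi -> test_function Omega' phi.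
Proof.
by move=> OO' [d c [K [cK KO p0]]]; split=> //; exists K; split=> //; exact: subset_trans OO'.
Qed.

Lemma sweakS Omega Omega' f g : Omega `<=` Omega' -> sweak Omega' f g -> sweak Omega f g.
Proof.
move=> OO' [mfg lf lg H]; split=> //.
- by move=> K cK KO; apply: lf => //; exact: subset_trans OO'.
- by move=> i K cK KO; apply: lg => //; exact: subset_trans OO'.
- by move=> i phi tphi; apply: H; exact: test_functionS tphi.
Qed.

Lemma sweakB Omega f g f' g' : sweak Omega f g -> sweak Omega f' g' ->
  sweak Omega (fun x => f x - f' x) (fun i x => g i x - g' i x).
Proof.
move=> sf sf'; have [[mf mg] lf lg H] := sf; have [[mf' mg'] lf' lg' H'] := sf'.
split.
- by split=> [|i]; exact: measurable_funB.
- move=> K cK KO.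
  exact: (integrable_realB (compact_measurable_rV cK) (lf K cK KO) (lf' K cK KO)).
- move=> i K cK KO.
  exact: (integrable_realB (compact_measurable_rV cK) (lg i K cK KO) (lg' i K cK KO)).
move=> i phi tphi.
have E : (fun x => (f x - f' x) * 'D_(basis_rV i) phi x + (g i x - g' i x) * phi x) =
    (fun x => (f x * 'D_(basis_rV i) phi x + g i x * phi x) -
              (f' x * 'D_(basis_rV i) phi x + g' i x * phi x)).
  by apply/funext => x; ring.
rewrite E RintegralB// ?H ?H' ?subr0//.
  apply: integrable_realD => //; first exact: loc_integrable_test_derive lf tphi.
  exact: loc_integrable_test (lg i) tphi.
apply: integrable_realD => //; first exact: loc_integrable_test_derive lf' tphi.
exact: loc_integrable_test (lg' i) tphi.
Qed.

Lemma sweak_unique Omega f g f' g' : open Omega ->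
  sweak Omega f g -> sweak Omega f' g' -> {ae mu, forall x, Omega x -> f x = f' x} ->
  forall i, {ae mu, forall x, Omega x -> g i x = g' i x}.
Proof.
move=> oO sf sf' ff' i.
have mO := open_measurable_rV oO.
have [[mf mg] lf lg H] := sf; have [[mf' mg'] lf' lg' H'] := sf'.
have sf2 : sweak Omega f' g.
  by apply: (sweak_ae mO mf' mg ff' _ sf) => j; apply: aeW.
have [[_ mh] _ lh Hh] := sweakB sf2 sf'.
have := ae_eq0_of_test oO (mh i) (lh i).
set P := (X in (X -> _) -> _) => HP.
have : P.
  move=> phi tphi; rewrite -[RHS](Hh i phi tphi); congr fine; apply: eq_integral => x _.
  by rewrite subrr mul0r add0r.
by move=> /HP; apply: filterS => x /[apply] /eqP; rewrite subr_eq0 => /eqP.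
Qed.

Lemma loc_integrable_continuous Omega f : open Omega ->
  (forall x, Omega x -> {for x, continuous f}) -> loc_integrable Omega (f \_ Omega).
Proof.
move=> oO cf K cK KO; have mK := compact_measurable_rV cK.
have mO := open_measurable_rV oO.
have mf : measurable_fun Omega f.
  by apply: open_continuous_measurable_rV => // x /set_mem /cf.
have mfO : measurable_fun setT (f \_ Omega) by apply/(measurable_restrictT _ mO).
have [->|/set0P K0] := eqVneq K set0; first exact: integrable_set0.
have cfK : {within K, continuous (fun x => `|f x|)}.
  apply: continuous_in_subspaceT => x /set_mem Kx.
  apply: (@continuous_comp _ _ _ f (@Num.norm R R)); first exact: cf (KO _ Kx).
  exact: norm_continuous.
have /= [x0 _ xK] := EVT_max_rV K0 cK cfK.
apply/integrableP; split; first by apply/measurable_EFinP; exact: measurable_funTS.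
apply: (@le_lt_trans _ _ (\int[mu]_(x in K) (`|f x0|)%:E)%E).
  apply: ge0_le_integral => //.
  - by apply: measurableT_comp => //; apply/measurable_EFinP; exact: measurable_funTS.
  - move=> x Kx /=; rewrite lee_fin /patch mem_set; last exact: KO.
    exact: xK (mem_set Kx).
rewrite integral_cst// ?lte_mul_pinfty ?lebesgue_rV_compact//.
Qed.

Definition C1_on Omega f g := forall x, Omega x ->
  [/\ {for x, continuous f}, (forall i, {for x, continuous (g i)}) &
      forall i, is_derive x (basis_rV i) f (g i x)].

Lemma test_functionM Omega f g phi : open Omega -> C1_on Omega f g ->
  test_function Omega phi ->
  test_function Omega (fun x => f x * phi x) /\ forall i x, Omega x ->
    'D_(basis_rV i) (fun x => f x * phi x) x = f x * 'D_(basis_rV i) phi x + g i x * phi x.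
Proof.
move=> oO c1 tphi; have [K [cK KO p0 dp0]] := test_support tphi.
have D i x : Omega x -> is_derive x (basis_rV i) (fun x => f x * phi x)
    (f x * 'D_(basis_rV i) phi x + g i x * phi x).
  move=> Ox; have [_ _ /(_ i) dx] := c1 x Ox.
  have := @is_deriveM _ _ f phi x (basis_rV i) _ _ dx (test_is_derive tphi i x).
  by rewrite -[_ *: _]/(f x * _) -[_ *: g i x]/(phi x * _) [phi x * _]mulrC.
split=> [|i x Ox]; last exact: (@derive_val _ _ _ _ _ _ _ (D i x Ox)).
apply: (test_functionI oO cK KO _ D) => [x nx|i x Ox]; first by rewrite p0 ?mulr0.
have [cf cg _] := c1 x Ox.
apply: ctsD; apply: ctsM => //; last exact: test_continuous tphi x.
exact: test_continuous_derive tphi i x.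
Qed.

(** The classical gradient is a weak gradient: the product of a C^1 function and
    a test function is a test function, whose derivatives integrate to 0. *)
Lemma sweak_C1 Omega f g : open Omega -> C1_on Omega f g ->
  sweak Omega (f \_ Omega) (fun i => g i \_ Omega).
Proof.
move=> oO c1; have mO := open_measurable_rV oO; split.
- split=> [|i]; apply/(measurable_restrictT _ mO);
    apply: open_continuous_measurable_rV => // x /set_mem /c1[cf cg _]; first exact: cf.
  exact: cg.
- by apply: (loc_integrable_continuous oO) => x /c1[].
- by move=> i; apply: (loc_integrable_continuous oO) => x /c1[].
move=> i phi tphi; have [tfp dfp] := test_functionM oO c1 tphi.
rewrite -[RHS](integral_test_derive i tfp); apply: eq_Rintegral => x _.
have [K [cK KO p0 dp0]] := test_support tphi.
have [K' [cK' KO' _ dp0']] := test_support tfp.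
have [Ox|nOx] := pselect (Omega x); first by rewrite /patch mem_set// dfp.
by rewrite p0 ?dp0 ?dp0' ?mulr0 ?addr0//; [move/KO'|move/KO|move/KO].
Qed.

End scalar_weak_gradient.

Section vector_weak_gradient.
Context {R : realType} (m : nat).
Local Notation mu := (@lebesgue_rV R m).
Variables (Omega : set 'rV[R]_m) (oO : open Omega).
Implicit Types (u : 'rV[R]_m -> 'rV[R]_m) (G : 'rV[R]_m -> 'M[R]_m).

Let mO : measurable Omega. Proof. exact: open_measurable_rV. Qed.

Let loc_patch (f : 'rV[R]_m -> R) : locally_integrable_rV Omega f ->
  measurable_fun setT (f \_ Omega) /\ loc_integrable Omega (f \_ Omega).
Proof.
move=> [mf intf]; have mfO : measurable_fun setT (f \_ Omega) by apply/(measurable_restrictT _ mO).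
split=> // K cK KO; apply/integrableP; split.
  by apply/measurable_EFinP; exact: measurable_funTS.
have := intf K KO cK; congr (_ < _)%E; apply: eq_integral => x /set_mem Kx.
by rewrite /= /patch mem_set//; exact: KO.
Qed.

Let integral_patch (f h : 'rV[R]_m -> R) : (forall x, ~ Omega x -> h x = 0) ->
  (\int[mu]_(x in Omega) (f x * h x)%:E = \int[mu]_x ((f \_ Omega) x * h x)%:E)%E.
Proof.
move=> h0; rewrite integral_mkcond; apply: eq_integral => x _; rewrite /patch.
case: ifPn => //; rewrite notin_setE => /h0 ->; by rewrite mulr0.
Qed.

Lemma sweak_of_weak_gradient u G : weak_gradient Omega u G -> forall j,
  sweak Omega ((fun x => u x ord0 j) \_ Omega) (fun i => (fun x => G x i j) \_ Omega).
Proof.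
move=> [lu lG H] j; have [mu_ lu_] := loc_patch (lu j).
split; [split=> [|i]//| |move=> i|move=> i phi tphi] => //.
- by have [] := loc_patch (lG i j).
- by have [] := loc_patch (lG i j).
have [mG_ lG_] := loc_patch (lG i j).
have [K [cK KO p0 dp0]] := test_support tphi.
have I1 := loc_integrable_test_derive i lu_ tphi.
have I2 := loc_integrable_test lG_ tphi.
rewrite RintegralD//.
have := H i j phi tphi; rewrite !integral_patch; last 2 first.
- by move=> x nO; apply: p0 => /KO.
- by move=> x nO; apply: dp0 => /KO.
rewrite /Rintegral => ->; rewrite fineN addNr//.
Qed.

Lemma weak_gradient_of_sweak u G (f : 'I_m -> 'rV[R]_m -> R)
    (g : 'I_m -> 'I_m -> 'rV[R]_m -> R) :
  (forall j, sweak Omega (f j) (g j)) ->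
  (forall x j, Omega x -> u x ord0 j = f j x) ->
  (forall x i j, Omega x -> G x i j = g j i x) -> weak_gradient Omega u G.
Proof.
move=> sw uf Gg.
have loc (h k : 'rV[R]_m -> R) : (forall x, Omega x -> h x = k x) ->
    measurable_fun setT k -> loc_integrable Omega k -> locally_integrable_rV Omega h.
  move=> hk mk lk; split.
    apply: (eq_measurable_fun k); last exact: measurable_funTS.
    by move=> x /set_mem Ox; rewrite hk.
  move=> K KO cK; have /integrableP[_] := lk K cK KO; congr (_ < _)%E.
  by apply: eq_integral => x /set_mem Kx; rewrite /= hk//; exact: KO.
split.
- by move=> j; have [[mf mg] lf lg _] := sw j; apply: (loc _ (f j)) => // x Ox; exact: uf.
- move=> i j; have [[mf mg] lf lg _] := sw j.
  by apply: (loc _ (g j i)) => // x Ox; exact: Gg.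
move=> i j phi tphi; have [K [cK KO p0 dp0]] := test_support tphi.
have [_ lf lg _] := sw j.
have I1 := loc_integrable_test_derive i lf tphi.
have I2 := loc_integrable_test (lg i) tphi.
have patchE (h k l : 'rV[R]_m -> R) : (forall x, Omega x -> h x = k x) ->
    (forall x, ~ K x -> l x = 0) ->
    (\int[mu]_(x in Omega) (h x * l x)%:E = \int[mu]_x (k x * l x)%:E)%E.
  move=> hk l0; rewrite integral_mkcond; apply: eq_integral => x _; rewrite /patch.
  have [Ox|nO] := pselect (Omega x); first by rewrite mem_set// hk.
  by rewrite memNset// l0 ?mulr0// => /KO.
rewrite (patchE _ (f j))//; last 2 first.
- by move=> x; exact: uf.
- by move=> x; exact: dp0.
rewrite (patchE _ (g j i))//; last by move=> x; exact: Gg.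
have := sweakE (sw j) i tphi; rewrite /Rintegral => E.
rewrite -[LHS]fineK; last exact: integrable_fin_num I1.
rewrite E EFinN fineK//; exact: integrable_fin_num I2.
Qed.

Lemma weak_gradient_wgrad u : weakly_differentiable Omega u ->
  weak_gradient Omega u (wgrad Omega u).
Proof. by move=> [G HG]; apply: xgetPex; exists G. Qed.

Lemma weak_gradient_unique u G G' : weak_gradient Omega u G -> weak_gradient Omega u G' ->
  {ae mu, forall x, Omega x -> G x = G' x}.
Proof.
move=> /sweak_of_weak_gradient sG /sweak_of_weak_gradient sG'.
have H i j := sweak_unique oO (sG j) (sG' j) (aeW _ (fun x _ => erefl)) i.
have {}H i : {ae mu, forall x (j : 'I_m), Omega x -> G x i j = G' x i j}.
  have : {ae mu, forall x, forall n : nat, forall j : 'I_m, j = n :> nat ->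
      Omega x -> G x i j = G' x i j}.
    apply: ae_foralln => n; have [nm|mn] := ltnP n m.
      have := H i (Ordinal nm); apply: filterS => x h j jn Ox.
      have -> : j = Ordinal nm by exact: val_inj.
      by have := h Ox; rewrite /patch mem_set.
    by apply: aeW => x j jn; have := ltn_ord j; rewrite jn ltnNge mn.
  by apply: filterS => x h j Ox; exact: (h j j erefl Ox).
have : {ae mu, forall x, forall n : nat, forall i : 'I_m, i = n :> nat ->
    forall j : 'I_m, Omega x -> G x i j = G' x i j}.
  apply: ae_foralln => n; have [nm|mn] := ltnP n m.
    have := H (Ordinal nm); apply: filterS => x h i jn j Ox.
    have -> : i = Ordinal nm by exact: val_inj.
    exact: h.
  by apply: aeW => x i jn; have := ltn_ord i; rewrite jn ltnNge mn.
by apply: filterS => x h Ox; apply/matrixP => i j; exact: (h i i erefl j Ox).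
Qed.

Lemma wgrad_ae u G : weak_gradient Omega u G ->
  {ae mu, forall x, Omega x -> wgrad Omega u x = G x}.
Proof.
move=> HG; have HW : weakly_differentiable Omega u by exists G.
exact: (weak_gradient_unique (weak_gradient_wgrad HW) HG).
Qed.

End vector_weak_gradient.

(** * The radial map and its energy *)

Section measurability_of_norms.
Context d (T : measurableType d) {R : realType} (m : nat) (D : set T).

Lemma measurable_sqrt (f : T -> R) : measurable_fun D f ->
  measurable_fun D (fun x => Num.sqrt (f x)).
Proof.
move=> mf; apply: (measurableT_comp (f := @Num.sqrt R) (continuous_measurable_fun _)) => //.
exact: sqrt_continuous.
Qed.

Lemma measurable_enorm_comp (u : T -> 'rV[R]_m) :
  (forall j, measurable_fun D (fun x => u x ord0 j)) ->
  measurable_fun D (fun x => enorm (u x)).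
Proof.
move=> mu; apply: measurable_sqrt; apply: measurable_sum => j.
exact: measurable_funX.
Qed.

Lemma measurable_mxnorm2 (G : T -> 'M[R]_m) :
  (forall i j, measurable_fun D (fun x => G x i j)) ->
  measurable_fun D (fun x => mxnorm2 (G x)).
Proof.
move=> mG; under eq_fun do rewrite -[mxnorm2 _]ger0_norm ?mxnorm2_ge0// -sqrtr_sqr sqr_mxnorm2.
by apply: measurable_sqrt; do 2 apply: measurable_sum => ?; exact: measurable_funX.
Qed.

Lemma measurable_powR_comp (f : T -> R) p : measurable_fun D f ->
  measurable_fun D (fun x => f x `^ p).
Proof. by move=> mf; apply: (measurableT_comp (measurable_powR p) mf). Qed.

End measurability_of_norms.

Section null_sets.
Context {R : realType} (m : nat).
Local Notation mu := (@lebesgue_rV R m).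

Lemma measurable_rV1 (x : 'rV[R]_m) : measurable [set x].
Proof. by apply: compact_measurable_rV; exact: compact_set1. Qed.

Lemma lebesgue_rV_set0 : (0 < m)%N -> mu [set 0] = 0%E.
Proof.
case: m => // k _.
have -> : [set 0] = [set x : 'rV[R]_k.+1 | forall i, [set 0] (x ord0 i)].
  apply/seteqP; split=> [x -> i|x h]; first by rewrite /= mxE.
  by apply/rowP => i; rewrite mxE; exact: h.
have := @lebesgue_rV_box R k.+1 (fun=> [set 0]) (fun=> measurable_set1 _) => ->.
rewrite big_ord_recl; apply/eqP; rewrite mule_eq0; apply/orP; left; apply/eqP.
exact: lebesgue_measure_set1.
Qed.

Lemma ae_neq0 : (0 < m)%N -> {ae mu, forall x : 'rV[R]_m, x != 0}.
Proof.
move=> m0; exists [set 0]; split; first exact: measurable_rV1.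
  exact: lebesgue_rV_set0.
by move=> x /negP; rewrite negbK => /eqP.
Qed.

Lemma integral_ball_punctured (f : 'rV[R]_m -> \bar R) : (0 < m)%N ->
  (forall x, 0 <= f x)%E -> measurable_fun (@punctured_ball R m) f ->
  (\int[mu]_(x in @ball_rV R m) f x = \int[mu]_(x in @punctured_ball R m) f x)%E.
Proof.
move=> m0 f0 mf.
have mb := @measurable_ball_rV R m.
have m1 := measurable_rV1 0.
rewrite (ge0_negligible_integral m1 mb)//; last exact: lebesgue_rV_set0.
have -> : @ball_rV R m = @punctured_ball R m `|` [set 0].
  by rewrite setUC /punctured_ball setDUK// => x ->; rewrite /ball_rV/= enorm0.
apply/measurable_funU => //; first by apply: measurableD.
split=> //; exact: measurable_fun_set1.
Qed.

End null_sets.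

Section continuity_rV.
Context {R : realType} {T : topologicalType} (m : nat).

Lemma cts_rV (f : T -> 'rV[R]_m) x :
  (forall i, {for x, continuous (fun y => f y ord0 i)}) -> {for x, continuous f}.
Proof.
move=> cf A /nbhs_ballP[e /= e0 eA].
have H i : \forall y \near x, ball (f x ord0 i) e (f y ord0 i).
  by apply: cf; exact: nbhsx_ballx.
have HA := @filter_forall _ _ _ (nbhs x) (nbhs_filter x) H.
suff : nbhs x (fun y => A (f y)) by [].
apply: filterS HA => y fy.
apply: eA; split=> // i j; have -> : i = ord0 by exact: ord1.
exact: fy.
Qed.

End continuity_rV.

Lemma is_derive_inv {R : realType} (x : R) : x != 0 ->
  is_derive x 1 (fun z => z^-1) (- x ^- 2).
Proof. by move=> x0; have := is_deriveV x0 (is_derive_id x 1); rewrite [_ *: 1]mulr1. Qed.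

Lemma sumr_delta {R : realType} (m : nat) (i : 'I_m) (F : 'I_m -> R) :
  \sum_j (i == j)%:R * F j = F i.
Proof.
rewrite (bigD1 i)//= eqxx mul1r big1 ?addr0// => j /negbTE ij.
by rewrite eq_sym ij mul0r.
Qed.

Section radial_map.
Context {R : realType} (m : nat).
Implicit Types x : 'rV[R]_m.

Lemma cts_enorm x : {for x, continuous (@enorm R m)}.
Proof. exact: continuous_enorm. Qed.

Lemma is_derive_enorm x i : x != 0 ->
  is_derive x (basis_rV i) (@enorm R m) (x ord0 i / enorm x).
Proof.
move=> x0; have r0 : 0 < enorm x by rewrite enorm_gt0.
have -> : @enorm R m = Num.sqrt \o (fun y : 'rV[R]_m => \sum_(k < m) y ord0 k ^+ 2) by [].
have S : is_derive x (basis_rV i) (\sum_(k < m) (fun y : 'rV[R]_m => y ord0 k) ^+ 2)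
    (\sum_(k < m) (2 * x ord0 k) * (k == i)%:R).
  apply: is_derive_sum => k; have := is_deriveX 2 (is_derive_coor k i x).
  by rewrite /= expr1 -[_ *: _]/(_ * _).
have {}S : is_derive x (basis_rV i) (fun y : 'rV[R]_m => \sum_(k < m) y ord0 k ^+ 2) (2 * x ord0 i).
  have E : \sum_(k < m) (2 * x ord0 k) * (k == i)%:R = 2 * x ord0 i.
    rewrite (bigD1 i)//= big1 ?addr0 ?eqxx ?mulr1// => k /negbTE ->.
    by rewrite mulr0.
  move: S; rewrite E; set F := (F in is_derive _ _ F _); suff -> : F = fun y : 'rV[R]_m => \sum_(k < m) y ord0 k ^+ 2 by [].
  by apply/funext => y; rewrite /F fct_sumE.
have D : 0 < \sum_(k < m) x ord0 k ^+ 2.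
  by rewrite -sqrtr_gt0.
have := is_derive_comp1 (is_derive1_sqrt D) S.
rewrite -/(enorm x); suff -> : x ord0 i / enorm x = (2 * enorm x)^-1 * (2 * x ord0 i) by [].
by field; rewrite gt_eqF.
Qed.

(** Entry (i, j) is the derivative of the j-th component in the direction e_i. *)
Definition radial_grad x : 'M[R]_m := \matrix_(i, j)
  ((i == j)%:R / enorm x - x ord0 i * x ord0 j / enorm x ^+ 3).

Lemma C1_radial (Omega : set 'rV[R]_m) j : (forall x, Omega x -> x != 0) ->
  C1_on Omega (fun x => radial x ord0 j) (fun i x => radial_grad x i j).
Proof.
move=> O0 x Ox; have x0 := O0 x Ox; have r0 : enorm x != 0 by rewrite gt_eqF// enorm_gt0.
have fE : (fun x => radial x ord0 j) = (fun y => (enorm y)^-1 * y ord0 j).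
  by apply/funext => y; rewrite mxE.
rewrite fE; split.
- apply: ctsM; last exact: cts_coor.
  by apply: ctsV => //; exact: cts_enorm.
- move=> i; have -> : (fun x => radial_grad x i j) =
      (fun y => (i == j)%:R * (enorm y)^-1 - y ord0 i * y ord0 j * (enorm y * (enorm y * enorm y))^-1).
    by apply/funext => y; rewrite mxE exprS expr2.
  apply: ctsB; apply: ctsM.
  + exact: ctsC.
  + by apply: ctsV => //; exact: cts_enorm.
  + by apply: ctsM; exact: cts_coor.
  + apply: ctsV; first by rewrite !mulf_neq0.
    by apply: ctsM; [|apply: ctsM]; exact: cts_enorm.
move=> i; have dV := is_derive_comp1 (is_derive_inv r0) (is_derive_enorm i x0).
have := is_deriveM dV (is_derive_coor j i x).
rewrite -[_ *: (j == i)%:R]/(_ * (j == i)%:R) -[x ord0 j *: _]/(x ord0 j * _).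
suff -> : (enorm x)^-1 * (j == i)%:R + x ord0 j * (- enorm x ^- 2 * (x ord0 i / enorm x))
   = radial_grad x i j by [].
by rewrite mxE eq_sym; field.
Qed.

Lemma mxnorm2_radial_grad x : (0 < m)%N -> x != 0 ->
  mxnorm2 (radial_grad x) = Num.sqrt (m%:R - 1) * (enorm x)^-1.
Proof.
move=> m0 x0; have r0 : enorm x != 0 by rewrite gt_eqF// enorm_gt0.
apply/eqP; rewrite -(eqrXn2 (n := 2))//; last 2 first.
- exact: mxnorm2_ge0.
- by rewrite mulr_ge0 ?sqrtr_ge0 ?invr_ge0 ?enorm_ge0.
apply/eqP; rewrite sqr_mxnorm2 exprMn sqr_sqrtr ?subr_ge0 ?ler1n//.
set r := enorm x; have S : \sum_(j < m) x ord0 j ^+ 2 = r ^+ 2.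
  by rewrite sqr_enorm; apply: eq_bigr => j _; rewrite expr2.
transitivity (\sum_(i < m) (r ^- 2 - r ^- 4 * x ord0 i ^+ 2)).
  apply: eq_bigr => i _; transitivity (\sum_j ((i == j)%:R * (r ^- 2 - 2 * r ^- 4 * x ord0 i * x ord0 j) +
      r ^- 6 * x ord0 i ^+ 2 * x ord0 j ^+ 2)).
    apply: eq_bigr => j _; rewrite mxE -/r; case: (i == j); rewrite ?mul1r ?mul0r; field => //.
  rewrite big_split/= sumr_delta -mulr_sumr S; field => //.
rewrite big_split/= sumr_const card_ord sumrN -mulr_sumr S -mulr_natl; field => //.
Qed.

End radial_map.

Section gradient_integrals.
Context {R : realType} (m : nat).
Local Notation mu := (@lebesgue_rV R m).
Variables (Omega : set 'rV[R]_m) (oO : open Omega).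
Implicit Types (u : 'rV[R]_m -> 'rV[R]_m) (G : 'rV[R]_m -> 'M[R]_m).

Lemma weak_gradient_measurable u G i j : weak_gradient Omega u G ->
  measurable_fun Omega (fun x => G x i j).
Proof. by case=> _ /(_ i j)[]. Qed.

Lemma weak_gradient_measurable_u u G j : weak_gradient Omega u G ->
  measurable_fun Omega (fun x => u x ord0 j).
Proof. by case=> /(_ j)[]. Qed.

(** Integrals of the weak gradient can be computed with any of its versions. *)
Lemma integral_wgrad u G (F : 'rV[R]_m -> 'M[R]_m -> R) :
  weak_gradient Omega u G -> (forall x A, 0 <= F x A) ->
  (forall H : 'rV[R]_m -> 'M[R]_m, (forall i j, measurable_fun Omega (fun x => H x i j)) ->
    measurable_fun Omega (fun x => F x (H x))) ->
  (\int[mu]_(x in Omega) (F x (wgrad Omega u x))%:E =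
   \int[mu]_(x in Omega) (F x (G x))%:E)%E.
Proof.
move=> HG F0 mF; have HW : weak_gradient Omega u (wgrad Omega u).
  by apply: weak_gradient_wgrad; exists G.
apply: ge0_ae_eq_integral.
- exact: open_measurable_rV.
- by apply/measurable_EFinP; apply: mF => i j; exact: weak_gradient_measurable HW.
- by apply/measurable_EFinP; apply: mF => i j; exact: weak_gradient_measurable HG.
- by move=> x _; rewrite lee_fin.
- by move=> x _; rewrite lee_fin.
by have := wgrad_ae oO HG; apply: filterS => x h Ox; rewrite h.
Qed.

End gradient_integrals.

Section energy_formula.
Context {R : realType} (m : nat).
Hypothesis m0 : (0 < m)%N.
Local Notation mu := (@lebesgue_rV R m).
Local Notation pball := (@punctured_ball R m).

Lemma open_punctured_ball : open pball.
Proof. by rewrite punctured_ballE; exact: open_annulus. Qed.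

Lemma measurable_punctured_ball : measurable pball.
Proof. exact: open_measurable_rV open_punctured_ball. Qed.

Lemma measurable_energy_density (D : set 'rV[R]_m) (p beta : R) (H : 'rV[R]_m -> 'M[R]_m) :
  (forall i j, measurable_fun D (fun x => H x i j)) ->
  measurable_fun D (fun x => enorm x `^ beta * mxnorm2 (H x) `^ p).
Proof.
move=> mH; apply: measurable_funM; apply: measurable_powR_comp.
  by apply: measurable_funTS; exact: measurable_enorm.
exact: measurable_mxnorm2.
Qed.

Lemma energyE p beta u (G : 'rV[R]_m -> 'M[R]_m) : weak_gradient pball u G ->
  energy p beta u =
  (\int[mu]_(x in pball) (enorm x `^ beta * mxnorm2 (G x) `^ p)%:E)%E.
Proof.
move=> HG; have HW : weak_gradient pball u (wgrad pball u).
  by apply: weak_gradient_wgrad; exists G.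
have F0 x : (0%:E <= (enorm x `^ beta * mxnorm2 (wgrad pball u x) `^ p)%:E)%E.
  by rewrite lee_fin mulr_ge0 ?powR_ge0.
have mF : measurable_fun pball
    (fun x => (enorm x `^ beta * mxnorm2 (wgrad pball u x) `^ p)%:E).
  apply/measurable_EFinP; apply: measurable_energy_density => i j.
  exact: weak_gradient_measurable HW.
rewrite /energy (integral_ball_punctured m0 F0 mF).
apply: (integral_wgrad open_punctured_ball
    (F := fun x A => enorm x `^ beta * mxnorm2 A `^ p) HG).
  by move=> x A; rewrite mulr_ge0 ?powR_ge0.
by move=> H mH; exact: measurable_energy_density.
Qed.

Lemma weak_gradient_radial (a b : R) : 0 <= a ->
  weak_gradient (annulus a b) (@radial R m) (@radial_grad R m).
Proof.
move=> a0; have O0 (x : 'rV[R]_m) : annulus a b x -> x != 0.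
  by move=> /andP[ax _]; rewrite -enorm_gt0 (le_lt_trans a0 ax).
have oO := @open_annulus R m a b.
have sw (j : 'I_m) := sweak_C1 oO (C1_radial j O0).
apply: (@weak_gradient_of_sweak R m _ _ _
  (fun j => (fun x => radial x ord0 j) \_ (annulus a b))
  (fun j i => (fun x => radial_grad x i j) \_ (annulus a b)) sw).
- by move=> x j Ox; rewrite /patch mem_set.
- by move=> x i j Ox; rewrite /patch mem_set.
Qed.

Lemma energy_radial p beta : energy p beta (@radial R m) =
  ((Num.sqrt (m%:R - 1) `^ p)%:E *
   \int[mu]_(x in pball) (enorm x `^ beta * (enorm x)^-1 `^ p)%:E)%E.
Proof.
have HG : weak_gradient pball (@radial R m) (@radial_grad R m).
  by rewrite punctured_ballE; exact: weak_gradient_radial.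
rewrite (energyE _ _ HG) -ge0_integralZl_EFin ?powR_ge0//.
- apply: eq_integral => x /set_mem; rewrite punctured_ballE => /andP[x0 _].
  rewrite -EFinM mxnorm2_radial_grad -?enorm_gt0//.
  have r0 : 0 <= (enorm x)^-1 by rewrite invr_ge0 enorm_ge0.
  by rewrite (powRM _ (sqrtr_ge0 _) r0) mulrCA.
- exact: measurable_punctured_ball.
- by move=> x _; rewrite lee_fin mulr_ge0 ?powR_ge0.
apply/measurable_EFinP; apply: measurable_funM; apply: measurable_powR_comp.
  by apply: measurable_funTS; exact: measurable_enorm.
apply: (eq_measurable_fun (fun x : 'rV[R]_m => enorm x `^ (-1))).
  by move=> x _; rewrite powR_inv1// enorm_ge0.
by apply: measurable_powR_comp; apply: measurable_funTS; exact: measurable_enorm.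
Qed.

End energy_formula.

Section radial_admissible.
Context {R : realType} (m : nat).
Hypothesis m0 : (0 < m)%N.
Local Notation mu := (@lebesgue_rV R m).
Local Notation pball := (@punctured_ball R m).
Variables (p beta : R).
Hypothesis p1 : 1 <= p.

Let p0 : p != 0. Proof. by rewrite gt_eqF// (lt_le_trans ltr01 p1). Qed.

Lemma lebesgue_collar : (mu (@collar R m) < +oo)%E.
Proof.
apply: le_lt_trans (lebesgue_rV_compact (@compact_closed_annulus R m 2^-1 1)).
apply: le_measure; rewrite ?inE; first exact: measurable_annulus.
  by apply: compact_measurable_rV; exact: compact_closed_annulus.
exact: annulus_sub_closed.
Qed.

Lemma integral_collar_bounded (f : 'rV[R]_m -> R) (M : R) :
  measurable_fun (@collar R m) f -> (forall x, collar x -> 0 <= f x <= M) ->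
  (\int[mu]_(x in @collar R m) (f x)%:E < +oo)%E.
Proof.
move=> mf fM; apply: (@le_lt_trans _ _ (\int[mu]_(x in @collar R m) M%:E)%E).
  apply: ge0_le_integral => //.
  - exact: measurable_annulus.
  - by move=> x /fM /andP[]; rewrite lee_fin.
  - exact/measurable_EFinP.
  - by move=> x /fM /andP[_]; rewrite lee_fin.
rewrite integral_cst; last exact: measurable_annulus.
have [M0|M0] := leP 0 M; first by rewrite lte_mul_pinfty// lebesgue_collar.
by apply: (@le_lt_trans _ _ 0%E) => //; rewrite mule_le0_ge0 ?lee_fin// ltW.
Qed.

Lemma sobolev_collar_radial : sobolev (@collar R m) p (@radial R m).
Proof.
have HG := @weak_gradient_radial R m 2^-1 1 ltac:(by rewrite invr_ge0).
have C0 (x : 'rV[R]_m) : collar x -> x != 0 /\ (enorm x)^-1 <= 2.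
  rewrite collarE => /andP[xl _]; have x0 : 0 < enorm x by apply: lt_trans xl; rewrite invr_gt0.
  by rewrite -enorm_gt0 x0 -[2]invrK lef_pV2 ?posrE ?invr_gt0// ltW.
split.
- by apply: measurable_funTS; exact: measurable_radial.
- apply: (@integral_collar_bounded _ 1).
    apply: measurable_powR_comp; apply: measurable_enorm_comp => j.
    exact: weak_gradient_measurable_u HG.
  by move=> x /C0[x0 _]; rewrite enorm_radial// powR1 ler01/=.
- by exists (@radial_grad R m).
rewrite (integral_wgrad (@open_annulus R m 2^-1 1) (F := fun x A => mxnorm2 A `^ p) HG).
- apply: (@integral_collar_bounded _ ((Num.sqrt (m%:R - 1) * 2) `^ p)).
    apply: measurable_powR_comp; apply: measurable_mxnorm2 => i j.
    exact: weak_gradient_measurable HG.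
  move=> x /C0[x0 x2]; rewrite powR_ge0/= ge0_ler_powR//.
  + by rewrite (le_trans ler01).
  + by rewrite nnegrE mxnorm2_ge0.
  + by rewrite nnegrE mulr_ge0 ?sqrtr_ge0.
  by rewrite mxnorm2_radial_grad// ler_wpM2l ?sqrtr_ge0.
- by move=> x A; exact: powR_ge0.
by move=> H mH; apply: measurable_powR_comp; exact: measurable_mxnorm2.
Qed.

Lemma admissible_radial : (energy p beta (@radial R m) < +oo)%E ->
  admissible p beta (@radial R m).
Proof.
move=> Eoo; have HG : weak_gradient pball (@radial R m) (@radial_grad R m).
  by rewrite punctured_ballE; exact: weak_gradient_radial.
split.
  split=> //; last by exists (@radial_grad R m).
    by apply: measurable_funTS; exact: measurable_radial.
  by have := @ae_neq0 R m m0; apply: filterS => x x0 _; exact: enorm_radial.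
have z0 : (0 : R) `^ p = 0 by exact: powR0.
exists (fun=> @radial R m); split.
- move=> _; split; last exact: sobolev_collar_radial.
  apply: continuous_in_subspaceT => x /set_mem/= /andP[xl _].
  have x0 : x != 0 by rewrite -enorm_gt0 (lt_le_trans _ xl)// invr_gt0.
  apply: cts_rV => i.
  by have [] := @C1_radial R m [set y | y != 0] i (fun y h => h) x x0.
- under eq_fun do under eq_integral do rewrite subrr enorm0 z0.
  under eq_fun do rewrite integral0; exact: cvg_cst.
- rewrite (_ : (fun k => _) = cst 0%E); first exact: cvg_cst.
  apply/funext => k; have HGc := @weak_gradient_radial R m 2^-1 1 ltac:(by rewrite invr_ge0).
  have HWc : weak_gradient (@collar R m) (@radial R m) (wgrad (@collar R m) (@radial R m)).
    by apply: weak_gradient_wgrad; exists (@radial_grad R m).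
  have HW : weak_gradient pball (@radial R m) (wgrad pball (@radial R m)).
    by apply: weak_gradient_wgrad; exists (@radial_grad R m).
  have cp : @collar R m `<=` pball.
    rewrite punctured_ballE => x /andP[h x1]; apply/andP; split=> //.
    by apply: lt_trans h; rewrite invr_gt0.
  transitivity (\int[mu]_(x in @collar R m) (0 : \bar R))%E; last by rewrite integral0.
  apply: ge0_ae_eq_integral => //.
  + exact: measurable_annulus.
  + apply/measurable_EFinP; apply: measurable_powR_comp; apply: measurable_mxnorm2 => i j.
    apply: (eq_measurable_fun (fun x => wgrad (@collar R m) (@radial R m) x i j - wgrad pball (@radial R m) x i j)).
      by move=> x _; rewrite !mxE.
    apply: measurable_funB; first exact: weak_gradient_measurable HWc.
    have mW := weak_gradient_measurable i j HW.
    exact: (measurable_funS (@measurable_punctured_ball R m) cp mW).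
  + by move=> x _; rewrite lee_fin powR_ge0.
  have := wgrad_ae (@open_annulus R m 2^-1 1) HGc.
  have := wgrad_ae (open_punctured_ball (m := m)) HG.
  apply: filterS2 => x h1 h2 Cx; rewrite h1 ?h2//; last exact: cp.
  by rewrite subrr mxnorm2_vec linear0 enorm0 z0.
rewrite (_ : (fun k => _) = cst 0%E); first exact: cvg_cst.
apply/funext => k; apply: integral0_eq => x /= Sx.
by rewrite /radial Sx invr1 scale1r subrr enorm0 z0.
Qed.

End radial_admissible.

(** * Polar coordinates about the first axis *)

Section cotangent_parameter.
Context {R : realType}.
Implicit Types t : R.
Local Notation leb := (@lebesgue_measure R).

(** With t = cot theta the cotangent of the colatitude, kap t = sin theta and
    kap t * t = cos theta. *)
Definition kap t : R := (Num.sqrt (1 + t ^+ 2))^-1.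

Lemma kap_gt0 t : 0 < kap t.
Proof. by rewrite invr_gt0 sqrtr_gt0 ltr_pwDl// sqr_ge0. Qed.

Lemma kap_neq0 t : kap t != 0. Proof. by rewrite gt_eqF// kap_gt0. Qed.

Lemma sqr_kap t : kap t ^+ 2 = (1 + t ^+ 2)^-1.
Proof. by rewrite exprVn sqr_sqrtr// addr_ge0// sqr_ge0. Qed.

Lemma kapE t : kap t ^+ 2 * (1 + t ^+ 2) = 1.
Proof. by rewrite sqr_kap mulVf// gt_eqF// ltr_pwDl// sqr_ge0. Qed.

Lemma kap_le1 t : kap t <= 1.
Proof.
rewrite invf_le1 ?sqrtr_gt0 ?ltr_pwDl ?sqr_ge0// -[leLHS]sqrtr1 ler_wsqrtr//.
by rewrite lerDl sqr_ge0.
Qed.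

Lemma norm_kapM t : `|kap t * t| <= 1.
Proof.
rewrite -(ler_pXn2r (n := 2))// ?nnegrE// -normrX expr1n exprMn ger0_norm; last first.
  by rewrite mulr_ge0 ?sqr_ge0.
rewrite -(kapE t) mulrDr mulr1 lerDr sqr_ge0//.
Qed.

Lemma continuous_kap : continuous kap.
Proof.
suff H t : {for t, continuous kap} by move=> t; exact: H.
rewrite /kap; apply: ctsV; first by rewrite gt_eqF// sqrtr_gt0 ltr_pwDl// sqr_ge0.
apply: (cts_comp (h := @Num.sqrt R)); last exact: sqrt_continuous.
by apply: ctsD; [exact: ctsC|exact: exprn_continuous].
Qed.

Lemma measurable_kap : measurable_fun setT kap.
Proof. exact: continuous_measurable_fun continuous_kap. Qed.

Lemma is_derive_kap t : is_derive t 1 kap (- t * kap t ^+ 3).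
Proof.
have D0 : 0 < 1 + t ^+ 2 by rewrite ltr_pwDl// sqr_ge0.
have dq : is_derive t 1 (fun s : R => 1 + s ^+ 2) (2 * t).
  have := is_deriveD (is_derive_cst (1 : R) t 1) (is_deriveX 2 (is_derive_id t 1)).
  by rewrite add0r /= expr1 [_ *: 1]mulr1.
have r0 : Num.sqrt (1 + t ^+ 2) != 0 by rewrite gt_eqF// sqrtr_gt0.
have ds := @is_derive_comp1 R R Num.sqrt (fun s => 1 + s ^+ 2) t 1 _ _ (is_derive1_sqrt D0) dq.
have := @is_derive_comp1 R R _ _ t 1 _ _ (is_derive_inv r0) ds.
suff -> : - t * kap t ^+ 3 = - Num.sqrt (1 + t ^+ 2) ^- 2 *
   ((2 * Num.sqrt (1 + t ^+ 2))^-1 * (2 * t)) by [].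
by rewrite /kap; field.
Qed.

Lemma integrable_sqr_kap : leb.-integrable setT (EFin \o (fun t => kap t ^+ 2)).
Proof.
apply/integrableP; split.
  by apply/measurable_EFinP; apply: measurable_funX; exact: measurable_kap.
have -> : (\int[leb]_t `|(EFin \o (fun t => kap t ^+ 2)%R) t| = \int[leb]_t ((oneDsqr t)^-1)%:E)%E.
  by apply: eq_integral => t _ /=; rewrite ger0_norm ?sqr_ge0// sqr_kap.
rewrite (ge0_symfun_integralT (f := fun t => (oneDsqr t)^-1)).
- by rewrite -set_itvcy integral0y_oneDsqr -EFinM ltry.
- by move=> t; rewrite invr_ge0 (le_trans ler01)// oneDsqr_ge1.
- exact: continuous_oneDsqrV.
- by move=> t; rewrite /= /oneDsqr sqrrN.
Qed.

Lemma integrable_kap (n : nat) : (2 <= n)%N ->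
  leb.-integrable setT (EFin \o (fun t => kap t ^+ n)).
Proof.
move=> n2; apply: le_integrable integrable_sqr_kap => //.
  by apply/measurable_EFinP; apply: measurable_funX; exact: measurable_kap.
move=> t _ /=; rewrite lee_fin !ger0_norm ?exprn_ge0 ?(ltW (kap_gt0 t))//.
by rewrite ler_wiXn2l// ?(ltW (kap_gt0 t)) ?kap_le1.
Qed.

Definition kap_int (n : nat) : R := \int[leb]_t (kap t ^+ n).

Lemma kap_intE n : (2 <= n)%N -> (\int[leb]_t (kap t ^+ n)%:E = (kap_int n)%:E)%E.
Proof. by move=> n2; rewrite /kap_int fineK//; exact: integrable_fin_num (integrable_kap n2). Qed.

Lemma kap_int_gt0 n : (2 <= n)%N -> 0 < kap_int n.
Proof.
move=> n2; suff : (0 < \int[leb]_t (kap t ^+ n)%:E)%E by rewrite kap_intE.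
have A : (0 < \int[leb]_(t in `[0%R, 1%R]) (kap 1 ^+ n)%:E)%E.
  rewrite integral_cst//= lebesgue_measure_itv/= lte_fin ltr01 oppr0 adde0.
  by rewrite mule1 lte_fin exprn_gt0// kap_gt0.
have mk : measurable_fun setT (fun t => (kap t ^+ n)%:E).
  by apply/measurable_EFinP; apply: measurable_funX; exact: measurable_kap.
have B : (\int[leb]_(t in `[0%R, 1%R]) (kap 1 ^+ n)%:E <=
    \int[leb]_(t in `[0%R, 1%R]) (kap t ^+ n)%:E)%E.
  apply: ge0_le_integral => //.
  - by move=> t _; rewrite lee_fin exprn_ge0// ltW// kap_gt0.
  - exact: (measurable_funTS mk).
  move=> t /=; rewrite in_itv/= => /andP[t0 t1]; rewrite lee_fin.
  apply: lerXn2r; rewrite ?nnegrE ?(ltW (kap_gt0 _))//.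
  rewrite lef_pV2 ?posrE ?sqrtr_gt0 ?ltr_pwDl ?sqr_ge0// ler_wsqrtr// lerD2l.
  by rewrite expr1n expr_le1.
apply: (lt_le_trans A); apply: (le_trans B); apply: ge0_subset_integral => //.
by move=> t _; rewrite lee_fin exprn_ge0// ltW// kap_gt0.
Qed.

End cotangent_parameter.

Section polar_map.
Context {R : realType} (n : nat).
Local Notation leb := (@lebesgue_measure R).
Local Notation mu := (@lebesgue_rV R).
Implicit Types (t : R) (y z : 'rV[R]_n) (x : 'rV[R]_n.+1).

(** The point at distance |z| from 0, in the half-plane spanned by the axis
    and z, whose latitude is given by t. *)
Definition polar (w : measurableTypeR R * 'rV[R]_n) : 'rV[R]_n.+1 :=
  cons_rV (kap w.1 * w.1 * enorm w.2, kap w.1 *: w.2).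

Definition unpolar x : 'rV[R]_n := enorm x *: radial (behead_rV x).

Lemma enorm_cons (w : measurableTypeR R * 'rV[R]_n) :
  enorm (cons_rV w) ^+ 2 = w.1 ^+ 2 + enorm w.2 ^+ 2.
Proof.
rewrite !sqr_enorm /dotr big_ord_recl cons_rV0 -expr2; congr (_ + _).
by apply: eq_bigr => i _; rewrite cons_rV_lift.
Qed.

Lemma enorm_polar t z : enorm (polar (t, z)) = enorm z.
Proof.
apply/eqP; rewrite -(eqrXn2 (n := 2)) ?enorm_ge0// enorm_cons/=.
rewrite enormZ ger0_norm ?(ltW (kap_gt0 t))// !exprMn; apply/eqP.
transitivity (kap t ^+ 2 * (1 + t ^+ 2) * enorm z ^+ 2); first by ring.
by rewrite kapE mul1r.
Qed.

Lemma behead_polar t z : behead_rV (polar (t, z)) = kap t *: z.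
Proof. by rewrite behead_cons_rV. Qed.

Lemma polar0 t z : polar (t, z) ord0 ord0 = kap t * t * enorm z.
Proof. by rewrite cons_rV0. Qed.

Lemma unpolarK t z : unpolar (polar (t, z)) = z.
Proof.
by rewrite /unpolar enorm_polar behead_polar radialZ ?kap_gt0// enorm_scale_radial.
Qed.

Lemma measurable_polar : measurable_fun setT polar.
Proof.
apply: (measurableT_comp (measurable_cons_rV (n:=n))).
have mk : measurable_fun setT (fun w : measurableTypeR R * 'rV[R]_n => kap w.1).
  exact: measurableT_comp measurable_kap measurable_fst.
apply/measurable_fun_pair => /=.
  apply: measurable_funM; last exact: measurableT_comp (@measurable_enorm R n) measurable_snd.
  by apply: measurable_funM => //; exact: measurable_fst.
apply: measurable_fun_rVP => i; under eq_fun do rewrite mxE.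
apply: measurable_funM => //.
exact: (measurableT_comp (@measurable_coor R n i) measurable_snd).
Qed.

Lemma measurable_unpolar : measurable_fun setT unpolar.
Proof.
apply: measurable_fun_rVP => i; under eq_fun do rewrite mxE.
apply: measurable_funM; first exact: measurable_enorm.
apply: (measurableT_comp (@measurable_coor R n i)).
exact: measurableT_comp (@measurable_radial R n) (@measurable_behead_rV R n).
Qed.

Local Open Scope ereal_scope.

Definition jac (w : measurableTypeR R * 'rV[R]_n) : R := kap w.1 ^+ n.+1 * enorm w.2.

Lemma jac_ge0 w : (0 <= jac w)%R.
Proof. by rewrite mulr_ge0 ?enorm_ge0// exprn_ge0// ltW// kap_gt0. Qed.

Lemma measurable_jac : measurable_fun setT jac.
Proof.
apply: measurable_funM; last exact: measurableT_comp (@measurable_enorm R n) measurable_snd.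
by apply: measurable_funX; exact: measurableT_comp measurable_kap measurable_fst.
Qed.

(** Put t = |y| s in the fibre over y, exchange the integrals, and dilate y by
    kap s. *)
Lemma ge0_integral_polar (f : 'rV[R]_n.+1 -> \bar R) : (0 < n)%N ->
  measurable_fun setT f -> (forall x, 0 <= f x) ->
  \int[mu n.+1]_x f x = \int[leb \x mu n]_w ((jac w)%:E * f (polar w)).
Proof.
move=> n0 mf f0.
pose g (w : measurableTypeR R * 'rV[R]_n) :=
  (enorm w.2)%:E * f (cons_rV (enorm w.2 * w.1, w.2)%R).
have mg : measurable_fun setT g.
  apply: emeasurable_funM.
    apply/measurable_EFinP; exact: measurableT_comp (@measurable_enorm R n) measurable_snd.
  apply: (measurableT_comp mf); apply: (measurableT_comp (measurable_cons_rV (n:=n))).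
  apply/measurable_fun_pair => /=; last exact: measurable_snd.
  apply: measurable_funM; last exact: measurable_fst.
  exact: measurableT_comp (@measurable_enorm R n) measurable_snd.
have g0 w : 0 <= g w by rewrite mule_ge0// lee_fin enorm_ge0.
have mh : measurable_fun setT (fun w => (jac w)%:E * f (polar w)).
  apply: emeasurable_funM; first by apply/measurable_EFinP; exact: measurable_jac.
  by apply: (measurableT_comp mf); exact: measurable_polar.
rewrite ge0_integral_lebesgue_iter//.
transitivity (\int[mu n]_y \int[leb]_t g (t, y)).
  apply: ge0_ae_eq_integral => //.
  - apply: (@measurable_fun_fubini_tonelli_G _ _ _ _ R leb
      (fun z : measurableTypeR R * 'rV[R]_n => f (cons_rV z))) => //.
    exact: measurable_comp_cons_rV.
  - exact: (@measurable_fun_fubini_tonelli_G _ _ _ _ R leb g).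
  - by move=> y _; exact: integral_ge0.
  - by move=> y _; exact: integral_ge0.
  have := @ae_neq0 R n n0; apply: filterS => y y0 _.
  have r0 : (0 < enorm y)%R by rewrite enorm_gt0.
  have mfy : measurable_fun setT (fun t => f (cons_rV (t, y))).
    apply: (measurableT_comp mf); apply: (measurableT_comp (measurable_cons_rV (n:=n))).
    exact: measurable_pair2.
  have := ge0_integral_affine 0%R r0 mfy (fun t => f0 _).
  under eq_integral do rewrite addr0.
  move=> E; rewrite /g/= ge0_integralZl_EFin ?enorm_ge0//; last first.
    apply: (measurableT_comp mf); apply: (measurableT_comp (measurable_cons_rV (n:=n))).
    apply/measurable_fun_pair => //=; exact: mulrl_measurable.
  by rewrite /= E muleA -EFinM mulfV ?gt_eqF// mul1e.
rewrite -(fubini_tonelli g)// (fubini_tonelli1 _ mh); last first.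
  by move=> w; rewrite mule_ge0// lee_fin jac_ge0.
apply: eq_integral => t _.
have k0 := kap_gt0 t.
have mgt : measurable_fun setT (fun y => g (t, y)).
  by apply: (measurableT_comp mg); exact: measurable_pair1.
have := ge0_integral_rV_affine 0%R k0 mgt (fun y => g0 _).
under eq_integral do rewrite addr0.
move=> E.
transitivity ((kap t ^+ n)%:E * \int[mu n]_x g (t, (kap t *: x)%R)).
  by rewrite E muleA -EFinM mulfV ?mul1e// expf_neq0// kap_neq0.
rewrite -ge0_integralZl_EFin ?exprn_ge0 ?(ltW k0)//; last first.
  apply: (measurableT_comp mgt).
  have := measurable_rV_affine (kap t) (0%R : 'rV[R]_n).
  by under eq_fun do rewrite addr0.
apply: eq_integral => z _; rewrite /g /jac /polar/= muleA -EFinM; congr (_%:E * f _).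
  by rewrite enormZ ger0_norm ?(ltW k0)// exprSr mulrA.
by rewrite enormZ ger0_norm ?(ltW k0)//; congr (cons_rV (_, _)); rewrite mulrAC.
Qed.

Lemma integral_polar (f : 'rV[R]_n.+1 -> \bar R) : (0 < n)%N ->
  measurable_fun setT f ->
  \int[mu n.+1]_x f x = \int[leb \x mu n]_w ((jac w)%:E * f (polar w)).
Proof.
move=> n0 mf; rewrite integralE [RHS]integralE.
rewrite (ge0_integral_polar n0 (measurable_funepos mf) (@funepos_ge0 _ _ _)).
rewrite (ge0_integral_polar n0 (measurable_funeneg mf) (@funeneg_ge0 _ _ _)).
congr (_ - _); apply: eq_integral => w _.
  by rewrite !funeposE maxe_pMr ?lee_fin ?jac_ge0// mule0.
by rewrite !funenegE maxe_pMr ?lee_fin ?jac_ge0// mule0 muleN.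
Qed.

(** The image of the volume of R^(n+1) under unpolar is |z| dz, up to a
    constant factor. *)
Lemma ge0_integral_unpolar (h : 'rV[R]_n -> \bar R) : (1 < n)%N ->
  measurable_fun setT h -> (forall z, 0 <= h z) ->
  \int[mu n.+1]_x h (unpolar x) =
  (kap_int n.+1)%:E * \int[mu n]_z ((enorm z)%:E * h z).
Proof.
move=> n1 mh h0.
rewrite (@ge0_integral_polar (fun x => h (unpolar x))) ?(ltn_trans _ n1)//; last first.
  by apply: (measurableT_comp mh); exact: measurable_unpolar.
have mk : measurable_fun setT (fun w : measurableTypeR R * 'rV[R]_n => (kap w.1 ^+ n.+1)%:E).
  apply/measurable_EFinP; apply: measurable_funX.
  exact: measurableT_comp measurable_kap measurable_fst.
have meh : measurable_fun setT (fun z : 'rV[R]_n => (enorm z)%:E * h z).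
  by apply: emeasurable_funM => //; apply/measurable_EFinP; exact: measurable_enorm.
have eh0 z : 0 <= (enorm z)%:E * h z by rewrite mule_ge0// lee_fin enorm_ge0.
transitivity (\int[leb \x mu n]_w ((kap w.1 ^+ n.+1)%:E * ((enorm w.2)%:E * h w.2))).
  by apply: eq_integral => -[t z] _; rewrite unpolarK /jac/= EFinM -muleA.
rewrite fubini_tonelli1/=; last 2 first.
- by apply: emeasurable_funM => //; exact: measurableT_comp meh measurable_snd.
- by move=> w; rewrite mule_ge0// lee_fin exprn_ge0// ltW// kap_gt0.
rewrite /fubini_F/=.
under eq_integral => t _.
  rewrite ge0_integralZl_EFin ?exprn_ge0 ?(ltW (kap_gt0 t))//; over.
rewrite ge0_integralZr//; last 3 first.
- by apply/measurable_EFinP; apply: measurable_funX; exact: measurable_kap.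
- by move=> t _; rewrite lee_fin exprn_ge0// ltW// kap_gt0.
- exact: integral_ge0.
by rewrite kap_intE// ltnS ltnW.
Qed.

Lemma ae_unpolar (P : 'rV[R]_n -> Prop) : (1 < n)%N ->
  {ae mu n, forall z, P z} -> {ae mu n.+1, forall x, P (unpolar x)}.
Proof.
move=> n1 [N [mN N0 PN]]; exists (unpolar @^-1` N); split.
- by rewrite -[X in measurable X]setTI; exact: measurable_unpolar.
- have mNN : measurable (unpolar @^-1` N).
    by rewrite -[X in measurable X]setTI; exact: measurable_unpolar.
  transitivity (\int[mu n.+1]_x (\1_N (unpolar x))%:E).
    by rewrite -[X in mu n.+1 X]setIT -integral_indic.
  have mi : measurable_fun setT (fun z : 'rV[R]_n => (\1_N z : R)%:E).
    by apply/measurable_EFinP; exact: measurable_indic.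
  have i0 z : 0 <= (\1_N z : R)%:E by rewrite lee_fin.
  rewrite (ge0_integral_unpolar n1 mi i0).
  rewrite (_ : (\int[mu n]_z _) = 0) ?mule0// -[RHS](integral0 (mu n) setT).
  apply: ge0_ae_eq_integral => //.
  + apply: emeasurable_funM; apply/measurable_EFinP; last exact: measurable_indic.
    exact: measurable_enorm.
  + by move=> z _; rewrite mule_ge0// lee_fin ?enorm_ge0.
  exists N; split=> // z /= nz; apply: contrapT => nNz; apply: nz => _.
  by rewrite indicE memNset// mule0.
by move=> x nPx; exact: PN.
Qed.

End polar_map.

(** * Test functions in polar coordinates *)

Section integral_R_derive.
Context {R : realType}.
Local Notation leb := (@lebesgue_measure R).

Lemma integral_translate_R (f : R -> \bar R) (b : R) : measurable_fun setT f ->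
  (\int[leb]_t f (b + t)%R = \int[leb]_t f t)%E.
Proof.
move=> mf.
have H (g : R -> \bar R) : measurable_fun setT g -> (forall x, 0 <= g x)%E ->
    (\int[leb]_t g (b + t)%R = \int[leb]_t g t)%E.
  move=> mg g0; have := ge0_integral_affine b ltr01 mg g0.
  rewrite invr1 mul1e => <-.
  by apply: eq_integral => t _; rewrite mul1r addrC.
rewrite integralE [RHS]integralE; congr (_ - _)%E.
  rewrite -(H _ (measurable_funepos mf)); last by move=> x; exact: funepos_ge0.
  by apply: eq_integral => x _; rewrite !funeposE.
rewrite -(H _ (measurable_funeneg mf)); last by move=> x; exact: funeneg_ge0.
by apply: eq_integral => x _; rewrite !funenegE.
Qed.

(** The integral over the line of the derivative of an integrable function. *)
Lemma integral_R_derive0 (f g G : R -> R) :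
  (forall t : R, is_derive t 1 f (g t)) ->
  leb.-integrable setT (EFin \o f) -> measurable_fun setT g ->
  leb.-integrable setT (EFin \o G) ->
  (forall (s t : R), 0 <= s <= 1 -> `|g (s + t)| <= G t) ->
  \int[leb]_t g t = 0.
Proof.
move=> fg intf mg intG gG.
have mf : measurable_fun setT (EFin \o f) by case/integrableP : intf.
apply: (@integral_derive_flow _ _ _ leb f g (fun s t => s + t) G) => //.
- by move=> t; rewrite add0r.
- move=> t s; have ds : is_derive s 1 (fun r : R => r + t) 1.
    have := is_deriveD (is_derive_id s 1) (is_derive_cst t s 1).
    by rewrite addr0.
  by have := @is_derive_comp1 R R f (fun r => r + t) s 1 _ _ (fg (s + t)) ds; rewrite mulr1.
- move=> s; apply/integrableP; split.
    apply: (measurableT_comp mf).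
    by have := measurable_affine 1 s; under eq_fun do rewrite mul1r addrC.
  have mabs : measurable_fun setT (fun x => `|(f x)%:E|%E) by exact: (measurableT_comp _ mf).
  have /= -> := integral_translate_R s mabs.
  by case/integrableP : intf.
by move=> s; exact: (integral_translate_R s mf).
Qed.

End integral_R_derive.

Section test_function_in_polar_coordinates.
Context {R : realType} (n : nat).
Local Notation P := (measurableTypeR R * 'rV[R]_n)%type.
Variables (a b : R) (phi : 'rV[R]_n.+1 -> R).
Hypotheses (a0 : 0 <= a) (ab : a < b).
Hypothesis tphi : test_function (annulus a b) phi.
Implicit Types (w : P) (t : R) (z : 'rV[R]_n).

Let V0 w := 'D_(basis_rV ord0) phi (polar w).
Let Vy (k : 'I_n) w := 'D_(basis_rV (lift ord0 k)) phi (polar w).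

(** The partial derivatives of phi o polar. *)
Definition polar_dt w : R := kap w.1 ^+ 3 * enorm w.2 * V0 w -
  w.1 * kap w.1 ^+ 3 * \sum_k w.2 ord0 k * Vy k w.

Definition polar_dz (k : 'I_n) w : R :=
  kap w.1 * w.1 * radial w.2 ord0 k * V0 w + kap w.1 * Vy k w.

Lemma is_derive_polar_t t z :
  is_derive t 1 (fun s : R => phi (polar (s, z))) (polar_dt (t, z)).
Proof.
pose c' : 'rV[R]_n.+1 := cons_rV (kap t ^+ 3 * enorm z, (- (t * kap t ^+ 3)) *: z).
have dk := is_derive_kap t.
have dc i : is_derive t 1 (fun s : R => (polar (s, z) : 'rV[R]_n.+1) ord0 i) (c' ord0 i).
  rewrite /polar/c'; have [k ->|->] := unliftP ord0 i.
    under eq_fun do rewrite cons_rV_lift/= mxE mulrC; rewrite cons_rV_lift/= mxE.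
    have := is_deriveZ (z ord0 k) dk; rewrite -[_ *: (- t * _)]/(_ * (- t * _)).
    by rewrite mulNr mulrN [z ord0 k * _]mulrC -mulNr.
  under eq_fun do rewrite cons_rV0/= mulrC; rewrite cons_rV0/=.
  have := is_deriveZ (enorm z) (is_deriveM dk (is_derive_id t 1)).
  rewrite -[_ *: 1]/(_ * 1) -[t *: _]/(t * _) -[enorm z *: _]/(enorm z * _).
  suff -> : enorm z * (kap t * 1 + t * (- t * kap t ^+ 3)) = kap t ^+ 3 * enorm z by [].
  transitivity ((kap t * (kap t ^+ 2 * (1 + t ^+ 2)) - t ^+ 2 * kap t ^+ 3) * enorm z).
    by rewrite kapE; ring.
  by ring.
have := is_derive_curve (test_is_derive tphi) (test_continuous_derive tphi) dc.
rewrite big_ord_recl /c' cons_rV0/=.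
suff -> : kap t ^+ 3 * enorm z * 'D_(basis_rV ord0) phi (polar (t, z)) +
  \sum_(i < n) cons_rV (kap t ^+ 3 * enorm z, - (t * kap t ^+ 3) *: z) ord0 (lift ord0 i) *
    'D_(basis_rV (lift ord0 i)) phi (polar (t, z)) = polar_dt (t, z) by [].
rewrite /polar_dt /=; congr (_ + _); rewrite mulr_sumr -sumrN; apply: eq_bigr => k _.
by rewrite cons_rV_lift/= mxE /Vy; ring.
Qed.

Lemma is_derive_polar_z t z k : z != 0 ->
  is_derive z (basis_rV k) (fun y => phi (polar (t, y))) (polar_dz k (t, z)).
Proof.
move=> z0; apply/is_derive_line0.
pose c' : 'rV[R]_n.+1 := cons_rV (kap t * t * radial z ord0 k, kap t *: basis_rV k).
have dc i : is_derive (0 : R) 1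
    (fun h => (polar (t, h *: basis_rV k + z) : 'rV[R]_n.+1) ord0 i) (c' ord0 i).
  rewrite /polar/c'; have [j ->|->] := unliftP ord0 i.
    under eq_fun do rewrite cons_rV_lift/= mxE; rewrite cons_rV_lift/= mxE basis_rVE.
    have /is_derive_line0 D := is_derive_coor j k z.
    exact: (is_deriveZ (kap t) D).
  under eq_fun do rewrite cons_rV0/=; rewrite cons_rV0/= mxE mulrC.
  have /is_derive_line0 D := is_derive_enorm k z0.
  have := is_deriveZ (kap t * t) D.
  by rewrite -[_ *: (_ / _)]/(_ * _) [in X in _ -> X]mulrC [(enorm z)^-1 * _]mulrC.
have := is_derive_curve (test_is_derive tphi) (test_continuous_derive tphi) dc.
rewrite scale0r add0r big_ord_recl /c' cons_rV0/=.
suff -> : kap t * t * radial z ord0 k * 'D_(basis_rV ord0) phi (polar (t, z)) +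
  \sum_(i < n) cons_rV (kap t * t * radial z ord0 k, kap t *: basis_rV k) ord0 (lift ord0 i) *
    'D_(basis_rV (lift ord0 i)) phi (polar (t, z)) = polar_dz k (t, z) by [].
rewrite /polar_dz/=; congr (_ + _); rewrite (bigD1 k)//= big1 ?addr0.
  by rewrite cons_rV_lift/= mxE basis_rVE eqxx mulr1.
by move=> j /negbTE jk; rewrite cons_rV_lift/= mxE basis_rVE jk mulr0 mul0r.
Qed.

Lemma polar_support : exists K : set 'rV[R]_n, [/\ compact K, K `<=` annulus a b,
  forall w, ~ K w.2 -> phi (polar w) = 0,
  forall w, ~ K w.2 -> polar_dt w = 0 &
  forall k w, ~ K w.2 -> polar_dz k w = 0].
Proof.
have [K [cK KO p0 dp0]] := test_support tphi.
have [a' [b' [aa' _ bb' Kab]]] := compact_annulus ab cK KO.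
have nK w : ~ closed_annulus a' b' w.2 -> ~ K (polar w).
  case: w => t z /= nz /Kab; rewrite /closed_annulus/= enorm_polar; exact: nz.
exists (closed_annulus a' b'); split.
- exact: compact_closed_annulus.
- exact: closed_annulus_sub.
- by move=> w /nK; exact: p0.
- move=> w /nK nw; rewrite /polar_dt /V0 dp0// mulr0 sub0r big1 ?mulr0 ?oppr0// => k _.
  by rewrite /Vy dp0// mulr0.
- by move=> k w /nK nw; rewrite /polar_dz /V0 /Vy !dp0// !mulr0 addr0.
Qed.

Lemma polar_bounded : exists M, [/\ 0 <= M, forall w, `|phi (polar w)| <= M,
  forall w, `|polar_dt w| <= M * kap w.1 & forall k w, `|polar_dz k w| <= M].
Proof.
have [M [M0 HM]] := test_derive_bounded tphi.
have [N [N0 HN]] := test_bounded tphi.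
have [K [cK KO _ dt0 _]] := polar_support.
have Kb w : K w.2 -> enorm w.2 <= b by move=> /KO /andP[_ /ltW].
have b0 : 0 <= b by apply: le_trans a0 (ltW ab).
exists (N + (b * M + n%:R * (b * M)) + (M + M)); split.
- by rewrite !addr_ge0// ?mulr_ge0// mulr_ge0.
- move=> w; apply: (le_trans (HN _)); rewrite -addrA lerDl.
  by rewrite !addr_ge0// ?mulr_ge0// mulr_ge0.
- move=> w; have k0 := kap_gt0 w.1; have k1 := kap_le1 w.1.
  have [Kw|nKw] := pselect (K w.2); last first.
    by rewrite dt0// normr0 mulr_ge0 ?(ltW k0)// !addr_ge0// ?mulr_ge0// mulr_ge0.
  apply: (@le_trans _ _ ((b * M + n%:R * (b * M)) * kap w.1)); last first.
    rewrite ler_wpM2r ?(ltW k0)// -addrA addrC -addrA lerDl.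
    by rewrite !addr_ge0.
  have k31 : kap w.1 ^+ 3 <= kap w.1.
    by rewrite exprS ler_piMr ?(ltW k0)// expr_le1 ?(ltW k0).
  have tk3 : `|w.1 * kap w.1 ^+ 3| <= kap w.1.
    have -> : w.1 * kap w.1 ^+ 3 = (kap w.1 * w.1) * kap w.1 ^+ 2 by ring.
    rewrite normrM (ger0_norm (sqr_ge0 _)) -[leRHS]mul1r ler_pM ?norm_kapM ?sqr_ge0//.
    by rewrite expr2 ler_piMr ?(ltW k0).
  rewrite /polar_dt; apply: (le_trans (ler_normB _ _)); rewrite mulrDl; apply: lerD.
    rewrite normrM [`|kap _ ^+ 3 * _|]normrM (ger0_norm (exprn_ge0 3 (ltW k0))) (ger0_norm (enorm_ge0 _)).
    rewrite -mulrA mulrC; apply: ler_pM => //; rewrite ?mulr_ge0 ?enorm_ge0 ?exprn_ge0 ?(ltW k0)//.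
    by apply: ler_pM; rewrite ?enorm_ge0//; [exact: Kb Kw|exact: HM].
  rewrite normrM mulrC; apply: ler_pM => //.
  apply: (le_trans (ler_norm_sum _ _ _)).
  apply: (@le_trans _ _ (\sum_(k < n) b * M)); last first.
    by rewrite sumr_const card_ord mulr_natl.
  apply: ler_sum => k _; rewrite normrM; apply: ler_pM => //; last exact: HM.
  by apply: le_trans (coor_le_enorm _ _) _; exact: Kb Kw.
- move=> k w; apply: (@le_trans _ _ (M + M)); last first.
    by rewrite lerDr !addr_ge0// ?mulr_ge0// mulr_ge0.
  rewrite /polar_dz; apply: (le_trans (ler_normD _ _)); apply: lerD.
    rewrite normrM -[leRHS]mul1r; apply: ler_pM => //; last exact: HM.
    rewrite normrM -[leRHS]mul1r; apply: ler_pM => //; first exact: norm_kapM.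
    apply: le_trans (coor_le_enorm _ _) _.
    have [->|z0] := eqVneq w.2 0; last by rewrite enorm_radial.
    by rewrite /radial enorm0 invr0 scale0r enorm0.
  rewrite normrM -[leRHS]mul1r; apply: ler_pM => //; last exact: HM.
  by rewrite ger0_norm ?kap_le1// ltW// kap_gt0.
Qed.

Lemma measurable_phi_polar : measurable_fun setT (fun w => phi (polar w)).
Proof. exact: measurableT_comp (test_measurable tphi) (@measurable_polar R n). Qed.

Let mV0 : measurable_fun setT V0.
Proof. exact: measurableT_comp (test_measurable_derive tphi _) (@measurable_polar R n). Qed.

Let mVy k : measurable_fun setT (Vy k).
Proof. exact: measurableT_comp (test_measurable_derive tphi _) (@measurable_polar R n). Qed.

Let mkap : measurable_fun setT (fun w : P => kap w.1).
Proof. exact: measurableT_comp measurable_kap measurable_fst. Qed.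

Let mz k : measurable_fun setT (fun w : P => w.2 ord0 k).
Proof. exact: measurableT_comp (@measurable_coor R n k) measurable_snd. Qed.

Let mez : measurable_fun setT (fun w : P => enorm w.2).
Proof. exact: measurableT_comp (@measurable_enorm R n) measurable_snd. Qed.

Lemma measurable_polar_dt : measurable_fun setT polar_dt.
Proof.
apply: measurable_funB; apply: measurable_funM => //.
- by apply: measurable_funM => //; exact: measurable_funX.
- by apply: measurable_funM; [exact: measurable_fst|exact: measurable_funX].
- by apply: measurable_sum => k; exact: measurable_funM.
Qed.

Lemma measurable_polar_dz k : measurable_fun setT (polar_dz k).
Proof.
apply: measurable_funD; apply: measurable_funM => //.
apply: measurable_funM; first by apply: measurable_funM => //; exact: measurable_fst.
apply: (measurableT_comp (@measurable_coor R n k)).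
exact: measurableT_comp (@measurable_radial R n) measurable_snd.
Qed.

Let Oz0 z : annulus a b z -> z != 0.
Proof. by move=> /andP[az _]; rewrite -enorm_gt0 (le_lt_trans a0 az). Qed.

Lemma cts_polar t z : {for z, continuous (fun y => polar (t, y) : 'rV[R]_n.+1)}.
Proof.
apply: cts_rV => i; have [k ->|->] := unliftP ord0 i.
  have -> : (fun y => (polar (t, y) : 'rV[R]_n.+1) ord0 (lift ord0 k)) =
      (fun y => kap t * y ord0 k).
    by apply/funext => y; rewrite cons_rV_lift/= mxE.
  by apply: ctsM; [exact: ctsC|exact: cts_coor].
have -> : (fun y => (polar (t, y) : 'rV[R]_n.+1) ord0 ord0) =
    (fun y => kap t * t * enorm y).
  by apply/funext => y; rewrite cons_rV0.
by apply: ctsM; [exact: ctsC|exact: cts_enorm].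
Qed.

Lemma test_function_polar t :
  test_function (annulus a b) (fun z => phi (polar (t, z))) /\
  forall k z, annulus a b z ->
    'D_(basis_rV k) (fun z => phi (polar (t, z))) z = polar_dz k (t, z).
Proof.
have [K [cK KO p0 dt0 dz0]] := polar_support.
have D k z : annulus a b z ->
    is_derive z (basis_rV k) (fun z => phi (polar (t, z))) (polar_dz k (t, z)).
  by move=> /Oz0; exact: is_derive_polar_z.
split=> [|k z Oz]; last exact: (@derive_val _ _ _ _ _ _ _ (D k z Oz)).
apply: (@test_functionI _ _ _ _ _ (fun k z => polar_dz k (t, z))
  (@open_annulus R n a b) cK KO) => //.
- by move=> z nK; exact: (p0 (t, z)).
move=> k z Oz; have z0 := Oz0 Oz.
have cV (i : 'I_n.+1) : {for z, continuous (fun y => 'D_(basis_rV i) phi (polar (t, y)))}.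
  apply: (@continuous_comp _ _ _ (fun y => polar (t, y)) ('D_(basis_rV i) phi)).
    exact: cts_polar.
  exact: test_continuous_derive tphi i _.
rewrite /polar_dz/=; apply: ctsD; apply: ctsM => //; try exact: ctsC; try exact: cV.
apply: ctsM; first exact: ctsC.
by have [] := @C1_radial R n [set y | y != 0] k (fun y h => h) z z0.
Qed.

End test_function_in_polar_coordinates.

(** * Integration by parts in polar coordinates *)

Section polar_stokes.
Context {R : realType} (n : nat).
Local Notation leb := (@lebesgue_measure R).
Local Notation mu := (@lebesgue_rV R n).
Local Notation lm := (leb \x mu)%E.
Local Notation P := (measurableTypeR R * 'rV[R]_n)%type.
Variables (a b : R) (phi : 'rV[R]_n.+1 -> R).
Hypotheses (a0 : 0 <= a) (ab : a < b).
Hypothesis tphi : test_function (annulus a b) phi.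
Local Notation Omega := (@annulus R n a b).

Lemma integrable_polar (A : R -> R) (h : 'rV[R]_n -> R) (B : P -> R) (C M : R)
    (K : set 'rV[R]_n) : compact K -> K `<=` Omega ->
  measurable_fun setT A -> (forall t, `|A t| <= C * kap t ^+ 2) ->
  measurable_fun setT h -> loc_integrable Omega h ->
  measurable_fun setT B -> (forall w, `|B w| <= M) -> (forall w, ~ K w.2 -> B w = 0) ->
  lm.-integrable setT (EFin \o (fun w => A w.1 * (h w.2 * B w))).
Proof.
move=> cK KO mA AC mh lh mB BM B0.
have mK := compact_measurable_rV cK.
pose hK z := `|h z| * \1_K z : R.
have mhK : measurable_fun setT hK.
  by apply: measurable_funM; [exact: measurableT_comp|exact: measurable_indic].
have intK : (\int[mu]_z (hK z)%:E < +oo)%E.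
  have /integrableP[_] := lh K cK KO; rewrite integral_mkcond; congr (_ < _)%E.
  apply: eq_integral => z _; rewrite /patch /hK indicE.
  by case: (z \in K); rewrite /= ?mulr1 ?mulr0.
have mf : measurable_fun setT (fun w : P => A w.1 * (h w.2 * B w)).
  apply: measurable_funM; first exact: (measurableT_comp mA measurable_fst).
  by apply: measurable_funM => //; exact: (measurableT_comp mh measurable_snd).
apply/integrableP; split; first exact/measurable_EFinP.
have M0 : 0 <= M by apply: le_trans (BM (0, 0)).
have C0 : 0 <= C by have := AC 0; rewrite -(pmulr_lge0 C (exprn_gt0 2 (kap_gt0 0))); exact: le_trans.
have mk2 : measurable_fun setT (fun w : P => kap w.1 ^+ 2).
  by apply: measurable_funX; exact: measurableT_comp measurable_kap measurable_fst.
apply: (@le_lt_trans _ _ (\int[lm]_w ((kap w.1 ^+ 2)%:E * (C * M * hK w.2)%:E))%E).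
  apply: ge0_le_integral => //.
  - by apply: measurableT_comp => //; exact/measurable_EFinP.
  - apply: emeasurable_funM; apply/measurable_EFinP => //.
    by apply: measurable_funM => //; exact: measurableT_comp mhK measurable_snd.
  move=> w _ /=; rewrite -EFinM lee_fin !normrM /hK indicE.
  have [Kw|nKw] := pselect (K w.2).
    rewrite mem_set// mulr1.
    apply: (@le_trans _ _ ((C * kap w.1 ^+ 2) * (`|h w.2| * M))).
      by apply: ler_pM => //; rewrite ?mulr_ge0// ler_wpM2l.
    by rewrite le_eqVlt; apply/orP; left; apply/eqP; ring.
  by rewrite B0// normr0 memNset//= !mulr0.
rewrite fubini_tonelli1/=; last 2 first.
- apply: emeasurable_funM; apply/measurable_EFinP => //.
  by apply: measurable_funM => //; exact: measurableT_comp mhK measurable_snd.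
- by move=> w; rewrite mule_ge0// lee_fin ?sqr_ge0// !mulr_ge0//; rewrite indicE.
rewrite /fubini_F/=.
have CM0 : 0 <= C * M by rewrite mulr_ge0.
have E t : (\int[mu]_y ((kap t ^+ 2)%:E * (C * M * hK y)%:E) =
    (kap t ^+ 2)%:E * ((C * M)%:E * \int[mu]_y (hK y)%:E))%E.
  rewrite ge0_integralZl_EFin ?sqr_ge0//; last 2 first.
  - by move=> z _; rewrite lee_fin mulr_ge0// mulr_ge0//; rewrite indicE.
  - by apply/measurable_EFinP; exact: measurable_funM.
  under eq_integral do rewrite EFinM; rewrite ge0_integralZl_EFin//.
  - by move=> z _; rewrite lee_fin mulr_ge0//; rewrite indicE.
  - exact/measurable_EFinP.
under eq_integral do rewrite E.
rewrite ge0_integralZr//; last 3 first.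
- by apply/measurable_EFinP; apply: measurable_funX; exact: measurable_kap.
- by move=> t _; rewrite lee_fin sqr_ge0.
- rewrite mule_ge0 ?lee_fin//; apply: integral_ge0 => z _.
  by rewrite lee_fin mulr_ge0//; rewrite indicE.
rewrite kap_intE// lte_mul_pinfty ?lee_fin ?(ltW (kap_int_gt0 _))//.
by rewrite lte_mul_pinfty.
Qed.

Variables (f : 'rV[R]_n -> R) (g : 'I_n -> 'rV[R]_n -> R).
Hypothesis sf : sweak Omega f g.
Local Notation dt := (polar_dt phi).
Local Notation dz := (polar_dz phi).

Let mf : measurable_fun setT f. Proof. by have [[]] := sf. Qed.
Let mg i : measurable_fun setT (g i). Proof. by have [[]] := sf. Qed.
Let lf : loc_integrable Omega f. Proof. by have [] := sf. Qed.
Let lg i : loc_integrable Omega (g i). Proof. by have [] := sf. Qed.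

Let mphi := measurable_phi_polar tphi.
Let mdt := measurable_polar_dt tphi.
Let mdz k := measurable_polar_dz tphi k.

(** Multiplication by a function of class C^1 preserves local integrability. *)
Lemma loc_integrable_C1 (h q : 'rV[R]_n -> R) : measurable_fun setT h ->
  loc_integrable Omega h -> (forall z, Omega z -> {for z, continuous q}) ->
  measurable_fun setT (q \_ Omega) /\ loc_integrable Omega (fun z => h z * (q \_ Omega) z).
Proof.
move=> mh lh cq; have oO := @open_annulus R n a b.
have mO := open_measurable_rV oO.
have mq : measurable_fun setT (q \_ Omega).
  apply/(measurable_restrictT _ mO); apply: open_continuous_measurable_rV => // z /set_mem.
  exact: cq.
split=> // K cK KO; have mK := compact_measurable_rV cK.
have [->|/set0P K0] := eqVneq K set0; first exact: integrable_set0.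
have cqK : {within K, continuous (fun x => `|q x|)}.
  apply: continuous_in_subspaceT => x /set_mem Kx.
  apply: (@continuous_comp _ _ _ q (@Num.norm R R)); first exact: cq (KO _ Kx).
  exact: norm_continuous.
have /= [x0 _ xK] := EVT_max_rV K0 cK cqK.
have := integrable_realZ mK `|q x0| (lh K cK KO).
apply: le_integrable => //.
  by apply/measurable_EFinP; apply: measurable_funTS; exact: measurable_funM.
move=> x Kx /=; rewrite lee_fin !normrM normr_id mulrC ler_wpM2r//.
by rewrite /patch mem_set; [exact: xK (mem_set Kx)|exact: KO].
Qed.

Lemma sqr_kap_shift (s t : R) : 0 <= s <= 1 -> kap (s + t) ^+ 2 <= 3 * kap t ^+ 2.
Proof.
move=> /andP[s0 s1]; rewrite !sqr_kap.
have d1 : 0 < 1 + t ^+ 2 by rewrite ltr_pwDl// sqr_ge0.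
have d2 : 0 < 1 + (s + t) ^+ 2 by rewrite ltr_pwDl// sqr_ge0.
rewrite ler_pdivlMr// mulrC ler_pdivrMr//.
have s2 : s ^+ 2 <= 1 by rewrite expr_le1.
have := sqr_ge0 (s + t); have := sqr_ge0 (s + t + s); nra.
Qed.

(** Integration by parts in t. *)
Lemma polar_stokes_t (A A' : R -> R) (C : R) (q : 'rV[R]_n -> R) :
  (forall t : R, is_derive t 1 A (A' t)) -> measurable_fun setT A' ->
  (forall t, `|A t| <= C * kap t ^+ 2) -> (forall t, `|A' t| <= C * kap t ^+ 2) ->
  (forall z, Omega z -> {for z, continuous q}) ->
  let F := fun w : P => f w.2 * q w.2 * (A' w.1 * phi (polar w) + A w.1 * dt w) in
  lm.-integrable setT (EFin \o F) /\ \int[lm]_w F w = 0.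
Proof.
move=> dA mA' AC A'C cq F.
have [K [cK KO p0 dt0 dz0]] := polar_support ab tphi.
have [M [M0 pM dtM dzM]] := polar_bounded a0 ab tphi.
have mA : measurable_fun setT A.
  apply: continuous_measurable_fun => t; apply/differentiable_continuous/derivable1_diffP.
  exact: (@ex_derive _ _ _ _ _ _ _ (dA t)).
have dtM' w : `|dt w| <= M.
  by apply: le_trans (dtM w) _; rewrite ler_piMr// kap_le1.
have C0 : 0 <= C.
  by have := le_trans (normr_ge0 _) (AC 0); rewrite pmulr_lge0// exprn_gt0// kap_gt0.
have [mq lfq] := loc_integrable_C1 mf lf cq.
pose F' w := A' w.1 * ((f w.2 * (q \_ Omega) w.2) * phi (polar w)) +
  A w.1 * ((f w.2 * (q \_ Omega) w.2) * dt w).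
have FE : F = F'.
  apply/funext => w; rewrite /F /F'; have [Kw|nKw] := pselect (K w.2).
    by rewrite /patch mem_set; [ring|exact: KO].
  by rewrite p0// dt0//; ring.
have i1 := integrable_polar cK KO mA' A'C (measurable_funM mf mq) lfq mphi pM p0.
have i2 := integrable_polar cK KO mA AC (measurable_funM mf mq) lfq mdt dtM' dt0.
have iF : lm.-integrable setT (EFin \o F) by rewrite FE; exact: integrable_realD.
split=> //; rewrite /Rintegral -integral21_prod_meas1//.
rewrite (_ : (\int[mu]_x _)%E = 0%E)//.
rewrite -[RHS](integral0 mu setT); apply: eq_integral => z _; rewrite /fubini_G/=.
pose h (t : R) := A' t * phi (polar (t, z)) + A t * dt (t, z).
have mpz : measurable_fun setT (fun t => phi (polar (t, z))).
  exact: (measurableT_comp mphi (measurable_pair2 z)).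
have mdz' : measurable_fun setT (fun t => dt (t, z)).
  exact: (measurableT_comp mdt (measurable_pair2 z)).
have mh : measurable_fun setT h by apply: measurable_funD; exact: measurable_funM.
have hC t : `|h t| <= 2 * C * M * kap t ^+ 2.
  apply: le_trans (ler_normD _ _) _; rewrite !normrM.
  have -> : 2 * C * M * kap t ^+ 2 = C * kap t ^+ 2 * M + C * kap t ^+ 2 * M by ring.
  by apply: lerD; apply: ler_pM.
have ih : leb.-integrable setT (EFin \o h).
  apply: le_integrable (integrable_realZ measurableT (2 * C * M) (@integrable_sqr_kap R)) => //.
    exact/measurable_EFinP.
  by move=> t _ /=; rewrite lee_fin (le_trans (hC t))// ler_norm.
have h0 : \int[leb]_t h t = 0.
  apply: (@integral_R_derive0 _ (fun t => A t * phi (polar (t, z))) h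
    (fun t => 6 * C * M * kap t ^+ 2)) => //.
  - move=> t; have := is_deriveM (dA t) (is_derive_polar_t tphi t z).
    rewrite -[_ *: dt _]/(_ * dt _) -[_ *: A' t]/(_ * A' t).
    by rewrite addrC [phi _ * _]mulrC.
  - apply: le_integrable (integrable_realZ measurableT (C * M) (@integrable_sqr_kap R)) => //.
      by apply/measurable_EFinP; exact: measurable_funM.
    move=> t _ /=; rewrite lee_fin normrM (le_trans _ (ler_norm _))//.
    have -> : C * M * kap t ^+ 2 = C * kap t ^+ 2 * M by ring.
    exact: ler_pM.
  - exact: (integrable_realZ measurableT (6 * C * M) (@integrable_sqr_kap R)).
  - move=> s t s01; apply: (le_trans (hC _)).
    have -> : 6 * C * M * kap t ^+ 2 = 2 * C * M * (3 * kap t ^+ 2) by ring.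
    by rewrite ler_wpM2l ?mulr_ge0//; exact: sqr_kap_shift.
transitivity (\int[leb]_t ((f z * q z)%:E * (h t)%:E))%E; first by [].
rewrite integralZl// -[X in (_ * X)%E]fineK; last exact: integrable_fin_num ih.
by rewrite [fine _]h0 mule0.
Qed.

(** Integration by parts in z. *)
Lemma polar_stokes_z (A : R -> R) (C : R) (Q : 'rV[R]_n -> R) (DQ : 'I_n -> 'rV[R]_n -> R) k :
  measurable_fun setT A -> (forall t, `|A t| <= C * kap t ^+ 2) ->
  C1_on Omega Q DQ ->
  let F := fun w : P => A w.1 * (f w.2 * (DQ k w.2 * phi (polar w) + Q w.2 * dz k w) +
    g k w.2 * (Q w.2 * phi (polar w))) in
  lm.-integrable setT (EFin \o F) /\ \int[lm]_w F w = 0.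
Proof.
move=> mA AC c1 F.
have [K [cK KO p0 dt0 dz0]] := polar_support ab tphi.
have [M [M0 pM dtM dzM]] := polar_bounded a0 ab tphi.
have cQ z : Omega z -> {for z, continuous Q} by move=> /c1[].
have cDQ z : Omega z -> {for z, continuous (DQ k)} by move=> /c1[].
have [mDQ lfDQ] := loc_integrable_C1 mf lf cDQ.
have [mQ lfQ] := loc_integrable_C1 mf lf cQ.
have [_ lgQ] := loc_integrable_C1 (mg k) (lg k) cQ.
pose F' w := A w.1 * ((f w.2 * (DQ k \_ Omega) w.2) * phi (polar w)) +
  (A w.1 * ((f w.2 * (Q \_ Omega) w.2) * dz k w) +
   A w.1 * ((g k w.2 * (Q \_ Omega) w.2) * phi (polar w))).
have FE : F = F'.
  apply/funext => w; rewrite /F /F'; have [Kw|nKw] := pselect (K w.2).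
    by rewrite /patch mem_set; [ring|exact: KO].
  by rewrite p0// dz0//; ring.
have i1 := integrable_polar cK KO mA AC (measurable_funM mf mDQ) lfDQ mphi pM p0.
have i2 := integrable_polar cK KO mA AC (measurable_funM mf mQ) lfQ (mdz k) (dzM k) (dz0 k).
have i3 := integrable_polar cK KO mA AC (measurable_funM (mg k) mQ) lgQ mphi pM p0.
have iF : lm.-integrable setT (EFin \o F).
  by rewrite FE; apply: integrable_realD => //; exact: integrable_realD.
split=> //; rewrite /Rintegral -integral12_prod_meas1//.
rewrite (_ : (\int[leb]_x _)%E = 0%E)//.
rewrite -[RHS](integral0 leb setT); apply: eq_integral => t _; rewrite /fubini_F/=.
have [tp dzE] := test_function_polar a0 ab tphi t.
have [tq dqE] := test_functionM (@open_annulus R n a b) c1 tp.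
have [_ _ _ Hs] := sf; have := Hs k _ tq.
have I1 := loc_integrable_test_derive k lf tq.
have I2 := loc_integrable_test (lg k) tq.
have I12 := integrable_realD measurableT I1 I2.
rewrite /Rintegral => H0.
transitivity (\int[mu]_z ((A t)%:E * (f z * 'D_(basis_rV k) (fun x => Q x * phi (polar (t, x))) z +
    g k z * (Q z * phi (polar (t, z))))%:E))%E.
  apply: eq_integral => z _; rewrite -EFinM; congr (_%:E); rewrite /F/=; congr (_ * (_ + _)).
  have [Kz|nKz] := pselect (K z).
    rewrite dqE; last exact: KO.
    by rewrite dzE; [congr (_ * _); ring|exact: KO].
  have Dq0 : 'D_(basis_rV k) (fun x => Q x * phi (polar (t, x))) z = 0.
    apply: (test_function_derive0 (K := K) cK (f := fun x => Q x * phi (polar (t, x)))) => //.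
    by move=> x nx; rewrite (p0 (t, x))// mulr0.
  by rewrite Dq0 (p0 (t, z))// (dz0 k (t, z))// !mulr0 addr0 mulr0.
rewrite (integralZl measurableT I12).
rewrite -[X in (_ * X)%E]fineK; last exact: integrable_fin_num I12.
by rewrite H0 mule0.
Qed.

End polar_stokes.

(** * Extension of functions along colatitudes *)

Section loc_integrable_closure.
Context {R : realType}.
Local Notation mu := (@lebesgue_rV R).

Lemma loc_integrable_bounded_mul m (Omega : set 'rV[R]_m) (h c : 'rV[R]_m -> R) :
  measurable_fun setT c ->
  (forall K, compact K -> K `<=` Omega -> exists M : R, forall x, K x -> `|c x| <= M) ->
  loc_integrable Omega h -> loc_integrable Omega (fun x => c x * h x).
Proof.
move=> mc Hc lh K cK KO; have mK := compact_measurable_rV cK.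
have [M cM] := Hc K cK KO.
apply: le_integrable (integrable_realZ mK M (lh K cK KO)) => //.
  apply/measurable_EFinP; apply: measurable_funM; first exact: measurable_funTS.
  by have /integrableP[/measurable_EFinP] := lh K cK KO.
move=> x Kx /=; rewrite lee_fin !normrM ler_wpM2r//.
by rewrite (le_trans (cM x Kx))// ler_norm.
Qed.

Lemma loc_integrable_bounded1_mul m (Omega : set 'rV[R]_m) (h c : 'rV[R]_m -> R) :
  measurable_fun setT c -> (forall x, `|c x| <= 1) ->
  loc_integrable Omega h -> loc_integrable Omega (fun x => c x * h x).
Proof. by move=> mc c1; apply: loc_integrable_bounded_mul => // K _ _; exists 1. Qed.

Lemma loc_integrableD m (Omega : set 'rV[R]_m) (h k : 'rV[R]_m -> R) :
  loc_integrable Omega h -> loc_integrable Omega k ->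
  loc_integrable Omega (fun x => h x + k x).
Proof.
by move=> lh lk K cK KO; apply: integrable_realD; [exact: compact_measurable_rV|exact: lh|exact: lk].
Qed.

Lemma loc_integrable0 m (Omega : set 'rV[R]_m) : loc_integrable Omega (fun=> 0).
Proof. by move=> K cK KO; exact: integrable0. Qed.

Lemma loc_integrable_sum m (Omega : set 'rV[R]_m) (I : Type) (r : seq I) (h : I -> 'rV[R]_m -> R) :
  (forall i, loc_integrable Omega (h i)) ->
  loc_integrable Omega (fun x => \sum_(i <- r) h i x).
Proof.
move=> lh; elim: r => [|i r IH]; first by under eq_fun do rewrite big_nil; exact: loc_integrable0.
by under eq_fun do rewrite big_cons; exact: loc_integrableD.
Qed.

End loc_integrable_closure.

Section extension.
Context {R : realType} (n : nat).
Local Notation mu := (@lebesgue_rV R).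
Implicit Types (f : 'rV[R]_n -> R) (g : 'I_n -> 'rV[R]_n -> R) (x : 'rV[R]_n.+1).

(** The cosine and the sine of the colatitude of x. *)
Definition colat_cos x : R := x ord0 ord0 / enorm x.
Definition colat_sin x : R := enorm (behead_rV x) / enorm x.

Definition ext f x : R := colat_sin x * f (unpolar x).

Definition ext_slope f g x : R :=
  \sum_m radial (behead_rV x) ord0 m * g m (unpolar x) - f (unpolar x) / enorm (unpolar x).

Definition ext_grad f g (i : 'I_n.+1) x : R :=
  if unlift ord0 i is Some j
  then g j (unpolar x) - colat_cos x ^+ 2 * radial (behead_rV x) ord0 j * ext_slope f g x
  else colat_cos x * colat_sin x * ext_slope f g x.

Lemma ext_grad0 f g x : ext_grad f g ord0 x = colat_cos x * colat_sin x * ext_slope f g x.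
Proof. by rewrite /ext_grad unlift_none. Qed.

Lemma ext_gradS f g j x : ext_grad f g (lift ord0 j) x =
  g j (unpolar x) - colat_cos x ^+ 2 * radial (behead_rV x) ord0 j * ext_slope f g x.
Proof. by rewrite /ext_grad liftK. Qed.

Lemma sqr_enormS x : enorm x ^+ 2 = x ord0 ord0 ^+ 2 + enorm (behead_rV x) ^+ 2.
Proof. by rewrite -[in LHS](cons_behead_rV x) enorm_cons. Qed.

Lemma enorm_behead_le x : enorm (behead_rV x) <= enorm x.
Proof.
by rewrite -(ler_pXn2r (n := 2))// ?nnegrE ?enorm_ge0// [leRHS]sqr_enormS lerDr sqr_ge0.
Qed.

Lemma norm_ratio_le1 (u r : R) : 0 <= r -> `|u| <= r -> `|u / r| <= 1.
Proof.
move=> r0 ur; rewrite normrM normfV (ger0_norm r0).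
have [->|rn0] := eqVneq r 0; first by rewrite invr0 mulr0.
by rewrite ler_pdivrMr ?mul1r// lt0r rn0.
Qed.

Lemma colat_cos_le1 x : `|colat_cos x| <= 1.
Proof. by rewrite norm_ratio_le1 ?enorm_ge0// coor_le_enorm. Qed.

Lemma colat_sin_le1 x : `|colat_sin x| <= 1.
Proof.
by rewrite norm_ratio_le1 ?enorm_ge0// ger0_norm ?enorm_ge0// enorm_behead_le.
Qed.

Lemma radial_coor_le1 m (y : 'rV[R]_m) j : `|radial y ord0 j| <= 1.
Proof.
by rewrite mxE mulrC norm_ratio_le1 ?enorm_ge0// coor_le_enorm.
Qed.

Lemma colat_cos_polar t z : z != 0 -> colat_cos (polar (t, z)) = kap t * t.
Proof.
by move=> z0; rewrite /colat_cos polar0 enorm_polar mulfK// gt_eqF// enorm_gt0.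
Qed.

Lemma colat_sin_polar t z : z != 0 -> colat_sin (polar (t, z)) = kap t.
Proof.
move=> z0; rewrite /colat_sin behead_polar enormZ enorm_polar.
by rewrite ger0_norm ?(ltW (kap_gt0 t))// mulfK// gt_eqF// enorm_gt0.
Qed.

Lemma radial_behead_polar t (z : 'rV[R]_n) : radial (behead_rV (polar (t, z))) = radial z.
Proof. by rewrite behead_polar radialZ// kap_gt0. Qed.

Lemma enorm_unpolar x : behead_rV x != 0 -> enorm (unpolar x) = enorm x.
Proof. by move=> y0; rewrite /unpolar enormZ enorm_radial// mulr1 ger0_norm ?enorm_ge0. Qed.

Lemma unpolar_eq0 x : behead_rV x = 0 -> unpolar x = 0.
Proof. by move=> y0; rewrite /unpolar y0 /radial scaler0 scaler0. Qed.

Lemma unpolar_neq0 x : unpolar x != 0 -> behead_rV x != 0.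
Proof. by apply: contra => /eqP/unpolar_eq0/eqP. Qed.

Lemma measurable_invr d (T : measurableType d) (h : T -> R) :
  measurable_fun setT h -> (forall w, 0 <= h w) -> measurable_fun setT (fun w => (h w)^-1).
Proof.
move=> mh h0; rewrite (_ : (fun w => _) = fun w => h w `^ (-1)); last first.
  by apply/funext => w; rewrite powR_inv1.
exact: measurable_powR_comp.
Qed.

Lemma measurable_colat_cos : measurable_fun setT colat_cos.
Proof.
apply: measurable_funM; first exact: measurable_coor.
by apply: measurable_invr; [exact: measurable_enorm|exact: enorm_ge0].
Qed.

Lemma measurable_enorm_behead :
  measurable_fun setT (fun x : 'rV[R]_n.+1 => enorm (behead_rV x)).
Proof. exact: measurableT_comp (@measurable_enorm R n) (@measurable_behead_rV R n). Qed.

Lemma measurable_colat_sin : measurable_fun setT colat_sin.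
Proof.
apply: measurable_funM; first exact: measurable_enorm_behead.
by apply: measurable_invr; [exact: measurable_enorm|exact: enorm_ge0].
Qed.

Lemma measurable_radial_behead j :
  measurable_fun setT (fun x : 'rV[R]_n.+1 => radial (behead_rV x) ord0 j).
Proof.
apply: (measurableT_comp (@measurable_coor R n j)).
exact: measurableT_comp (@measurable_radial R n) (@measurable_behead_rV R n).
Qed.

Lemma measurable_comp_unpolar (h : 'rV[R]_n -> R) : measurable_fun setT h ->
  measurable_fun setT (fun x => h (unpolar x)).
Proof. by move=> mh; exact: measurableT_comp mh (@measurable_unpolar R n). Qed.

Lemma measurable_ext f : measurable_fun setT f -> measurable_fun setT (ext f).
Proof.
move=> mf; apply: measurable_funM; first exact: measurable_colat_sin.
exact: measurable_comp_unpolar.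
Qed.

Lemma measurable_ext_slope f g : measurable_fun setT f ->
  (forall i, measurable_fun setT (g i)) -> measurable_fun setT (ext_slope f g).
Proof.
move=> mf mg; apply: measurable_funB.
  apply: measurable_sum => k; apply: measurable_funM; first exact: measurable_radial_behead.
  exact: measurable_comp_unpolar.
apply: measurable_funM; first exact: measurable_comp_unpolar.
apply: measurable_invr; last by move=> x; exact: enorm_ge0.
by apply: measurable_comp_unpolar; exact: measurable_enorm.
Qed.

Lemma measurable_ext_grad f g i : measurable_fun setT f ->
  (forall i, measurable_fun setT (g i)) -> measurable_fun setT (ext_grad f g i).
Proof.
move=> mf mg; have ms := measurable_ext_slope mf mg.
rewrite /ext_grad; case: unliftP => [j|] _.
  apply: measurable_funB; first exact: measurable_comp_unpolar.
  apply: measurable_funM => //; apply: measurable_funM; last exact: measurable_radial_behead.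
  by apply: measurable_funX; exact: measurable_colat_cos.
apply: measurable_funM => //; apply: measurable_funM; first exact: measurable_colat_cos.
exact: measurable_colat_sin.
Qed.

Hypothesis n1 : (1 < n)%N.
Variables (a b : R).
Hypotheses (a0 : 0 <= a) (ab : a < b).
Local Notation Om := (@annulus R n a b).
Local Notation Om' := (@annulus R n.+1 a b).

Lemma ae_unpolar_neq0 : {ae mu n.+1, forall x, unpolar x != 0 :> 'rV[R]_n}.
Proof.
apply: (ae_unpolar (P := fun z => z != 0)) => //.
by apply: ae_neq0; exact: ltn_trans n1.
Qed.

Lemma loc_integrable_unpolar (h : 'rV[R]_n -> R) : measurable_fun setT h ->
  loc_integrable Om h -> loc_integrable Om' (fun x => h (unpolar x)).
Proof.
move=> mh lh K cK KO; have mK := compact_measurable_rV cK.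
have [a' [b' [aa' ab' bb' Kab]]] := compact_annulus ab cK KO.
have cA := @compact_closed_annulus R n a' b'.
have mA := compact_measurable_rV cA.
have AO : @closed_annulus R n a' b' `<=` Om by exact: closed_annulus_sub.
have b0 : 0 <= b' by apply: le_trans ab'; rewrite (le_trans a0) ?(ltW aa').
have mhu := measurable_comp_unpolar mh.
apply/integrableP; split; first by apply/measurable_EFinP; exact: measurable_funTS.
pose hA z := `|h z| * \1_(@closed_annulus R n a' b') z : R.
have mhA : measurable_fun setT (EFin \o hA).
  apply/measurable_EFinP; apply: measurable_funM; last exact: measurable_indic.
  exact: measurableT_comp.
have hA0 z : (0%:E <= (EFin \o hA) z)%E by rewrite lee_fin mulr_ge0// indicE.
rewrite integral_mkcond.
apply: (@le_lt_trans _ _ (\int[mu n.+1]_x (EFin \o hA) (unpolar x))%E).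
  apply: ae_ge0_le_integral => //.
  - by move=> x _; rewrite /patch; case: ifPn.
  - apply/(measurable_restrictT _ mK); apply: measurable_funTS.
    by apply: measurableT_comp => //; exact/measurable_EFinP.
  - exact: measurableT_comp mhA (@measurable_unpolar R n).
  have := ae_unpolar_neq0; apply: filterS => x ux _; rewrite /patch.
  case: ifPn => [/set_mem Kx|_]; last exact: hA0.
  rewrite /= lee_fin /hA indicE mem_set ?mulr1//.
  have := Kab _ Kx; rewrite /closed_annulus/= enorm_unpolar//; exact: unpolar_neq0.
rewrite ge0_integral_unpolar// lte_mul_pinfty ?lee_fin ?(ltW (kap_int_gt0 _))//; last 2 first.
- by rewrite ltnS ltnW.
apply: (@le_lt_trans _ _ (\int[mu n]_z (b'%:E * (EFin \o hA) z))%E).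
  apply: ge0_le_integral => //.
  - by move=> z _; rewrite mule_ge0// lee_fin enorm_ge0.
  - apply: emeasurable_funM => //; apply/measurable_EFinP; exact: measurable_enorm.
  - by apply: emeasurable_funM.
  move=> z _; rewrite /= -!EFinM lee_fin /hA indicE.
  have [Az|nAz] := pselect (closed_annulus a' b' z).
    by rewrite mem_set// mulr1 ler_wpM2r//; case/andP : Az.
  by rewrite memNset// !mulr0.
rewrite ge0_integralZl_EFin// lte_mul_pinfty ?lee_fin//.
have /integrableP[_] := lh _ cA AO; rewrite [X in (X < _)%E -> _]integral_mkcond; congr (_ < _)%E.
apply: eq_integral => z _; rewrite /patch /hA/= indicE.
by case: (z \in _); rewrite ?mulr1 ?mulr0.
Qed.

Lemma loc_integrable_ext f : measurable_fun setT f -> loc_integrable Om f ->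
  loc_integrable Om' (ext f).
Proof.
move=> mf lf; apply: loc_integrable_bounded1_mul; [exact: measurable_colat_sin|exact: colat_sin_le1|].
exact: loc_integrable_unpolar.
Qed.

Lemma loc_integrable_ext_slope f g : measurable_fun setT f -> loc_integrable Om f ->
  (forall i, measurable_fun setT (g i)) -> (forall i, loc_integrable Om (g i)) ->
  loc_integrable Om' (ext_slope f g).
Proof.
move=> mf lf mg lg.
have -> : ext_slope f g = (fun x =>
    \sum_m radial (behead_rV x) ord0 m * g m (unpolar x) +
    (- (enorm (unpolar x))^-1) * f (unpolar x)).
  by apply/funext => x; rewrite /ext_slope mulNr [(enorm _)^-1 * _]mulrC.
apply: loc_integrableD.
  apply: loc_integrable_sum => k; apply: loc_integrable_bounded1_mul.
  - exact: measurable_radial_behead.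
  - by move=> x; exact: radial_coor_le1.
  - exact: loc_integrable_unpolar.
apply: loc_integrable_bounded_mul; last exact: loc_integrable_unpolar.
  apply: measurable_funN; apply: measurable_invr; last by move=> x; exact: enorm_ge0.
  by apply: measurable_comp_unpolar; exact: measurable_enorm.
move=> K cK KO; have [a' [b' [aa' ab' bb' Kab]]] := compact_annulus ab cK KO.
have a'0 : 0 < a' by exact: le_lt_trans aa'.
exists a'^-1 => x /Kab /andP[ax _]; rewrite normrN normfV ger0_norm ?enorm_ge0//.
have [y0|y0] := eqVneq (behead_rV x) 0.
  by rewrite unpolar_eq0// enorm0 invr0 invr_ge0 ltW.
by rewrite enorm_unpolar// lef_pV2// posrE// (lt_le_trans a'0).
Qed.

Lemma loc_integrable_ext_grad f g i : measurable_fun setT f -> loc_integrable Om f ->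
  (forall i, measurable_fun setT (g i)) -> (forall i, loc_integrable Om (g i)) ->
  loc_integrable Om' (ext_grad f g i).
Proof.
move=> mf lf mg lg; have ls := loc_integrable_ext_slope mf lf mg lg.
have mc := measurable_colat_cos; have c1 := colat_cos_le1.
rewrite /ext_grad; case: unliftP => [j|] _.
  have -> : (fun x => g j (unpolar x) - colat_cos x ^+ 2 * radial (behead_rV x) ord0 j * ext_slope f g x)
      = (fun x => g j (unpolar x) + (- (colat_cos x ^+ 2 * radial (behead_rV x) ord0 j)) * ext_slope f g x).
    by apply/funext => x; rewrite mulNr.
  apply: loc_integrableD; first exact: loc_integrable_unpolar.
  apply: loc_integrable_bounded1_mul => //.
    apply: measurable_funN; apply: measurable_funM; last exact: measurable_radial_behead.
    exact: measurable_funX.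
  move=> x; rewrite normrN normrM mulr_ile1// ?radial_coor_le1//.
  by rewrite normrX exprn_ile1.
apply: loc_integrable_bounded1_mul => //.
  by apply: measurable_funM => //; exact: measurable_colat_sin.
by move=> x; rewrite normrM mulr_ile1// colat_sin_le1.
Qed.

End extension.

(** * The weak gradient of an extension *)

Section kap_powers.
Context {R : realType}.
Implicit Types t : R.

Lemma is_derive_kapX m t : is_derive t 1 (fun s : R => kap s ^+ m.+1)
  (- m.+1%:R * t * kap t ^+ m.+3).
Proof.
have := is_deriveX m.+1 (is_derive_kap t).
rewrite -[_ *: (_ * _)]/(_ * (_ * _)) /=.
have -> : m.+1%:R * kap t ^+ m * (- t * kap t ^+ 3) = - m.+1%:R * t * kap t ^+ m.+3.
  by rewrite !exprS; ring.
by rewrite exprfctE.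
Qed.

Lemma is_derive_tkapX m t : is_derive t 1 (fun s : R => s * kap s ^+ m.+1)
  (kap t ^+ m.+1 - m.+1%:R * t ^+ 2 * kap t ^+ m.+3).
Proof.
have := is_deriveM (is_derive_id t 1) (is_derive_kapX m t).
rewrite -[_ *: (_ * _)]/(_ * (_ * _)) -[_ *: 1]/(_ * 1).
have -> : t * (- m.+1%:R * t * kap t ^+ m.+3) + kap t ^+ m.+1 * 1 =
  kap t ^+ m.+1 - m.+1%:R * t ^+ 2 * kap t ^+ m.+3 by ring.
by [].
Qed.

Lemma norm_kapX i j t : (i.+2 <= j)%N -> `|t ^+ i * kap t ^+ j| <= kap t ^+ 2.
Proof.
move=> ij; rewrite -(subnK ij).
have -> : t ^+ i * kap t ^+ (j - i.+2 + i.+2) =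
    (kap t * t) ^+ i * kap t ^+ (j - i.+2) * kap t ^+ 2.
  by rewrite exprD -addn2 exprD exprMn; ring.
have k0 := ltW (kap_gt0 t).
rewrite normrM [X in _ * X]ger0_norm ?exprn_ge0// ler_piMl ?exprn_ge0//.
rewrite normrM mulr_ile1// normrX exprn_ile1 ?norm_kapM//.
by rewrite ger0_norm// kap_le1.
Qed.

Lemma measurable_kapX i j : measurable_fun setT (fun t : R => t ^+ i * kap t ^+ j).
Proof.
by apply: measurable_funM; apply: measurable_funX => //; exact: measurable_kap.
Qed.

End kap_powers.

Lemma C1_onM {R : realType} m (Omega : set 'rV[R]_m) f g f' g' :
  C1_on Omega f g -> C1_on Omega f' g' ->
  C1_on Omega (fun x => f x * f' x) (fun i x => f x * g' i x + g i x * f' x).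
Proof.
move=> c1 c1' x Ox; have [cf cg df] := c1 x Ox; have [cf' cg' df'] := c1' x Ox.
split; first exact: ctsM.
  by move=> i; apply: ctsD; exact: ctsM.
move=> i; have := @is_deriveM _ _ f f' x (basis_rV i) _ _ (df i) (df' i).
by rewrite -[_ *: g' i x]/(_ * _) -[_ *: g i x]/(_ * _) [f' x * _]mulrC.
Qed.

Lemma C1_on_coor {R : realType} m (Omega : set 'rV[R]_m) k :
  C1_on Omega (fun x => x ord0 k) (fun i _ => (k == i)%:R).
Proof.
move=> x _; split; first exact: cts_coor.
  by move=> i; exact: ctsC.
by move=> i; exact: is_derive_coor.
Qed.

Lemma C1_on_enorm {R : realType} m (Omega : set 'rV[R]_m) : (forall x, Omega x -> x != 0) ->
  C1_on Omega (@enorm R m) (fun i x => radial x ord0 i).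
Proof.
move=> O0 x Ox; split; first exact: cts_enorm.
  by move=> i; have [] := C1_radial i O0 Ox.
by move=> i; rewrite mxE mulrC; apply: is_derive_enorm; exact: O0.
Qed.

Section null_integral.
Context d (T : measurableType d) {R : realType} (mu : {measure set T -> \bar R}).

Definition null_integral (f : T -> R) :=
  mu.-integrable setT (EFin \o f) /\ \int[mu]_x f x = 0.

Lemma null_integralD f g : null_integral f -> null_integral g ->
  null_integral (fun x => f x + g x).
Proof.
move=> [If f0] [Ig g0]; split; first exact: integrable_realD.
by rewrite RintegralD// f0 g0 addr0.
Qed.

Lemma null_integral_sum (I : Type) (r : seq I) (f : I -> T -> R) :
  (forall i, null_integral (f i)) -> null_integral (fun x => \sum_(i <- r) f i x).
Proof.
move=> H; elim: r => [|i r IH].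
  under eq_fun do rewrite big_nil.
  by split; [exact: integrable0|rewrite Rintegral_cst// mul0r].
by under eq_fun do rewrite big_cons; exact: null_integralD.
Qed.

End null_integral.

Section sweak_extension.
Context {R : realType} (n : nat).
Local Notation leb := (@lebesgue_measure R).
Local Notation mu := (@lebesgue_rV R).
Local Notation lm := (leb \x mu n)%E.
Local Notation P := (measurableTypeR R * 'rV[R]_n)%type.
Hypothesis n1 : (1 < n)%N.
Variables (a b : R).
Hypotheses (a0 : 0 <= a) (ab : a < b).
Local Notation Om := (@annulus R n a b).
Local Notation Om' := (@annulus R n.+1 a b).

Lemma weak_ext_polar (F : 'rV[R]_n.+1 -> R) (H : P -> R) :
  measurable_fun setT F -> null_integral lm H ->
  (forall t z, z != 0 -> jac (t, z) * F (polar (t, z)) = H (t, z)) ->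
  (forall t, H (t, 0) = 0) -> \int[mu n.+1]_x F x = 0.
Proof.
move=> mF [_ H0] FH Hz; rewrite -H0 /Rintegral integral_polar; last 2 first.
- exact: ltn_trans n1.
- exact/measurable_EFinP.
congr fine; apply: eq_integral => -[t z] _; rewrite -EFinM; congr EFin.
have [->|z0] := eqVneq z 0; last exact: FH.
by rewrite Hz /jac/= enorm0 mulr0 mul0r.
Qed.

Variables (f : 'rV[R]_n -> R) (g : 'I_n -> 'rV[R]_n -> R).
Hypothesis sf : sweak Om f g.
Variable phi : 'rV[R]_n.+1 -> R.
Hypothesis tphi : test_function Om' phi.

Let O0 z : Om z -> z != 0.
Proof. by move=> /andP[az _]; rewrite -enorm_gt0 (le_lt_trans a0 az). Qed.

Lemma polar_test0 : [/\ forall t, phi (polar (t, 0)) = 0,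
  forall t, polar_dt phi (t, 0) = 0 & forall k t, polar_dz phi k (t, 0) = 0].
Proof.
have [K [cK KO p0 dt0 dz0]] := polar_support ab tphi.
have nK : ~ K 0 by move=> /KO/O0/eqP.
by split=> [t|t|k t]; [exact: p0|exact: dt0|exact: dz0].
Qed.

Let mext : measurable_fun setT (ext f). Proof. by apply: measurable_ext; have [[]] := sf. Qed.
Let mgrad i : measurable_fun setT (ext_grad f g i).
Proof. by apply: measurable_ext_grad; have [[]] := sf. Qed.

Let mF i : measurable_fun setT (fun x => ext f x * 'D_(basis_rV i) phi x + ext_grad f g i x * phi x).
Proof.
apply: measurable_funD; apply: measurable_funM => //.
  exact: (test_measurable_derive tphi).
exact: (test_measurable tphi).
Qed.

Lemma sum_coor_radial (z : 'rV[R]_n) : \sum_k z ord0 k * radial z ord0 k = enorm z.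
Proof.
have [->|z0] := eqVneq z 0.
  by rewrite enorm0 big1// => k _; rewrite mxE mul0r.
have r0 : enorm z != 0 by rewrite gt_eqF// enorm_gt0.
transitivity ((enorm z)^-1 * dotr z z).
  by rewrite /dotr mulr_sumr; apply: eq_bigr => k _; rewrite mxE; ring.
by rewrite -sqr_enorm expr2 mulKf.
Qed.

Lemma sum_coor_dz t (z : 'rV[R]_n) : \sum_k z ord0 k * polar_dz phi k (t, z) =
  kap t * t * enorm z * 'D_(basis_rV ord0) phi (polar (t, z)) +
  kap t * \sum_k z ord0 k * 'D_(basis_rV (lift ord0 k)) phi (polar (t, z)).
Proof.
rewrite -(sum_coor_radial z) mulr_sumr mulr_suml mulr_sumr -big_split/=.
by apply: eq_bigr => k _; rewrite /polar_dz/=; ring.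
Qed.

Lemma weak_ext_axis :
  \int[mu n.+1]_x (ext f x * 'D_(basis_rV ord0) phi x + ext_grad f g ord0 x * phi x) = 0.
Proof.
have n2 : (2 <= n)%N by [].
pose A' t : R := - n.+1%:R * t * kap t ^+ n.+3.
pose B t : R := t * kap t ^+ n.+3.
have E1 : A' = (fun t => - n.+1%:R * (t ^+ 1 * kap t ^+ n.+3)) by apply/funext => t; rewrite /A'; ring.
have E2 : B = (fun t => t ^+ 1 * kap t ^+ n.+3) by apply/funext => t; rewrite /B; ring.
have N1 : null_integral lm (fun w => f w.2 * 1 * (A' w.1 * phi (polar w) +
    kap w.1 ^+ n.+1 * polar_dt phi w)).
  apply: (@polar_stokes_t _ _ _ _ _ a0 ab tphi _ _ sf (fun t => kap t ^+ n.+1) A' n.+1%:R (fun=> 1)).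
  - exact: is_derive_kapX.
  - by rewrite E1; apply: measurable_funM => //; exact: measurable_kapX.
  - move=> t; have := @norm_kapX R 0 n.+1 t ltac:(by rewrite ltnW); rewrite mul1r => h.
    by rewrite (le_trans h)// ler_peMl ?sqr_ge0// ler1n.
  - move=> t; rewrite E1 normrM normrN [`|n.+1%:R|]ger0_norm ?ler0n// ler_wpM2l ?ler0n//; apply: norm_kapX.
    by rewrite ?ltnS ?(ltnW n1).
  - by move=> z _; exact: ctsC.
have N2 k : null_integral lm (fun w => B w.1 * (f w.2 * ((k == k)%:R * phi (polar w) +
     w.2 ord0 k * polar_dz phi k w) + g k w.2 * (w.2 ord0 k * phi (polar w)))).
  apply: (@polar_stokes_z _ _ _ _ _ a0 ab tphi _ _ sf B 1 _ _ k _ _ (@C1_on_coor R n Om k)).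
    by rewrite E2; exact: measurable_kapX.
  by move=> t; rewrite E2 mul1r; apply: norm_kapX; rewrite ?ltnS ?(ltnW n1).
have [p0 dt0 dz0] := polar_test0.
apply: (weak_ext_polar (mF ord0) (null_integralD N1 (null_integral_sum (index_enum 'I_n) N2))).
  move=> t z z0 /=; have r0 : enorm z != 0 by rewrite gt_eqF// enorm_gt0.
  rewrite ext_grad0 /ext /ext_slope colat_cos_polar// colat_sin_polar// unpolarK radial_behead_polar.
  under [X in _ = _ + X]eq_bigr => k _.
    rewrite eqxx mul1r.
    have -> : B t * (f z * (phi (polar (t, z)) + z ord0 k * polar_dz phi k (t, z)) +
       g k z * (z ord0 k * phi (polar (t, z)))) =
       B t * f z * (z ord0 k * polar_dz phi k (t, z)) +
       B t * phi (polar (t, z)) * enorm z * (radial z ord0 k * g k z) + B t * f z * phi (polar (t, z)).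
      by rewrite mxE; field.
    over.
  rewrite !big_split/= -!mulr_sumr sum_coor_dz sumr_const card_ord -mulr_natr /polar_dt/= /jac/= /B /A'.
  move: (\sum_k radial _ _ _ * _) => S; move: (\sum_k _) => T.
  move: (phi _) ('D_(_) _ _) (f z) => p V u.
  have := kapE t; move: (kap t) (enorm z) r0 => k r r0 kE.
  rewrite -natr1; move: (n%:R) => N.
  set L := (X in X = _); set Rr := (X in _ = X).
  have E : L - Rr = k ^+ n.+2 * r * u * V * (1 - k ^+ 2 * (1 + t ^+ 2)).
    by rewrite /L /Rr !exprS; field.
  by apply/eqP; rewrite -subr_eq0 E kE subrr mulr0.
move=> t /=; rewrite p0 dt0 !mulr0 addr0 mulr0 add0r big1// => k _.
by rewrite dz0 !(mulr0, addr0).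
Qed.

Lemma weak_ext_coor j : \int[mu n.+1]_x (ext f x * 'D_(basis_rV (lift ord0 j)) phi x +
  ext_grad f g (lift ord0 j) x * phi x) = 0.
Proof.
have n2 : (2 <= n)%N by [].
pose A t : R := - 1 * (t * kap t ^+ n.+1).
pose A' t : R := - 1 * (kap t ^+ n.+1 - n.+1%:R * t ^+ 2 * kap t ^+ n.+3).
pose B t : R := - t ^+ 2 * kap t ^+ n.+3.
have EA : A = (fun t => - (t ^+ 1 * kap t ^+ n.+1)) by apply/funext => t; rewrite /A; ring.
have EA' : A' = (fun t => n.+1%:R * (t ^+ 2 * kap t ^+ n.+3) - t ^+ 0 * kap t ^+ n.+1).
  by apply/funext => t; rewrite /A'; ring.
have EB : B = (fun t => - (t ^+ 2 * kap t ^+ n.+3)) by apply/funext => t; rewrite /B; ring.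
have cr k := C1_radial k O0.
have N1 : null_integral lm (fun w => f w.2 * radial w.2 ord0 j * (A' w.1 * phi (polar w) +
    A w.1 * polar_dt phi w)).
  apply: (@polar_stokes_t _ _ _ _ _ a0 ab tphi _ _ sf A A' n.+2%:R (fun z => radial z ord0 j)).
  - move=> t; have := is_deriveZ (-1) (is_derive_tkapX n t).
    by rewrite -[_ *: (_ - _)]/(_ * (_ - _)).
  - rewrite EA'; apply: measurable_funB; last exact: measurable_kapX.
    by apply: measurable_funM => //; exact: measurable_kapX.
  - move=> t; rewrite EA normrN.
    rewrite (le_trans (norm_kapX (i := 1) (j := n.+1) t _))// ler_peMl ?sqr_ge0// ler1n//.
  - move=> t; rewrite EA' (le_trans (ler_normB _ _))// -[n.+2%:R]natr1 mulrDl mul1r.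
    apply: lerD; last by apply: norm_kapX; rewrite ltnW.
    by rewrite normrM [`|n.+1%:R|]ger0_norm ?ler0n// ler_wpM2l ?ler0n//; apply: norm_kapX; rewrite ?ltnS ?(ltnW n1).
  - by move=> z Oz; have [] := cr j z Oz.
have N0 : null_integral lm (fun w => kap w.1 ^+ n.+1 * (f w.2 * (radial w.2 ord0 j * phi (polar w) +
     enorm w.2 * polar_dz phi j w) + g j w.2 * (enorm w.2 * phi (polar w)))).
  apply: (@polar_stokes_z _ _ _ _ _ a0 ab tphi _ _ sf (fun t => kap t ^+ n.+1) 1 _ _ j _ _ (C1_on_enorm O0)).
    by apply: measurable_funX; exact: measurable_kap.
  by move=> t; have := @norm_kapX R 0 n.+1 t ltac:(by rewrite ltnW); rewrite !mul1r.
have N2 k : null_integral lm (fun w => B w.1 * (f w.2 * (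
     (radial w.2 ord0 j * (k == k)%:R + radial_grad w.2 k j * w.2 ord0 k) * phi (polar w) +
     radial w.2 ord0 j * w.2 ord0 k * polar_dz phi k w) +
     g k w.2 * (radial w.2 ord0 j * w.2 ord0 k * phi (polar w)))).
  apply: (@polar_stokes_z _ _ _ _ _ a0 ab tphi _ _ sf B 1 _ _ k _ _
    (C1_onM (cr j) (@C1_on_coor R n Om k))).
    by rewrite EB; apply: measurable_funN; exact: measurable_kapX.
  by move=> t; rewrite EB mul1r normrN; apply: norm_kapX; rewrite ?ltnS ?(ltnW n1).
have [p0 dt0 dz0] := polar_test0.
apply: (weak_ext_polar (mF _) (null_integralD (null_integralD N1 N0)
  (null_integral_sum (index_enum 'I_n) N2))).
  move=> t z z0 /=; have r0 : enorm z != 0 by rewrite gt_eqF// enorm_gt0.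
  have grad0 : \sum_k radial_grad z k j * z ord0 k = 0.
    under eq_bigr => k _.
      rewrite mxE mulrBl.
      have -> : (k == j)%:R / enorm z * z ord0 k = (j == k)%:R * (z ord0 k / enorm z).
        by rewrite eq_sym; ring.
      have -> : z ord0 k * z ord0 j / enorm z ^+ 3 * z ord0 k =
        (z ord0 j / enorm z ^+ 2) * (z ord0 k * radial z ord0 k) by rewrite [radial _ _ _]mxE; field.
      over.
    by rewrite sumrB sumr_delta -mulr_sumr sum_coor_radial; field.
  rewrite ext_gradS /ext /ext_slope colat_cos_polar// colat_sin_polar// unpolarK radial_behead_polar.
  under [X in _ = _ + X]eq_bigr => k _.
    rewrite eqxx mulr1.
    have -> : B t * (f z * ((radial z ord0 j + radial_grad z k j * z ord0 k) * phi (polar (t, z)) +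
      radial z ord0 j * z ord0 k * polar_dz phi k (t, z)) +
       g k z * (radial z ord0 j * z ord0 k * phi (polar (t, z)))) =
       B t * f z * radial z ord0 j * (z ord0 k * polar_dz phi k (t, z)) +
       B t * radial z ord0 j * phi (polar (t, z)) * enorm z * (radial z ord0 k * g k z) +
       B t * f z * phi (polar (t, z)) * (radial_grad z k j * z ord0 k) +
       B t * f z * radial z ord0 j * phi (polar (t, z)).
      by rewrite [radial z ord0 k]mxE; field.
    over.
  rewrite !big_split/= -!mulr_sumr grad0 sum_coor_dz sumr_const card_ord -mulr_natr.
  rewrite /polar_dt /polar_dz/= /jac/= /B /A' /A.
  move: (\sum_k radial _ _ _ * _) => S; move: (\sum_k _) => T.
  move: (phi _) ('D_(basis_rV ord0) _ _) ('D_(_) _ _) (f z) (g j z) (radial z ord0 j) => p V W u G e.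
  have := kapE t; move: (kap t) (enorm z) r0 => k r r0 kE.
  rewrite -natr1; move: (n%:R) => N.
  set L := (X in X = _); set Rr := (X in _ = X).
  have E : L - Rr = - (u * e * r * t * V * k ^+ n.+2 * (1 - k ^+ 2 * (1 + t ^+ 2))).
    by rewrite /L /Rr !exprS; field.
  by apply/eqP; rewrite -subr_eq0 E kE subrr mulr0 oppr0.
move=> t /=; rewrite p0 dt0 dz0 !mulr0 !addr0 !mulr0 !add0r big1// => k _.
by rewrite dz0 !(mulr0, addr0).
Qed.

End sweak_extension.

(** The weak gradient of the extension. *)
Lemma sweak_ext {R : realType} n (n1 : (1 < n)%N) (a b : R) f g : 0 <= a -> a < b ->
  sweak (@annulus R n a b) f g -> sweak (@annulus R n.+1 a b) (ext f) (ext_grad f g).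
Proof.
move=> a0 ab sf; have [[mf mg] lf lg _] := sf; split; first split.
- exact: measurable_ext.
- by move=> i; exact: measurable_ext_grad.
- exact: loc_integrable_ext.
- by move=> i; exact: loc_integrable_ext_grad.
move=> i phi tphi; have [j ->|->] := unliftP ord0 i.
  exact: (weak_ext_coor n1 a0 ab sf tphi j).
exact: (weak_ext_axis n1 a0 ab sf tphi).
Qed.

(** * The suspension of a map *)

Section integral_unpolar.
Context {R : realType} (n : nat).
Local Notation mu := (@lebesgue_rV R).
Hypothesis n1 : (1 < n)%N.
Variables (a b : R).
Hypothesis a0 : 0 <= a.
Local Notation Om := (@annulus R n a b).
Local Notation Om' := (@annulus R n.+1 a b).

Lemma annulus_unpolar (x : 'rV[R]_n.+1) : unpolar x != 0 -> Om (unpolar x) = Om' x.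
Proof. by move=> ux; rewrite /annulus/= enorm_unpolar//; exact: unpolar_neq0. Qed.

Lemma integral_unpolar (h : 'rV[R]_n -> R) : measurable_fun setT h -> (forall z, 0 <= h z) ->
  (\int[mu n.+1]_(x in Om') (h (unpolar x))%:E =
   (kap_int n.+1)%:E * \int[mu n]_(z in Om) (enorm z * h z)%:E)%E.
Proof.
move=> mh h0; have mA := @measurable_annulus R n a b.
have mA' := @measurable_annulus R n.+1 a b.
pose H z := h z * \1_Om z : R.
have mH : measurable_fun setT (EFin \o H).
  by apply/measurable_EFinP; apply: measurable_funM => //; exact: measurable_indic.
have H0 z : (0%:E <= (EFin \o H) z)%E by rewrite lee_fin mulr_ge0// indicE.
transitivity (\int[mu n.+1]_x (EFin \o H) (unpolar x))%E.
  rewrite integral_mkcond; apply: ge0_ae_eq_integral => //.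
  - apply/(measurable_restrictT _ mA'); apply: measurable_funTS; apply/measurable_EFinP.
    exact: measurable_comp_unpolar.
  - exact: measurableT_comp mH (@measurable_unpolar R n).
  - by move=> x _; rewrite /patch; case: ifPn => // _; rewrite lee_fin.
  have := @ae_unpolar_neq0 R n n1; apply: filterS => x ux _.
  rewrite /patch /H/= indicE.
  have -> : (unpolar x \in Om) = (x \in Om').
    by apply/idP/idP => /set_mem hx; apply/mem_set; move: hx; rewrite (annulus_unpolar ux).
  by case: (x \in Om'); rewrite ?mulr1 ?mulr0.
rewrite (ge0_integral_unpolar n1 mH H0) [in RHS]integral_mkcond; congr (_ * _)%E.
apply: eq_integral => z _; rewrite /patch /H/= indicE -EFinM.
by case: (z \in Om); rewrite ?mulr1 ?mulr0.
Qed.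

Lemma le_integral_unpolar (F : 'rV[R]_n.+1 -> R) (h : 'rV[R]_n -> R) :
  measurable_fun Om' F -> measurable_fun Om h ->
  (forall x, 0 <= F x) -> (forall z, 0 <= h z) ->
  {ae mu n.+1, forall x, Om' x -> behead_rV x != 0 -> Om (unpolar x) -> F x <= h (unpolar x)} ->
  (\int[mu n.+1]_(x in Om') (F x)%:E <=
   (kap_int n.+1)%:E * \int[mu n]_(z in Om) (enorm z * h z)%:E)%E.
Proof.
move=> mF mh F0 h0 Fh; have mA := @measurable_annulus R n a b.
have mA' := @measurable_annulus R n.+1 a b.
have mH : measurable_fun setT (h \_ Om) by apply/(measurable_restrictT _ mA).
have H0 z : 0 <= (h \_ Om) z by rewrite /patch; case: ifPn.
have -> : (\int[mu n]_(z in Om) (enorm z * h z)%:E = \int[mu n]_(z in Om) (enorm z * (h \_ Om) z)%:E)%E.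
  by apply: eq_integral => z zO; rewrite /patch zO.
rewrite -(integral_unpolar mH H0); apply: ae_ge0_le_integral => //.
- by move=> x _; rewrite lee_fin.
- exact/measurable_EFinP.
- by move=> x _; rewrite lee_fin.
- by apply: measurable_funTS; apply/measurable_EFinP; exact: measurable_comp_unpolar.
have := @ae_unpolar_neq0 R n n1; apply: filterS2 Fh => x Fh ux Ox.
have uO : Om (unpolar x) by rewrite annulus_unpolar.
by rewrite lee_fin /patch mem_set//; apply: Fh => //; exact: unpolar_neq0.
Qed.

End integral_unpolar.

Section extended_map.
Context {R : realType} (n : nat).
Local Notation mu := (@lebesgue_rV R).
Implicit Types (v : 'rV[R]_n -> 'rV[R]_n) (G : 'rV[R]_n -> 'M[R]_n) (x : 'rV[R]_n.+1).

Definition extv v x : 'rV[R]_n.+1 := cons_rV (colat_cos x, colat_sin x *: v (unpolar x)).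

Definition extv_grad v G x : 'M[R]_n.+1 := \matrix_(i, l)
  if unlift ord0 l is Some j
  then (behead_rV x != 0)%:R * ext_grad (fun z => v z ord0 j) (fun k z => G z k j) i x
  else radial_grad x i ord0.

Lemma sqr_colat x : x != 0 -> colat_cos x ^+ 2 + colat_sin x ^+ 2 = 1.
Proof.
move=> x0; rewrite /colat_cos /colat_sin !exprMn -mulrDl -sqr_enormS -exprMn mulfV ?expr1n//.
by rewrite gt_eqF// enorm_gt0.
Qed.

Lemma behead_neq0 x : behead_rV x != 0 -> x != 0.
Proof. by apply: contra => /eqP ->; apply/eqP/rowP => i; rewrite !mxE. Qed.

Lemma sqr_sum_ext_grad (f : 'rV[R]_n -> R) (g : 'I_n -> 'rV[R]_n -> R) x : behead_rV x != 0 ->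
  \sum_i ext_grad f g i x ^+ 2 = \sum_i g i (unpolar x) ^+ 2 + colat_cos x ^+ 2 *
    ((f (unpolar x) / enorm (unpolar x)) ^+ 2 -
     (\sum_m radial (behead_rV x) ord0 m * g m (unpolar x)) ^+ 2).
Proof.
move=> y0; rewrite big_ord_recl ext_grad0.
under eq_bigr => i _ do rewrite ext_gradS.
have h1 : \sum_i radial (behead_rV x) ord0 i ^+ 2 = 1.
  have := sqr_enorm (radial (behead_rV x)); rewrite enorm_radial// expr1n => ->.
  by apply: eq_bigr => i _; rewrite expr2.
have h2 := sqr_colat (behead_neq0 y0).
rewrite /ext_slope; set a := \sum_m _ * _.
move: (colat_cos x) (colat_sin x) h2 => c s h2.
set e := f _ / _; set S := a - e.
have -> : \sum_(i < n) (g i (unpolar x) - c ^+ 2 * radial (behead_rV x) ord0 i * S) ^+ 2 =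
   \sum_i g i (unpolar x) ^+ 2 - 2 * c ^+ 2 * S * a + c ^+ 4 * S ^+ 2.
  under eq_bigr => i _.
    have -> : (g i (unpolar x) - c ^+ 2 * radial (behead_rV x) ord0 i * S) ^+ 2 =
      g i (unpolar x) ^+ 2 + (- (2 * c ^+ 2 * S)) * (radial (behead_rV x) ord0 i * g i (unpolar x)) +
      c ^+ 4 * S ^+ 2 * (radial (behead_rV x) ord0 i ^+ 2) by ring.
    over.
  by rewrite !big_split/= -!mulr_sumr h1; rewrite -/a; ring.
have hs : s ^+ 2 = 1 - c ^+ 2 by rewrite -h2; ring.
by rewrite [(c * s * S) ^+ 2]exprMn [(c * s) ^+ 2]exprMn hs /S; ring.
Qed.

Lemma sqr_sum_radial_grad0 x : behead_rV x != 0 ->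
  \sum_i radial_grad x i ord0 ^+ 2 = (colat_sin x / enorm x) ^+ 2.
Proof.
move=> y0; have x0 := behead_neq0 y0.
have r0 : enorm x != 0 by rewrite gt_eqF// enorm_gt0.
have h2 := sqr_colat x0.
have -> : (colat_sin x / enorm x) ^+ 2 = (1 - colat_cos x ^+ 2) / enorm x ^+ 2.
  by rewrite -h2 exprMn exprVn; ring.
under eq_bigr => i _.
  rewrite mxE.
  have -> : ((i == ord0)%:R / enorm x - x ord0 i * x ord0 ord0 / enorm x ^+ 3) ^+ 2 =
    (ord0 == i)%:R * ((enorm x)^-1 ^+ 2 * (ord0 == i)%:R - 2 * x ord0 i * x ord0 ord0 / enorm x ^+ 4) +
    (x ord0 ord0 / enorm x ^+ 3) ^+ 2 * (x ord0 i * x ord0 i) by rewrite eq_sym; field.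
  over.
rewrite big_split/= sumr_delta -mulr_sumr -/(dotr x x) -sqr_enorm /colat_cos eqxx.
have -> : true%:R = 1 :> R by [].
by field.
Qed.

Lemma sum_cols (F : 'M[R]_n.+1) : mxnorm2 F ^+ 2 =
  \sum_i F i ord0 ^+ 2 + \sum_j \sum_i F i (lift ord0 j) ^+ 2.
Proof.
rewrite sqr_mxnorm2 exchange_big/= big_ord_recl; congr (_ + _).
Qed.

Lemma sqr_mxnorm2_cols (F : 'M[R]_n) : mxnorm2 F ^+ 2 = \sum_j \sum_i F i j ^+ 2.
Proof. by rewrite sqr_mxnorm2 exchange_big. Qed.

(** The slope of v along the rays contributes with the favourable sign, so that
    discarding it only increases the gradient of the extension. *)
Lemma sum_ext_cols v G x : behead_rV x != 0 ->
  \sum_j \sum_i extv_grad v G x i (lift ord0 j) ^+ 2 <=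
  mxnorm2 (G (unpolar x)) ^+ 2 + colat_cos x ^+ 2 * (enorm (v (unpolar x)) / enorm x) ^+ 2.
Proof.
move=> y0.
under eq_bigr => j _.
  under eq_bigr => i _ do rewrite mxE liftK y0 mul1r.
  rewrite sqr_sum_ext_grad//; over.
rewrite big_split/= sqr_mxnorm2_cols lerD2l -mulr_sumr ler_wpM2l ?sqr_ge0//.
rewrite enorm_unpolar// exprMn sqr_enorm /dotr mulr_suml; apply: ler_sum => j _.
by rewrite exprMn -expr2 gerBl sqr_ge0.
Qed.

Lemma mxnorm2_extv_grad v G x : behead_rV x != 0 -> enorm (v (unpolar x)) = 1 ->
  mxnorm2 (extv_grad v G x) ^+ 2 <= mxnorm2 (G (unpolar x)) ^+ 2 + (enorm (unpolar x))^-1 ^+ 2.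
Proof.
move=> y0 v1; rewrite sum_cols.
under eq_bigr => i _ do rewrite mxE unlift_none.
rewrite sqr_sum_radial_grad0//; apply: le_trans (lerD (lexx _) (sum_ext_cols _ _ y0)) _.
rewrite v1 enorm_unpolar// addrCA lerD2l mul1r exprMn -mulrDl addrC sqr_colat ?behead_neq0//.
by rewrite mul1r.
Qed.

Lemma extv_gradB v w G H x :
  extv_grad v G x - extv_grad w H x =
  \matrix_(i, l) if unlift ord0 l is Some j
    then extv_grad (fun z => v z - w z) (fun z => G z - H z) x i l else 0.
Proof.
apply/matrixP => i l; rewrite !mxE; case: unliftP => [j|] _; last by rewrite subrr.
rewrite -mulrBr; congr (_ * _); rewrite /ext_grad /ext_slope.
have E : \sum_m radial (behead_rV x) ord0 m * (G (unpolar x) - H (unpolar x)) m j =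
   \sum_m radial (behead_rV x) ord0 m * G (unpolar x) m j -
   \sum_m radial (behead_rV x) ord0 m * H (unpolar x) m j.
  by rewrite -sumrB; apply: eq_bigr => m _; rewrite !mxE mulrBr.
by rewrite E !mxE; case: unliftP => [k|] _; rewrite ?mxE; ring.
Qed.

Lemma mxnorm2_extv_gradB v w G H x : behead_rV x != 0 ->
  mxnorm2 (extv_grad v G x - extv_grad w H x) ^+ 2 <=
  mxnorm2 (G (unpolar x) - H (unpolar x)) ^+ 2 +
  (enorm (v (unpolar x) - w (unpolar x)) / enorm (unpolar x)) ^+ 2.
Proof.
move=> y0; rewrite sum_cols extv_gradB big1 ?add0r; last first.
  by move=> i _; rewrite mxE unlift_none expr0n.
under eq_bigr => j _ do under eq_bigr => i _ do rewrite mxE liftK.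
apply: le_trans (sum_ext_cols _ _ y0) _; rewrite enorm_unpolar// lerD2l.
by rewrite ler_piMl ?sqr_ge0// -real_normK ?num_real// expr_le1 ?colat_cos_le1.
Qed.

Lemma extvB v w x : extv v x - extv w x = cons_rV (0, colat_sin x *: (v (unpolar x) - w (unpolar x))).
Proof.
apply/rowP => i; rewrite mxE [(- extv w x) _ _]mxE; have [j ->|->] := unliftP ord0 i.
  by rewrite !cons_rV_lift/= !mxE mulrBr.
by rewrite !cons_rV0/= subrr.
Qed.

Lemma enorm_extvB v w x : enorm (extv v x - extv w x) <= enorm (v (unpolar x) - w (unpolar x)).
Proof.
rewrite extvB -(ler_pXn2r (n := 2))// ?nnegrE ?enorm_ge0// enorm_cons/= expr0n add0r.
rewrite enormZ exprMn ler_piMl ?sqr_ge0// expr_le1//; exact: colat_sin_le1.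
Qed.

Lemma enorm_extv v x : behead_rV x != 0 -> enorm (v (unpolar x)) = 1 -> enorm (extv v x) = 1.
Proof.
move=> y0 v1; apply/eqP; rewrite -(eqrXn2 (n := 2)) ?enorm_ge0// enorm_cons/=.
by rewrite enormZ v1 mulr1 real_normK ?num_real// sqr_colat ?behead_neq0// expr1n.
Qed.

Lemma measurable_extv a b v : 0 <= a -> measurable_fun (@annulus R n a b) v ->
  measurable_fun (@annulus R n.+1 a b) (extv v).
Proof.
move=> a0 mv; have mA := @measurable_annulus R n a b.
have mv' : measurable_fun setT (v \_ (annulus a b)) by apply/(measurable_restrictT _ mA).
apply: (eq_measurable_fun (extv (v \_ (annulus a b)))).
  move=> x /set_mem Ox; rewrite /extv; have [y0|y0] := eqVneq (behead_rV x) 0.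
    by rewrite /colat_sin y0 enorm0 !mul0r !scale0r.
  by rewrite /patch mem_set// /annulus/= enorm_unpolar.
apply: measurable_funTS; apply: (measurableT_comp (measurable_cons_rV (n:=n))).
apply/measurable_fun_pair => /=; first exact: measurable_colat_cos.
apply: measurable_fun_rVP => i; under eq_fun do rewrite mxE.
apply: measurable_funM; first exact: measurable_colat_sin.
apply: (measurableT_comp (@measurable_coor R n i)).
exact: measurableT_comp mv' (@measurable_unpolar R n).
Qed.

Lemma weak_gradient_extv (a b : R) v G : (1 < n)%N -> 0 <= a -> a < b ->
  weak_gradient (@annulus R n a b) v G ->
  weak_gradient (@annulus R n.+1 a b) (extv v) (extv_grad v G).
Proof.
move=> n1 a0 ab HG; have sv := sweak_of_weak_gradient (@open_annulus R n a b) HG.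
have HR := @weak_gradient_radial R n.+1 a b a0.
have sr := sweak_of_weak_gradient (@open_annulus R n.+1 a b) HR ord0.
have O0 x : @annulus R n.+1 a b x -> x != 0.
  by move=> /andP[ax _]; rewrite -enorm_gt0 (le_lt_trans a0 ax).
pose f (j : 'I_n.+1) := if unlift ord0 j is Some k
  then ext ((fun z => v z ord0 k) \_ (@annulus R n a b))
  else (fun x => radial x ord0 ord0) \_ (@annulus R n.+1 a b).
pose g (j : 'I_n.+1) := if unlift ord0 j is Some k
  then ext_grad ((fun z => v z ord0 k) \_ (@annulus R n a b))
    (fun i => (fun z => G z i k) \_ (@annulus R n a b))
  else (fun i => (fun x => radial_grad x i ord0) \_ (@annulus R n.+1 a b)).
apply: (@weak_gradient_of_sweak R n.+1 _ _ _ f g).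
- move=> j; rewrite /f /g; case: unliftP => [k|] _; last exact: sr.
  exact: (sweak_ext n1 a0 ab (sv k)).
- move=> x j Ox; rewrite /f; have [k ->|->] := unliftP ord0 j.
    rewrite cons_rV_lift/= mxE /ext; have [y0|y0] := eqVneq (behead_rV x) 0.
      by rewrite /colat_sin y0 enorm0 !mul0r.
    rewrite /patch mem_set// /annulus/= enorm_unpolar//.
  by rewrite cons_rV0/= /patch mem_set// mxE mulrC.
- move=> x i j Ox; rewrite mxE /g; case: unliftP => [k _|_]; last by rewrite /patch mem_set.
  have [y0|y0] := eqVneq (behead_rV x) 0.
    rewrite mul0r /ext_grad; case: unliftP => [l|] _.
      rewrite {1}/patch unpolar_eq0// memNset.
        by rewrite y0 /radial scaler0 mxE mulr0 mul0r subr0.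
      by rewrite /annulus/= enorm0 ltNge a0.
    by rewrite /colat_sin y0 enorm0 mul0r mulr0 mul0r.
  have uO : @annulus R n a b (unpolar x) by rewrite /annulus/= enorm_unpolar.
  rewrite mul1r /ext_grad /ext_slope /patch mem_set//.
Qed.

End extended_map.

(** * Energy of the suspension *)

Section powR_inequalities.
Context {R : realType}.
Implicit Types (a b p q N : R).

Lemma powR_half (a p : R) : 0 <= a -> a `^ p = (a ^+ 2) `^ (p / 2).
Proof.
move=> a0; rewrite -powR_mulrn// -powRrM; congr (_ `^ _).
by rewrite mulrCA mulfV ?mulr1// pnatr_eq0.
Qed.

Lemma powRS (a p : R) : 0 <= a -> 0 <= p -> a `^ (p + 1) = a * a `^ p.
Proof.
move=> a0 p0; rewrite powRD ?powRr1//; first by rewrite mulrC.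
by apply/implyP => /eqP h; move: p0; lra.
Qed.

(** The two terms have weights (N - 1) / N and 1 / N: this is the inequality that
    becomes an equality when b = a / (N - 1). *)
Lemma powR_convex_weights N a b q : 1 < N -> 1 <= q -> 0 <= a -> 0 <= b ->
  (a + b) `^ q <= N `^ (q - 1) * ((N - 1) `^ (q - 1))^-1 * a `^ q + N `^ (q - 1) * b `^ q.
Proof.
move=> N1 q1 a0 b0; have N0 : 0 < N by apply: lt_trans N1.
have M0 : 0 < N - 1 by rewrite subr_gt0.
have t0 : 0 <= N^-1 by rewrite invr_ge0 ltW.
have t1 : N^-1 <= 1 by rewrite invf_le1// ltW.
have x0 : 0 <= N * b by rewrite mulr_ge0// ltW.
have y0 : 0 <= N / (N - 1) * a by rewrite mulr_ge0// divr_ge0// ltW.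
have := @convex_powR R q q1 (Itv01 t0 t1) (N * b) (N / (N - 1) * a).
rewrite !inE/= !in_itv/= !andbT => /(_ x0 y0); rewrite !convRE/= /unstable.onem.
have qE : q = (q - 1) + 1 by rewrite subrK.
have q0 : 0 <= q - 1 by rewrite subr_ge0.
have Nq : N `^ q = N * N `^ (q - 1) by rewrite {1}qE powRS// ltW.
have Mq : (N - 1) `^ q = (N - 1) * (N - 1) `^ (q - 1) by rewrite {1}qE powRS// ltW.
have Mn0 : (N - 1) `^ (q - 1) != 0 by rewrite gt_eqF// powR_gt0.
have NM : (N / (N - 1)) `^ q = N `^ q / (N - 1) `^ q.
  rewrite powRM ?invr_ge0 ?(ltW M0) ?(ltW N0)//; congr (_ * _).
  by rewrite -[(N - 1)^-1]powR_inv1 ?(ltW M0)// -powRrM mulN1r powRN.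
rewrite (@powRM _ N b q) ?(ltW N0)// (@powRM _ (N / (N - 1)) a q) ?divr_ge0 ?(ltW M0) ?(ltW N0)// NM Nq Mq.
have N0' : N != 0 by rewrite gt_eqF.
have M0' : N - 1 != 0 by rewrite gt_eqF.
set L := (X in X <= _ -> _); set Rr := (X in _ <= X -> _).
have -> : L = (a + b) `^ q.
  by rewrite /L; congr (_ `^ _); change (N^-1 * (N * b) + (1 - N^-1) * (N / (N - 1) * a) = a + b); field; rewrite N0' M0'.
have -> : Rr = N `^ (q - 1) * ((N - 1) `^ (q - 1))^-1 * a `^ q + N `^ (q - 1) * b `^ q.
  by rewrite /Rr; field; rewrite N0' M0' Mn0.
by [].
Qed.

Lemma powR_sum2 a b p : 0 <= p -> 0 <= a -> 0 <= b ->
  (a + b) `^ p <= 2 `^ p * (a `^ p + b `^ p).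
Proof.
move=> p0; wlog ab : a b / a <= b => [H a0 b0|a0 b0].
  by have [/H|/ltW/H] := leP a b; [exact|rewrite [a + b]addrC [_ + b `^ p]addrC; exact].
apply: (@le_trans _ _ ((2 * b) `^ p)).
  by apply: ge0_ler_powR; rewrite ?nnegrE ?addr_ge0 ?mulr_ge0// mulr2n mulrDl mul1r lerD.
by rewrite powRM// ler_wpM2l ?powR_ge0// lerDr powR_ge0.
Qed.

End powR_inequalities.

Section extended_energy.
Context {R : realType} (n : nat).
Local Notation mu := (@lebesgue_rV R).
Local Notation pball := (@punctured_ball R n).
Local Notation pball' := (@punctured_ball R n.+1).
Hypothesis n1 : (1 < n)%N.
Variables (p alpha : R).
Hypotheses (alpha0 : 0 <= alpha) (p1 : 1 <= p).

(** The energy of the radial map of the ball of dimension n, for the weight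
    alpha + 1 and without its constant factor. *)
Definition radial_integral : \bar R :=
  (\int[mu n]_(z in pball) (enorm z `^ (alpha + 1) * (enorm z)^-1 `^ p)%:E)%E.

Let p0 : 0 <= p. Proof. exact: le_trans p1. Qed.

Lemma energy_radial_unpolar : energy p alpha (@radial R n.+1) =
  ((Num.sqrt n%:R `^ p)%:E * ((kap_int n.+1)%:E * radial_integral))%E.
Proof.
rewrite energy_radial// (_ : n.+1%:R - 1 = n%:R :> R); last by rewrite -natr1 addrK.
congr (_ * _)%E.
pose h (z : 'rV[R]_n) : R := enorm z `^ alpha * (enorm z)^-1 `^ p.
have mh : measurable_fun setT h.
  apply: measurable_funM; apply: measurable_powR_comp; first exact: measurable_enorm.
  by apply: measurable_invr; [exact: measurable_enorm|exact: enorm_ge0].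
have h0 z : 0 <= h z by rewrite mulr_ge0// powR_ge0.
transitivity (\int[mu n.+1]_(x in annulus 0%R 1%R) (h (unpolar x))%:E)%E.
  rewrite punctured_ballE; have mA := @measurable_annulus R n.+1 0 1.
  apply: ge0_ae_eq_integral => //.
  - apply: measurable_funTS; apply/measurable_EFinP; apply: measurable_funM; apply: measurable_powR_comp.
      exact: measurable_enorm.
    by apply: measurable_invr; [exact: measurable_enorm|exact: enorm_ge0].
  - by apply: measurable_funTS; apply/measurable_EFinP; exact: measurable_comp_unpolar.
  - by move=> x _; rewrite lee_fin mulr_ge0// powR_ge0.
  - by move=> x _; rewrite lee_fin.
  have := @ae_unpolar_neq0 R n n1; apply: filterS => x ux _.
  by rewrite /h enorm_unpolar//; exact: unpolar_neq0.
rewrite (@integral_unpolar R n n1 0 1 h mh h0) /radial_integral punctured_ballE.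
congr (_ * _)%E; apply: eq_integral => z _; congr EFin.
by rewrite powRS ?enorm_ge0// /h mulrA.
Qed.

Lemma radial_integral_lty : (energy p alpha (@radial R n.+1) < +oo)%E ->
  (radial_integral < +oo)%E.
Proof.
rewrite energy_radial_unpolar; apply: contraTT; rewrite -!leNgt !leye_eq => /eqP ->.
rewrite gt0_muley ?lte_fin ?kap_int_gt0 ?ltnS 1?ltnW// gt0_muley// lte_fin powR_gt0//.
by rewrite sqrtr_gt0 ltr0n ltnW.
Qed.

Lemma energy_radial_lty : (energy p alpha (@radial R n.+1) < +oo)%E ->
  (energy p (alpha + 1) (@radial R n) < +oo)%E.
Proof.
move=> /radial_integral_lty I; rewrite energy_radial ?(ltnW n1)// lte_mul_pinfty ?lee_fin ?powR_ge0//.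
Qed.

Variables (v : 'rV[R]_n -> 'rV[R]_n) (G : 'rV[R]_n -> 'M[R]_n).
Hypothesis HG : weak_gradient pball v G.
Hypothesis v1 : {ae mu n, forall z, @ball_rV R n z -> enorm (v z) = 1}.

Let mG i j : measurable_fun pball (fun z => G z i j).
Proof. exact: weak_gradient_measurable HG. Qed.

Lemma weak_gradient_extv_ball : weak_gradient pball' (extv v) (extv_grad v G).
Proof. by rewrite punctured_ballE; apply: weak_gradient_extv => //; rewrite -punctured_ballE. Qed.

Lemma energy_extv_le : (energy p alpha (extv v) <= (kap_int n.+1)%:E *
  \int[mu n]_(z in pball) (enorm z * (enorm z `^ alpha *
    (mxnorm2 (G z) ^+ 2 + (enorm z)^-1 ^+ 2) `^ (p / 2)))%:E)%E.
Proof.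
rewrite (@energyE R n.+1 (ltn0Sn n) p alpha _ _ weak_gradient_extv_ball) !punctured_ballE.
apply: (@le_integral_unpolar R n n1 0 1 _ (fun z => enorm z `^ alpha *
    (mxnorm2 (G z) ^+ 2 + (enorm z)^-1 ^+ 2) `^ (p / 2))) => //.
- apply: measurable_energy_density => i j; have := weak_gradient_extv_ball.
  by rewrite punctured_ballE => /weak_gradient_measurable; exact.
- apply: measurable_funM; apply: measurable_powR_comp.
    by apply: measurable_funTS; exact: measurable_enorm.
  apply: measurable_funD; apply: measurable_funX.
    by apply: measurable_mxnorm2 => i j; rewrite -punctured_ballE; exact: mG.
  by apply: measurable_funTS; apply: measurable_invr; [exact: measurable_enorm|exact: enorm_ge0].
- by move=> x; rewrite mulr_ge0// powR_ge0.
- by move=> z; rewrite mulr_ge0// powR_ge0.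
have := ae_unpolar n1 v1; apply: filterS => x vx Ox y0 uO.
rewrite enorm_unpolar// ler_wpM2l ?powR_ge0// powR_half ?mxnorm2_ge0//.
apply: ge0_ler_powR; rewrite ?nnegrE ?sqr_ge0 ?addr_ge0 ?sqr_ge0 ?divr_ge0//.
rewrite -(enorm_unpolar y0); apply: mxnorm2_extv_grad => //; apply: vx.
by case/andP : uO.
Qed.

Lemma energy_extv_bound : 2 <= p ->
  (energy p alpha (extv v) <= (kap_int n.+1)%:E *
    ((n%:R `^ (p / 2 - 1) * ((n%:R - 1) `^ (p / 2 - 1))^-1)%:E * energy p (alpha + 1) v +
     (n%:R `^ (p / 2 - 1))%:E * radial_integral))%E.
Proof.
move=> p2; apply: (le_trans energy_extv_le).
rewrite lee_wpmul2l ?lee_fin ?(ltW (kap_int_gt0 _)) ?ltnS 1?ltnW//.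
rewrite (@energyE R n (ltnW n1) p (alpha + 1) _ _ HG) /radial_integral.
have mB := @measurable_punctured_ball R n.
have me : measurable_fun pball (fun z : 'rV[R]_n => enorm z).
  by apply: measurable_funTS; exact: measurable_enorm.
have mi : measurable_fun pball (fun z : 'rV[R]_n => (enorm z)^-1).
  by apply: measurable_funTS; apply: measurable_invr; [exact: measurable_enorm|exact: enorm_ge0].
have mm : measurable_fun pball (fun z => mxnorm2 (G z)) by exact: measurable_mxnorm2.
rewrite -!ge0_integralZl_EFin ?mulr_ge0 ?invr_ge0 ?powR_ge0//; first last.
- by apply/measurable_EFinP; exact: measurable_energy_density.
- by move=> z _; rewrite lee_fin mulr_ge0 ?powR_ge0.
- by apply/measurable_EFinP; apply: measurable_funM; exact: measurable_powR_comp.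
- by move=> z _; rewrite lee_fin mulr_ge0 ?powR_ge0.
rewrite -ge0_integralD//; first last.
- apply: emeasurable_funM => //; apply/measurable_EFinP; apply: measurable_funM; exact: measurable_powR_comp.
- by move=> z _; rewrite -EFinM lee_fin !mulr_ge0 ?powR_ge0.
- by apply: emeasurable_funM => //; apply/measurable_EFinP; exact: measurable_energy_density.
- by move=> z _; rewrite -EFinM lee_fin !mulr_ge0 ?invr_ge0 ?powR_ge0.
apply: ge0_le_integral => //.
- by move=> z _; rewrite lee_fin !mulr_ge0 ?enorm_ge0 ?powR_ge0.
- apply/measurable_EFinP; apply: measurable_funM => //; apply: measurable_funM; apply: measurable_powR_comp => //.
  by apply: measurable_funD; apply: measurable_funX.
- apply: emeasurable_funD; apply: emeasurable_funM => //; apply/measurable_EFinP.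
    exact: measurable_energy_density.
  by apply: measurable_funM; exact: measurable_powR_comp.
move=> z _; rewrite -!EFinM -EFinD lee_fin powRS ?enorm_ge0//.
have N1 : 1 < n%:R :> R by rewrite ltr1n.
have q1 : 1 <= p / 2 by lra.
have := powR_convex_weights N1 q1 (sqr_ge0 (mxnorm2 (G z))) (sqr_ge0 (enorm z)^-1).
rewrite -!powR_half ?mxnorm2_ge0 ?invr_ge0 ?enorm_ge0// => h.
apply: le_trans (ler_wpM2l (enorm_ge0 z) (ler_wpM2l (powR_ge0 (enorm z) alpha) h)) _.
rewrite le_eqVlt; apply/orP; left; apply/eqP; ring.
Qed.

Lemma energy_radial_le_of_extv : 2 <= p -> (radial_integral < +oo)%E ->
  (energy p alpha (@radial R n.+1) <= energy p alpha (extv v))%E ->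
  (energy p (alpha + 1) (@radial R n) <= energy p (alpha + 1) v)%E.
Proof.
move=> p2 I min; have := le_trans min (energy_extv_bound p2).
have I0 : (0 <= radial_integral)%E.
  by apply: integral_ge0 => z _; rewrite lee_fin mulr_ge0 ?powR_ge0.
have E0 : (0 <= energy p (alpha + 1) v)%E.
  by apply: integral_ge0 => z _; rewrite lee_fin mulr_ge0 ?powR_ge0.
have -> : energy p (alpha + 1) (@radial R n) =
    ((Num.sqrt (n%:R - 1) `^ p)%:E * radial_integral)%E by exact: energy_radial (ltnW n1) _ _.
rewrite energy_radial_unpolar.
have := @kap_int_gt0 R n.+1; rewrite ltnS => /(_ (ltnW n1)).
move: I0 I E0; case: radial_integral => // i i0 _; case: (energy _ _ v) => [e| |] // e0 k0.
  2: by rewrite leey.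
rewrite -!EFinM !lee_fin.
have N1 : 1 < n%:R :> R by rewrite ltr1n.
move: (n%:R) N1 => N N1; move: (kap_int _) k0 => C C0.
have N0 : 0 < N by apply: lt_trans N1.
have M0 : 0 < N - 1 by rewrite subr_gt0.
have sq (x : R) : 0 <= x -> Num.sqrt x `^ p = x * x `^ (p / 2 - 1).
  move=> x0; rewrite powR_half ?sqrtr_ge0// sqr_sqrtr// -powRS ?subrK//.
  by rewrite subr_ge0; lra.
rewrite !sq ?(ltW M0) ?(ltW N0)//.
have := powR_gt0 (p / 2 - 1) N0; have := powR_gt0 (p / 2 - 1) M0.
move: (N `^ _) ((N - 1) `^ _) => A B B0 A0 h.
have {}h : N * A * i <= A / B * e + A * i.
  by rewrite -(ler_pM2l C0); apply: le_trans h; rewrite le_eqVlt; apply/orP; left; apply/eqP; ring.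
have h' : A * ((N - 1) * i) <= A * (e / B).
  by rewrite -subr_ge0; move: h; rewrite -subr_ge0; congr (_ <= _); ring.
move: h'; rewrite ler_pM2l// ler_pdivlMr//; congr (_ <= _); ring.
Qed.

End extended_energy.

(** * Spherical integrals and continuity of the suspension *)

Section surface_measure_formula.
Context {R : realType} (m : nat).
Lemma surface_integralE (F : 'rV[R]_m -> R) : (0 < m)%N ->
  measurable_fun (@sphere_rV R m) F -> (forall x, 0 <= F x) ->
  (\int[@surface_measure R m]_(x in @sphere_rV R m) (F x)%:E =
  m%:R%:E * \int[lebesgue_rV m]_(z in @punctured_ball R m) (F (radial z))%:E)%E.
Proof.
move=> m0 mF F0.
have mS : measurable (@sphere_rV R m).
  apply: closed_measurable_rV; rewrite (_ : @sphere_rV R m = @enorm R m @^-1` [set 1]) //.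
  by apply: closed_comp; [move=> x _; exact: continuous_enorm|exact: closed_eq].
have mF' : measurable_fun (@sphere_rV R m) (EFin \o F) by exact/measurable_EFinP.
rewrite ge0_integral_mscale//; last by move=> x _; rewrite lee_fin.
congr (_ * _)%E.
have mR := @measurable_radial R m.
rewrite (@ge0_integral_pushforward _ _ _ _ _ _ (@measurable_radial R m))//; last by move=> x _; rewrite lee_fin.
have DE : (@radial R m @^-1` @sphere_rV R m) = [set z | z != 0].
  apply/seteqP; split => z /=; last exact: enorm_radial.
  rewrite /sphere_rV/= => h; apply/eqP => z0; move: h; rewrite /sphere_rV/= z0 /radial scaler0 enorm0 => /eqP.
  by rewrite eq_sym oner_eq0.
have mD : measurable (@radial R m @^-1` @sphere_rV R m) by rewrite -[X in measurable X]setTI; exact: mR.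
have mFr : measurable_fun (@radial R m @^-1` @sphere_rV R m) ((fun x => (F x)%:E) \o @radial R m).
  apply: (measurable_comp (F := @sphere_rV R m)) => //; first by move=> _ [z Dz <-].
  exact: measurable_funTS.
rewrite (@ge0_negligible_integral _ _ _ _ _ (~` @ball_rV R m))//; first last.
- by rewrite /= /mrestr setICl measure0.
- by move=> x _; rewrite lee_fin.
- by apply: measurableC; exact: measurable_ball_rV.
have E : (@radial R m @^-1` @sphere_rV R m) `\` ~` @ball_rV R m = @punctured_ball R m.
  rewrite DE; apply/seteqP; split => z /=.
    by move=> [z0 /contrapT bz]; split=> //; exact/eqP.
  by move=> [bz z0]; split=> [|h]; [exact/eqP|exact: h].
rewrite E; apply: eq_measure_integral => A mA AB.
rewrite /= /mrestr setIidl// => x /AB[] //.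
Qed.
End surface_measure_formula.

Section continuity_on_closed_sets.
Context {R : realType}.

Lemma measurable_within_continuous m (A : set 'rV[R]_m) (f : 'rV[R]_m -> R) : closed A ->
  {within A, continuous f} -> measurable_fun A f.
Proof.
move=> cA cf; have mA := closed_measurable_rV cA.
apply: (measurability _ (measurable_realfun.RGenOpens.measurableE R)).
move=> _ [_ [a [b ->]] <-].
have /open_subspaceP[V oV VA] : open (f @^-1` `]a, b[%classic : set (subspace A)).
  by move/continuousP : cf; apply; exact: itv_open.
rewrite setIC -VA; apply: measurableI => //; exact: open_measurable_rV.
Qed.

Lemma cvg_rV (T : Type) m (F : set_system T) (FF : Filter F) (f : T -> 'rV[R]_m) (l : 'rV[R]_m) :
  (forall i, (fun y => f y ord0 i) @ F --> l ord0 i) -> f @ F --> l.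
Proof.
move=> cf A /nbhs_ballP[e /= e0 eA].
have H i : F (fun y => ball (l ord0 i) e (f y ord0 i)).
  by apply: (cf i); exact: nbhsx_ballx.
have HA := @filter_forall _ _ _ F FF H.
suff : F (fun y => A (f y)) by [].
apply: filterS HA => y fy; apply: eA; split=> // i j; have -> : i = ord0 by exact: ord1.
exact: fy.
Qed.

Lemma compact_closed_collar m : compact (@closed_collar R m).
Proof. exact: compact_closed_annulus. Qed.

Lemma closed_collar_bounded m (w : 'rV[R]_m -> 'rV[R]_m) :
  {within @closed_collar R m, continuous w} ->
  exists2 M, 0 <= M & forall x, closed_collar x -> forall i, `|w x ord0 i| <= M.
Proof.
move=> cw; have := continuous_compact cw (@compact_closed_collar m).
move=> /compact_coor_le[M HM]; exists (Num.max M 0); first by rewrite le_max lexx orbT.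
by move=> x cx i; rewrite le_max (HM (w x))//; exists x.
Qed.

Lemma continuous_radial m (x : 'rV[R]_m) : x != 0 -> {for x, continuous (@radial R m)}.
Proof.
move=> x0; apply: cts_rV => i.
by have [] := @C1_radial R m [set y | y != 0] i (fun y h => h) x x0.
Qed.

End continuity_on_closed_sets.

Section continuous_extension.
Context {R : realType} (n : nat).
Implicit Types x : 'rV[R]_n.+1.

Lemma cts_behead x : {for x, continuous (@behead_rV R n)}.
Proof.
apply: cts_rV => i; have -> : (fun y => @behead_rV R n y ord0 i) = (fun y => y ord0 (lift ord0 i)).
  by apply/funext => y; rewrite mxE.
exact: cts_coor.
Qed.

Lemma cts_enorm_behead x : {for x, continuous (fun y => enorm (behead_rV y))}.
Proof.
by apply: (@continuous_comp _ _ _ (@behead_rV R n) (@enorm R n)); [exact: cts_behead|exact: cts_enorm].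
Qed.

Lemma cts_colat_cos x : x != 0 -> {for x, continuous (@colat_cos R n)}.
Proof.
move=> x0; apply: ctsM; first exact: cts_coor.
by apply: ctsV; [rewrite gt_eqF// enorm_gt0|exact: cts_enorm].
Qed.

Lemma cts_colat_sin x : x != 0 -> {for x, continuous (@colat_sin R n)}.
Proof.
move=> x0; apply: ctsM; first exact: cts_enorm_behead.
by apply: ctsV; [rewrite gt_eqF// enorm_gt0|exact: cts_enorm].
Qed.

Lemma cts_unpolar x : behead_rV x != 0 -> {for x, continuous (@unpolar R n)}.
Proof.
move=> y0; apply: cts_rV => i.
have -> : (fun y => @unpolar R n y ord0 i) = (fun y => enorm y * radial (behead_rV y) ord0 i).
  by apply/funext => y; rewrite mxE.
apply: ctsM; first exact: cts_enorm.
have cr : {for x, continuous (fun y : 'rV[R]_n.+1 => radial (behead_rV y))}.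
  by apply: (@continuous_comp _ _ _ (@behead_rV R n) (@radial R n));
    [exact: cts_behead|exact: continuous_radial].
by apply: (@continuous_comp _ _ _ _ (fun z : 'rV[R]_n => z ord0 i) _ cr); exact: cts_coor.
Qed.

(** Continuity at the points of the axis holds because the sine of the
    colatitude vanishes there while the map is bounded. *)
Lemma within_continuous_extv (w : 'rV[R]_n -> 'rV[R]_n) :
  {within @closed_collar R n, continuous w} ->
  {within @closed_collar R n.+1, continuous (extv w)}.
Proof.
move=> cw; have [M M0 wM] := closed_collar_bounded cw.
apply/subspace_continuousP => x cx.
have x0 : x != 0.
  by rewrite -enorm_gt0; case/andP : cx => + _; apply: lt_le_trans; rewrite invr_gt0.
have FF : Filter (within (@closed_collar R n.+1) (nbhs x)) by exact: within_filter.
have toW (h : 'rV[R]_n.+1 -> R) : {for x, continuous h} ->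
    h @ within (@closed_collar R n.+1) (nbhs x) --> h x.
  move=> ch A /ch hA.
  suff : nbhs x (fun y => closed_collar y -> A (h y)) by [].
  have {}hA : nbhs x (fun y => A (h y)) by exact: hA.
  by apply: filterS hA.
apply: cvg_rV => i; have [j ->|->] := unliftP ord0 i; last first.
  have -> : (fun y => extv w y ord0 ord0) = @colat_cos R n.
    by apply/funext => y; rewrite cons_rV0.
  rewrite cons_rV0/=.
  exact: (toW _ (cts_colat_cos x0)).
have -> : (fun y => extv w y ord0 (lift ord0 j)) = (fun y => colat_sin y * w (unpolar y) ord0 j).
  by apply/funext => y; rewrite cons_rV_lift/= mxE.
have -> : extv w x ord0 (lift ord0 j) = colat_sin x * w (unpolar x) ord0 j.
  by rewrite cons_rV_lift/= mxE.
have cs := cts_colat_sin x0.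
have [y0|y0] := eqVneq (behead_rV x) 0.
  have s0 : colat_sin x = 0 by rewrite /colat_sin y0 enorm0 mul0r.
  rewrite s0 mul0r => A /nbhs_ballP[e /= e0 eA].
  have e1 : 0 < e / (M + 1) by rewrite divr_gt0// ltr_wpDl.
  have : nbhs x (fun y => ball (colat_sin x) (e / (M + 1)) (colat_sin y)).
    by apply: cs; exact: nbhsx_ballx.
  suff S y : ball (colat_sin x) (e / (M + 1)) (colat_sin y) -> closed_collar y ->
    A (colat_sin y * w (unpolar y) ord0 j) by apply: filterS.
  rewrite s0 /ball/= sub0r normrN => sy cy; apply: eA; rewrite /ball/= sub0r normrN normrM.
  have [yy0|yy0] := eqVneq (behead_rV y) 0.
    by rewrite /colat_sin yy0 enorm0 mul0r normr0 mul0r.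
  have wy : `|w (unpolar y) ord0 j| <= M.
    by apply: wM; rewrite /closed_collar/= enorm_unpolar.
  apply: (@le_lt_trans _ _ (`|colat_sin y| * M)); first by rewrite ler_wpM2l.
  have M1 : 0 < M + 1 by rewrite ltr_wpDl.
  apply: (@le_lt_trans _ _ (`|colat_sin y| * (M + 1))); first by rewrite ler_wpM2l// lerDl.
  by rewrite -ltr_pdivlMr.
have c1 := toW _ cs.
have c2 : (fun y => w (unpolar y) ord0 j) @ within (@closed_collar R n.+1) (nbhs x) -->
    w (unpolar x) ord0 j.
  have uc : closed_collar (unpolar x) by rewrite /closed_collar/= enorm_unpolar.
  have cwj : (fun z => w z ord0 j) @ within (@closed_collar R n) (nbhs (unpolar x)) -->
      w (unpolar x) ord0 j.
    have /subspace_continuousP/(_ _ uc) h := cw.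
    by move=> A hA; exact: (h _ (@cts_coor R n j (w (unpolar x)) A hA)).
  move=> A /cwj; rewrite /within/= /nbhs/= => hA.
  have : nbhs x (fun y => closed_collar (unpolar y) -> A (w (unpolar y) ord0 j)).
    exact: (cts_unpolar y0 hA).
  have : nbhs x (fun y => 0 < enorm (behead_rV y)).
    have h0 : nbhs (enorm (behead_rV x)) (fun r : R => 0 < r).
      by apply: open_nbhs_nbhs; split; [exact: open_gt|rewrite /= enorm_gt0].
    exact: (@cts_enorm_behead x _ h0).
  apply: filterS2 => y; rewrite enorm_gt0 => yy0 H cy; apply: H.
  by rewrite /closed_collar/= enorm_unpolar.
exact: (cvgM c1 c2).
Qed.

End continuous_extension.

(** * Trace of the suspension *)

Section extended_trace.
Context {R : realType} (n : nat).
Local Notation mu := (@lebesgue_rV R).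
Local Notation col := (@collar R n).
Local Notation col' := (@collar R n.+1).
Hypothesis n1 : (1 < n)%N.
Variable p : R.
Hypothesis p1 : 1 <= p.
Implicit Types (w v : 'rV[R]_n -> 'rV[R]_n) (G : 'rV[R]_n -> 'M[R]_n).

Let p0 : 0 <= p. Proof. exact: le_trans p1. Qed.

Let two0 : (0 : R) < 2^-1. Proof. by rewrite invr_gt0. Qed.

Lemma le_add_of_sqr (x a b : R) : 0 <= x -> 0 <= a -> 0 <= b ->
  x ^+ 2 <= a ^+ 2 + b ^+ 2 -> x <= a + b.
Proof.
move=> x0 a0 b0 h; rewrite -(ler_pXn2r (n := 2))// ?nnegrE ?addr_ge0//.
by apply: le_trans h _; rewrite sqrrD lerD2r lerDl mulrn_wge0// mulr_ge0.
Qed.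

Lemma measurable_collar m : measurable (@collar R m).
Proof. by rewrite collarE; exact: measurable_annulus. Qed.

Lemma le_integral_collar (F : 'rV[R]_n.+1 -> R) (h1 h2 : 'rV[R]_n -> R) :
  measurable_fun col' F -> measurable_fun col h1 -> measurable_fun col h2 ->
  (forall x, 0 <= F x) -> (forall z, 0 <= h1 z) -> (forall z, 0 <= h2 z) ->
  {ae mu n.+1, forall x, col' x -> behead_rV x != 0 -> col (unpolar x) ->
    F x <= h1 (unpolar x) + h2 (unpolar x)} ->
  (\int[mu n.+1]_(x in col') (F x)%:E <= (kap_int n.+1)%:E *
    (\int[mu n]_(z in col) (h1 z)%:E + \int[mu n]_(z in col) (h2 z)%:E))%E.
Proof.
move=> mF mh1 mh2 F0 h10 h20 H; have mc := @measurable_collar n.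
apply: (@le_trans _ _ ((kap_int n.+1)%:E *
   \int[mu n]_(z in col) (enorm z * (h1 z + h2 z))%:E)%E).
  move: mF mh1 mh2 H; rewrite !collarE => mF mh1 mh2 H.
  apply: (@le_integral_unpolar R n n1 2^-1 1 _ (fun z => h1 z + h2 z)) => //.
    exact: measurable_funD.
  by move=> z; rewrite addr_ge0.
rewrite lee_wpmul2l ?lee_fin ?(ltW (kap_int_gt0 _)) ?ltnS 1?ltnW//.
rewrite -ge0_integralD//; first last.
- exact/measurable_EFinP.
- by move=> z _; rewrite lee_fin.
- exact/measurable_EFinP.
- by move=> z _; rewrite lee_fin.
apply: ge0_le_integral => //.
- by move=> z _; rewrite lee_fin mulr_ge0 ?enorm_ge0 ?addr_ge0.
- apply/measurable_EFinP; apply: measurable_funM.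
    by apply: measurable_funTS; exact: measurable_enorm.
  exact: measurable_funD.
- by apply/measurable_EFinP; exact: measurable_funD.
move=> z /andP[_ z1]; rewrite -EFinD lee_fin ler_piMl ?addr_ge0// ltW//.
Qed.

Lemma weak_gradient_collar_extv w : weakly_differentiable col w ->
  weak_gradient col' (extv w) (extv_grad w (wgrad col w)).
Proof.
move=> dw; have := weak_gradient_wgrad dw; rewrite !collarE.
by apply: weak_gradient_extv => //; rewrite invf_lt1// ltr1n.
Qed.

Lemma enorm_extv_le w x : enorm (extv w x) <= 1 + enorm (w (unpolar x)).
Proof.
apply: le_add_of_sqr; rewrite ?enorm_ge0//. rewrite enorm_cons/= enormZ [X in _ + X <= _]exprMn.
apply: lerD; last by rewrite ler_piMl ?sqr_ge0// expr_le1// colat_sin_le1.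
by rewrite -real_normK ?num_real// expr1n expr_le1// colat_cos_le1.
Qed.

Lemma collar_inv_le m (z : 'rV[R]_m) : collar z -> 0 < (enorm z)^-1 <= 2.
Proof.
move=> /andP[zl _]; have z0 : 0 < enorm z by apply: lt_trans zl.
by rewrite invr_gt0 z0 -[2]invrK lef_pV2 ?posrE// ltW.
Qed.

Lemma sobolev_collar_extv w : sobolev col p w -> sobolev col' p (extv w).
Proof.
move=> [mw Iw dw IG]; have HG := weak_gradient_wgrad dw.
have HE := weak_gradient_collar_extv dw.
have oc : open col' by rewrite collarE; exact: open_annulus.
have mE : measurable_fun col' (extv w).
  by move: mw; rewrite !collarE; apply: measurable_extv; exact: ltW.
have C0 : 0 < kap_int (R := R) n.+1 by apply: kap_int_gt0; rewrite ltnS ltnW.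
have mwp : measurable_fun col (fun z => enorm (w z) `^ p).
  by apply: measurable_powR_comp; apply: measurable_enorm_comp => j; exact: weak_gradient_measurable_u HG.
have mGp : measurable_fun col (fun z => mxnorm2 (wgrad col w z) `^ p).
  by apply: measurable_powR_comp; apply: measurable_mxnorm2 => i j; exact: weak_gradient_measurable HG.
have mEj j : measurable_fun col' (fun x => extv w x ord0 j) by exact: weak_gradient_measurable_u HE.
have mc := @measurable_collar n.
have lin (c : R) (h : 'rV[R]_n -> R) : 0 <= c -> measurable_fun col h -> (forall z, 0 <= h z) ->
    (\int[mu n]_(z in col) (h z)%:E < +oo)%E -> (\int[mu n]_(z in col) (c * h z)%:E < +oo)%E.
  move=> c0 mh h0 Ih; under eq_integral do rewrite EFinM.
  rewrite ge0_integralZl_EFin//; first by rewrite lte_mul_pinfty// ge0_fin_numE ?lee_fin.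
    by move=> z _; rewrite lee_fin.
  exact/measurable_EFinP.
have c1 (c : R) : 0 <= c -> (\int[mu n]_(z in col) c%:E < +oo)%E.
  by move=> c0; rewrite integral_cst// lte_mul_pinfty// ?lee_fin// lebesgue_collar ?(ltnW n1).
have P2 : (0 : R) <= 2 `^ p := powR_ge0 2 p.
split=> //; last 2 first.
- by exists (extv_grad w (wgrad col w)).
- rewrite (integral_wgrad oc (F := fun x A => mxnorm2 A `^ p) HE); last 2 first.
  + by move=> x A; exact: powR_ge0.
  + by move=> H mH; apply: measurable_powR_comp; exact: measurable_mxnorm2.
  pose h1 z := 2 `^ p * (2 `^ p * mxnorm2 (wgrad col w z) `^ p) : R.
  pose h2 z := 2 `^ p * (2 `^ p * (2 `^ p * (enorm (w z) `^ p + 1))) : R.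
  apply: (@le_lt_trans _ _ ((kap_int n.+1)%:E *
    (\int[mu n]_(z in col) (h1 z)%:E + \int[mu n]_(z in col) (h2 z)%:E))%E).
    apply: le_integral_collar.
    + by apply: measurable_powR_comp; apply: measurable_mxnorm2 => i j; exact: weak_gradient_measurable HE.
    + by apply: measurable_funM => //; apply: measurable_funM.
    + by do 3 (apply: measurable_funM => //); apply: measurable_funD.
    + by move=> x; exact: powR_ge0.
    + by move=> z; rewrite !mulr_ge0 ?powR_ge0.
    + by move=> z; rewrite !mulr_ge0 ?addr_ge0 ?powR_ge0.
    apply: aeW => x _ y0 cz; rewrite /h1 /h2.
    set g := mxnorm2 (wgrad _ _ _); set e := enorm (w _).
    have g0 : 0 <= g by exact: mxnorm2_ge0.
    have e0 : 0 <= e by exact: enorm_ge0.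
    have b : mxnorm2 (extv_grad w (wgrad col w) x) <= g + 2 * (e + 1).
      have /andP[i0 i2] := collar_inv_le cz.
      apply: le_add_of_sqr; rewrite ?mxnorm2_ge0 ?mulr_ge0 ?addr_ge0//.
      rewrite sum_cols; under eq_bigr => i _ do rewrite mxE unlift_none.
      rewrite sqr_sum_radial_grad0//; apply: le_trans (lerD (lexx _) (sum_ext_cols _ _ y0)) _.
      rewrite addrCA lerD2l -(enorm_unpolar y0) -/e.
      have s1 : colat_sin x ^+ 2 <= 1 by rewrite -real_normK ?num_real// expr_le1// colat_sin_le1.
      have k1 : colat_cos x ^+ 2 <= 1 by rewrite -real_normK ?num_real// expr_le1// colat_cos_le1.
      move: (enorm (unpolar x))^-1 i0 i2 => r r0 r2; rewrite exprMn.
      have r4 : r ^+ 2 <= 4 by rewrite -[4](_ : 2 ^+ 2 = 4); [rewrite lerXn2r ?nnegrE// ltW|rewrite -natrX].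
      apply: (@le_trans _ _ (4 + e ^+ 2 * 4)).
        apply: lerD.
          by apply: le_trans (ler_piMl (sqr_ge0 _) s1) _.
        apply: le_trans (ler_piMl (sqr_ge0 _) k1) _; rewrite exprMn ler_wpM2l ?sqr_ge0//.
      have -> : (2 * (e + 1)) ^+ 2 = 4 + e ^+ 2 * 4 + 8 * e by ring.
      by rewrite lerDl mulr_ge0.
    apply: (@le_trans _ _ ((g + 2 * (e + 1)) `^ p)).
      by apply: ge0_ler_powR; rewrite ?nnegrE ?mxnorm2_ge0 ?addr_ge0 ?mulr_ge0 ?addr_ge0.
    apply: le_trans (powR_sum2 p0 g0 _) _; first by rewrite mulr_ge0// addr_ge0.
    rewrite mulrDr; apply: lerD; rewrite ler_wpM2l ?powR_ge0//.
      by rewrite ler_peMl ?powR_ge0// -[leLHS](powRr0 2) ler_powR// ler1n.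
    rewrite powRM ?addr_ge0// ler_wpM2l ?powR_ge0//.
    by apply: le_trans (powR_sum2 p0 e0 ler01) _; rewrite powR1.
  apply: lte_mul_pinfty; [by rewrite lee_fin ltW|by []|apply: lte_add_pinfty].
    have a1 := lin _ _ P2 mGp (fun z => powR_ge0 _ _) IG.
    apply: (lin _ _ P2 _ _ a1); first exact: measurable_funM.
    by move=> z; rewrite mulr_ge0 ?powR_ge0.
  have a0 : (\int[mu n]_(z in col) (enorm (w z) `^ p + 1)%:E < +oo)%E.
    have E := @ge0_integralD _ _ _ (mu n) _ mc (fun z => (enorm (w z) `^ p)%:E) (fun=> 1%:E)
      (fun z _ => powR_ge0 _ _) (proj2 (measurable_EFinP _ _) mwp) (fun z _ => ler01)
      (measurable_cst _).
    apply: le_lt_trans (lte_add_pinfty Iw (c1 1 ler01)); rewrite -E.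
    exact: lexx.
  have m0 : measurable_fun col (fun z => enorm (w z) `^ p + 1) by exact: measurable_funD.
  have a1 := lin _ _ P2 m0 (fun z => addr_ge0 (powR_ge0 _ _) ler01) a0.
  have m1 : measurable_fun col (fun z => 2 `^ p * (enorm (w z) `^ p + 1)) by exact: measurable_funM.
  have q1 z : 0 <= 2 `^ p * (enorm (w z) `^ p + 1) by rewrite mulr_ge0 ?addr_ge0 ?powR_ge0.
  have a2 := lin _ _ P2 m1 q1 a1.
  apply: (lin _ _ P2 _ _ a2); first exact: measurable_funM.
  by move=> z; rewrite mulr_ge0.
pose h1 z := 2 `^ p * enorm (w z) `^ p : R.
apply: (@le_lt_trans _ _ ((kap_int n.+1)%:E *
    (\int[mu n]_(z in col) (h1 z)%:E + \int[mu n]_(z in col) (2 `^ p)%:E))%E).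
  apply: le_integral_collar => //.
  + by apply: measurable_powR_comp; exact: measurable_enorm_comp.
  + by apply: measurable_funM.
  + by move=> x; exact: powR_ge0.
  + by move=> z; rewrite !mulr_ge0 ?powR_ge0.
  apply: aeW => x _ y0 cz; rewrite /h1.
  apply: (@le_trans _ _ ((enorm (w (unpolar x)) + 1) `^ p)).
    by apply: ge0_ler_powR; rewrite ?nnegrE ?enorm_ge0 ?addr_ge0 ?enorm_ge0// addrC enorm_extv_le.
  by apply: le_trans (powR_sum2 p0 (enorm_ge0 _) ler01) _; rewrite powR1 mulrDr mulr1.
apply: lte_mul_pinfty; [by rewrite lee_fin ltW|by []|apply: lte_add_pinfty].
  exact: (lin _ _ P2 mwp (fun z => powR_ge0 _ _) Iw).
exact: (c1 _ P2).
Qed.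

Lemma squeeze_collar (a b c : nat -> \bar R) (k : R) : 0 <= k ->
  (forall i, (0 <= a i)%E) -> (forall i, (a i <= k%:E * (b i + c i))%E) ->
  b i @[i --> \oo] --> 0%E -> c i @[i --> \oo] --> 0%E -> a i @[i --> \oo] --> 0%E.
Proof.
move=> k0 a0 ab b0 c0.
apply: (@squeeze_cvge _ _ _ _ (cst 0%E) a (fun i => k%:E * (b i + c i))%E).
- by apply: nearW => i; rewrite a0 ab.
- exact: cvg_cst.
- rewrite -[X in _ --> X](mule0 k%:E); apply: cvgeZl => //.
  by rewrite -[X in _ --> X](adde0 0%E); apply: cvgeD.
Qed.

Lemma has_trace_extv v : measurable_fun (@ball_rV R n) v ->
  weakly_differentiable (@punctured_ball R n) v ->
  has_trace p v id -> has_trace p (extv v) id.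
Proof.
move=> mv dv [w [Hw Lw Gw Sw]]; exists (fun k => extv (w k)).
have HG := weak_gradient_wgrad dv.
have C0 : 0 < kap_int (R := R) n.+1 by apply: kap_int_gt0; rewrite ltnS ltnW.
have dw k : weakly_differentiable col (w k) by have [_ []] := Hw k.
have cb m : @collar R m `<=` @punctured_ball R m.
  by rewrite punctured_ballE => x /andP[h x1]; apply/andP; split=> //; apply: lt_trans h.
have mvc : measurable_fun col v.
  apply: measurable_funS mv; first exact: measurable_ball_rV.
  by move=> z /andP[].
have HV : weak_gradient (@punctured_ball R n.+1) (extv v) (extv_grad v (wgrad (@punctured_ball R n) v)).
  by rewrite punctured_ballE; apply: weak_gradient_extv => //; rewrite -punctured_ballE.
have mwv k : measurable_fun col (fun z => enorm (w k z - v z) `^ p).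
  apply: measurable_powR_comp; apply: measurable_enorm_comp => j.
  rewrite (_ : (fun x => _) = (fun x => w k x ord0 j - v x ord0 j)); last by apply/funext => z; rewrite !mxE.
  apply: measurable_funB; first exact: weak_gradient_measurable_u (weak_gradient_wgrad (dw k)).
  exact: measurableT_comp (@measurable_coor R n j) mvc.
have mGG k : measurable_fun col (fun z => mxnorm2 (wgrad col (w k) z - wgrad (@punctured_ball R n) v z) `^ p).
  apply: measurable_powR_comp; apply: measurable_mxnorm2 => i j.
  rewrite (_ : (fun x => _) = (fun x => wgrad col (w k) x i j - wgrad (@punctured_ball R n) v x i j));
    last by apply/funext => z; rewrite !mxE.
  apply: measurable_funB; first exact: weak_gradient_measurable (weak_gradient_wgrad (dw k)).
  apply: (measurable_funS _ (@cb n)); first exact: measurable_punctured_ball.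
  exact: weak_gradient_measurable HG.
split.
- move=> k; have [cw sw] := Hw k; split; first exact: within_continuous_extv.
  exact: sobolev_collar_extv.
- apply: (squeeze_collar (ltW C0) _ _ Lw (cvg_cst 0%E)) => k.
    by apply: integral_ge0 => x _; rewrite lee_fin powR_ge0.
  rewrite -[0%E](integral0 (mu n) col); apply: (le_integral_collar (h2 := fun=> 0)) => //.
  + apply: measurable_powR_comp; apply: measurable_enorm_comp => j.
    rewrite (_ : (fun x => _) = (fun x => extv (w k) x ord0 j - extv v x ord0 j)); last by apply/funext => z; rewrite !mxE.
    apply: measurable_funB; first exact: weak_gradient_measurable_u (weak_gradient_collar_extv (dw k)).
    apply: (measurable_funS _ (@cb n.+1)); first exact: measurable_punctured_ball.
    exact: weak_gradient_measurable_u HV.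
  + by move=> x; exact: powR_ge0.
  + by move=> x; exact: powR_ge0.
  apply: aeW => x _ y0 _; rewrite addr0.
  by apply: ge0_ler_powR; rewrite ?nnegrE ?enorm_ge0 ?enorm_extvB.
- pose K : R := 2 `^ p * (2 `^ p).
  have K0 : 0 <= K by rewrite mulr_ge0 ?powR_ge0.
  apply: (squeeze_collar (mulr_ge0 (ltW C0) K0) _ _ Gw Lw) => k.
    by apply: integral_ge0 => x _; rewrite lee_fin powR_ge0.
  rewrite EFinM -muleA.
  have lin (h : 'rV[R]_n -> R) : measurable_fun col h -> (forall z, 0 <= h z) ->
      (\int[mu n]_(z in col) (K * h z)%:E = K%:E * \int[mu n]_(z in col) (h z)%:E)%E.
    move=> mh h0; under eq_integral do rewrite EFinM.
    rewrite ge0_integralZl_EFin//; first exact: measurable_collar.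
      by move=> z _; rewrite lee_fin.
    exact/measurable_EFinP.
  rewrite ge0_muleDr; last 2 first.
  + by apply: integral_ge0 => x _; rewrite lee_fin powR_ge0.
  + by apply: integral_ge0 => x _; rewrite lee_fin powR_ge0.
  have L1 := lin _ (mGG k) (fun z => powR_ge0 _ _).
  have L2 := lin _ (mwv k) (fun z => powR_ge0 _ _).
  rewrite -[X in (_ <= _ * (X + _))%E]L1 -[X in (_ <= _ * (_ + X))%E]L2.
  apply: le_integral_collar.
  + apply: measurable_powR_comp; apply: measurable_mxnorm2 => i j.
    rewrite (_ : (fun x => _) = (fun x => wgrad col' (extv (w k)) x i j -
      wgrad (@punctured_ball R n.+1) (extv v) x i j)); last by apply/funext => z; rewrite !mxE.
    apply: measurable_funB.
      have HE : weakly_differentiable col' (extv (w k)).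
        by exists (extv_grad (w k) (wgrad col (w k))); exact: weak_gradient_collar_extv.
      exact: weak_gradient_measurable (weak_gradient_wgrad HE).
    apply: (measurable_funS _ (@cb n.+1)); first exact: measurable_punctured_ball.
    have HE : weakly_differentiable (@punctured_ball R n.+1) (extv v).
      by exists (extv_grad v (wgrad (@punctured_ball R n) v)).
    exact: weak_gradient_measurable (weak_gradient_wgrad HE).
  + exact: measurable_funM.
  + exact: measurable_funM.
  + by move=> x; exact: powR_ge0.
  + by move=> x; rewrite mulr_ge0 ?powR_ge0.
  + by move=> x; rewrite mulr_ge0 ?powR_ge0.
  have oc : open col' by rewrite collarE; exact: open_annulus.
  have A1 := wgrad_ae oc (weak_gradient_collar_extv (dw k)).
  have A2 := wgrad_ae (@open_punctured_ball R n.+1) HV.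
  apply: filterS2 A1 A2 => x A1 A2 cx y0 cz.
  rewrite (A1 cx) (A2 (cb _ _ cx)).
  set g := mxnorm2 (wgrad _ _ _ - _); set e := enorm (_ - _).
  have g0 : 0 <= g by exact: mxnorm2_ge0.
  have e0 : 0 <= e by exact: enorm_ge0.
  have /andP[i0 i2] := collar_inv_le cz.
  have b : mxnorm2 (extv_grad (w k) (wgrad col (w k)) x - extv_grad v (wgrad (@punctured_ball R n) v) x)
      <= g + 2 * e.
    apply: le_trans (_ : _ <= g + e / enorm (unpolar x)) _; last by rewrite lerD2l mulrC ler_wpM2r.
    apply: le_add_of_sqr; rewrite ?mxnorm2_ge0 ?mulr_ge0 ?(ltW i0)//.
    exact: mxnorm2_extv_gradB.
  apply: (@le_trans _ _ ((g + 2 * e) `^ p)).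
    by apply: ge0_ler_powR; rewrite ?nnegrE ?mxnorm2_ge0 ?addr_ge0 ?mulr_ge0.
  apply: le_trans (powR_sum2 p0 g0 _) _; first by rewrite mulr_ge0.
  rewrite powRM// mulrDr /K; apply: lerD; last by rewrite mulrA.
  rewrite ler_wpM2r ?powR_ge0// ler_peMr ?powR_ge0//.
  by rewrite -[leLHS](powRr0 2) ler_powR// ler1n.
- have cS m : @sphere_rV R m `<=` @closed_collar R m.
    by move=> x sx; rewrite /closed_collar/= sx lexx invf_le1// ler1n.
  have cl m : closed (@sphere_rV R m).
    rewrite (_ : @sphere_rV R m = @enorm R m @^-1` [set 1]) //.
    by apply: closed_comp; [move=> x _; exact: continuous_enorm|exact: closed_eq].
  have mS m (u : 'rV[R]_m -> 'rV[R]_m) : {within @closed_collar R m, continuous u} ->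
      measurable_fun (@sphere_rV R m) (fun x => enorm (u x - x) `^ p).
    move=> cu; apply: measurable_powR_comp; apply: measurable_enorm_comp => j.
    rewrite (_ : (fun x => _) = (fun x => u x ord0 j - x ord0 j)); last by apply/funext => z; rewrite !mxE.
    apply: measurable_funB; last by apply: measurable_funTS; exact: measurable_coor.
    apply: measurable_within_continuous => //.
    have cu' := continuous_subspaceW (@cS m) cu.
    by move=> x; apply: (@continuous_comp _ _ _ _ (fun z : 'rV[R]_m => z ord0 j) _ (cu' x)); exact: cts_coor.
  pose K : R := n.+1%:R * kap_int n.+1 / n%:R.
  have K0 : 0 <= K by rewrite !mulr_ge0 ?invr_ge0 ?(ltW C0).
  apply: (squeeze_collar K0 _ _ Sw (cvg_cst 0%E)) => k.
    by apply: integral_ge0 => x _; rewrite lee_fin powR_ge0.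
  have [cw _] := Hw k.
  have m1 := mS _ _ cw; have m2 := mS _ _ (within_continuous_extv cw).
  rewrite adde0 (surface_integralE _ m1) ?(ltnW n1)//; last by move=> x; exact: powR_ge0.
  rewrite (surface_integralE _ m2)//; last by move=> x; exact: powR_ge0.
  rewrite muleA -EFinM /K mulfVK ?pnatr_eq0 -?lt0n ?(ltnW n1)// EFinM -muleA.
  rewrite lee_wpmul2l ?lee_fin//.
  have mr m (F : 'rV[R]_m -> R) : measurable_fun (@sphere_rV R m) F ->
      measurable_fun (@punctured_ball R m) (fun z => F (radial z)).
    move=> mF; apply: (measurable_comp (F := @sphere_rV R m)) => //.
    + exact: closed_measurable_rV.
    + by move=> _ [z [_ z0] <-]; apply: enorm_radial; exact/eqP.
    + by apply: measurable_funTS; exact: measurable_radial.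
  have := mr _ _ m1; have := mr _ _ m2.
  rewrite !punctured_ballE => m2' m1'; have mA := @measurable_annulus R n 0 1.
  apply: (@le_trans _ _ ((kap_int n.+1)%:E * \int[mu n]_(z in annulus 0%R 1%R)
     (enorm z * enorm (w k (radial z) - radial z) `^ p)%:E)%E).
    apply: (@le_integral_unpolar R n n1 0 1 _ (fun z => enorm (w k (radial z) - radial z) `^ p)) => //.
    + by move=> x; exact: powR_ge0.
    + by move=> x; exact: powR_ge0.
    apply: aeW => x _ y0 _; apply: ge0_ler_powR; rewrite ?nnegrE ?enorm_ge0//.
    have x0 := behead_neq0 y0.
    have br : behead_rV (radial x) = (enorm x)^-1 *: behead_rV x.
      by apply/rowP => i; rewrite !mxE.
    have i0 : 0 < (enorm x)^-1 by rewrite invr_gt0 enorm_gt0.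
    have br0 : behead_rV (radial x) != 0 by rewrite br scaler_eq0 negb_or gt_eqF.
    have ur : unpolar (radial x) = radial (unpolar x).
      have rr : radial (radial (behead_rV x)) = radial (behead_rV x).
        by rewrite {1}/radial enorm_radial// invr1 scale1r.
      by rewrite /unpolar br (radialZ _ i0) enorm_radial// scale1r radialZ ?enorm_gt0// rr.
    have er : radial x = extv id (radial x).
      apply/rowP => i; have [j ->|->] := unliftP ord0 i.
        rewrite cons_rV_lift/= /colat_sin !enorm_radial// /unpolar enorm_radial// invr1 mulr1 scale1r.
        by rewrite enorm_scale_radial !mxE.
      by rewrite cons_rV0/= /colat_cos enorm_radial// invr1 mulr1.
    by rewrite {2}er -ur; exact: enorm_extvB.
  rewrite lee_wpmul2l ?lee_fin ?(ltW C0)//; apply: ge0_le_integral => //.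
  + by move=> z _; rewrite lee_fin mulr_ge0 ?enorm_ge0 ?powR_ge0.
  + apply/measurable_EFinP; apply: measurable_funM => //.
    by apply: measurable_funTS; exact: measurable_enorm.
  + exact/measurable_EFinP.
  by move=> z /andP[_ z1]; rewrite lee_fin ler_piMl ?powR_ge0// ltW.
Qed.

End extended_trace.

(** * Lines parallel to an axis *)

Section lines.
Context {R : realType} (m : nat) (e : 'rV[R]_m).
Local Notation leb := (@lebesgue_measure R).
Local Notation mu := (@lebesgue_rV R m).
Local Notation lm := (leb \x mu)%E.
Local Notation P := (measurableTypeR R * 'rV[R]_m)%type.

Lemma measurable_along_line d (T : measurableType d) (g : 'rV[R]_m -> T) : measurable_fun setT g ->
  measurable_fun setT (fun w : P => g (w.2 + w.1 *: e)).
Proof.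
move=> mg; apply: (measurableT_comp mg); apply: measurable_fun_rVP => i.
under eq_fun do rewrite !mxE.
apply: measurable_funD; first exact: measurableT_comp (@measurable_coor R m i) measurable_snd.
by apply: measurable_funM => //; exact: measurable_fst.
Qed.

Lemma ge0_integral_along_line (k : R -> \bar R) (g : 'rV[R]_m -> \bar R) :
  measurable_fun setT k -> (forall s, 0 <= k s)%E ->
  measurable_fun setT g -> (forall x, 0 <= g x)%E ->
  (\int[lm]_w (k w.1 * g (w.2 + w.1 *: e)%R) = \int[leb]_s k s * \int[mu]_x g x)%E.
Proof.
move=> mk k0 mg g0.
rewrite fubini_tonelli1/=; last 2 first.
- apply: emeasurable_funM; first exact: measurableT_comp mk measurable_fst.
  exact: measurable_along_line.
- by move=> w; rewrite mule_ge0.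
rewrite /fubini_F/=.
have mgs (s : R) : measurable_fun setT (fun x : 'rV[R]_m => g (x + s *: e)).
  exact: (measurableT_comp (measurable_along_line mg) (measurable_pair1 (s : measurableTypeR R))).
have E (s : R) : (\int[mu]_x (k s * g (x + s *: e)%R) = k s * \int[mu]_x g x)%E.
  by rewrite ge0_integralZl// (integral_translate _ mg).
under eq_integral do rewrite E.
by rewrite ge0_integralZr//; exact: integral_ge0.
Qed.

Lemma ae_line (Q : 'rV[R]_m -> Prop) : {ae mu, forall y, Q y} ->
  {ae mu, forall x, {ae leb, forall s, Q (x + s *: e)}}.
Proof.
move=> [N [mN N0 QN]].
pose h (y : 'rV[R]_m) : \bar R := (\1_N y : R)%:E.
have mh : measurable_fun setT h by apply/measurable_EFinP; exact: measurable_indic.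
have h0 y : (0 <= h y)%E by rewrite lee_fin.
have H : (\int[lm]_w h (w.2 + w.1 *: e)%R = 0)%E.
  have := @ge0_integral_along_line (fun=> 1%E) h (measurable_cst _) (fun=> lee01) mh h0.
  under eq_integral do rewrite mul1e.
  move=> ->; rewrite (_ : (\int[mu]_x h x)%E = 0%E) ?mule0//.
  by rewrite integral_indic// setIT.
have ml := measurable_along_line mh.
move: H; rewrite fubini_tonelli2//= => H.
have /(ae_eq_integral_abs mu measurableT) : measurable_fun setT
    (fun x : 'rV[R]_m => \int[leb]_s h (x + s *: e)%R)%E.
  exact: (@measurable_fun_fubini_tonelli_G _ _ _ _ R leb (fun w : P => h (w.2 + w.1 *: e))).
move=> [+ _].
have -> : (\int[mu]_x `|\int[leb]_s h (x + s *: e)%R| = 0)%E.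
  rewrite -[RHS]H; apply: eq_integral => x _; rewrite gee0_abs//; exact: integral_ge0.
move=> /(_ erefl); apply: filterS => x /(_ I) Hx.
have mhx : measurable_fun setT (fun s : R => h (x + s *: e)).
  exact: (measurableT_comp ml (measurable_pair2 x)).
have [+ _] := ae_eq_integral_abs leb measurableT mhx.
have -> : (\int[leb]_s `|h (x + s *: e)%R| = 0)%E.
  by rewrite -[RHS]Hx; apply: eq_integral => s _; rewrite gee0_abs.
move=> /(_ erefl); apply: filterS => s /(_ I) hs; apply: contrapT => /QN Nx.
by move: hs; rewrite /h indicE mem_set//= => -[] /eqP; rewrite oner_eq0.
Qed.

Lemma ae_of_lines (g : 'rV[R]_m -> R) : measurable_fun setT g ->
  {ae mu, forall x, {ae leb, forall s, 0 <= s <= 1 -> g (x + s *: e) = 0}} ->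
  {ae mu, forall x, g x = 0}.
Proof.
move=> mg H.
pose k s : \bar R := (\1_(`[0%R, 1%R]%classic : set R) s : R)%:E.
have mk : measurable_fun setT k by apply/measurable_EFinP; exact: measurable_indic.
have k0 s : (0 <= k s)%E by rewrite lee_fin.
have mag : measurable_fun setT (fun x => `|g x|%:E).
  by apply/measurable_EFinP; exact: measurableT_comp.
have ag0 x : (0 <= `|g x|%:E)%E by rewrite lee_fin.
have := ge0_integral_along_line mk k0 mag ag0.
have -> : (\int[leb]_s k s = 1)%E.
  have E := @lebesgue_measure_itv R `[0, 1]; rewrite /= lte_fin ltr01 oppr0 adde0 in E.
  by rewrite integral_indic// setIT; exact: E.
rewrite mul1e.
have mF : measurable_fun setT (fun w : P => k w.1 * `|g (w.2 + w.1 *: e)|%:E)%E.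
  apply: emeasurable_funM; first exact: measurableT_comp mk measurable_fst.
  exact: (measurable_along_line mag).
rewrite fubini_tonelli2//; last by move=> w; rewrite mule_ge0.
have -> : (\int[mu]_y fubini_G leb (fun w : P => k w.1 * `|g (w.2 + w.1 *: e)|%:E) y = 0)%E.
  rewrite -[RHS](integral0 mu setT); apply: ge0_ae_eq_integral => //.
  - apply: (@measurable_fun_fubini_tonelli_G _ _ _ _ R leb (fun w : P => k w.1 * `|g (w.2 + w.1 *: e)|%:E)%E) => //.
    by move=> w; rewrite mule_ge0.
  - by move=> y _; apply: integral_ge0 => s _; rewrite mule_ge0.
  apply: filterS H => x Hx _; rewrite /fubini_G/=.
  rewrite -[RHS](integral0 leb setT); apply: ge0_ae_eq_integral => //.
  - exact: (measurableT_comp mF (measurable_pair2 x)).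
  - by move=> s _; rewrite mule_ge0.
  move: Hx; apply: filterS; first exact: (ae_filter_ringOfSetsType leb).
  move=> s Hs _; rewrite /k indicE.
  have [/set_mem|_] := boolP (s \in _); last by rewrite mul0e.
  by rewrite /= in_itv/= => /Hs ->; rewrite normr0 mule0.
move=> /esym Z; have mEg : measurable_fun setT (EFin \o g) by exact/measurable_EFinP.
have [+ _] := ae_eq_integral_abs mu measurableT mEg.
by move=> /(_ Z); apply: filterS => x /(_ I) [].
Qed.

Lemma integrable_along_line (k : R -> R) (g : 'rV[R]_m -> R) (B : P -> R) (M : R) :
  leb.-integrable setT (EFin \o k) -> mu.-integrable setT (EFin \o g) ->
  measurable_fun setT B -> (forall w, `|B w| <= M) ->
  lm.-integrable setT (EFin \o (fun w => k w.1 * (g (w.2 + w.1 *: e) * B w))).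
Proof.
move=> /integrableP[/measurable_EFinP mk ik] /integrableP[/measurable_EFinP mg ig] mB BM.
have M0 : 0 <= M by apply: le_trans (BM (0, 0)).
have mT : measurable_fun setT (fun w : P => k w.1 * (g (w.2 + w.1 *: e) * B w)).
  apply: measurable_funM; first exact: measurableT_comp mk measurable_fst.
  by apply: measurable_funM => //; exact: measurable_along_line.
apply/integrableP; split; first exact/measurable_EFinP.
have mk' : measurable_fun setT (fun s => `|k s|%:E).
  by apply/measurable_EFinP; exact: measurableT_comp.
have mg' : measurable_fun setT (fun x => (M * `|g x|)%:E).
  by apply/measurable_EFinP; apply: measurable_funM => //; exact: measurableT_comp.
apply: (@le_lt_trans _ _ (\int[lm]_w (`|k w.1|%:E * (M * `|g (w.2 + w.1 *: e)|)%:E))%E).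
  apply: ge0_le_integral => //.
  - by apply: measurableT_comp => //; exact/measurable_EFinP.
  - apply: emeasurable_funM; first exact: measurableT_comp mk' measurable_fst.
    exact: (measurable_along_line mg').
  move=> w _ /=; rewrite -EFinM lee_fin !normrM ler_wpM2l// mulrC ler_wpM2r//.
rewrite (ge0_integral_along_line mk' _ mg')//; last by move=> x; rewrite lee_fin mulr_ge0.
under [X in (_ * X)%E]eq_integral do rewrite EFinM.
rewrite ge0_integralZl_EFin//; last by apply/measurable_EFinP; exact: measurableT_comp.
have J : (0 <= \int[mu]_x `|g x|%:E)%E by apply: integral_ge0.
rewrite lte_mul_pinfty ?integral_ge0// ?ge0_fin_numE ?integral_ge0//.
by rewrite lte_mul_pinfty.
Qed.

End lines.

(** * Differences of a weakly differentiable function along an axis *)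

Lemma continuous_addr {R : realType} m (b : 'rV[R]_m) : continuous (fun x : 'rV[R]_m => x + b).
Proof.
suff H x : {for x, continuous (fun x : 'rV[R]_m => x + b)} by move=> x; exact: H.
apply: cts_rV => j.
have -> : (fun y : 'rV[R]_m => (y + b) ord0 j) = (fun y => y ord0 j + b ord0 j).
  by apply/funext => y; rewrite mxE.
by apply: ctsD; [exact: cts_coor|exact: ctsC].
Qed.

Section difference_along_axis.
Context {R : realType} (m : nat) (i : 'I_m).
Local Notation leb := (@lebesgue_measure R).
Local Notation mu := (@lebesgue_rV R m).
Local Notation lm := (leb \x mu)%E.
Local Notation P := (measurableTypeR R * 'rV[R]_m)%type.
Local Notation e := (basis_rV i : 'rV[R]_m).

Definition step_ind (h : R) : R -> R := \1_(`]0%R, h]%classic : set R).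

Lemma integrable_ind (a b : R) : leb.-integrable setT (EFin \o (\1_(`]a, b]%classic : set R) : R -> R)).
Proof.
apply/integrableP; split; first by apply/measurable_EFinP; exact: measurable_indic.
under eq_integral => s _ do rewrite /= ger0_norm ?indicE//.
have -> : (\int[leb]_s ((s \in `]a, b]%classic)%:R : R)%:E)%E = leb `]a, b]%classic.
  have := @integral_indic _ _ _ leb _ measurableT `]a, b]%classic (measurable_itv _).
  rewrite setIT => <-; apply: eq_integral => s _; by rewrite indicE.
rewrite lebesgue_measure_itv/=; by case: ifP => _; rewrite ?ltry.
Qed.

Lemma is_derive_along_axis (Omega : set 'rV[R]_m) phi (x : 'rV[R]_m) (s : R) : test_function Omega phi ->
  is_derive s 1 (fun t : R => - phi (x - t *: e)) ('D_e phi (x - s *: e)).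
Proof.
move=> tphi; have d1 : is_derive (- s) 1 (fun h : R => phi (h *: e + x)) ('D_e phi (x - s *: e)).
  have E : - s *: e + x = x - s *: e by rewrite scaleNr [RHS]addrC.
  have := test_is_derive tphi i (- s *: e + x).
  by rewrite {2}E; exact: (proj1 (is_derive_line phi x e (- s) _)).
have d2 : is_derive s 1 (fun t : R => - t) (-1) by exact: is_deriveN.
have := is_deriveN (@is_derive_comp1 R R _ _ s 1 _ _ d1 d2).
rewrite mulrN1 opprK.
have -> // : - ((fun h : R => phi (h *: e + x)) \o (fun t => - t)) = (fun t : R => - phi (x - t *: e)).
apply/funext => t; change (- phi (- t *: e + x) = - phi (x - t *: e)).
by rewrite scaleNr [x - _]addrC.
Qed.

Lemma integral_derive_axis (Omega : set 'rV[R]_m) phi (x : 'rV[R]_m) (h : R) : 0 < h ->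
  test_function Omega phi ->
  (\int[leb]_s (step_ind h s * 'D_e phi (x - s *: e))%:E = (phi x - phi (x - h *: e))%:E)%E.
Proof.
move=> h0 tphi.
have cs : continuous (fun s : R => x - s *: e).
  move=> s; apply: cvgB; first exact: cvg_cst.
  by apply: cvgZl; exact: cvg_id.
have cD : continuous (fun s : R => 'D_e phi (x - s *: e)).
  move=> s; apply: (@continuous_comp _ _ _ (fun s : R => x - s *: e) ('D_e phi)); first exact: cs.
  exact: (test_continuous_derive tphi).
have dF (s : R) := is_derive_along_axis x s tphi.
have cF : continuous (fun t : R => - phi (x - t *: e)).
  move=> s; apply/differentiable_continuous/derivable1_diffP.
  exact: (@ex_derive _ _ _ _ _ _ _ (dF s)).
transitivity (\int[leb]_(s in `[0%R, h]) ('D_e phi (x - s *: e))%:E)%E.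
  rewrite -integral_itv_obnd_cbnd; last first.
    have mD := continuous_measurable_fun cD.
    by first [exact: measurable_funTS mD|apply/measurable_EFinP; exact: measurable_funTS mD].
  rewrite [RHS]integral_mkcond; apply: eq_integral => s _.
  by rewrite /patch /step_ind indicE; case: ifP => _; rewrite ?mul1r ?mul0r.
rewrite (@continuous_FTC2 _ (fun s => 'D_e phi (x - s *: e)) (fun t => - phi (x - t *: e)))//.
- by rewrite scale0r subr0 -EFinB; congr EFin; rewrite opprK addrC.
- by apply: continuous_subspaceT.
- split.
  + by move=> s _; exact: (@ex_derive _ _ _ _ _ _ _ (dF s)).
  + by apply: cvg_at_right_filter; exact: cF.
  + by apply: cvg_at_left_filter; exact: cF.
- by move=> s _; rewrite derive1E; exact: (@derive_val _ _ _ _ _ _ _ (dF s)).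
Qed.

Lemma test_function_shift phi (b : 'rV[R]_m) : test_function setT phi ->
  test_function setT (fun x => phi (x - b)) /\
  forall x, 'D_e (fun x => phi (x - b)) x = 'D_e phi (x - b).
Proof.
move=> tphi; have [K [cK KO p0 dp0]] := test_support tphi.
have D j x : is_derive x (basis_rV j) (fun x => phi (x - b)) ('D_(basis_rV j) phi (x - b)).
  have := test_is_derive tphi j (x - b); rewrite !is_derive_quotP.
  by under eq_fun do rewrite addrA.
split; last by move=> x; exact: (@derive_val _ _ _ _ _ _ _ (D i x)).
have cb : continuous (fun x : 'rV[R]_m => x - b).
  exact: continuous_addr.
split.
- by move=> j x; exact: (@ex_derive _ _ _ _ _ _ _ (D j x)).
- move=> j; have -> : 'D_(basis_rV j) (fun x => phi (x - b)) = (fun x => 'D_(basis_rV j) phi (x - b)).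
    by apply/funext => x; exact: (@derive_val _ _ _ _ _ _ _ (D j x)).
  have cD : continuous ('D_(basis_rV j) phi) by exact: (test_continuous_derive tphi).
  by move=> x; exact: (continuous_comp (cb x) (cD (x - b))).
exists ((fun x => x + b) @` K); split=> //.
  apply: continuous_compact => //; apply: continuous_subspaceT.
  exact: continuous_addr.
move=> x nx; apply: p0 => Kx; apply: nx; exists (x - b) => //; by rewrite subrK.
Qed.

Variables (f g : 'rV[R]_m -> R).
Hypotheses (intf : mu.-integrable setT (EFin \o f)) (intg : mu.-integrable setT (EFin \o g)).
Hypothesis weakf : forall phi, test_function setT phi ->
  \int[mu]_x (f x * 'D_e phi x + g x * phi x) = 0.

Let mf : measurable_fun setT f. Proof. by case/integrableP : intf => /measurable_EFinP. Qed.
Let mg : measurable_fun setT g. Proof. by case/integrableP : intg => /measurable_EFinP. Qed.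

Let int_bounded (u b : 'rV[R]_m -> R) (M : R) : mu.-integrable setT (EFin \o u) ->
  measurable_fun setT b -> (forall x, `|b x| <= M) ->
  mu.-integrable setT (EFin \o (fun x => u x * b x)).
Proof.
move=> iu mb bM; have mu_ : measurable_fun setT u by case/integrableP : iu => /measurable_EFinP.
apply: le_integrable (integrable_realZ measurableT M iu) => //.
  by apply/measurable_EFinP; exact: measurable_funM.
move=> x _ /=; rewrite lee_fin !normrM mulrC ler_wpM2r//.
by rewrite (le_trans (bM x))// ler_norm.
Qed.

Definition segment_integral (h : R) (x : 'rV[R]_m) : R :=
  fine (\int[leb]_s (step_ind h s * g (x + s *: e))%:E)%E.

Let iT1 h : lm.-integrable setT (EFin \o (fun w : P => step_ind h w.1 * (g (w.2 + w.1 *: e) * 1))).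
Proof. by apply: (integrable_along_line (M := 1) _ (integrable_ind 0 h) intg) => // w; rewrite normr1. Qed.

Let GE h (x : 'rV[R]_m) :
  fubini_G leb (EFin \o (fun w : P => step_ind h w.1 * (g (w.2 + w.1 *: e) * 1))) x =
  (\int[leb]_s (step_ind h s * g (x + s *: e))%:E)%E.
Proof. by apply: eq_integral => s _; rewrite /= mulr1. Qed.

Lemma integrable_segment_integral h : mu.-integrable setT (EFin \o segment_integral h).
Proof.
have /integrableP[mT fT] := iT1 h.
have mA : measurable_fun setT (abse \o (EFin \o (fun w : P => step_ind h w.1 * (g (w.2 + w.1 *: e) * 1)))).
  exact: measurableT_comp.
have iG : mu.-integrable setT (fubini_G leb (EFin \o (fun w : P => step_ind h w.1 * (g (w.2 + w.1 *: e) * 1)))).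
  apply/integrableP; split; first exact: measurable_fubini_G (iT1 h).
  apply: le_lt_trans fT; rewrite (fubini_tonelli2 _ mA); last by move=> w; exact: abse_ge0.
  apply: ge0_le_integral => //.
  - by apply: measurableT_comp => //; exact: measurable_fubini_G (iT1 h).
  - by apply: (@measurable_fun_fubini_tonelli_G _ _ _ _ R leb (abse \o (EFin \o (fun w : P => step_ind h w.1 * (g (w.2 + w.1 *: e) * 1))))) => //= w; exact: abse_ge0.
  move=> x _; apply: le_abse_integral => //.
  exact: (measurableT_comp mT (measurable_pair2 x)).
have mG : measurable_fun setT (segment_integral h).
  have := measurableT_comp (@fine_measurable R setT measurableT) (measurable_fubini_G (iT1 h)).
  by congr measurable_fun; apply/funext => x; rewrite /= GE.
apply: le_integrable iG => //; first exact/measurable_EFinP.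
move=> x _; rewrite GE /segment_integral /=; case: (integral _ _ _) => [r| |] //=.
all: by rewrite leey.
Qed.

Lemma weak_shift phi (s : R) : test_function setT phi ->
  (\int[mu]_x (g (x + s *: e) * phi x)%:E = - \int[mu]_x (f x * 'D_e phi (x - s *: e))%:E)%E.
Proof.
move=> tphi; have [M [M0 pM]] := test_bounded tphi; have [N [N0 dN]] := test_derive_bounded tphi.
have [tps dps] := test_function_shift (s *: e) tphi.
have mps := test_measurable tps; have mdps := test_measurable_derive tps i.
have ig : mu.-integrable setT (EFin \o (fun x : 'rV[R]_m => g x * phi (x - s *: e))).
  by apply: (int_bounded intg mps) => x; exact: pM.
have dE : 'D_e (fun x : 'rV[R]_m => phi (x - s *: e)) = (fun x : 'rV[R]_m => 'D_e phi (x - s *: e)).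
  by apply/funext => x; exact: dps.
have iff : mu.-integrable setT (EFin \o (fun x : 'rV[R]_m => f x * 'D_e phi (x - s *: e))).
  by rewrite dE in mdps; apply: (int_bounded intf mdps) => x; exact: dN.
have W : \int[mu]_x (f x * 'D_e phi (x - s *: e) + g x * phi (x - s *: e)) = 0.
  by rewrite -(weakf tps); apply: eq_Rintegral => x _; rewrite dps.
move: W; rewrite (RintegralD measurableT iff ig) => /eqP.
rewrite addrC addr_eq0 => /eqP E.
have mgp : measurable_fun setT (EFin \o (fun x : 'rV[R]_m => g x * phi (x - s *: e))) by case/integrableP : ig.
transitivity (\int[mu]_x (g x * phi (x - s *: e))%:E)%E.
  rewrite -(integral_translate (s *: e) mgp); apply: eq_integral => x _.
  by rewrite /= addrK.
rewrite -[LHS]fineK; last exact: integrable_fin_num ig.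
rewrite -[X in (- X)%E]fineK; last exact: integrable_fin_num iff.
by rewrite -EFinN; congr EFin.
Qed.

Lemma integral_segment_test h phi : 0 < h -> test_function setT phi ->
  (\int[mu]_x (segment_integral h x * phi x)%:E =
   - \int[mu]_x (f x * (phi x - phi (x - h *: e)))%:E)%E.
Proof.
move=> h0 tphi; have iS := integrable_segment_integral h.
have [M [M0 pM]] := test_bounded tphi; have [N [N0 dN]] := test_derive_bounded tphi.
have mp := test_measurable tphi; have mdp := test_measurable_derive tphi i.
have mpw : measurable_fun setT (fun w : P => phi w.2) by exact: measurableT_comp mp measurable_snd.
have iT := integrable_along_line e (integrable_ind 0 h) intg mpw (fun w : P => pM w.2).
have mB : measurable_fun setT (fun w : P => 'D_e phi (w.2 - w.1 *: e)).
  have -> : (fun w : P => 'D_e phi (w.2 - w.1 *: e)) = (fun w : P => 'D_e phi (w.2 + w.1 *: (- e))).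
    by apply/funext => w; rewrite scalerN.
  exact: (measurable_along_line (- e) mdp).
have iV : lm.-integrable setT (EFin \o (fun w : P => step_ind h w.1 * (f w.2 * 'D_e phi (w.2 - w.1 *: e)))).
  have := integrable_along_line 0 (integrable_ind 0 h) intf mB (fun w : P => dN i (w.2 - w.1 *: e)).
  congr integrable; apply/funext => w /=; by rewrite scaler0 addr0.
have FT := Fubini iT; have FV := Fubini iV.
have mst : measurable_fun setT (step_ind h) by exact: measurable_indic.
have inner (s : R) : (\int[mu]_x (step_ind h s * (g (x + s *: e) * phi x))%:E =
    - \int[mu]_x (step_ind h s * (f x * 'D_e phi (x - s *: e)))%:E)%E.
  rewrite /step_ind indicE; case: (s \in _).
    under eq_integral do rewrite mul1r.
    under [in RHS]eq_integral do rewrite mul1r.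
    exact: weak_shift.
  under eq_integral do rewrite mul0r.
  under [in RHS]eq_integral do rewrite mul0r.
  by rewrite integral0 oppe0.
have iSp := int_bounded iS mp pM.
transitivity (\int[mu]_y \int[leb]_s (step_ind h s * (g (y + s *: e) * phi y))%:E)%E.
  apply: ae_eq_integral => //.
  - by case/integrableP : iSp.
  - exact: measurable_fubini_G iT.
  have := ae_integrable2 (iT1 h); apply: filterS => y Iy _.
  have Iy' : leb.-integrable setT (EFin \o (fun s : R => step_ind h s * g (y + s *: e))).
    by move: Iy; congr integrable; apply/funext => s; rewrite /= mulr1.
  rewrite /= EFinM /segment_integral fineK; last exact: integrable_fin_num Iy'.
  rewrite muleC -(integralZl measurableT Iy'); apply: eq_integral => s _.
  by rewrite /= -EFinM; congr EFin; ring.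
rewrite -[LHS]FT; under eq_integral do rewrite inner.
transitivity (- \int[leb]_s \int[mu]_x (step_ind h s * (f x * 'D_e phi (x - s *: e)))%:E)%E.
  rewrite -mulN1e -integralZl//; first by apply: eq_integral => s _; rewrite mulN1e.
  apply/integrableP; split; first exact: measurable_fubini_F iV.
  have /integrableP[mV fV] := iV.
  have mA : measurable_fun setT (abse \o (EFin \o (fun w : P => step_ind h w.1 * (f w.2 * 'D_e phi (w.2 - w.1 *: e))))).
    exact: measurableT_comp.
  apply: le_lt_trans fV; rewrite (fubini_tonelli1 _ mA); last by move=> w; exact: abse_ge0.
  apply: ge0_le_integral => //.
  - by apply: measurableT_comp => //; exact: measurable_fubini_F iV.
  - by apply: (@measurable_fun_fubini_tonelli_F _ _ _ _ R mu (abse \o (EFin \o (fun w : P => step_ind h w.1 * (f w.2 * 'D_e phi (w.2 - w.1 *: e)))))) => //= w; exact: abse_ge0.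
  move=> s _; apply: le_abse_integral => //.
  exact: (measurableT_comp mV (measurable_pair1 (s : measurableTypeR R))).
congr (- _)%E; rewrite [LHS]FV; apply: eq_integral => x _ /=.
have iD : leb.-integrable setT (EFin \o (fun s : R => step_ind h s * 'D_e phi (x - s *: e))).
  apply: le_integrable (integrable_realZ measurableT N (integrable_ind 0 h)) => //.
    apply/measurable_EFinP; apply: measurable_funM => //.
    exact: (measurableT_comp mB (measurable_pair2 x)).
  move=> s _ /=; rewrite lee_fin !normrM mulrC [`|N|]ger0_norm//; apply: ler_wpM2r => //.
rewrite EFinM -(integral_derive_axis x h0 tphi) -(integralZl measurableT iD).
by apply: eq_integral => s _; rewrite -EFinM; congr EFin; ring.
Qed.

Lemma shift_difference h : 0 < h ->
  {ae mu, forall x, f (x + h *: e) - f x = segment_integral h x}.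
Proof.
move=> h0; have iS := integrable_segment_integral h.
have iD := integrable_realB measurableT (integrable_realB measurableT (integrable_translate (h *: e) intf) intf) iS.
suff : {ae mu, forall x, setT x -> f (x + h *: e) - f x - segment_integral h x = 0}.
  by apply: filterS => x /(_ I) /eqP; rewrite subr_eq0 => /eqP.
apply: ae_eq0_of_test.
- exact: openT.
- by case/integrableP : iD => /measurable_EFinP.
- by move=> K cK _; apply: integrableS iD => //; exact: compact_measurable_rV.
move=> phi tphi; have [M [M0 pM]] := test_bounded tphi.
have mp := test_measurable tphi.
have [tps _] := test_function_shift (h *: e) tphi; have mps := test_measurable tps.
have mfp : measurable_fun setT (EFin \o (fun x : 'rV[R]_m => f x * phi (x - h *: e))).
  by apply/measurable_EFinP; apply: measurable_funM.
have tf : \int[mu]_x (f (x + h *: e) * phi x) = \int[mu]_x (f x * phi (x - h *: e)).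
  have tE : (\int[mu]_x (f (x + h *: e) * phi x)%:E = \int[mu]_x (f x * phi (x - h *: e))%:E)%E.
    rewrite -(integral_translate (h *: e) mfp); apply: eq_integral => x _.
    by rewrite /= addrK.
  by rewrite /Rintegral tE.
have i1 := int_bounded (integrable_translate (h *: e) intf) mp pM.
have i2 := int_bounded intf mp pM.
have i3 := int_bounded intf mps (fun x => pM (x - h *: e)).
have i4 := int_bounded iS mp pM.
have E : \int[mu]_x (segment_integral h x * phi x) = - \int[mu]_x (f x * (phi x - phi (x - h *: e))).
  by rewrite /Rintegral (integral_segment_test h0 tphi) fineN.
have E' : \int[mu]_x (f x * (phi x - phi (x - h *: e))) =
    \int[mu]_x (f x * phi x) - \int[mu]_x (f x * phi (x - h *: e)).
  by rewrite -(RintegralB measurableT i2 i3); apply: eq_Rintegral => x _; rewrite mulrBr.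
transitivity (\int[mu]_x (f (x + h *: e) * phi x - f x * phi x - segment_integral h x * phi x)).
  by apply: eq_Rintegral => x _; rewrite !mulrBl.
rewrite (RintegralB measurableT (integrable_realB measurableT i1 i2) i4) (RintegralB measurableT i1 i2).
by rewrite E E' tf; ring.
Qed.

End difference_along_axis.

(** * Weak derivatives of a sum of squares *)

Section derivative_of_sum_of_squares.
Context {R : realType}.
Local Notation leb := (@lebesgue_measure R).

Lemma derive_zero_of_seq (D : R -> R) d : is_derive (0 : R) 1 D d -> D 0 = 0 ->
  (forall k, D (k.+1%:R^-1) = 0) -> d = 0.
Proof.
move=> /is_derive1_quotP/cvgr_dnbhsP H D0 Dk.
have h0 : (forall n, n.+1%:R^-1 != 0 :> R) /\ n.+1%:R^-1 @[n --> \oo] --> (0 : R).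
  by split=> [n|]; [rewrite invr_eq0 pnatr_eq0|exact: cvg_harmonic].
have {}H := H _ h0; have E : (fun n : nat => n.+1%:R^-1^-1 * (D (n.+1%:R^-1 + 0) - D 0)) = (fun=> 0).
  by apply/funext => k; rewrite addr0 Dk D0 subrr mulr0.
have H' : (fun=> 0 : R) @ \oo --> d by rewrite -E.
by apply: (cvg_unique (@norm_hausdorff _ _) H'); exact: cvg_cst.
Qed.

Lemma ae_translate m (Q : 'rV[R]_m -> Prop) (b : 'rV[R]_m) :
  {ae lebesgue_rV m, forall y, Q y} -> {ae lebesgue_rV m, forall y, Q (y + b)}.
Proof.
move=> [N [mN N0 QN]].
have mt : measurable_fun setT (fun x : 'rV[R]_m => x + b).
  by have := measurable_rV_affine 1 b; under eq_fun do rewrite scale1r.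
have mP : measurable ((fun x : 'rV[R]_m => x + b) @^-1` N).
  by rewrite -[X in measurable X]setTI; exact: mt.
exists ((fun x : 'rV[R]_m => x + b) @^-1` N); split=> //; last by move=> y nQ; exact: QN.
have mi : measurable_fun setT (fun x : 'rV[R]_m => (\1_N x : R)%:E).
  by apply/measurable_EFinP; exact: measurable_indic.
have E1 : (\int[lebesgue_rV m]_x (\1_N x : R)%:E = 0)%E.
  by rewrite integral_indic// setIT; exact: N0.
rewrite -[RHS]E1 -(integral_translate b mi).
by rewrite -[X in lebesgue_rV m X]setIT -integral_indic.
Qed.

Lemma primitive_difference (L : R -> R) (s h : R) : leb.-integrable setT (EFin \o L) -> 0 < h ->
  \int[leb]_(t in `]-oo, (s + h)]) L t - \int[leb]_(t in `]-oo, s]) L t =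
  fine (\int[leb]_r (step_ind h r * L (s + r))%:E)%E.
Proof.
move=> iL h0; have mL : measurable_fun setT L by case/integrableP : iL => /measurable_EFinP.
have FE t : \int[leb]_(u in `]-oo, t]) L u = \int[leb]_u (\1_(`]-oo, t]%classic : set R) u * L u).
  rewrite Rintegral_mkcond; apply: eq_Rintegral => u _; rewrite /patch indicE.
  by case: ifP => _; rewrite ?mul1r ?mul0r.
have iI (A : set R) : measurable A -> leb.-integrable setT (EFin \o (fun u => \1_A u * L u)).
  move=> mA; apply: le_integrable iL => //.
    by apply/measurable_EFinP; apply: measurable_funM => //; exact: measurable_indic.
  move=> u _ /=; rewrite lee_fin normrM ler_piMl// indicE.
  by case: (u \in A); rewrite ?normr1 ?normr0.
rewrite !FE -RintegralB//; last 2 first.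
- exact: iI.
- exact: iI.
have mK : measurable_fun setT (EFin \o (fun u => step_ind h (u - s) * L u)).
  apply/measurable_EFinP; apply: measurable_funM => //.
  apply: (measurableT_comp (f := step_ind h)); first exact: measurable_indic.
  exact: measurable_funB.
rewrite /Rintegral; congr fine.
transitivity (\int[leb]_u (step_ind h (u - s) * L u)%:E)%E.
  apply: eq_integral => u _ /=; congr EFin; rewrite -mulrBl; congr (_ * _).
  rewrite /step_ind !indicE !mem_setE !in_itv/= subr_gt0 lerBlDl.
  have [us|su] := leP u s; have [uh|hu] := leP u (s + h); rewrite ?subrr ?subr0//.
  by move: hu us h0; lra.
rewrite -(integral_translate_R s mK); apply: eq_integral => r _ /=.
by rewrite [s + r]addrC addrK [r + s]addrC.
Qed.

Variables (m : nat) (i : 'I_m).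
Local Notation mu := (@lebesgue_rV R m).
Local Notation e := (basis_rV i : 'rV[R]_m).
Local Notation P := (measurableTypeR R * 'rV[R]_m)%type.

Lemma ae_line_primitive (g : 'rV[R]_m -> R) : mu.-integrable setT (EFin \o g) ->
  {ae mu, forall x : 'rV[R]_m, exists F : R -> R, {ae leb, forall s : R, 0 <= s <= 1 ->
    is_derive s 1 F (g (x + s *: e)) /\
    (forall h, 0 < h <= 1 -> F (s + h) - F s = segment_integral i g h (x + s *: e))}}.
Proof.
move=> ig.
pose k : R -> R := \1_(`]-1, 3]%classic : set R).
have iT : (leb \x mu)%E.-integrable setT
    (EFin \o (fun w : P => k w.1 * (g (w.2 + w.1 *: e) * 1))).
  by apply: (integrable_along_line (M := 1) _ (integrable_ind (-1) 3) ig) => // w; rewrite normr1.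
have := ae_integrable2 iT; apply: filterS => x Ix.
pose L s := k s * g (x + s *: e).
have iL : leb.-integrable setT (EFin \o L).
  by move: Ix; congr integrable; apply/funext => s; rewrite /= mulr1.
exists (fun t => \int[leb]_(u in `]-oo, t]) L u).
have iLy y : leb.-integrable `]-oo, y] (EFin \o L) by apply: integrableS iL.
have lL : locally_integrable [set: R] L.
  by have := integrable_locally measurableT iL; rewrite patch_setT.
have := FTC1Ny iLy lL; apply: filterS; first exact: (ae_filter_ringOfSetsType leb).
move=> s [dF F's] /andP[s0 s1].
have kE t : -1 < t <= 3 -> k t = 1.
  by move=> /andP[t0 t1]; rewrite /k indicE mem_set//= in_itv/= t0 t1.
split.
  have LE : L s = g (x + s *: e).
    by rewrite /L kE ?mul1r//; apply/andP; split; [move: s0|move: s1]; lra.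
  rewrite -LE -F's; apply: DeriveDef => //; exact/esym/derive1E.
move=> h /andP[h0 h1]; rewrite primitive_difference// /segment_integral; congr fine.
apply: eq_integral => r _; congr EFin; rewrite /step_ind indicE.
have [/set_mem|_] := boolP (r \in _); last by rewrite !mul0r.
rewrite /= in_itv/= => /andP[r0 r1]; rewrite !mul1r /L kE.
  by rewrite mul1r scalerDl addrA.
by apply/andP; split; [move: s0 r0|move: s1 r1 h1]; lra.
Qed.

Variables (f g : 'I_m -> 'rV[R]_m -> R) (c c' : 'rV[R]_m -> R).
Hypotheses (intf : forall j, mu.-integrable setT (EFin \o f j))
  (intg : forall j, mu.-integrable setT (EFin \o g j)).
Hypothesis weakf : forall j phi, test_function setT phi ->
  \int[mu]_x (f j x * 'D_e phi x + g j x * phi x) = 0.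
Hypothesis dc : forall x, is_derive x e c (c' x).
Hypothesis mc' : measurable_fun setT c'.
Hypothesis fc : {ae mu, forall x, \sum_j f j x ^+ 2 = c x}.

(** The product rule for the sum of the squares, whose difference quotients
    are computed on almost every line. *)
Lemma derive_sum_sqr : {ae mu, forall x, 2 * \sum_j f j x * g j x = c' x}.
Proof.
pose h (k : nat) : R := k.+1%:R^-1.
have h0 k : 0 < h k <= 1 by rewrite invr_gt0 ltr0n invf_le1// ler1n.
have A : {ae mu, forall y, forall k j, f j (y + h k *: e) - f j y = segment_integral i (g j) (h k) y}.
  apply: ae_foralln => k; apply: filter_forall => j.
  by apply: shift_difference (intf j) (intg j) (weakf j) _ _; case/andP : (h0 k).
have B : {ae mu, forall y, forall k, \sum_j f j (y + h k *: e) ^+ 2 = c (y + h k *: e)}.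
  by apply: ae_foralln => k; exact: (ae_translate (h k *: e) fc).
have ABC : {ae mu, forall y, [/\ forall k j, f j (y + h k *: e) - f j y = segment_integral i (g j) (h k) y,
    forall k, \sum_j f j (y + h k *: e) ^+ 2 = c (y + h k *: e) & \sum_j f j y ^+ 2 = c y]}.
  by apply: filterS3 A B fc => y a b d; split.
have S : {ae mu, forall x, forall j : 'I_m, exists F : R -> R, {ae leb, forall s : R, 0 <= s <= 1 ->
    is_derive s 1 F (g j (x + s *: e)) /\
    (forall h, 0 < h <= 1 -> F (s + h) - F s = segment_integral i (g j) h (x + s *: e))}}.
  by apply: filter_forall => j; exact: ae_line_primitive.
have mf j : measurable_fun setT (f j) by case/integrableP : (intf j) => /measurable_EFinP.
have mg j : measurable_fun setT (g j) by case/integrableP : (intg j) => /measurable_EFinP.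
suff : {ae mu, forall x, 2 * (\sum_j f j x * g j x) - c' x = 0}.
  by apply: filterS => x /eqP; rewrite subr_eq0 => /eqP.
apply: (@ae_of_lines R m e).
  apply: measurable_funB => //; apply: measurable_funM => //.
  by apply: measurable_sum => j; exact: measurable_funM.
have := ae_line e ABC; apply: filterS2 S => x /choice[F HF] HA.
have FA := ae_filter_ringOfSetsType leb.
have HF' := @filter_forall _ _ _ _ FA HF.
have := @filterI _ _ FA _ _ HA HF'; apply: filterS => s [[a b d] HFs] s01.
set y := x + s *: e in a b d *.
pose q j (t : R) := (f j y + (F j (s + t) - F j s)) ^+ 2.
pose D (t : R) := \sum_j q j t - c (t *: e + y).
have dq j : is_derive (0 : R) 1 (q j) (2 * (f j y * g j y)).
  have [dF _] := HFs j s01.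
  have dsh : is_derive (0 : R) 1 (fun t : R => s + t) 1.
    by have := is_deriveD (is_derive_cst s (0 : R) 1) (is_derive_id (0 : R) 1); rewrite add0r.
  have dF' : is_derive (s + 0) 1 (F j) (g j y) by rewrite addr0.
  have d1 := @is_derive_comp1 R R (F j) (fun t => s + t) 0 1 _ _ dF' dsh.
  have d2 := is_deriveD (is_derive_cst (f j y - F j s) (0 : R) 1) d1.
  have := is_deriveX 2 d2.
  rewrite add0r mulr1 expr1 -[_ *: _]/(_ * _).
  have -> : ((cst (f j y - F j s) + (F j \o (fun t => s + t))) ^+ 2) = q j.
    apply/funext => t; rewrite /q exprfctE.
    change ((f j y - F j s + F j (s + t)) ^+ 2 = (f j y + (F j (s + t) - F j s)) ^+ 2); ring.
  have -> : 2 * (cst (f j y - F j s) + (F j \o (fun t => s + t))) 0 * g j y = 2 * (f j y * g j y).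
    change (2 * (f j y - F j s + F j (s + 0)) * g j y = 2 * (f j y * g j y)).
    by rewrite addr0; ring.
  by [].
have dD : is_derive (0 : R) 1 D (2 * (\sum_j f j y * g j y) - c' y).
  have /is_derive_line0 dcy := dc y.
  have := is_deriveB (is_derive_sum dq) dcy.
  by rewrite fct_sumE mulr_sumr.
apply: (derive_zero_of_seq dD).
  rewrite /D scale0r add0r -d; apply/eqP; rewrite subr_eq0; apply/eqP.
  by apply: eq_bigr => j _; rewrite /q addr0 subrr addr0.
move=> k; rewrite /D [_ *: e + y]addrC -(b k); apply/eqP; rewrite subr_eq0; apply/eqP.
apply: eq_bigr => j _; have [_ HFj] := HFs j s01.
by rewrite /q (HFj (h k) (h0 k)) -/y -a [f j y + _]addrC subrK.
Qed.

End derivative_of_sum_of_squares.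

(** * Radial test functions and tangential gradients *)

Section radial_test_functions.
Context {R : realType} (m : nat).
Local Notation mu := (@lebesgue_rV R m).
Implicit Types (x : 'rV[R]_m).

Lemma is_derive_sqnorm x i : is_derive x (basis_rV i) (fun y => enorm y ^+ 2) (2 * x ord0 i).
Proof.
have := is_derive_sum (fun k => is_deriveM (is_derive_coor k i x) (is_derive_coor k i x)).
rewrite fct_sumE.
have -> : (fun y : 'rV[R]_m => \sum_(k < m) ((fun y => y ord0 k) * (fun y => y ord0 k)) y) =
    (fun y => enorm y ^+ 2) by apply/funext => y; rewrite sqr_enorm.
have -> // : \sum_(k < m) (x ord0 k *: ((k == i)%:R : R) + x ord0 k *: ((k == i)%:R : R)) = 2 * x ord0 i.
rewrite -(sumr_delta i (fun k => 2 * x ord0 k)); apply: eq_bigr => k _.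
by rewrite -[_ *: _]/(_ * _) eq_sym; ring.
Qed.

Variables (F F' : R -> R) (a b : R).
Hypotheses (dF : forall t : R, is_derive t 1 F (F' t)) (cF' : continuous F').
Hypotheses (a0 : 0 <= a) (b0 : 0 <= b).
Hypothesis F0 : forall t, t < a ^+ 2 \/ b ^+ 2 < t -> F t = 0.
Variable Omega : set 'rV[R]_m.
Hypothesis ab : closed_annulus a b `<=` Omega.

Lemma is_derive_radial x i : is_derive x (basis_rV i) (fun y => F (enorm y ^+ 2))
  (F' (enorm x ^+ 2) * (2 * x ord0 i)).
Proof. exact: (@is_derive_comp1 R _ F _ x _ _ _ (dF _) (is_derive_sqnorm x i)). Qed.

Lemma test_function_radial : test_function Omega (fun x => F (enorm x ^+ 2)).
Proof.
split.
- by move=> i x; exact: (@ex_derive _ _ _ _ _ _ _ (is_derive_radial x i)).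
- move=> i; have -> : 'D_(basis_rV i) (fun y : 'rV[R]_m => F (enorm y ^+ 2)) =
      (fun x => F' (enorm x ^+ 2) * (2 * x ord0 i)).
    by apply/funext => x; exact: (@derive_val _ _ _ _ _ _ _ (is_derive_radial x i)).
  suff H (x : 'rV[R]_m) : {for x, continuous (fun x => F' (enorm x ^+ 2) * (2 * x ord0 i))}.
    by move=> x; exact: H.
  apply: ctsM; last by apply: ctsM; [exact: ctsC|exact: cts_coor].
  have c2 : {for x, continuous (fun x : 'rV[R]_m => enorm x ^+ 2)}.
    have -> : (fun x : 'rV[R]_m => enorm x ^+ 2) = (fun x => enorm x * enorm x).
      by apply/funext => y; rewrite expr2.
    by apply: ctsM; exact: cts_enorm.
  by apply: (continuous_comp c2); exact: cF'.
exists (closed_annulus a b); split=> //; first exact: compact_closed_annulus.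
move=> x nx; apply: F0; have e0 := enorm_ge0 x.
have [ax|xa] := ltP (enorm x) a.
  by left; rewrite ltrXn2r// ?nnegrE.
have [bx|xb] := ltP b (enorm x); first by right; rewrite ltrXn2r// ?nnegrE.
by exfalso; apply: nx; apply/andP.
Qed.

Lemma derive_test_radial i x :
  'D_(basis_rV i) (fun y => F (enorm y ^+ 2)) x = F' (enorm x ^+ 2) * (2 * x ord0 i).
Proof. exact: (@derive_val _ _ _ _ _ _ _ (is_derive_radial x i)). Qed.

Variables (u : 'rV[R]_m -> 'rV[R]_m) (G : 'rV[R]_m -> 'M[R]_m).
Hypotheses (oO : open Omega) (HG : weak_gradient Omega u G).

(** The divergence theorem, with a radial test function. *)
Lemma integral_trace_radial :
  let T := fun x => (\tr (G x) * F (enorm x ^+ 2)) * \1_Omega x in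
  let U := fun x => (dotr (u x) x * (2 * F' (enorm x ^+ 2))) * \1_Omega x in
  [/\ mu.-integrable setT (EFin \o T), mu.-integrable setT (EFin \o U) &
      \int[mu]_x T x = - \int[mu]_x U x].
Proof.
move=> T U; have sw := sweak_of_weak_gradient oO HG.
have tphi := test_function_radial.
pose Tj (j : 'I_m) x := ((fun x => G x j j) \_ Omega) x * F (enorm x ^+ 2).
pose Uj (j : 'I_m) x := ((fun x => u x ord0 j) \_ Omega) x * (F' (enorm x ^+ 2) * (2 * x ord0 j)).
have iT j : mu.-integrable setT (EFin \o Tj j).
  by have [_ _ lg _] := sw j; exact: loc_integrable_test (lg j) tphi.
have iU j : mu.-integrable setT (EFin \o Uj j).
  have [_ lf _ _] := sw j; have := loc_integrable_test_derive j lf tphi.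
  by congr integrable; apply/funext => x; rewrite /Uj /= derive_test_radial.
have TE : T = (fun x => \sum_(j < m) Tj j x).
  apply/funext => x; rewrite /T /Tj /mxtrace mulr_suml mulr_suml; apply: eq_bigr => j _.
  by rewrite /patch indicE; case: ifP => _; rewrite ?mulr1 ?mulr0 ?mul0r.
have UE : U = (fun x => \sum_(j < m) Uj j x).
  apply/funext => x; rewrite /U /Uj /dotr mulr_suml mulr_suml; apply: eq_bigr => j _.
  by rewrite /patch indicE; case: ifP => _; [rewrite mulr1; ring|rewrite mulr0 mul0r].
have Z j : null_integral mu (fun x => Tj j x + Uj j x).
  have [_ _ _ H] := sw j; split; first exact: integrable_realD.
  by rewrite -[RHS](H j _ tphi); apply: eq_Rintegral => x _; rewrite derive_test_radial addrC.
have sumi (f : 'I_m -> 'rV[R]_m -> R) : (forall j, mu.-integrable setT (EFin \o f j)) ->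
    mu.-integrable setT (EFin \o (fun x => \sum_(j < m) f j x)).
  move=> H; rewrite (_ : EFin \o _ = (fun x => \sum_(j < m) (f j x)%:E)%E); last first.
    by apply/funext => x /=; rewrite sumEFin.
  by apply: integrable_sum => // j _; exact: H.
have IT := sumi _ iT; have IU := sumi _ iU.
rewrite TE UE; split=> //.
have [_] := null_integral_sum (index_enum 'I_m) Z.
under eq_Rintegral do rewrite big_split/=.
by rewrite (RintegralD measurableT IT IU) => /eqP; rewrite addr_eq0 => /eqP.
Qed.

End radial_test_functions.

Section tangential_gradient.
Context {R : realType} (m : nat).
Local Notation mu := (@lebesgue_rV R m).
Local Notation pball := (@punctured_ball R m).
Variables (v : 'rV[R]_m -> 'rV[R]_m) (G : 'rV[R]_m -> 'M[R]_m).
Hypothesis HG : weak_gradient pball v G.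
Hypothesis v1 : {ae mu, forall x, @ball_rV R m x -> enorm (v x) = 1}.

Definition bump (a b t : R) : R := sqpos (t - a) * sqpos (b - t).
Definition dbump (a b t : R) : R :=
  sqpos (t - a) * - (2 * Num.max (b - t) 0) + sqpos (b - t) * (2 * Num.max (t - a) 0).

Lemma is_derive_bump (a b t : R) : is_derive t 1 (bump a b) (dbump a b t).
Proof.
have d1 : is_derive t 1 (fun s : R => s - a) 1.
  by have := is_deriveB (is_derive_id t (1 : R)) (is_derive_cst a t 1); rewrite subr0.
have d2 : is_derive t 1 (fun s : R => b - s) (-1).
  by have := is_deriveB (is_derive_cst b t 1) (is_derive_id t (1 : R)); rewrite sub0r.
have e1 := @is_derive_comp1 R R (@sqpos R) _ t 1 _ _ (is_derive_sqpos (t - a)) d1.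
have e2 := @is_derive_comp1 R R (@sqpos R) _ t 1 _ _ (is_derive_sqpos (b - t)) d2.
have := is_deriveM e1 e2; rewrite -[_ *: _]/(_ * _) -[_ *: (_ * 1)]/(_ * (_ * 1)).
by rewrite mulr1 mulrN1.
Qed.

Lemma cts_id (t : R) : {for t, continuous (fun s : R => s)}.
Proof. exact: cvg_id. Qed.

Lemma continuous_dbump a b : continuous (dbump a b).
Proof.
suff H (t : R) : {for t, continuous (dbump a b)} by move=> t; exact: H.
have c1 : {for t, continuous (fun s : R => s - a)} by apply: ctsB; [exact: cts_id|exact: ctsC].
have c2 : {for t, continuous (fun s : R => b - s)} by apply: ctsB; [exact: ctsC|exact: cts_id].
have s1 : {for t, continuous (fun s : R => sqpos (s - a))} by apply: (continuous_comp c1); exact: continuous_sqpos.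
have s2 : {for t, continuous (fun s : R => sqpos (b - s))} by apply: (continuous_comp c2); exact: continuous_sqpos.
apply: ctsD; apply: ctsM => //.
  by apply: ctsN; apply: ctsM; [exact: ctsC|exact: cts_max0].
by apply: ctsM; [exact: ctsC|exact: cts_max0].
Qed.

Lemma tangential_annulus (a b : R) (i : 'I_m) : 0 < a -> b < 1 -> 0 <= b ->
  {ae mu, forall x, annulus a b x -> \sum_j v x ord0 j * G x i j = 0}.
Proof.
move=> a0 b1 b0; pose chi (x : 'rV[R]_m) := bump (a ^+ 2) (b ^+ 2) (enorm x ^+ 2).
pose e := basis_rV i : 'rV[R]_m.
have AO : @closed_annulus R m a b `<=` pball.
  rewrite punctured_ballE => x /andP[ax xb]; apply/andP; split; last exact: le_lt_trans b1.
  exact: lt_le_trans ax.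
have F0 t : t < a ^+ 2 \/ b ^+ 2 < t -> bump (a ^+ 2) (b ^+ 2) t = 0.
  rewrite /bump => -[h|h]; first by rewrite (@sqpos_eq0 _ (t - _)) ?mul0r// subr_le0 ltW.
  by rewrite [X in _ * X]sqpos_eq0 ?mulr0// subr_le0 ltW.
have tchi : test_function pball chi.
  apply: (test_function_radial (F := bump (a ^+ 2) (b ^+ 2)) (F' := dbump (a ^+ 2) (b ^+ 2))
    (a := a) (b := b)) => //;
    first [by move=> t; exact: is_derive_bump|exact: continuous_dbump|exact: ltW].
have oO := @open_punctured_ball R m.
have sw := sweak_of_weak_gradient oO HG.
pose vj j := (fun x => v x ord0 j) \_ pball; pose gj j := (fun x => G x i j) \_ pball.
have lv j : loc_integrable pball (vj j) by have [] := sw j.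
have lg j : loc_integrable pball (gj j) by have [_ _ /(_ i)] := sw j.
pose f j x := vj j x * chi x.
pose g j x := vj j x * 'D_e chi x + gj j x * chi x.
have intf j : mu.-integrable setT (EFin \o f j) by exact: loc_integrable_test (lv j) tchi.
have intg j : mu.-integrable setT (EFin \o g j).
  apply: integrable_realD => //; first exact: loc_integrable_test_derive i (lv j) tchi.
  exact: loc_integrable_test (lg j) tchi.
have weakf j phi : test_function setT phi -> \int[mu]_x (f j x * 'D_e phi x + g j x * phi x) = 0.
  move=> tphi; have c1 : C1_on pball phi (fun k => 'D_(basis_rV k) phi).
    move=> x _; split; first exact: (test_continuous tphi).
      by move=> k; exact: (test_continuous_derive tphi).
    by move=> k; exact: test_is_derive tphi k x.
  have [tpc dpc] := test_functionM oO c1 tchi.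
  have [_ _ _ H] := sw j; rewrite -[RHS](H i _ tpc); apply: eq_Rintegral => x _.
  have [Ox|nOx] := pselect (pball x).
    by rewrite dpc// /f /g /e /vj /gj; ring.
  by rewrite /f /g /vj /gj /patch memNset//= !(mul0r, addr0).
have dc x : is_derive x e (fun y => chi y ^+ 2) (2 * (chi x * 'D_e chi x)).
  have := @is_deriveM _ _ chi chi x e _ _ (test_is_derive tchi i x) (test_is_derive tchi i x).
  rewrite -[_ *: _]/(_ * _).
  have -> : chi * chi = (fun y => chi y ^+ 2) by apply/funext => y; rewrite expr2.
  by have -> : chi x * 'D_e chi x + chi x * 'D_e chi x = 2 * (chi x * 'D_e chi x) by ring.
have mc' : measurable_fun setT (fun x => 2 * (chi x * 'D_e chi x)).
  by do 2 (apply: measurable_funM => //); [exact: test_measurable tchi|exact: test_measurable_derive tchi i].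
have fc : {ae mu, forall x, \sum_j f j x ^+ 2 = chi x ^+ 2}.
  apply: filterS v1 => x vx; have [Ox|nOx] := pselect (pball x).
    have := vx Ox.1 => /(congr1 (fun r => r ^+ 2)); rewrite expr1n sqr_enorm => v1x.
    rewrite -[RHS]mul1r -v1x /dotr mulr_suml; apply: eq_bigr => j _.
    by rewrite /f /vj /patch mem_set// exprMn -expr2.
  have [K [cK KO p0 _]] := test_support tchi.
  rewrite p0; last by move=> /KO.
  by rewrite expr0n/= big1// => j _; rewrite /f p0 ?mulr0 ?expr0n// => /KO.
have := derive_sum_sqr intf intg weakf dc mc' fc.
apply: filterS2 v1 => x vx D /andP[ax xb].
have Ox : pball x by apply: AO; rewrite /closed_annulus/= !ltW.
have := vx Ox.1 => /(congr1 (fun r => r ^+ 2)); rewrite expr1n sqr_enorm => v1x.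
have c0 : chi x != 0.
  rewrite /chi /bump mulf_neq0// gt_eqF// sqpos_gt0// subr_gt0 ltrXn2r// ?nnegrE ?enorm_ge0//.
  by rewrite ltW.
move: D; set S := \sum_j v x ord0 j * G x i j.
have -> : \sum_j f j x * g j x = chi x * 'D_e chi x * dotr (v x) (v x) + chi x ^+ 2 * S.
  rewrite /dotr /S !mulr_sumr -big_split/=; apply: eq_bigr => j _.
  by rewrite /f /g /vj /gj /patch mem_set//; ring.
have c2 : chi x ^+ 2 != 0 by rewrite expf_neq0.
rewrite v1x mulr1 mulrDr -[RHS]addr0 => /addrI; move: (chi x ^+ 2) c2 => k k0 /eqP.
by rewrite !mulf_eq0 pnatr_eq0 (negbTE k0) /= => /eqP.
Qed.

Lemma tangential_gradient : {ae mu, forall x, pball x -> forall i, \sum_j v x ord0 j * G x i j = 0}.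
Proof.
have H : {ae mu, forall x, forall k : nat, forall i,
    annulus (k.+2%:R^-1) (1 - k.+2%:R^-1) x -> \sum_j v x ord0 j * G x i j = 0}.
  apply: ae_foralln => k; apply: filter_forall => i; apply: tangential_annulus.
  - by rewrite invr_gt0.
  - by rewrite gtrBl invr_gt0.
  - by rewrite subr_ge0 invf_le1// ler1n.
apply: filterS H => x H; rewrite punctured_ballE => /andP[x0 x1] i.
pose d := Num.min (enorm x) (1 - enorm x).
have d0 : 0 < d by rewrite lt_min x0 subr_gt0.
have [k kd] : exists k : nat, k.+2%:R^-1 < d.
  exists (Num.truncn d^-1); rewrite -[ltRHS]invrK ltf_pV2 ?posrE ?invr_gt0//.
  apply: lt_trans (truncnS_gt _) _; by rewrite ltr_nat.
move: kd; rewrite lt_min => /andP[k1 k2]; apply: (H k).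
by apply/andP; split=> //; rewrite ltrBrDr addrC -ltrBrDr.
Qed.

End tangential_gradient.

(** * The tangent inequality and a step of class C^1 *)

Section pointwise_inequalities.
Context {R : realType}.

Lemma trace_le m (v : 'rV[R]_m) (G : 'M[R]_m) : enorm v = 1 ->
  (forall i, \sum_j v ord0 j * G i j = 0) -> \tr G <= Num.sqrt (m%:R - 1) * mxnorm2 G.
Proof.
move=> v1 vG.
have vv : \sum_i v ord0 i ^+ 2 = 1.
  by have := sqr_enorm v; rewrite v1 expr1n => ->; apply: eq_bigr => i _; rewrite expr2.
pose t i : 'rV[R]_m := \row_j ((i == j)%:R - v ord0 i * v ord0 j).
have tE i : enorm (t i) ^+ 2 = 1 - v ord0 i ^+ 2.
  rewrite sqr_enorm /dotr.
  under eq_bigr => j _.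
    rewrite mxE; have -> : ((i == j)%:R - v ord0 i * v ord0 j) * ((i == j)%:R - v ord0 i * v ord0 j) =
      (i == j)%:R * ((i == j)%:R - 2 * v ord0 i * v ord0 j) + v ord0 i ^+ 2 * v ord0 j ^+ 2 by ring.
    over.
  rewrite big_split/= sumr_delta -mulr_sumr vv eqxx.
  have -> : true%:R = 1 :> R by [].
  by ring.
pose A : 'rV[R]_m := \row_i enorm (row i G); pose B : 'rV[R]_m := \row_i enorm (t i).
have A2 : enorm A = mxnorm2 G.
  by rewrite /enorm /mxnorm2; congr Num.sqrt; apply: eq_bigr => i _; rewrite mxE.
have B2 : enorm B = Num.sqrt (m%:R - 1).
  rewrite /enorm; congr Num.sqrt; under eq_bigr => i _ do rewrite mxE tE.
  by rewrite sumrB vv sumr_const card_ord.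
rewrite -A2 -B2 mulrC; apply: le_trans (dotr_le A B).
rewrite /mxtrace /dotr; apply: ler_sum => i _; rewrite !mxE.
apply: le_trans (dotr_le (row i G) (t i)).
rewrite le_eqVlt; apply/orP; left; apply/eqP; rewrite /dotr.
under eq_bigr => j _.
  rewrite !mxE mulrBr; have -> : G i j * (i == j)%:R - G i j * (v ord0 i * v ord0 j) =
    (i == j)%:R * G i j - v ord0 i * (v ord0 j * G i j) by ring.
  over.
by rewrite sumrB sumr_delta -mulr_sumr vG mulr0 subr0.
Qed.

(** Young's inequality is the convexity of the power function. *)
Lemma powR_tangent (x y p : R) : 1 <= p -> 0 < x -> 0 <= y ->
  x `^ p + p * x `^ (p - 1) * (y - x) <= y `^ p.
Proof.
move=> p1 x0 y0; have xp : x `^ p = x * x `^ (p - 1).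
  have p10 : 0 <= p - 1 by rewrite subr_ge0.
  by rewrite -(powRS (ltW x0) p10) subrK.
have [pE|pn1] := eqVneq p 1.
  by rewrite pE subrr powRr0 (powRr1 (ltW x0)) (powRr1 y0) mul1r mul1r addrC subrK.
have pgt1 : 1 < p by rewrite lt_neqAle eq_sym pn1.
have p0 : 0 < p by exact: lt_trans pgt1.
have q0 : 0 < p / (p - 1) by rewrite divr_gt0// subr_gt0.
have pq : p^-1 + (p / (p - 1))^-1 = 1.
  have h1 : p != 0 by rewrite gt_eqF.
  have h2 : p - 1 != 0 by rewrite subr_eq0.
  by field; rewrite h1 h2.
have := conjugate_powR y0 (powR_ge0 x (p - 1)) p0 q0 pq.
rewrite -powRrM.
have -> : (p - 1) * (p / (p - 1)) = p by rewrite mulrCA mulfV ?mulr1// subr_eq0.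
rewrite xp; move: (x `^ (p - 1)) (y `^ p) => X Y h.
have h' : p * (y * X) <= Y + (p - 1) * (x * X).
  have -> : Y + (p - 1) * (x * X) = p * (Y / p + x * X / (p / (p - 1))).
    have h1 : p != 0 by rewrite gt_eqF.
    have h2 : p - 1 != 0 by rewrite subr_eq0.
    by field; rewrite h1 h2.
  by rewrite ler_pM2l.
by move: h'; lra.
Qed.

Lemma density_lower (r c g tau beta p : R) : 1 <= p -> 0 < r -> 0 < c -> 0 <= g -> tau <= c * g ->
  c `^ p * (r `^ beta * r^-1 `^ p) +
    p * c `^ (p - 1) / c * (r `^ (beta + 1 - p) * (tau - c ^+ 2 / r)) <= r `^ beta * g `^ p.
Proof.
move=> p1 r0 c0 g0 tg; have i0 : 0 < r^-1 by rewrite invr_gt0.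
have cr : 0 < c / r by rewrite divr_gt0.
have T := powR_tangent p1 cr g0.
have rb : r `^ (beta + 1 - p) = r `^ beta * r^-1 `^ (p - 1).
  have -> : beta + 1 - p = beta + -1 * (p - 1) by ring.
  rewrite powRD; last by rewrite (gt_eqF r0) implybT.
  by rewrite powRrM powR_inv1// ltW.
have p10 : 0 <= p - 1 by rewrite subr_ge0.
rewrite rb; have E := @powRM R c r^-1 p (ltW c0) (ltW i0).
have E1 := @powRM R c r^-1 (p - 1) (ltW c0) (ltW i0).
rewrite E E1 in T.
have b0 := powR_ge0 r beta; apply: le_trans (ler_wpM2l b0 T).
move: (powR_ge0 c (p - 1)) (powR_ge0 r^-1 (p - 1)).
move: (r `^ beta) b0 (c `^ p) (r^-1 `^ p) (c `^ (p - 1)) (r^-1 `^ (p - 1)) => b b0 C D A B A0 B0.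
have cn : c != 0 by rewrite gt_eqF.
have rn : r != 0 by rewrite gt_eqF.
rewrite -subr_ge0.
have -> : b * (C * D + p * (A * B) * (g - c / r)) -
   (C * (b * D) + p * A / c * (b * B * (tau - c ^+ 2 / r))) = b * p * A * B / c * (c * g - tau).
  by field; rewrite cn rn.
by rewrite !mulr_ge0 ?invr_ge0 ?subr_ge0 ?(ltW c0)// (le_trans ler01).
Qed.

End pointwise_inequalities.

Section smooth_step.
Context {R : realType}.
Implicit Types (t q N : R).

(** A primitive of a tent, so that the step is of class C^1. *)
Definition sstep t : R := 2 * sqpos t - 4 * sqpos (t - 2^-1) + 2 * sqpos (t - 1).
Definition dsstep t : R := 2 * (2 * Num.max t 0) - 4 * (2 * Num.max (t - 2^-1) 0) + 2 * (2 * Num.max (t - 1) 0).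

Lemma is_derive_subr (c t : R) : is_derive t 1 (fun s : R => s - c) 1.
Proof. by have := is_deriveB (is_derive_id t (1 : R)) (is_derive_cst c t 1); rewrite subr0. Qed.

Lemma is_derive_sstep t : is_derive t 1 sstep (dsstep t).
Proof.
have e c : is_derive t 1 (fun s : R => sqpos (s - c)) (2 * Num.max (t - c) 0).
  by have := @is_derive_comp1 R R (@sqpos R) _ t 1 _ _ (is_derive_sqpos (t - c)) (is_derive_subr c t); rewrite mulr1.
exact: (is_deriveD (is_deriveB (is_deriveZ 2 (is_derive_sqpos t)) (is_deriveZ 4 (e 2^-1))) (is_deriveZ 2 (e 1))).
Qed.

Lemma continuous_dsstep : continuous dsstep.
Proof.
suff H (t : R) : {for t, continuous dsstep} by move=> t; exact: H.
have ci : {for t, continuous (fun s : R => s)} by exact: cvg_id.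
have m c : {for t, continuous (fun s : R => Num.max (s - c) 0)}.
  by apply: cts_max0; apply: ctsB => //; exact: ctsC.
have m0 : {for t, continuous (fun s : R => Num.max s 0)} by exact: cts_max0.
by apply: ctsD; [apply: ctsB|]; apply: ctsM; do ?exact: ctsC; apply: ctsM; do ?exact: ctsC.
Qed.

Lemma sstep_le0 t : t <= 0 -> sstep t = 0 /\ dsstep t = 0.
Proof.
move=> t0; rewrite /sstep /dsstep /sqpos !max_r; [|by lra..].
by split; rewrite !(expr0n, mulr0, subr0, addr0).
Qed.

Lemma sstep_ge1 t : 1 <= t -> sstep t = 1 /\ dsstep t = 0.
Proof.
move=> t1; rewrite /sstep /dsstep /sqpos !max_l; [|by lra..].
by split; field.
Qed.

Lemma sstep_itv t : 0 <= sstep t <= 1 /\ 0 <= dsstep t <= 2.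
Proof.
rewrite /sstep /dsstep /sqpos; have [a|a] := leP t 0; have [b|b] := leP (t - 2^-1) 0;
  have [c|c] := leP (t - 1) 0; split; apply/andP; split; nra.
Qed.

End smooth_step.

(** * Behaviour near the sphere *)

Section near_the_sphere.
Context {R : realType} (m : nat).
Local Notation mu := (@lebesgue_rV R m).
Local Notation pball := (@punctured_ball R m).

Lemma uniform_near_sphere (w : 'rV[R]_m -> 'rV[R]_m) (eta : R) : 0 < eta ->
  {within @closed_collar R m, continuous w} ->
  exists2 b, b < 1 & forall x, closed_collar x -> b < enorm x ->
    enorm (w x - w (radial x)) <= eta.
Proof.
move=> eta0 cw; pose A := @closed_collar R m.
pose q x := enorm (w x - w (radial x)).
have A0 x : A x -> x != 0.
  by move=> /andP[xl _]; rewrite -enorm_gt0; apply: lt_le_trans xl; rewrite invr_gt0.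
have Ar x : A x -> A (radial x).
  by move=> Ax; rewrite /A /closed_collar/= enorm_radial ?A0// lexx invf_le1// ler1n.
have c1 j : {within A, continuous (fun x => w x ord0 j)}.
  by move=> x; apply: (@continuous_comp _ _ _ _ (fun z : 'rV[R]_m => z ord0 j) _ (cw x)); exact: cts_coor.
have c2 j : {within A, continuous (fun x => w (radial x) ord0 j)}.
  apply/subspace_continuousP => x Ax.
  have cwj : (fun z => w z ord0 j) @ within A (nbhs (radial x)) --> w (radial x) ord0 j.
    by have /subspace_continuousP := c1 j; apply; exact: Ar.
  move=> B /cwj; rewrite /within/= /nbhs/= => hB.
  have H1 : nbhs x (fun y => A (radial y) -> B (w (radial y) ord0 j)).
    exact: (continuous_radial (A0 _ Ax) hB).
  by apply: filterS H1 => y H Ay; apply: H; exact: Ar.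
have cq : {within A, continuous q}.
  have cs : {within A, continuous (fun x => \sum_j (w x ord0 j - w (radial x) ord0 j) * (w x ord0 j - w (radial x) ord0 j))}.
    suff H (x : subspace A) : {for x, continuous (fun x : subspace A =>
        \sum_j (w x ord0 j - w (radial x) ord0 j) * (w x ord0 j - w (radial x) ord0 j))}.
      by move=> x; exact: H.
    apply: cts_sum => j; have cj : {for x, continuous (fun x : subspace A => w x ord0 j - w (radial x) ord0 j)}.
      by apply: ctsB; [exact: c1|exact: c2].
    exact: ctsM.
  have -> : q = Num.sqrt \o (fun x => \sum_j (w x ord0 j - w (radial x) ord0 j) * (w x ord0 j - w (radial x) ord0 j)).
    apply/funext => x; rewrite /q /enorm /=; congr Num.sqrt.
    by apply: eq_bigr => j _; rewrite !mxE expr2.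
  by move=> x; apply: (continuous_comp (cs x)); exact: sqrt_continuous.
pose K := [set x | A x /\ eta <= q x].
have cK : compact K.
  apply: (subclosed_compact _ (@compact_closed_collar R m)); last by move=> x [].
  have cA : closed A by apply: compact_closed_rV; exact: compact_closed_collar.
  have /closed_subspaceP[V cV VA] : closed (q @^-1` [set y | eta <= y] : set (subspace A)).
    by apply: closed_comp; [move=> x _; exact: cq|exact: closed_ge].
  have -> : K = V `&` A.
    by rewrite VA; apply/seteqP; split => x [].
  exact: closedI.
have KO : K `<=` @annulus R m 0 1.
  move=> x [Ax qx]; have x0 := A0 _ Ax; case/andP : Ax => _ x1.
  apply/andP; split; first by rewrite enorm_gt0.
  rewrite lt_neqAle x1 andbT; apply/eqP => xe; move: qx.
  by rewrite /q /radial xe invr1 scale1r subrr enorm0 leNgt eta0.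
have [a' [b' [_ _ b1 Kab]]] := compact_annulus (ltr01 : (0 : R) < 1) cK KO.
exists b' => // x Ax bx; rewrite leNgt; apply/negP => qx.
by have /andP[_] := Kab x (conj Ax (ltW qx)); rewrite leNgt bx.
Qed.

Lemma bernoulli_sub (d : R) k : 0 <= d <= 1 -> 1 - (1 - d) ^+ k <= k%:R * d.
Proof.
move=> /andP[d0 d1]; elim: k => [|k IH]; first by rewrite expr0 subrr mul0r.
rewrite exprS -natr1 [(_ + 1) * d]mulrDl mul1r.
have h1 : 0 <= 1 - d by rewrite subr_ge0.
have h2 : 1 - d <= 1 by rewrite gerBl.
have : (1 - d) ^+ k <= 1 by rewrite exprn_ile1.
have : 0 <= (1 - d) ^+ k by rewrite exprn_ge0// subr_ge0.
move: IH; move: (k%:R * d) ((1 - d) ^+ k) => a b ab b0 b1.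
have : d * b <= d by rewrite ler_piMr.
have -> : 1 - (1 - d) * b = (1 - b) + d * b by ring.
by move: ab; lra.
Qed.

(** The mass of a radially constant function in a shell, by scaling. *)
Lemma integral_shell (F : 'rV[R]_m -> R) (d : R) : (0 < m)%N -> 0 <= d < 1 ->
  measurable_fun pball (fun x => F (radial x)) -> (forall x, 0 <= F x) ->
  (\int[mu]_(x in pball) (F (radial x))%:E < +oo)%E ->
  (\int[mu]_(x in pball `&` [set x | (1 - d <= enorm x)%R]) (F (radial x))%:E <=
   (m%:R * d)%:E * \int[mu]_(x in pball) (F (radial x))%:E)%E.
Proof.
move=> m0 /andP[d0 d1] mF F0 Foo; set s := 1 - d; have s0 : 0 < s by rewrite subr_gt0.
have s1 : s <= 1 by rewrite gerBl.
pose h x : \bar R := (F (radial x))%:E.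
have h0 x : (0 <= h x)%E by rewrite lee_fin.
pose inn := @annulus R m 0 s; pose out := pball `&` [set x | s <= enorm x].
have mp := @measurable_punctured_ball R m; have mi := @measurable_annulus R m 0 s.
have mo : measurable out.
  apply: measurableI => //; rewrite -[X in measurable X]setTI.
  have -> : [set x : 'rV[R]_m | s <= enorm x] = @enorm R m @^-1` `[s, +oo[%classic.
    by apply/seteqP; split => x /=; rewrite in_itv/= andbT.
  exact: measurable_enorm.
have U : pball = inn `|` out.
  rewrite /inn /out punctured_ballE; apply/seteqP; split => x /=.
    move=> /andP[x0 x1]; have [xs|sx] := ltP (enorm x) s; first by left; apply/andP.
    by right; split=> //; apply/andP.
  by move=> [/andP[x0 xs]|[]//]; apply/andP; split=> //; exact: lt_le_trans s1.
have D : [disjoint inn & out].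
  by apply/disj_set2P/seteqP; split => // x [/andP[_ xs] [_ /=]]; rewrite leNgt xs.
have mh : measurable_fun pball h by exact/measurable_EFinP.
have split_ : (\int[mu]_(x in pball) h x = \int[mu]_(x in inn) h x + \int[mu]_(x in out) h x)%E.
  by rewrite {1}U ge0_integral_setU// -U.
have inner : (\int[mu]_(x in inn) h x = (s ^+ m)%:E * \int[mu]_(x in pball) h x)%E.
  have mr : measurable_fun setT (h \_ inn).
    apply/(measurable_restrictT _ mi); apply: measurable_funS mh => //.
    by rewrite U; exact: subsetUl.
  have r0 x : (0 <= (h \_ inn) x)%E by rewrite /patch; case: ifP.
  have := ge0_integral_rV_affine (0 : 'rV[R]_m) s0 mr r0.
  under eq_integral do rewrite addr0.
  move=> E.
  have E2 : (\int[mu]_x (h \_ inn) (s *: x) = \int[mu]_(x in pball) h x)%E.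
    rewrite [RHS]integral_mkcond; apply: eq_integral => x _; rewrite /patch.
    have -> : (s *: x \in inn) = (x \in pball).
      rewrite punctured_ballE; apply/idP/idP => /set_mem hx; apply/mem_set; move: hx;
        by rewrite /inn /annulus/= enormZ ger0_norm ?(ltW s0)// pmulr_rgt0// gtr_pMr.
    by case: ifP => // _; rewrite /h radialZ.
  rewrite [LHS]integral_mkcond -E2 E muleA -EFinM mulfV ?mul1e// expf_neq0// gt_eqF//.
move: split_; rewrite inner -/out.
have I0 : (0 <= \int[mu]_(x in pball) h x)%E by exact: integral_ge0.
have O0 : (0 <= \int[mu]_(x in out) h x)%E by exact: integral_ge0.
move: Foo I0 O0; rewrite -/(h _).
case: (integral mu pball h) => [i| |] // _ i0.
case: (integral mu out h) => [u| |] // u0.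
move=> E0; have {}E0 : i = s ^+ m * i + u by case: E0.
rewrite -EFinM lee_fin.
have := @bernoulli_sub d m; rewrite d0 (ltW d1) => /(_ isT) B.
have -> : u = (1 - s ^+ m) * i by rewrite mulrBl mul1r {1}E0 addrC addKr.
by rewrite ler_wpM2r.
Qed.

End near_the_sphere.

(** * Flux through thin shells *)

Section radial_pairings.
Context {R : realType} (m : nat).
Local Notation mu := (@lebesgue_rV R m).
Variable Omega : set 'rV[R]_m.
Hypothesis oO : open Omega.

Lemma weak_gradientS (Omega' : set 'rV[R]_m) u G : open Omega' -> Omega `<=` Omega' ->
  weak_gradient Omega' u G -> weak_gradient Omega u G.
Proof.
move=> oO' OO' HG; have sw := sweak_of_weak_gradient oO' HG.
apply: (@weak_gradient_of_sweak R m Omega u G (fun j => (fun x => u x ord0 j) \_ Omega')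
  (fun j i => (fun x => G x i j) \_ Omega')).
- by move=> j; exact: (sweakS OO' (sw j)).
- by move=> x j Ox; rewrite /patch mem_set//; exact: OO'.
- by move=> x i j Ox; rewrite /patch mem_set//; exact: OO'.
Qed.

Lemma integrable_dot_radial (u : 'rV[R]_m -> 'rV[R]_m) G (h : R -> R) (a b M : R) : weak_gradient Omega u G ->
  0 <= a -> 0 <= b -> closed_annulus a b `<=` Omega -> b <= 1 ->
  continuous h -> (forall t, `|h t| <= M) -> (forall t, t < a ^+ 2 \/ b ^+ 2 < t -> h t = 0) ->
  mu.-integrable setT (EFin \o (fun x => (dotr (u x) x * h (enorm x ^+ 2)) * \1_Omega x)).
Proof.
move=> HG a0 b0 ab b1 ch hM h0; have sw := sweak_of_weak_gradient oO HG.
pose Uj (j : 'I_m) x := ((fun x => u x ord0 j) \_ Omega) x * (x ord0 j * h (enorm x ^+ 2)).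
have hK x : ~ closed_annulus a b x -> h (enorm x ^+ 2) = 0.
  move=> nx; apply: h0; have e0 := enorm_ge0 x.
  have [ax|xa] := ltP (enorm x) a; first by left; rewrite ltrXn2r// ?nnegrE.
  have [bx|xb] := ltP b (enorm x); first by right; rewrite ltrXn2r// ?nnegrE.
  by exfalso; apply: nx; apply/andP.
have mh : measurable_fun setT (fun x : 'rV[R]_m => h (enorm x ^+ 2)).
  apply: (measurableT_comp (f := h)); first exact: continuous_measurable_fun.
  by apply: measurable_funX; exact: measurable_enorm.
have cK := @compact_closed_annulus R m a b.
have iU j : mu.-integrable setT (EFin \o Uj j).
  have [_ lf _ _] := sw j; apply: (integrable_mul_support (M := M) cK (lf _ cK ab)).
  - by apply: measurable_funM => //; exact: measurable_coor.
  - move=> x; have [Kx|nKx] := pselect (closed_annulus a b x); last first.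
      by rewrite hK// mulr0 normr0 (le_trans (normr_ge0 _) (hM 0)).
    rewrite normrM -[leRHS]mul1r; apply: ler_pM => //.
    by apply: le_trans (coor_le_enorm x j) _; case/andP : Kx => _ xb; exact: le_trans b1.
  - by move=> x nKx; rewrite hK// mulr0.
have -> : (EFin \o (fun x => (dotr (u x) x * h (enorm x ^+ 2)) * \1_Omega x)) =
    (fun x => \sum_(j < m) (Uj j x)%:E)%E.
  apply/funext => x /=; rewrite sumEFin; congr EFin.
  rewrite /Uj /dotr mulr_suml mulr_suml; apply: eq_bigr => j _.
  by rewrite /patch indicE; case: ifP => _; [rewrite mulr1 mulrA|rewrite mulr0 mul0r].
by apply: integrable_sum => // j _; exact: iU.
Qed.

Lemma trace_radialB (F F' : R -> R) (a b : R) u1 G1 u2 G2 :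
  (forall t : R, is_derive t 1 F (F' t)) -> continuous F' -> 0 <= a -> 0 <= b ->
  (forall t, t < a ^+ 2 \/ b ^+ 2 < t -> F t = 0) -> closed_annulus a b `<=` Omega ->
  weak_gradient Omega u1 G1 -> weak_gradient Omega u2 G2 ->
  [/\ mu.-integrable setT (EFin \o (fun x => ((\tr (G1 x) - \tr (G2 x)) * F (enorm x ^+ 2)) * \1_Omega x)),
      mu.-integrable setT (EFin \o (fun x => (dotr (u1 x - u2 x) x * (2 * F' (enorm x ^+ 2))) * \1_Omega x)) &
      \int[mu]_x (((\tr (G1 x) - \tr (G2 x)) * F (enorm x ^+ 2)) * \1_Omega x) =
      - \int[mu]_x ((dotr (u1 x - u2 x) x * (2 * F' (enorm x ^+ 2))) * \1_Omega x)].
Proof.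
move=> dF cF a0 b0 F0 ab H1 H2.
have [T1 U1 E1] := integral_trace_radial dF cF b0 F0 ab oO H1.
have [T2 U2 E2] := integral_trace_radial dF cF b0 F0 ab oO H2.
have -> : (fun x => ((\tr (G1 x) - \tr (G2 x)) * F (enorm x ^+ 2)) * \1_Omega x) =
    (fun x => \tr (G1 x) * F (enorm x ^+ 2) * \1_Omega x - \tr (G2 x) * F (enorm x ^+ 2) * \1_Omega x).
  by apply/funext => x; ring.
have -> : (fun x => (dotr (u1 x - u2 x) x * (2 * F' (enorm x ^+ 2))) * \1_Omega x) =
    (fun x => dotr (u1 x) x * (2 * F' (enorm x ^+ 2)) * \1_Omega x -
      dotr (u2 x) x * (2 * F' (enorm x ^+ 2)) * \1_Omega x).
  by apply/funext => x; rewrite dotrBl; ring.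
split; [exact: integrable_realB|exact: integrable_realB|].
by rewrite (RintegralB measurableT T1 T2) (RintegralB measurableT U1 U2) E1 E2; ring.
Qed.

End radial_pairings.

Lemma Rintegral_le_abs d (T : measurableType d) {R : realType} (mu : {measure set T -> \bar R}) (f : T -> R) :
  mu.-integrable setT (EFin \o f) -> ((\int[mu]_x f x)%:E <= \int[mu]_x `|f x|%:E)%E.
Proof.
move=> intf; rewrite /Rintegral fineK; last exact: integrable_fin_num intf.
apply: (@le_trans _ _ `|\int[mu]_x (f x)%:E|%E); first exact: lee_abs.
by apply: le_abse_integral => //; case/integrableP : intf.
Qed.

Section boundary_flux.
Context {R : realType} (m : nat).
Local Notation mu := (@lebesgue_rV R m).
Local Notation pball := (@punctured_ball R m).
Local Notation col := (@collar R m).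
Hypothesis m0 : (0 < m)%N.
Variables (v : 'rV[R]_m -> 'rV[R]_m) (G : 'rV[R]_m -> 'M[R]_m).
Hypothesis HG : weak_gradient pball v G.
Variables (w : 'rV[R]_m -> 'rV[R]_m) (H : 'rV[R]_m -> 'M[R]_m).
Hypothesis HH : weak_gradient col w H.
Hypothesis cw : {within @closed_collar R m, continuous w}.
Variables (N eta b : R).
Hypotheses (N8 : 8 <= N) (eta0 : 0 < eta) (bN : b < 1 - 2 / N).
Hypothesis wb : forall x, closed_collar x -> b < enorm x -> enorm (w x - w (radial x)) <= eta.
Implicit Types (t : R).

Definition chi (t : R) : R := sstep (N - 1 - N * t).
Definition dchi (t : R) : R := - (N * dsstep (N - 1 - N * t)).
Definition omega (t : R) : R := sstep (4 * t - 5 / 4).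
Definition domega (t : R) : R := 4 * dsstep (4 * t - 5 / 4).

Lemma is_derive_affine (c d t : R) : is_derive t 1 (fun s : R => d + c * s) c.
Proof.
have := is_deriveD (is_derive_cst d t 1) (is_deriveZ c (is_derive_id t (1 : R))).
by rewrite add0r -[c *: _]/(c * 1) mulr1.
Qed.

Lemma is_derive_chi t : is_derive t 1 chi (dchi t).
Proof.
have -> : chi = (@sstep R) \o (fun s => (N - 1) + (- N) * s).
  by apply/funext => s; rewrite /chi /= mulNr.
have -> : dchi t = dsstep ((N - 1) + (- N) * t) * - N.
  by rewrite /dchi mulNr; ring.
exact: (@is_derive_comp1 R R _ _ t 1 _ _ (is_derive_sstep _) (is_derive_affine _ _ _)).
Qed.

Lemma is_derive_omega t : is_derive t 1 omega (domega t).
Proof.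
have -> : omega = (@sstep R) \o (fun s => - (5 / 4) + 4 * s).
  by apply/funext => s; rewrite /omega /= addrC.
have -> : domega t = dsstep (- (5 / 4) + 4 * t) * 4.
  by rewrite /domega [- _ + _]addrC mulrC.
exact: (@is_derive_comp1 R R _ _ t 1 _ _ (is_derive_sstep _) (is_derive_affine _ _ _)).
Qed.

Lemma continuous_affine (c d : R) : continuous (fun s : R => d + c * s).
Proof.
move=> t; apply/differentiable_continuous/derivable1_diffP.
exact: (@ex_derive _ _ _ _ _ _ _ (is_derive_affine c d t)).
Qed.

Lemma continuous_sstep : continuous (@sstep R).
Proof.
move=> t; apply/differentiable_continuous/derivable1_diffP.
exact: (@ex_derive _ _ _ _ _ _ _ (is_derive_sstep t)).
Qed.

Lemma cts_step_affine (f : R -> R) (c d t : R) : continuous f -> {for t, continuous (fun s : R => f (d + c * s))}.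
Proof. by move=> cf; apply: (continuous_comp (@continuous_affine c d t)); exact: cf. Qed.

Lemma cts_chi (t : R) : {for t, continuous chi}.
Proof.
have -> : chi = (fun s => sstep ((N - 1) + (- N) * s)) by apply/funext => s; rewrite /chi mulNr.
by apply: cts_step_affine; exact: continuous_sstep.
Qed.

Lemma cts_dchi (t : R) : {for t, continuous dchi}.
Proof.
have -> : dchi = (fun s => - (N * dsstep ((N - 1) + (- N) * s))) by apply/funext => s; rewrite /dchi mulNr.
by apply: ctsN; apply: ctsM; [exact: ctsC|apply: cts_step_affine; exact: continuous_dsstep].
Qed.

Lemma cts_omega (t : R) : {for t, continuous omega}.
Proof.
have -> : omega = (fun s => sstep (- (5 / 4) + 4 * s)) by apply/funext => s; rewrite /omega addrC.
by apply: cts_step_affine; exact: continuous_sstep.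
Qed.

Lemma cts_domega (t : R) : {for t, continuous domega}.
Proof.
have -> : domega = (fun s => 4 * dsstep (- (5 / 4) + 4 * s)) by apply/funext => s; rewrite /domega addrC.
by apply: ctsM; [exact: ctsC|apply: cts_step_affine; exact: continuous_dsstep].
Qed.

Let N0 : 0 < N. Proof. by move: N8; lra. Qed.
Let NV : (0 < N^-1) && (8 * N^-1 <= 1).
Proof. by rewrite invr_gt0 N0 ler_pdivrMr// mul1r. Qed.

Lemma dchi_le0 t : 0 <= - dchi t <= 2 * N.
Proof.
rewrite /dchi opprK; have [_] := sstep_itv (N - 1 - N * t); move: (dsstep _) => s /andP[s0 s2].
by apply/andP; split; move: N0; nra.
Qed.

Lemma dchi_shell t : t < 1 - 2 / N \/ 1 - 1 / N < t -> dchi t = 0.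
Proof.
have h := mulfV (lt0r_neq0 N0).
move=> [h1|h1]; rewrite /dchi.
  have [|_ ->] := @sstep_ge1 R (N - 1 - N * t); last by rewrite mulr0 oppr0.
  by move: h1; rewrite -(ltr_pM2l N0) mulrBr mulr1 mulrCA h mulr1; lra.
have [|_ ->] := @sstep_le0 R (N - 1 - N * t); last by rewrite mulr0 oppr0.
by move: h1; rewrite -(ltr_pM2l N0) mulrBr mulr1 mul1r h; lra.
Qed.

Lemma omega_shell t : 1 - 2 / N <= t -> omega t = 1 /\ domega t = 0.
Proof.
move=> ht; rewrite /omega; have [|-> d0] := @sstep_ge1 R (4 * t - 5 / 4).
  by case/andP : NV; move: ht; move: (N^-1) => n; lra.
by split=> //; rewrite /domega d0 mulr0.
Qed.

Lemma measurable_sphere_gap :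
  measurable_fun pball (fun x => eta + enorm (w (radial x) - radial x)).
Proof.
apply: measurable_funD => //; apply: measurable_enorm_comp => j.
rewrite (_ : (fun x => _) = (fun x => w (radial x) ord0 j - radial x ord0 j)); last by apply/funext => z; rewrite !mxE.
have mr := measurable_funTS (D := pball) (@measurable_radial R m).
apply: measurable_funB; last exact: measurableT_comp (@measurable_coor R m j) mr.
have cS : @sphere_rV R m `<=` @closed_collar R m.
  by move=> x sx; rewrite /closed_collar/= sx lexx invf_le1// ler1n.
have clS : closed (@sphere_rV R m).
  rewrite (_ : @sphere_rV R m = @enorm R m @^-1` [set 1]) //.
  by apply: closed_comp; [move=> x _; exact: continuous_enorm|exact: closed_eq].
apply: (measurable_comp (F := @sphere_rV R m) (f := fun y => w y ord0 j)) => //.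
- exact: closed_measurable_rV.
- by move=> _ [z [_ z0] <-]; apply: enorm_radial; exact/eqP.
apply: measurable_within_continuous => //; have cu := continuous_subspaceW cS cw.
by move=> x; apply: (@continuous_comp _ _ _ _ (fun z : 'rV[R]_m => z ord0 j) _ (cu x)); exact: cts_coor.
Qed.

Lemma flux_inner : let Q1 := fun x => dotr (radial x - w x) x * (2 * - dchi (enorm x ^+ 2)) * \1_col x in
  mu.-integrable setT (EFin \o Q1) ->
  ((\int[mu]_x Q1 x)%:E <= (8 * m%:R)%:E *
    \int[mu]_(x in pball) (eta + enorm (w (radial x) - radial x))%:E)%E.
Proof.
move=> Q1 I1; set F := fun y => eta + enorm (w y - y).
have F0 y : 0 <= F y by rewrite addr_ge0 ?enorm_ge0 ?ltW.
have mF : measurable_fun pball (fun x => F (radial x)) by exact: measurable_sphere_gap.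
have m8 : 0 < 8 * m%:R :> R by rewrite mulr_gt0// ltr0n.
have J0 : (0 <= \int[mu]_(x in pball) (F (radial x))%:E)%E by apply: integral_ge0 => x _; rewrite lee_fin.
have [Foo|] := ltP (\int[mu]_(x in pball) (F (radial x))%:E)%E +oo%E; last first.
  by rewrite leye_eq => /eqP ->; rewrite gt0_muley ?leey// lte_fin.
case/andP : NV => NV0 NV8; have NN : N * N^-1 = 1 by rewrite mulfV// gt_eqF.
have d01 : 0 <= 2 / N < 1 by apply/andP; split; move: NV0 NV8; move: (N^-1) => n; lra.
have := integral_shell m0 d01 mF F0 Foo.
set S := pball `&` _ => HS.
have mp := @measurable_punctured_ball R m.
have mS : measurable S.
  apply: measurableI => //; rewrite -[X in measurable X]setTI.
  have -> : [set x : 'rV[R]_m | 1 - 2 / N <= enorm x] = @enorm R m @^-1` `[1 - 2 / N, +oo[%classic.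
    by apply/seteqP; split => x /=; rewrite in_itv/= andbT.
  exact: measurable_enorm.
have mFS : measurable_fun S (fun x => (F (radial x))%:E).
  by apply/measurable_EFinP; apply: measurable_funS mF => // x [].
apply: (@le_trans _ _ ((4 * N)%:E * \int[mu]_(x in S) (F (radial x))%:E)%E); last first.
  apply: le_trans (lee_wpmul2l _ HS) _; first by rewrite lee_fin mulr_ge0// ltW.
  rewrite muleA -EFinM.
  by have -> : 4 * N * (m%:R * (2 / N)) = 8 * m%:R by field; rewrite gt_eqF.
apply: le_trans (Rintegral_le_abs I1) _.
rewrite -ge0_integralZl_EFin//; last 2 first.
- by move=> x _; rewrite lee_fin.
- by rewrite mulr_ge0// ltW.
rewrite [leRHS]integral_mkcond.
have mI1 : measurable_fun setT Q1 by case/integrableP : I1 => /measurable_EFinP.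
have mP : measurable_fun setT ((fun x => (4 * N)%:E * (F (radial x))%:E)%E \_ S).
  by apply/(measurable_restrictT _ mS); exact: emeasurable_funM.
have P0 x : (0 <= ((fun x => (4 * N)%:E * (F (radial x))%:E)%E \_ S) x)%E.
  rewrite /patch; case: ifP => _ //; rewrite -EFinM lee_fin mulr_ge0// mulr_ge0// ltW//.
apply: ge0_le_integral => //.
  by apply/measurable_EFinP; exact: measurableT_comp.
move=> x _; have [cx|ncx] := pselect (col x); last first.
  by rewrite /Q1 indicE (memNset ncx) mulr0 normr0; exact: P0.
have [ht|ht] := ltP (enorm x ^+ 2) (1 - 2 / N).
  have dc0 : dchi (enorm x ^+ 2) = 0 by apply: dchi_shell; left.
  by rewrite /Q1 dc0 oppr0 !mulr0 mul0r normr0; exact: P0.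
have /andP[xl x1] : 2^-1 < enorm x < 1 by exact: cx.
have r0 : 0 < enorm x by apply: lt_trans xl; rewrite invr_gt0.
have rs : 1 - 2 / N <= enorm x.
  by apply: le_trans ht _; rewrite expr2 ler_piMr ?(ltW x1)// ltW.
have Sx : S x.
  by split=> //; rewrite punctured_ballE; apply/andP.
have cc : closed_collar x by apply/andP; rewrite !ltW.
rewrite /patch (mem_set Sx) /Q1 indicE (mem_set cx) mulr1 -EFinM lee_fin normrM mulrC.
have /andP[d1 d2] := dchi_le0 (enorm x ^+ 2).
apply: ler_pM => //; first by rewrite ger0_norm ?mulr_ge0//; lra.
have dl (y : 'rV[R]_m) : `|dotr y x| <= enorm y.
  have h1 := dotr_le y x; have h2 := dotr_le (- y) x.
  have yx : enorm y * enorm x <= enorm y by rewrite ler_piMr ?enorm_ge0// ltW.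
  rewrite ler_norml; apply/andP; split; last exact: le_trans yx.
  rewrite lerNl -mulN1r -dotrZl scaleN1r; apply: le_trans h2 _; by rewrite enormN.
apply: le_trans (dl _) _.
have -> : radial x - w x = - ((w x - w (radial x)) + (w (radial x) - radial x)).
  by rewrite addrA subrK opprB.
rewrite enormN; apply: le_trans (ler_enormD _ _) _; rewrite /F lerD2r.
by apply: wb => //; apply: lt_le_trans rs.
Qed.

(** The flux of the radial field minus v through a thin shell near the sphere. *)
Lemma boundary_flux :
  ((\int[mu]_x ((dotr (radial x - v x) x * (2 * - dchi (enorm x ^+ 2))) * \1_pball x))%:E <=
   \int[mu]_(x in col) `|\tr (H x) - \tr (G x)|%:E + 16%:E * \int[mu]_(x in col) (enorm (w x - v x))%:E +
   (8 * m%:R)%:E * \int[mu]_(x in pball) (eta + enorm (w (radial x) - radial x))%:E)%E.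
Proof.
have oc : open col by rewrite collarE; exact: open_annulus.
have cp : col `<=` pball.
  rewrite punctured_ballE collarE => x /andP[h x1]; apply/andP; split=> //.
  by apply: lt_trans h; rewrite invr_gt0.
have mc := @measurable_collar R m; have mp := @measurable_punctured_ball R m.
have HGc := weak_gradientS (@open_punctured_ball R m) cp HG.
have HR : weak_gradient pball (@radial R m) (@radial_grad R m).
  by rewrite punctured_ballE; exact: weak_gradient_radial.
have HRc := weak_gradientS (@open_punctured_ball R m) cp HR.
have h4 : (2^-1 : R) ^+ 2 = 1 / 4 by field.
case/andP : NV => NV0 NV8.
have NN : N * N^-1 = 1 by rewrite mulfV// gt_eqF.
pose bb := Num.sqrt (1 - N^-1); pose aa := Num.sqrt (5 / 16 : R).
have aa2 : aa ^+ 2 = 5 / 16 by rewrite sqr_sqrtr// divr_ge0.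
have bb2 : bb ^+ 2 = 1 - N^-1 by rewrite sqr_sqrtr// subr_ge0; move: NV0 NV8; move: (N^-1) => n; lra.
have aa0 : 0 <= aa by exact: sqrtr_ge0.
have bb0 : 0 <= bb by exact: sqrtr_ge0.
have bb1 : bb <= 1 by rewrite -(ler_pXn2r (n := 2))// ?nnegrE// bb2 expr1n; move: NV0 NV8; move: (N^-1) => n; lra.
have AO : closed_annulus aa bb `<=` col.
  move=> x /andP[ax xb]; rewrite collarE; apply/andP; split.
    apply: lt_le_trans ax; rewrite -(ltr_pXn2r (n := 2))// ?nnegrE// aa2 h4; lra.
  apply: le_lt_trans xb _; rewrite -(ltr_pXn2r (n := 2))// ?nnegrE// bb2 expr1n; move: NV0 NV8; move: (N^-1) => n; lra.
pose Ph t := omega t * chi t; pose Ph' t := omega t * dchi t + chi t * domega t.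
have dPh (t : R) : is_derive t 1 Ph (Ph' t).
  have := is_deriveM (is_derive_omega t) (is_derive_chi t).
  by rewrite -[_ *: dchi t]/(_ * _) -[_ *: domega t]/(_ * _).
have cPh : continuous Ph'.
  suff K (t : R) : {for t, continuous Ph'} by move=> t; exact: K.
  by apply: ctsD; apply: ctsM; [exact: cts_omega|exact: cts_dchi|exact: cts_chi|exact: cts_domega].
have om0 t : t < aa ^+ 2 -> omega t = 0 /\ domega t = 0.
  rewrite aa2 => ht; have [|w1 w2] := @sstep_le0 R (4 * t - 5 / 4); first by move: ht; lra.
  by rewrite /omega /domega w1 w2 mulr0.
have ch0 t : bb ^+ 2 < t -> chi t = 0 /\ dchi t = 0.
  rewrite bb2 => ht; have [|w1 w2] := @sstep_le0 R (N - 1 - N * t).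
    by move: ht; rewrite -(ltr_pM2l N0) mulrBr mulr1 NN; lra.
  by rewrite /chi /dchi w1 w2 mulr0 oppr0.
have Ph0 t : t < aa ^+ 2 \/ bb ^+ 2 < t -> Ph t = 0.
  by rewrite /Ph => -[/om0[-> _]|/ch0[-> _]]; rewrite ?mul0r ?mulr0.
have [IT IU EU] := trace_radialB oc dPh cPh aa0 bb0 Ph0 AO HH HGc.
pose ad t : R := 2 * - dchi t.
have ad0 t : 0 <= ad t <= 4 * N by have /andP[] := dchi_le0 t; rewrite /ad => ? ?; apply/andP; split; lra.
have sh t : t < 1 - 2 / N -> ad t = 0 by move=> ht; rewrite /ad dchi_shell ?oppr0 ?mulr0//; left.
have cad : continuous ad.
  suff K (t : R) : {for t, continuous ad} by move=> t; exact: K.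
  by apply: ctsM; [exact: ctsC|apply: ctsN; exact: cts_dchi].
have adM t : `|ad t| <= 4 * N by have /andP[? ?] := ad0 t; rewrite ger0_norm.
have adS t : t < aa ^+ 2 \/ bb ^+ 2 < t -> ad t = 0.
  rewrite /ad => -[h|/ch0[_ ->]]; last by rewrite oppr0 mulr0.
  by apply: sh; move: h; rewrite aa2; move: NV0 NV8; move: (N^-1) => n; lra.
pose od t : R := 2 * (domega t * chi t).
have od0 t : 0 <= od t <= 16.
  have [_ /andP[a1 a2]] := sstep_itv (4 * t - 5 / 4); have [/andP[a3 a4] _] := sstep_itv (N - 1 - N * t).
  rewrite /od /domega /chi; apply/andP; split; first by rewrite !mulr_ge0.
  have : dsstep (4 * t - 5 / 4) * sstep (N - 1 - N * t) <= 2 * 1 by apply: ler_pM.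
  lra.
have cod : continuous od.
  suff K (t : R) : {for t, continuous od} by move=> t; exact: K.
  by apply: ctsM; [exact: ctsC|apply: ctsM; [exact: cts_domega|exact: cts_chi]].
have odM t : `|od t| <= 16 by have /andP[? ?] := od0 t; rewrite ger0_norm.
have odS t : t < aa ^+ 2 \/ bb ^+ 2 < t -> od t = 0.
  by rewrite /od => -[/om0[_ ->]|/ch0[-> _]]; rewrite ?mul0r ?mulr0.
have idot := integrable_dot_radial oc.
have i1 := idot _ _ _ _ _ _ HH aa0 bb0 AO bb1 cad adM adS.
have i2 := idot _ _ _ _ _ _ HRc aa0 bb0 AO bb1 cad adM adS.
have i3 := idot _ _ _ _ _ _ HH aa0 bb0 AO bb1 cod odM odS.
have i4 := idot _ _ _ _ _ _ HGc aa0 bb0 AO bb1 cod odM odS.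
pose Q1 x := dotr (radial x - w x) x * ad (enorm x ^+ 2) * \1_col x.
pose Q2 x := dotr (w x - v x) x * od (enorm x ^+ 2) * \1_col x.
pose Q3 x := dotr (w x - v x) x * (2 * Ph' (enorm x ^+ 2)) * \1_col x.
pose QT x := (\tr (H x) - \tr (G x)) * Ph (enorm x ^+ 2) * \1_col x.
have I1 : mu.-integrable setT (EFin \o Q1).
  have := integrable_realB measurableT i2 i1; congr integrable; apply/funext => x /=.
  by rewrite /Q1 dotrBl; congr EFin; ring.
have I2 : mu.-integrable setT (EFin \o Q2).
  have := integrable_realB measurableT i3 i4; congr integrable; apply/funext => x /=.
  by rewrite /Q2 dotrBl; congr EFin; ring.
have ptw x : dotr (radial x - v x) x * ad (enorm x ^+ 2) * \1_pball x = Q1 x + Q2 x - Q3 x.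
  rewrite /Q1 /Q2 /Q3 !indicE.
  have [ht|ht] := ltP (enorm x ^+ 2) (1 - 2 / N).
    have dc0 : dchi (enorm x ^+ 2) = 0 by apply: dchi_shell; left.
    by rewrite sh// /Ph' /od dc0; ring.
  have [w1 w2] := omega_shell ht.
  have [ht1|ht1] := ltP (1 - 1 / N) (enorm x ^+ 2).
    have dc0 : dchi (enorm x ^+ 2) = 0 by apply: dchi_shell; right.
    by rewrite /ad /Ph' /od dc0 w2; ring.
  have cx : col x.
    have r0 := enorm_ge0 x; rewrite collarE; apply/andP; split.
      rewrite -(ltr_pXn2r (n := 2))// ?nnegrE//; apply: lt_le_trans ht.
      by rewrite h4; move: NV0 NV8; move: (N^-1) => n; lra.
    by rewrite -(ltr_pXn2r (n := 2))// ?nnegrE// expr1n; apply: le_lt_trans ht1 _; move: NV0 NV8; move: (N^-1) => n; lra.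
  rewrite (mem_set cx) (mem_set (cp _ cx)) /ad /Ph' /od w1 w2 !dotrBl; ring.
have I3 : mu.-integrable setT (EFin \o Q3) by exact: IU.
have I12 := integrable_realD measurableT I1 I2.
have -> : \int[mu]_x ((dotr (radial x - v x) x * (2 * - dchi (enorm x ^+ 2))) * \1_pball x) =
    \int[mu]_x Q1 x + \int[mu]_x Q2 x + \int[mu]_x QT x.
  transitivity (\int[mu]_x (Q1 x + Q2 x - Q3 x)); first by apply: eq_Rintegral => x _; exact: ptw.
  rewrite (RintegralB measurableT I12 I3) (RintegralD measurableT I1 I2); congr (_ + _).
  by rewrite /QT EU.
rewrite !EFinD.
have mwv : measurable_fun col (fun x => enorm (w x - v x)).
  apply: measurable_enorm_comp => j.
  rewrite (_ : (fun x => _) = (fun x => w x ord0 j - v x ord0 j)); last by apply/funext => z; rewrite !mxE.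
  by apply: measurable_funB; [exact: weak_gradient_measurable_u HH|exact: weak_gradient_measurable_u HGc].
have mtr : measurable_fun col (fun x => `|\tr (H x) - \tr (G x)|).
  apply: measurableT_comp => //; apply: measurable_funB; apply: measurable_sum => j.
    exact: weak_gradient_measurable HH.
  exact: weak_gradient_measurable HGc.
have B3 : ((\int[mu]_x QT x)%:E <= \int[mu]_(x in col) `|\tr (H x) - \tr (G x)|%:E)%E.
  apply: le_trans (Rintegral_le_abs IT) _; rewrite [leRHS]integral_mkcond.
  have mIT : measurable_fun setT QT by case/integrableP : IT => /measurable_EFinP.
  apply: ge0_le_integral => //.
  - by apply/measurable_EFinP; exact: measurableT_comp.
  - by apply/(measurable_restrictT _ mc); exact/measurable_EFinP.
  move=> x _; rewrite /patch indicE; case: ifP => _; last by rewrite mulr0 normr0.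
  rewrite mulr1 lee_fin normrM ler_piMr// /Ph /omega /chi.
  have [/andP[a1 a2] _] := sstep_itv (4 * enorm x ^+ 2 - 5 / 4).
  have [/andP[a3 a4] _] := sstep_itv (N - 1 - N * enorm x ^+ 2).
  by rewrite ger0_norm ?mulr_ge0// mulr_ile1.
have dotl (y x : 'rV[R]_m) : col x -> `|dotr y x| <= enorm y.
  move=> /andP[_ x1]; have h1 := dotr_le y x; have h2 := dotr_le (- y) x.
  have e0 := enorm_ge0 y; have yx : enorm y * enorm x <= enorm y by rewrite ler_piMr// ltW.
  rewrite ler_norml; apply/andP; split; last exact: le_trans yx.
  rewrite lerNl -mulN1r -dotrZl scaleN1r; apply: le_trans h2 _; by rewrite enormN.
have B2 : ((\int[mu]_x Q2 x)%:E <= 16%:E * \int[mu]_(x in col) (enorm (w x - v x))%:E)%E.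
  apply: le_trans (Rintegral_le_abs I2) _.
  rewrite -ge0_integralZl_EFin//; last 2 first.
  - by move=> x _; rewrite lee_fin enorm_ge0.
  - exact/measurable_EFinP.
  rewrite [leRHS]integral_mkcond.
  have mI2 : measurable_fun setT Q2 by case/integrableP : I2 => /measurable_EFinP.
  apply: ge0_le_integral => //.
  - by apply/measurable_EFinP; exact: measurableT_comp.
  - by apply/(measurable_restrictT _ mc); apply: emeasurable_funM => //; exact/measurable_EFinP.
  move=> x _; rewrite /patch /Q2 indicE; case: ifP => [/set_mem cx|_]; last by rewrite mulr0 normr0.
  rewrite mulr1 -EFinM lee_fin normrM mulrC; apply: ler_pM => //; exact: dotl.
have B1 : ((\int[mu]_x Q1 x)%:E <= (8 * m%:R)%:E *
    \int[mu]_(x in pball) (eta + enorm (w (radial x) - radial x))%:E)%E.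
  exact: flux_inner.
set q1 := (\int[mu]_x Q1 x)%:E; set q2 := (\int[mu]_x Q2 x)%:E.
rewrite (addeC (q1 + q2)%E) (addeC q1) addeA.
exact: (leeD (leeD B3 B2) B1).
Qed.

End boundary_flux.

(** * Direct comparison with the radial map *)

Lemma is_derive_powR {R : realType} (q s : R) : 0 < s ->
  is_derive s 1 (fun x : R => x `^ q) (q * s `^ (q - 1)).
Proof.
move=> s0; have si : s \in `]0, +oo[ by rewrite in_itv/= s0.
apply: DeriveDef; first exact: derivable_powR.
by rewrite -derive1E powR_derive1.
Qed.

Lemma is_derive_rsub {R : realType} (c t : R) : is_derive t 1 (fun s : R => c - s) (- 1).
Proof.
have -> : (fun s : R => c - s) = (fun s => c + (-1) * s) by apply/funext => s; rewrite mulN1r.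
exact: is_derive_affine.
Qed.

Section inner_cutoff.
Context {R : realType} (N q : R).
Hypothesis N0 : 0 < N.
Implicit Types t : R.

(** A positive C^1 function equal to the identity from 1/N on, so that its
    real powers are of class C^1 on the whole line. *)
Definition qf t : R := t + N * sqpos (N^-1 - t).
Definition dqf t : R := 1 - N * (2 * Num.max (N^-1 - t) 0).

(** The power t^q, cut off near the origin. *)
Definition theta t : R := qf t `^ q * sstep (N * t - 1).
Definition dtheta t : R :=
  qf t `^ q * (N * dsstep (N * t - 1)) + sstep (N * t - 1) * (q * qf t `^ (q - 1) * dqf t).

Lemma qf_high t : N^-1 <= t -> qf t = t /\ dqf t = 1.
Proof.
move=> h; rewrite /qf /dqf sqpos_eq0 ?subr_le0// max_r ?subr_le0//.
by rewrite !mulr0 addr0 subr0.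
Qed.

Lemma qf_gt0 t : 0 < qf t.
Proof.
have i0 : 0 < N^-1 by rewrite invr_gt0.
have [h|h] := leP N^-1 t; first by rewrite (qf_high h).1; exact: lt_le_trans h.
rewrite /qf /sqpos max_l ?subr_ge0 ?ltW//.
have : N * N^-1 = 1 by rewrite mulfV// gt_eqF.
move: (N^-1) i0 h => n n0 tn Nn.
have -> : t + N * (n - t) ^+ 2 = (n - t) ^+ 2 * N + t by ring.
have -> : (n - t) ^+ 2 * N + t = N * (t - n / 2) ^+ 2 + (N * n) * (3 / 4 * n) - (N * n - 1) * t by field.
rewrite Nn subrr mul0r subr0 mul1r.
have : 0 <= N * (t - n / 2) ^+ 2 by rewrite mulr_ge0 ?sqr_ge0// ltW.
by move=> h2; apply: ltr_wpDl => //; rewrite mulr_gt0// divr_gt0.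
Qed.

Lemma is_derive_qf t : is_derive t 1 qf (dqf t).
Proof.
have d1 := is_derive_rsub N^-1 t.
have d2 := @is_derive_comp1 R R (@sqpos R) _ t 1 _ _ (is_derive_sqpos (N^-1 - t)) d1.
have := is_deriveD (is_derive_id t 1) (is_deriveZ N d2).
congr is_derive; rewrite /dqf -[N *: _]/(N * _); ring.
Qed.

Lemma cts_stepN (f : R -> R) t : continuous f -> {for t, continuous (fun s : R => f (N * s - 1))}.
Proof.
move=> cf; have -> : (fun s : R => f (N * s - 1)) = (fun s => f (-1 + N * s)).
  by apply/funext => s; rewrite addrC.
exact: cts_step_affine.
Qed.

Lemma is_derive_qf_pow t (r : R) : is_derive t 1 (fun s => qf s `^ r) (r * qf t `^ (r - 1) * dqf t).
Proof.
exact: (@is_derive_comp1 R R (fun x => x `^ r) _ t 1 _ _ (is_derive_powR r (qf_gt0 t)) (is_derive_qf t)).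
Qed.

Lemma cts_qf_pow t (r : R) : {for t, continuous (fun s => qf s `^ r)}.
Proof.
apply/differentiable_continuous/derivable1_diffP.
exact: (@ex_derive _ _ _ _ _ _ _ (is_derive_qf_pow t r)).
Qed.

Lemma is_derive_stepN t : is_derive t 1 (fun s : R => sstep (N * s - 1)) (N * dsstep (N * t - 1)).
Proof.
have -> : (fun s : R => sstep (N * s - 1)) = (@sstep R) \o (fun s => -1 + N * s).
  by apply/funext => s; rewrite /= addrC.
have -> : N * dsstep (N * t - 1) = dsstep (-1 + N * t) * N by rewrite [-1 + _]addrC mulrC.
exact: (@is_derive_comp1 R R _ _ t 1 _ _ (is_derive_sstep _) (is_derive_affine _ _ _)).
Qed.

Lemma is_derive_theta t : is_derive t 1 theta (dtheta t).
Proof.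
have := is_deriveM (is_derive_qf_pow t q) (is_derive_stepN t).
by rewrite -[_ *: (N * _)]/(_ * _) -[_ *: (q * _ * _)]/(_ * _).
Qed.

Lemma cts_theta t : {for t, continuous theta}.
Proof.
apply: ctsM; first exact: cts_qf_pow.
exact: cts_stepN continuous_sstep.
Qed.

Lemma cts_dtheta t : {for t, continuous dtheta}.
Proof.
have cd : {for t, continuous dqf}.
  apply: ctsD; first exact: ctsC.
  apply: ctsN; apply: ctsM; first exact: ctsC.
  apply: ctsM; first exact: ctsC.
  have c1 : {for t, continuous (fun s : R => N^-1 - s)}.
    apply/differentiable_continuous/derivable1_diffP.
    exact: (@ex_derive _ _ _ _ _ _ _ (is_derive_rsub N^-1 t)).
  exact: cts_max0.
apply: ctsD; apply: ctsM.
- exact: cts_qf_pow.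
- by apply: ctsM; [exact: ctsC|exact: cts_stepN (@continuous_dsstep R)].
- exact: cts_stepN continuous_sstep.
- by apply: ctsM => //; apply: ctsM; [exact: ctsC|exact: cts_qf_pow].
Qed.

Lemma stepN_low t : t < N^-1 -> sstep (N * t - 1) = 0 /\ dsstep (N * t - 1) = 0.
Proof.
move=> h; apply: sstep_le0; rewrite subr_le0 -(mulfV (lt0r_neq0 N0)).
by rewrite ler_pM2l// ltW.
Qed.

Lemma theta_low t : t < N^-1 -> theta t = 0.
Proof. by move=> /stepN_low[h _]; rewrite /theta h mulr0. Qed.

Lemma theta_itv t : 0 <= theta t <= t `^ q.
Proof.
have [h|h] := ltP t N^-1; first by rewrite theta_low// lexx powR_ge0.
have [/andP[s0 s1] _] := sstep_itv (N * t - 1).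
by rewrite /theta (qf_high h).1 mulr_ge0 ?powR_ge0//= ler_piMr ?powR_ge0.
Qed.

Lemma dtheta_ge0 t : 0 <= q -> 0 <= dtheta t.
Proof.
move=> q0; rewrite /dtheta; have [h|h] := ltP t N^-1.
  by have [-> ->] := stepN_low h; rewrite mul0r !mulr0 addr0.
have [/andP[s0 s1] /andP[t0 t1]] := sstep_itv (N * t - 1).
rewrite (qf_high h).2 mulr1; apply: addr_ge0; apply: mulr_ge0; rewrite ?powR_ge0//.
  by apply: mulr_ge0 => //; exact: ltW.
by rewrite mulr_ge0 ?powR_ge0.
Qed.

Lemma theta_high t : 2 / N <= t -> theta t = t `^ q.
Proof.
move=> h; have i0 : 0 < N^-1 by rewrite invr_gt0.
have hN : N^-1 <= t by move: h; move: (N^-1) i0 => n; lra.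
rewrite /theta (qf_high hN).1.
have [|-> _] := @sstep_ge1 R (N * t - 1); last by rewrite mulr1.
have : N * (2 / N) <= N * t by rewrite ler_pM2l.
rewrite mulrCA (mulfV (lt0r_neq0 N0)) mulr1; lra.
Qed.

End inner_cutoff.

Section real_integrals.
Context d (T : measurableType d) {R : realType} (mu : {measure set T -> \bar R}).

Lemma ae_le_Rintegral (f g : T -> R) :
  mu.-integrable setT (EFin \o f) -> mu.-integrable setT (EFin \o g) ->
  {ae mu, forall x, f x <= g x} -> \int[mu]_x f x <= \int[mu]_x g x.
Proof.
move=> intf intg fg; have I := integrable_realB measurableT intg intf.
rewrite -subr_ge0 -(RintegralB measurableT intg intf) /Rintegral fine_ge0//.
have mI : measurable_fun setT (fun x => g x - f x) by case/integrableP : I => /measurable_EFinP.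
rewrite (@ae_eq_integral _ _ _ mu setT (fun x => `|g x - f x|%:E) (fun x => (g x - f x)%:E)) //.
- by apply: integral_ge0 => x _; rewrite lee_fin.
- exact/measurable_EFinP.
- by apply/measurable_EFinP; exact: measurableT_comp.
- by apply: filterS fg => x fgx _; rewrite ger0_norm// subr_ge0.
Qed.

Lemma integral_indicE (A : set T) (f : T -> R) : measurable A -> measurable_fun A f ->
  (forall x, 0 <= f x) -> (\int[mu]_(x in A) (f x)%:E < +oo)%E ->
  mu.-integrable setT (EFin \o (fun x => f x * \1_A x)) /\
  (\int[mu]_(x in A) (f x)%:E)%E = (\int[mu]_x (f x * \1_A x))%:E.
Proof.
move=> mA mf f0 fin.
have iA : mu.-integrable A (EFin \o f).
  apply/integrableP; split; first exact/measurable_EFinP.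
  by under eq_integral do rewrite /= ger0_norm//.
have E : (EFin \o f) \_ A = EFin \o (fun x => f x * \1_A x).
  by apply/funext => x; rewrite /patch /= indicE; case: ifP => _; rewrite ?mulr1 ?mulr0.
have I : mu.-integrable setT (EFin \o (fun x => f x * \1_A x)).
  by rewrite -E; apply/(integrable_mkcond _ mA).
split=> //; rewrite /Rintegral fineK; last exact: integrable_fin_num I.
by rewrite integral_mkcond -/(EFin \o f) E.
Qed.

(** Chebyshev splitting: an average of a is at most eta plus a multiple of the
    p-th mean of a, because a is at most eta or eta^(p-1) a is at most a^p. *)
Lemma small_of_Lp (A : set T) (f : nat -> T -> R) (p : R) : measurable A -> (mu A < +oo)%E -> 1 <= p ->
  (forall k, measurable_fun A (f k)) -> (forall k x, 0 <= f k x) ->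
  (\int[mu]_(x in A) (f k x `^ p)%:E)%E @[k --> \oo] --> 0%E ->
  forall e : R, 0 < e -> \forall k \near \oo, (\int[mu]_(x in A) (f k x)%:E <= e%:E)%E.
Proof.
move=> mA fA p1 mf f0 cv e e0.
have Mfin : mu A \is a fin_num by rewrite ge0_fin_numE.
set M := fine (mu A); have M0 : 0 <= M by rewrite fine_ge0.
pose eta := e / 2 / (M + 1).
have eta0 : 0 < eta by rewrite !divr_gt0// ltr_wpDl.
pose c := eta `^ (p - 1); have c0 : 0 < c by rewrite powR_gt0.
have /fine_cvgP[fin /cvgrPdist_lt cv0] :
  (\int[mu]_(x in A) (f k x `^ p)%:E)%E @[k --> \oo] --> 0%R%:E by exact: cv.
have ce : 0 < c * (e / 2) by rewrite mulr_gt0// divr_gt0.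
near=> k.
have fk : (\int[mu]_(x in A) (f k x `^ p)%:E)%E \is a fin_num by near: k.
have sk : (\int[mu]_(x in A) (f k x `^ p)%:E <= (c * (e / 2))%:E)%E.
  rewrite -(fineK fk) lee_fin; apply: ltW; apply: le_lt_trans (ler_norm _) _.
  rewrite -normrN -[X in `|X|]add0r; near: k; exact: cv0.
have mp : measurable_fun A (fun x => f k x `^ p) by exact: measurable_powR_comp.
have ptw x : c * f k x <= c * eta + f k x `^ p.
  have [h|h] := leP (f k x) eta.
    by apply: (@le_trans _ _ (c * eta)); [rewrite ler_pM2l|rewrite lerDl powR_ge0].
  have h0 : 0 < f k x by exact: lt_trans h.
  apply: (@le_trans _ _ (f k x `^ p)); last by rewrite lerDr mulr_ge0// ltW.
  have -> : f k x `^ p = f k x `^ (p - 1) * f k x.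
    by rewrite -[X in _ * X](powRr1 (f0 k x)) -powRD ?subrK// (gt_eqF h0) implybT.
  rewrite ler_pM2r//; apply: ge0_ler_powR; rewrite ?nnegrE ?subr_ge0//; exact: ltW.
have I1 : (c%:E * \int[mu]_(x in A) (f k x)%:E <= (c * eta * M)%:E + (c * (e / 2))%:E)%E.
  have mfE : measurable_fun A (EFin \o f k) by exact/measurable_EFinP.
  have f0E y : A y -> (0 <= (EFin \o f k) y)%E by rewrite lee_fin.
  rewrite -(ge0_integralZl_EFin mu mA f0E mfE (ltW c0)).
  apply: (@le_trans _ _ (\int[mu]_(y in A) ((c * eta)%:E + (f k y `^ p)%:E))%E).
    apply: ge0_le_integral => //.
    all: try (by move=> y _; rewrite -EFinM lee_fin mulr_ge0// ltW).
    all: try (by move=> y _; rewrite -EFinD lee_fin addr_ge0 ?powR_ge0// mulr_ge0// ltW).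
    all: try (by move=> y _; rewrite -EFinM -EFinD lee_fin).
    all: try (by apply: emeasurable_funM => //; exact/measurable_EFinP).
    all: try (by apply: emeasurable_funD => //; exact/measurable_EFinP).
  have ce0 : 0 <= c * eta by rewrite mulr_ge0// ltW.
  have mpE : measurable_fun A (EFin \o (fun x => f k x `^ p)) by exact/measurable_EFinP.
  have n1 y : A y -> (0 <= cst (c * eta)%:E y)%E by rewrite lee_fin.
  have n2 y : A y -> (0 <= (EFin \o (fun x => (f k x `^ p)%R)) y)%E by rewrite lee_fin powR_ge0.
  have := @ge0_integralD _ _ _ mu A mA _ _ n1 (@measurable_cst _ _ _ _ _ _) n2 mpE.
  rewrite /= => ->.
  by apply: leeD => //; rewrite integral_cst// -(fineK Mfin) -EFinM.
rewrite -(@lee_pmul2l _ c%:E)//; apply: le_trans I1 _.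
rewrite -EFinD -EFinM lee_fin -mulrA -mulrDr ler_pM2l//.
have h : eta * M + eta = e / 2.
  by rewrite -[X in _ + X]mulr1 -mulrDr divfK// gt_eqF// ltr_wpDl.
by move: h eta0; move: (eta * M) => y; lra.
Unshelve. all: by end_near.
Qed.

End real_integrals.

Lemma powR_split {R : realType} (r g beta p : R) : 1 <= p -> 0 < r -> 0 <= g ->
  r `^ (beta + 1 - p) * g <= r `^ beta * (r^-1 `^ p + g `^ p).
Proof.
move=> p1 r0 g0; have i0 : 0 < r^-1 by rewrite invr_gt0.
have -> : r `^ (beta + 1 - p) = r `^ beta * r^-1 `^ (p - 1).
  have -> : beta + 1 - p = beta + -1 * (p - 1) by ring.
  rewrite powRD; last by rewrite (gt_eqF r0) implybT.
  by rewrite powRrM powR_inv1// ltW.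
have p10 : 0 <= p - 1 by rewrite subr_ge0.
have pS (y : R) : 0 <= y -> y `^ p = y * y `^ (p - 1) by move=> y0; rewrite -(powRS y0 p10) subrK.
rewrite -mulrA; apply: ler_wpM2l; first exact: powR_ge0.
have [h|h] := leP g r^-1.
  apply: (@le_trans _ _ (r^-1 `^ p)); last by rewrite lerDl powR_ge0.
  by rewrite (pS _ (ltW i0)) mulrC ler_wpM2r ?powR_ge0.
apply: (@le_trans _ _ (g `^ p)); last by rewrite lerDr powR_ge0.
rewrite (pS _ g0) mulrC ler_wpM2l//; apply: ge0_ler_powR; rewrite ?nnegrE//; exact: ltW.
Qed.

Section traces.
Context {R : realType} (m : nat).

Lemma trace_radial_grad (x : 'rV[R]_m) : x != 0 -> \tr (radial_grad x) = (m%:R - 1) / enorm x.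
Proof.
move=> x0; have r0 : enorm x != 0 by rewrite gt_eqF// enorm_gt0.
set r := enorm x; have S : \sum_(j < m) x ord0 j ^+ 2 = r ^+ 2.
  by rewrite sqr_enorm; apply: eq_bigr => j _; rewrite expr2.
rewrite /mxtrace; transitivity (\sum_(i < m) (r^-1 - r ^- 3 * x ord0 i ^+ 2)).
  by apply: eq_bigr => i _; rewrite mxE eqxx -/r expr2 mul1r; congr (_ - _); rewrite mulrC.
have r3 : r ^- 3 * r ^+ 2 = r^-1 by rewrite exprS invfM -mulrA mulVf ?mulr1// expf_neq0.
by rewrite big_split/= sumr_const card_ord sumrN -mulr_sumr S r3 mulrBl mul1r mulr_natl.
Qed.

Lemma normr_trace_le (A : 'M[R]_m) : `|\tr A| <= m%:R * mxnorm2 A.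
Proof.
apply: le_trans (ler_norm_sum _ _ _) _.
apply: (@le_trans _ _ (\sum_(i < m) mxnorm2 A)); first by apply: ler_sum => i _; exact: mxnorm2_entry.
by rewrite sumr_const card_ord mulr_natl.
Qed.

End traces.

Section small_flux.
Context {R : realType} (m : nat).
Hypothesis m0 : (0 < m)%N.
Local Notation mu := (@lebesgue_rV R m).
Local Notation pball := (@punctured_ball R m).
Local Notation col := (@collar R m).
Variables (p : R) (v : 'rV[R]_m -> 'rV[R]_m).
Hypotheses (p1 : 1 <= p) (dv : weakly_differentiable pball v) (tr : has_trace p v id).

Lemma lebesgue_pball_lty : (mu pball < +oo)%E.
Proof.
have cK := @compact_closed_annulus R m 0 1.
apply: le_lt_trans (lebesgue_rV_compact cK); apply: le_measure; rewrite ?inE.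
- exact: measurable_punctured_ball.
- by apply: closed_measurable_rV; apply: compact_closed => //; exact: norm_hausdorff.
by rewrite punctured_ballE => x /andP[x0 x1]; apply/andP; rewrite !ltW.
Qed.

(** The trace condition makes the flux of the radial field minus v through the
    thin shells vanish: the three error terms bounding it are controlled by
    the p-th means that tend to zero in the definition of the trace. *)
Lemma small_flux (del : R) : 0 < del -> exists N0 : R, forall N, N0 <= N -> 8 <= N ->
  \int[mu]_x ((dotr (radial x - v x) x * (2 * - dchi N (enorm x ^+ 2))) * \1_pball x) <= del.
Proof.
move=> d0; case: tr => w [Hw Lw Gw Sw].
have HG := weak_gradient_wgrad dv; set G := wgrad pball v in HG.
have mR0 : 0 < m%:R :> R by rewrite ltr0n.
pose K : R := 17 * m%:R + 16; have K0 : 0 < K by rewrite addr_gt0// mulr_gt0.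
pose e := del / K; have e0 : 0 < e by rewrite divr_gt0.
have dw k : weakly_differentiable col (w k) by have [_ []] := Hw k.
have HH k := weak_gradient_wgrad (dw k).
have cw k : {within @closed_collar R m, continuous (w k)} by have [] := Hw k.
have mc := @measurable_collar R m; have mp := @measurable_punctured_ball R m.
have cb : col `<=` pball.
  by rewrite punctured_ballE => x /andP[h x1]; apply/andP; split=> //; apply: lt_trans h.
have HGc := weak_gradientS (@open_punctured_ball R m) cb HG.
have mwv k : measurable_fun col (fun z => enorm (w k z - v z)).
  apply: measurable_enorm_comp => j.
  rewrite (_ : (fun x => _) = (fun x => w k x ord0 j - v x ord0 j)); last by apply/funext => z; rewrite !mxE.
  by apply: measurable_funB; [exact: weak_gradient_measurable_u (HH k)|exact: weak_gradient_measurable_u HGc].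
have mGG k : measurable_fun col (fun z => mxnorm2 (wgrad col (w k) z - G z)).
  apply: measurable_mxnorm2 => i j.
  rewrite (_ : (fun x => _) = (fun x => wgrad col (w k) x i j - G x i j)); last by apply/funext => z; rewrite !mxE.
  by apply: measurable_funB; [exact: weak_gradient_measurable (HH k)|exact: weak_gradient_measurable HGc].
have msp k : measurable_fun pball (fun x => enorm (w k (radial x) - radial x)).
  have := measurable_sphere_gap (cw k) 0; congr measurable_fun.
  by apply/funext => x; rewrite add0r.
have S1 := small_of_Lp mc (lebesgue_collar m) p1 mwv (fun k x => enorm_ge0 _) Lw e0.
have S2 := small_of_Lp mc (lebesgue_collar m) p1 mGG (fun k x => mxnorm2_ge0 _) Gw e0.
have Lr : (\int[mu]_(x in pball) (enorm (w k (radial x) - radial x) `^ p)%:E)%E @[k --> \oo] --> 0%E.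
  apply: (squeeze_cvge _ (cvg_cst 0%E) Sw); near=> k; apply/andP; split.
    by apply: integral_ge0 => x _; rewrite lee_fin powR_ge0.
  have mF : measurable_fun (@sphere_rV R m) (fun y => enorm (w k y - y) `^ p).
    apply: measurable_powR_comp; apply: measurable_enorm_comp => j.
    rewrite (_ : (fun x => _) = (fun x => w k x ord0 j - x ord0 j)); last by apply/funext => z; rewrite !mxE.
    apply: measurable_funB; last by apply: measurable_funTS; exact: measurable_coor.
    have cS : @sphere_rV R m `<=` @closed_collar R m.
      by move=> x sx; rewrite /closed_collar/= sx lexx invf_le1// ler1n.
    have clS : closed (@sphere_rV R m).
      rewrite (_ : @sphere_rV R m = @enorm R m @^-1` [set 1]) //.
      by apply: closed_comp; [move=> x _; exact: continuous_enorm|exact: closed_eq].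
    have mS := closed_measurable_rV clS.
    apply: measurable_within_continuous => //.
    have cu := continuous_subspaceW cS (cw k).
    by move=> x; apply: (@continuous_comp _ _ _ _ (fun z : 'rV[R]_m => z ord0 j) _ (cu x)); exact: cts_coor.
  have := surface_integralE m0 mF (fun y => powR_ge0 _ _); rewrite /= => ->.
  rewrite -[leLHS]mul1e; apply: lee_wpmul2r; last by rewrite lee_fin ler1n.
  by apply: integral_ge0 => x _; rewrite lee_fin powR_ge0.
have S3 := small_of_Lp mp lebesgue_pball_lty p1 msp (fun k x => enorm_ge0 _) Lr e0.
have [k [[s1 s2] s3]] := filter_ex (filterI (filterI S1 S2) S3).
have Mfin : mu pball \is a fin_num by rewrite ge0_fin_numE// lebesgue_pball_lty.
set M := fine (mu pball); have M0 : 0 <= M by rewrite fine_ge0.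
pose eta := e / (M + 1); have M1 : 0 < M + 1 by rewrite ltr_wpDl.
have eta0 : 0 < eta by rewrite divr_gt0.
have [b b1 hb] := uniform_near_sphere eta0 (cw k).
exists (2 / (1 - b) + 1) => N NN N8.
have N0 : 0 < N by apply: lt_le_trans N8.
have bb : 0 < 1 - b by rewrite subr_gt0.
have bN : b < 1 - 2 / N.
  rewrite ltrBrDr addrC -ltrBrDr ltr_pdivrMr// -ltr_pdivrMl//.
  by rewrite [_^-1 * 2]mulrC; apply: lt_le_trans NN; rewrite ltrDl.
rewrite -lee_fin; apply: le_trans (boundary_flux m0 HG (HH k) (cw k) N8 eta0 bN hb) _.
have T1 : (\int[mu]_(x in col) `|\tr (wgrad col (w k) x) - \tr (G x)|%:E <= (m%:R * e)%:E)%E.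
  have mE : measurable_fun col (EFin \o (fun z => mxnorm2 (wgrad col (w k) z - G z))) by exact/measurable_EFinP.
  have E0 y : col y -> (0 <= (EFin \o (fun z => (mxnorm2 (wgrad col (w k) z - G z))%R)) y)%E by rewrite lee_fin mxnorm2_ge0.
  rewrite EFinM; apply: (@le_trans _ _ (m%:R%:E * \int[mu]_(x in col) (mxnorm2 (wgrad col (w k) x - G x))%:E)%E);
    last by apply: lee_wpmul2l; rewrite ?lee_fin.
  rewrite -(ge0_integralZl_EFin mu mc E0 mE (ler0n _ _)).
  apply: ge0_le_integral => //.
  all: try (by move=> y _; rewrite -EFinM lee_fin mulr_ge0 ?mxnorm2_ge0).
  all: try (by move=> y _; rewrite -EFinM lee_fin -linearB; exact: normr_trace_le).
  all: try (by apply: emeasurable_funM).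
  apply/measurable_EFinP; apply: measurableT_comp => //; apply: measurable_funB; apply: measurable_sum => j.
    exact: weak_gradient_measurable (HH k).
  exact: weak_gradient_measurable HGc.
have T3 : (\int[mu]_(x in pball) (eta + enorm (w k (radial x) - radial x))%:E <= (e + e)%:E)%E.
  have mE : measurable_fun pball (EFin \o (fun x => enorm (w k (radial x) - radial x))) by exact/measurable_EFinP.
  have n1 y : pball y -> (0 <= cst eta%:E y)%E by rewrite lee_fin ltW.
  have n2 y : pball y -> (0 <= (EFin \o (fun x => (enorm (w k (radial x) - radial x))%R)) y)%E by rewrite lee_fin enorm_ge0.
  have -> : (\int[mu]_(x in pball) (eta + enorm (w k (radial x) - radial x))%:E =
      eta%:E * mu pball + \int[mu]_(x in pball) (enorm (w k (radial x) - radial x))%:E)%E.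
    rewrite -(integral_cst mu mp eta%:E).
    exact: (@ge0_integralD _ _ _ mu pball mp _ _ n1 (@measurable_cst _ _ _ _ _ _) n2 mE).
  rewrite EFinD; apply: leeD => //; rewrite -(fineK Mfin) -EFinM lee_fin -/M.
  by rewrite /eta mulrAC ler_pdivrMr// ler_pM2l// lerDl.
have -> : del = m%:R * e + 16 * e + 8 * m%:R * (e + e).
  by rewrite /e /K; field; rewrite -/K gt_eqF.
rewrite !EFinD; apply: leeD; first apply: leeD => //.
  by rewrite EFinM; apply: lee_wpmul2l; rewrite ?lee_fin.
by rewrite [leRHS]EFinM; apply: lee_wpmul2l => //; rewrite lee_fin mulr_ge0.
Unshelve. all: by end_near.
Qed.

End small_flux.

Section trace_energy.
Context {R : realType} (m : nat).
Hypothesis m1 : (1 < m)%N.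
Local Notation mu := (@lebesgue_rV R m).
Local Notation pball := (@punctured_ball R m).
Variables (p beta : R) (v : 'rV[R]_m -> 'rV[R]_m).
Hypotheses (p1 : 1 <= p) (pb : p <= beta + 1).
Implicit Types (x : 'rV[R]_m) (k : nat) (t : R).
Hypothesis adm : admissible p beta v.
Hypothesis RI : (\int[mu]_(x in pball) (enorm x `^ beta * (enorm x)^-1 `^ p)%:E < +oo)%E.

Let G := wgrad pball v.
Let D0 (x : 'rV[R]_m) := enorm x `^ beta * (enorm x)^-1 `^ p.
Let D1 (x : 'rV[R]_m) := enorm x `^ beta * mxnorm2 (G x) `^ p.
Let tt (x : 'rV[R]_m) := \tr (G x) - \tr (radial_grad x).
Let q := (beta + 1 - p) / 2.
Let phi (x : 'rV[R]_m) := tt x * (enorm x ^+ 2) `^ q * \1_pball x.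
Let Nk (k : nat) : R := (k + 8)%:R.
Let Phi k t := theta (Nk k) q t * chi (Nk k) t.
Let dPhi k t := theta (Nk k) q t * dchi (Nk k) t + chi (Nk k) t * dtheta (Nk k) q t.
Let fk k (x : 'rV[R]_m) := tt x * Phi k (enorm x ^+ 2) * \1_pball x.

Let m0 : (0 < m)%N. Proof. exact: ltnW. Qed.
Let mp : measurable pball. Proof. exact: measurable_punctured_ball. Qed.
Let op : open pball. Proof. exact: open_punctured_ball. Qed.
Let dv : weakly_differentiable pball v. Proof. by case: adm => [[]]. Qed.
Let v1 : {ae mu, forall x, @ball_rV R m x -> enorm (v x) = 1}. Proof. by case: adm => [[]]. Qed.
Let HG : weak_gradient pball v G. Proof. exact: (weak_gradient_wgrad dv). Qed.
Let HR : weak_gradient pball (@radial R m) (@radial_grad R m).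
Proof. by rewrite punctured_ballE; exact: weak_gradient_radial. Qed.
Let q0 : 0 <= q. Proof. by rewrite divr_ge0// subr_ge0. Qed.
Let N8 k : 8 <= Nk k. Proof. by rewrite /Nk ler_nat leq_addl. Qed.
Let N0 k : 0 < Nk k. Proof. exact: lt_le_trans (N8 k). Qed.

Let pball_itv x : pball x -> 0 < enorm x < 1.
Proof. by rewrite punctured_ballE. Qed.

Let sq_powR x : 0 < enorm x -> (enorm x ^+ 2) `^ q = enorm x `^ (beta + 1 - p).
Proof.
move=> r0; rewrite -powR_mulrn ?ltW// -powRrM; congr (_ `^ _).
by rewrite /q; field.
Qed.

Let D0_ge0 x : 0 <= D0 x. Proof. by rewrite mulr_ge0 ?powR_ge0. Qed.
Let D1_ge0 x : 0 <= D1 x. Proof. by rewrite mulr_ge0 ?powR_ge0. Qed.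

Let mD1 : measurable_fun pball D1.
Proof.
apply: measurable_funM; apply: measurable_powR_comp.
  by apply: measurable_funTS; exact: measurable_enorm.
by apply: measurable_mxnorm2 => i j; exact: weak_gradient_measurable HG.
Qed.

Let mD0 : measurable_fun pball D0.
Proof.
apply: measurable_funM; apply: measurable_powR_comp.
  by apply: measurable_funTS; exact: measurable_enorm.
apply: (eq_measurable_fun (fun x : 'rV[R]_m => enorm x `^ (-1))).
  by move=> x _; rewrite powR_inv1// enorm_ge0.
by apply: measurable_powR_comp; apply: measurable_funTS; exact: measurable_enorm.
Qed.

Let E1fin : (\int[mu]_(x in pball) (D1 x)%:E < +oo)%E.
Proof. by rewrite -(energyE m0 p beta HG); case: adm => [[]]. Qed.

Let is_derive_Phi k (t : R) : is_derive t 1 (Phi k) (dPhi k t).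
Proof.
have := is_deriveM (@is_derive_theta R (Nk k) q (N0 k) t) (is_derive_chi (Nk k) t).
by rewrite -[_ *: dchi _ t]/(_ * _) -[_ *: dtheta _ _ t]/(_ * _).
Qed.

Let continuous_dPhi k : continuous (dPhi k).
Proof.
suff K (t : R) : {for t, continuous (dPhi k)} by move=> t; exact: K.
apply: ctsD; apply: ctsM; [exact: (cts_theta (N0 k))|exact: cts_dchi|exact: cts_chi|exact: (cts_dtheta (N0 k))].
Qed.

Let chi_high k (t : R) : 1 - (Nk k)^-1 < t -> chi (Nk k) t = 0 /\ dchi (Nk k) t = 0.
Proof.
move=> h; have [|a1 a2] := @sstep_le0 R (Nk k - 1 - Nk k * t); last by rewrite /chi /dchi a1 a2 mulr0 oppr0.
have : Nk k * (1 - (Nk k)^-1) <= Nk k * t by rewrite (ler_pM2l (N0 k)) ltW.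
rewrite mulrBr mulr1 (mulfV (lt0r_neq0 (N0 k))); lra.
Qed.

Let NV k : 0 < (Nk k)^-1 /\ 8 * (Nk k)^-1 <= 1.
Proof. by split; [rewrite invr_gt0 N0|rewrite ler_pdivrMr ?N0// mul1r N8]. Qed.

Let pairing k :
  [/\ mu.-integrable setT (EFin \o fk k),
      mu.-integrable setT (EFin \o (fun x => (dotr (v x - radial x) x * (2 * dPhi k (enorm x ^+ 2))) * \1_pball x)),
      mu.-integrable setT (EFin \o (fun x => (dotr (radial x - v x) x * (2 * - dchi (Nk k) (enorm x ^+ 2))) * \1_pball x)) &
      \int[mu]_x fk k x =
      - \int[mu]_x ((dotr (v x - radial x) x * (2 * dPhi k (enorm x ^+ 2))) * \1_pball x)].
Proof.
have [n0 n8] := NV k; pose a := Num.sqrt (Nk k)^-1; pose b := Num.sqrt (1 - (Nk k)^-1).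
have a2 : a ^+ 2 = (Nk k)^-1 by rewrite sqr_sqrtr// ltW.
have b2 : b ^+ 2 = 1 - (Nk k)^-1 by rewrite sqr_sqrtr// subr_ge0; move: n0 n8; move: (_^-1) => n; lra.
have a0 : 0 <= a by exact: sqrtr_ge0.
have b0 : 0 <= b by exact: sqrtr_ge0.
have b1 : b < 1 by rewrite -(ltr_pXn2r (n := 2))// ?nnegrE// b2 expr1n; move: n0; move: (_^-1) => n; lra.
have AO : closed_annulus a b `<=` pball.
  move=> x /andP[ax xb]; rewrite punctured_ballE; apply/andP; split; last exact: le_lt_trans b1.
  by apply: lt_le_trans ax; rewrite sqrtr_gt0.
have P0 t : t < a ^+ 2 \/ b ^+ 2 < t -> Phi k t = 0.
  rewrite a2 b2 /Phi => -[h|h]; first by rewrite (@theta_low R (Nk k) q (N0 k) t h) mul0r.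
  by rewrite (chi_high h).1 mulr0.
have [IT IU EU] := trace_radialB op (is_derive_Phi k) (@continuous_dPhi k) a0 b0 P0 AO HG HR.
pose h t : R := 2 * - dchi (Nk k) t.
have ch : continuous h.
  suff K (t : R) : {for t, continuous h} by move=> t; exact: K.
  by apply: ctsM; [exact: ctsC|apply: ctsN; exact: cts_dchi].
have hM t : `|h t| <= 4 * Nk k.
  have /andP[d1 d2] := dchi_le0 (N8 k) t.
  by rewrite ger0_norm ?mulr_ge0// /h; move: d2; lra.
have h0 t : t < a ^+ 2 \/ b ^+ 2 < t -> h t = 0.
  rewrite a2 b2 /h => -[ht|/chi_high[_ ->]]; last by rewrite oppr0 mulr0.
  rewrite (dchi_shell (N8 k)) ?oppr0 ?mulr0//; left.
  by apply: lt_le_trans ht _; move: n0 n8; move: (_^-1) => n; lra.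
have idot := integrable_dot_radial op.
have i1 := idot _ _ _ _ _ _ HG a0 b0 AO (ltW b1) ch hM h0.
have i2 := idot _ _ _ _ _ _ HR a0 b0 AO (ltW b1) ch hM h0.
split=> //.
have := integrable_realB measurableT i2 i1; congr integrable; apply/funext => x /=.
by rewrite dotrBl /h; congr EFin; ring.
Qed.

(** The radial field and v are unit fields, so v has the smaller radial
    component; only the outer part of the derivative of the cut-off can then
    contribute with the wrong sign. *)
Let pairing_ge k (del : R) :
  \int[mu]_x ((dotr (radial x - v x) x * (2 * - dchi (Nk k) (enorm x ^+ 2))) * \1_pball x) <= del ->
  - del <= \int[mu]_x fk k x.
Proof.
have [_ IU IS ->] := pairing k => le; rewrite lerN2; apply: le_trans le.
apply: ae_le_Rintegral => //; apply: filterS v1 => x vx.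
have [px|npx] := pselect (pball x); last by rewrite indicE (memNset npx) !mulr0.
rewrite indicE (mem_set px).
have /andP[r0 r1] := pball_itv px; rewrite !mulr1.
have {}vx : enorm (v x) = 1 by apply: vx; exact: r1.
have s0 : 0 <= dotr (radial x - v x) x.
  rewrite dotrBl subr_ge0 dotrZl -[dotr x x]sqr_enorm expr2 mulKf ?gt_eqF//.
  by apply: le_trans (dotr_le _ _) _; rewrite vx mul1r.
have -> : dotr (v x - radial x) x = - dotr (radial x - v x) x by rewrite !dotrBl opprB.
move: (dotr _ _) s0 => s s0; rewrite /dPhi.
have /andP[d0 _] := dchi_le0 (N8 k) (enorm x ^+ 2).
have e0 := @dtheta_ge0 R (Nk k) q (N0 k) (enorm x ^+ 2) q0.
have /andP[t0 t1] := @theta_itv R (Nk k) q (N0 k) (enorm x ^+ 2).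
have t2 : (enorm x ^+ 2) `^ q <= 1.
  have e1 : 1 `^ q = 1 :> R by rewrite powR1.
  rewrite -[leRHS]e1; apply: ge0_ler_powR; rewrite ?nnegrE ?sqr_ge0//.
  by apply: exprn_ile1 => //; exact: ltW.
have [/andP[c0 c1] _] := sstep_itv (Nk k - 1 - Nk k * enorm x ^+ 2).
rewrite -/(chi (Nk k) (enorm x ^+ 2)) in c0 c1.
have {t1 t2} t1 := le_trans t1 t2.
move: (chi _ _) c0 c1 (dchi _ _) d0 (theta _ _ _) t0 t1 (dtheta _ _ _) e0 => c c0 c1 d d0 t t0 t1 e e0.
rewrite -subr_ge0.
have -> : s * (2 * - d) - - s * (2 * (t * d + c * e)) = 2 * s * ((1 - t) * - d + c * e) by ring.
by rewrite mulr_ge0 ?mulr_ge0// addr_ge0 ?mulr_ge0// subr_ge0.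
Qed.

Let dom x : R := 3 * m%:R * (D0 x * \1_pball x + D1 x * \1_pball x).

Let I0 := integral_indicE mp mD0 D0_ge0 RI.
Let I1 := integral_indicE mp mD1 D1_ge0 E1fin.

Let Idom : mu.-integrable setT (EFin \o dom).
Proof.
have := integrableZl measurableT (3 * m%:R) (integrable_realD measurableT I0.1 I1.1).
by congr integrable.
Qed.

Let dominated x : pball x -> `|tt x| * (enorm x ^+ 2) `^ q <= 3 * m%:R * (D0 x + D1 x).
Proof.
move=> px; have /andP[r0 r1] := pball_itv px; rewrite (sq_powR r0).
have g0 := mxnorm2_ge0 (G x); have i0 : 0 <= (enorm x)^-1 by rewrite invr_ge0 ltW.
have A1 := powR_split beta p1 r0 g0; have A2 := powR_split beta p1 r0 i0.
have T : `|tt x| <= m%:R * (mxnorm2 (G x) + (enorm x)^-1).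
  apply: le_trans (ler_normB _ _) _; rewrite mulrDr; apply: lerD; first exact: normr_trace_le.
  rewrite trace_radial_grad -?enorm_gt0// ger0_norm; last first.
    by rewrite mulr_ge0// subr_ge0 ler1n m0.
  by apply: ler_wpM2r => //; rewrite lerBlDr lerDl.
apply: le_trans (ler_wpM2r (powR_ge0 _ _) T) _.
apply: (@le_trans _ _ (m%:R * (3 * (D0 x + D1 x)))); last by rewrite mulrCA mulrA.
rewrite -[leLHS]mulrA; apply: ler_wpM2l; first exact: ler0n.
have P1 : 0 <= enorm x `^ beta * mxnorm2 (G x) `^ p by rewrite mulr_ge0 ?powR_ge0.
move: A1 A2 P1; rewrite /D0 /D1; move: ((enorm x)^-1) => rho; lra.
Qed.

Let fk_dom k x : `|fk k x| <= dom x.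
Proof.
rewrite /fk /dom !indicE; have [px|npx] := pselect (pball x); last by rewrite (memNset npx) !mulr0 normr0 addr0 mulr0.
rewrite (mem_set px).
rewrite !mulr1; apply: le_trans (dominated px); rewrite normrM; apply: ler_wpM2l => //.
have /andP[t0 t1] := @theta_itv R (Nk k) q (N0 k) (enorm x ^+ 2).
have [/andP[c0 c1] _] := sstep_itv (Nk k - 1 - Nk k * enorm x ^+ 2).
have h0 : 0 <= Phi k (enorm x ^+ 2) by exact: mulr_ge0 t0 c0.
by rewrite (ger0_norm h0); exact: le_trans (ler_piMr t0 c1) t1.
Qed.

Let fk_cvg x : (EFin \o fk k) x @[k --> \oo] --> (EFin \o phi) x.
Proof.
apply: cvg_near_cst; have [px|npx] := pselect (pball x); last first.
  by apply: nearW => k; rewrite /= /fk /phi indicE (memNset npx) !mulr0.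
have /andP[r0 r1] := pball_itv px; set t := enorm x ^+ 2.
have t0 : 0 < t by rewrite exprn_gt0.
have t1 : t < 1 by rewrite exprn_ilt1// ltW.
have A : \forall k \near \oo, 2 / t <= k%:R :> R by exact: nbhs_infty_ger.
have B : \forall k \near \oo, 2 / (1 - t) <= k%:R :> R by exact: nbhs_infty_ger.
apply: filterS2 A B => k A B; rewrite /= /fk /phi -/t /Phi.
have kN : k%:R <= Nk k by rewrite /Nk ler_nat leq_addr.
have t10 : 0 < 1 - t by rewrite subr_gt0.
have A' : 2 <= Nk k * t by rewrite -ler_pdivrMr//; exact: le_trans kN.
have B' : 2 <= Nk k * (1 - t) by rewrite -ler_pdivrMr//; exact: le_trans kN.
rewrite (@theta_high R (Nk k) q (N0 k)); last by rewrite (ler_pdivrMr _ _ (N0 k)) mulrC.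
rewrite /chi; have [|-> _] := @sstep_ge1 R (Nk k - 1 - Nk k * t); last by rewrite mulr1.
by move: B'; rewrite mulrBr mulr1; lra.
Qed.

Let phi_limit : mu.-integrable setT (EFin \o phi) /\ 0 <= \int[mu]_x phi x.
Proof.
have mfk k : measurable_fun setT (EFin \o fk k) by have [/integrableP[]] := pairing k.
have mphi : measurable_fun setT (EFin \o phi).
  by apply: (emeasurable_fun_cvg (fun k => EFin \o fk k)) => // x _; exact: fk_cvg.
have fd x (_ : True) k : setT x -> (`|(EFin \o fk k) x| <= (EFin \o dom) x)%E.
  by move=> _; rewrite /= lee_fin; exact: fk_dom.
have [Iphi _ C] := dominated_convergence measurableT mfk mphi
  (aeW _ (fun x _ => @fk_cvg x)) Idom (aeW _ (fun x => fd x I)).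
split=> //; rewrite leNgt; apply/negP => J0.
pose del := - (\int[mu]_x phi x) / 2.
have d0 : 0 < del by rewrite divr_gt0// oppr_gt0.
have tr : has_trace p v id by case: adm.
have [M HM] := small_flux m0 p1 dv tr d0.
have nearM : \forall k \near \oo, M <= k%:R by exact: nbhs_infty_ger.
have L : \forall k \near \oo, ((- del)%:E <= \int[mu]_x (EFin \o fk k) x)%E.
  apply: filterS nearM => k Mk.
  have Mk' : M <= Nk k by apply: le_trans Mk _; rewrite /Nk ler_nat leq_addr.
  have := pairing_ge (HM _ Mk' (N8 k)); rewrite /Rintegral -lee_fin fineK//.
  by have [I _ _ _] := pairing k; exact: integrable_fin_num I.
have := lime_ge (cvgP _ C) L; rewrite (cvg_lim _ C)// => H.
have {}H : - del <= \int[mu]_x phi x.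
  by rewrite -lee_fin /Rintegral fineK; [exact: H|exact: integrable_fin_num Iphi].
by move: H d0; rewrite /del; move: (Rintegral _ _ _) => J; lra.
Qed.

(** Along tangential gradients the trace is controlled by the norm, and the
    weighted integral of the trace can only grow when the radial field is
    replaced by v; the tangent inequality for the p-th power then compares
    the two energies. *)
Lemma energy_radial_le_of_trace : (energy p beta (@radial R m) <= energy p beta v)%E.
Proof.
have [Iphi J0] := phi_limit.
rewrite (energy_radial m0) (energyE m0 p beta HG) I0.2 I1.2 -EFinM lee_fin.
pose c : R := Num.sqrt (m%:R - 1).
have m10 : 0 < m%:R - 1 :> R by rewrite subr_gt0 ltr1n.
have c0 : 0 < c by rewrite sqrtr_gt0.
have c2 : c ^+ 2 = m%:R - 1 by rewrite sqr_sqrtr// ltW.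
pose kk := p * c `^ (p - 1) / c.
have kk0 : 0 <= kk by rewrite !mulr_ge0 ?powR_ge0 ?invr_ge0// ?(ltW c0)// (le_trans ler01).
have IA := integrableZl measurableT (c `^ p) I0.1.
have IB := integrableZl measurableT kk Iphi.
have Iab : mu.-integrable setT (EFin \o (fun x => c `^ p * (D0 x * \1_pball x) + kk * phi x)).
  exact: (integrable_realD measurableT (f := fun x => c `^ p * (D0 x * \1_pball x)) (g := fun x => kk * phi x) IA IB).
have key : {ae mu, forall x, c `^ p * (D0 x * \1_pball x) + kk * phi x <= D1 x * \1_pball x}.
  have v1' := v1; have := tangential_gradient HG v1; apply: filterS2 v1' => x vx Tx.
  rewrite /phi !indicE; have [px|npx] := pselect (pball x); last by rewrite (memNset npx) !mulr0 addr0.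
  rewrite (mem_set px).
  have /andP[r0 r1] := pball_itv px; rewrite !mulr1 (sq_powR r0).
  have {}vx : enorm (v x) = 1 by apply: vx; exact: r1.
  have tl := trace_le vx (Tx px).
  have := density_lower beta p1 r0 c0 (mxnorm2_ge0 (G x)) tl.
  by rewrite c2 /tt trace_radial_grad -?enorm_gt0// [_ * enorm x `^ (_ - _)]mulrC.
have := ae_le_Rintegral Iab I1.1 key.
rewrite (RintegralD measurableT (f1 := fun x => c `^ p * (D0 x * \1_pball x)) (f2 := fun x => kk * phi x) IA IB).
rewrite (RintegralZl _ measurableT I0.1) (RintegralZl _ measurableT Iphi).
by apply: le_trans; rewrite lerDl mulr_ge0.
Qed.

End trace_energy.

(** * Minimality of the radial map *)

Theorem theorem1 (R : realType) (n : nat) (alpha p : R)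
  (hn : (2 <= n)%N) (halpha : 0 <= alpha)
  (hp1 : 1 <= p) (hp2 : p < n%:R + alpha + 1)
  (hmin : minimizes_energy p alpha (@radial R n.+1)) :
  minimizes_energy p (alpha + 1) (@radial R n).
Proof.
have Erad : (energy p alpha (@radial R n.+1) < +oo)%E by case: hmin => [[[]]].
have RI := radial_integral_lty hn halpha Erad.
split; first exact: (admissible_radial (ltnW hn) hp1 (energy_radial_lty hn halpha Erad)).
move=> v adm; have [[mv v1 dv Ev] tr] := adm.
have [p2|p2] := leP 2 p; last first.
  have pb : p <= alpha + 1 + 1 by move: halpha p2; lra.
  exact: (energy_radial_le_of_trace hn hp1 pb adm RI).
have HG := weak_gradient_wgrad dv.
apply: (energy_radial_le_of_extv hn halpha hp1 HG v1 p2 RI).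
apply: hmin.2; split; last exact: has_trace_extv.
split.
- have m0 : measurable [set 0 : 'rV[R]_n.+1].
    apply: closed_measurable_rV; rewrite (_ : [set 0] = @enorm R n.+1 @^-1` [set 0]).
      by apply: closed_comp; [move=> x _; exact: continuous_enorm|exact: closed_eq].
    apply/seteqP; split => x /=; first by move=> ->; exact: enorm0.
    by move=> x0; apply/eqP; rewrite -[_ == _]negbK -enorm_gt0 x0 ltxx.
  have -> : @ball_rV R n.+1 = @punctured_ball R n.+1 `|` [set 0].
    apply/seteqP; split => x /=; first by move=> bx; have [->|/eqP x0] := eqVneq x 0; [right|left].
    by case=> [[]//|->]; rewrite /ball_rV/= enorm0.
  apply/measurable_funU => //; first exact: measurable_punctured_ball.
  split; last exact: measurable_fun_set1.
  rewrite punctured_ballE; apply: measurable_extv => //; apply: measurable_funS mv; first exact: measurable_ball_rV.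
  by move=> z /andP[].
- apply: filterS2 (ae_unpolar hn v1) (ae_unpolar_neq0 hn) => x vx ux bx.
  have bx0 : behead_rV x != 0 by exact: unpolar_neq0.
  apply: enorm_extv => //; apply: vx.
  by rewrite /ball_rV/= enorm_unpolar.
- by exists (extv_grad v (wgrad (@punctured_ball R n) v)); exact: weak_gradient_extv_ball.
apply: le_lt_trans (energy_extv_bound hn halpha hp1 HG v1 p2) _.
have RI0 : (0 <= radial_integral n p alpha)%E.
  by apply: integral_ge0 => x _; rewrite lee_fin mulr_ge0 ?powR_ge0.
have E0 : (0 <= energy p (alpha + 1) v)%E.
  by apply: integral_ge0 => x _; rewrite lee_fin mulr_ge0 ?powR_ge0.
have K (k : R) (e : \bar R) : 0 <= k -> (0 <= e)%E -> (e < +oo)%E -> (k%:E * e < +oo)%E.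
  by move=> k0 e0 eoo; apply: lte_mul_pinfty => //; rewrite lee_fin.
have c1 : 0 <= n%:R `^ (p / 2 - 1) / (n%:R - 1) `^ (p / 2 - 1) :> R.
  by apply: divr_ge0; exact: powR_ge0.
have c2 : 0 <= n%:R `^ (p / 2 - 1) :> R by exact: powR_ge0.
apply: (K).
- by apply: ltW; apply: kap_int_gt0; rewrite ltnS ltnW.
- apply: adde_ge0; apply: mule_ge0; rewrite ?lee_fin.
  + exact: c1.
  + exact: E0.
  + exact: c2.
  + exact: RI0.
apply: lte_add_pinfty; first exact: (K _ _ c1 E0 Ev).
exact: (K _ _ c2 RI0 RI).
Qed.
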